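(* Let $f:X\longrightarrow Y$ be a locally flat branched covering between closed topological $n$-manifolds. Let the branch locus $R\subset Y$ be a closed topologically stratified space, with the stratification $R=R_{n-2}\supset R_{n-3}\supset\cdots$, and set $B:=f^{-1}(R)$. Let $j:Y\setminus R\hookrightarrow Y$ be the inclusion and let $\mathcal{L}$ be the local system on $Y\setminus R$ associated with the unbranched covering $f|_{X\setminus B}:X\setminus B\longrightarrow Y\setminus R$. Let $\overline{p}$ be either the lower middle perversity or the upper middle perversity. Then the direct image sheaf complex $Rf_{\ast}\underline{\mathbb{Q}}_{X}\in D^{b}_{c}(Y)$ decomposes as $$Rf_{\ast}\underline{\mathbb{Q}}_{X}[n]\simeq \underline{\mathbb{Q}}_{Y}[n]\oplus IC^{\overline p}_{Y}(\mathcal{L}),$$ where Deligne's sheaf complex $IC^{\overline p}_{Y}(\mathcal{L})$ is computed with respect to the stratification $Y\supset R_{n-2}\supset R_{n-3}\supset\cdots$. Furthermore, the constructible sheaf $R^{0}j_{\ast}\mathcal{L}$ is uniquely determined (up to isomorphism) by the restriction map $f|_{X\setminus B}$.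
   Context: **Branched coverings.** Let $X$ and $Y$ be path-connected, locally compact Hausdorff spaces. A continuous, open, finite-to-one, proper surjection $f:X\to Y$ is a (topological) branched covering if there is a closed nowhere dense subset $R\subset Y$ such that $f|:f^{-1}(Y\setminus R)\to Y\setminus R$ is a finite covering map. The branch locus $R$ of $f$ always means the minimal such set, i.e. the set of all $y\in Y$ having no evenly covered neighborhood. **Stratified spaces.** A $0$-dimensional topologically stratified space is a countable discrete set. For $m>0$, an $m$-dimensional topologically stratified space is a paracompact Hausdorff space $Z$ with a filtration by closed subsets $Z=Z_m\supseteq Z_{m-1}\supseteq\dots\supseteq Z_0\supseteq Z_{-1}=\emptyset$ such that every $x\in Z_j\setminus Z_{j-1}$ has a (distinguished) neighborhood $\mathcal{N}_x$ in $Z$, a compact $(m-j-1)$-dimensional topologically stratified space $L=L_{m-j-1}\supseteq\dots\supseteq L_0\supseteq L_{-1}=\emptyset$ (a link) and a homeomorphism $\phi:\mathcal{N}_x\to\mathbb{R}^j\times C(L)$ ($C$ = open cone) taking $\mathcal{N}_x\cap Z_{j+i+1}$ homeomorphically onto $\mathbb{R}^j\times C(L_i)$ for $m-j-1\ge i\ge 0$ and $\mathcal{N}_x\cap Z_j$ onto $\mathbb{R}^j\times\{\text{vertex}\}$. The strata are the connected components of the manifolds $Z_j\setminus Z_{j-1}$. An $m$-dimensional topological pseudomanifold is a paracompact Hausdorff space admitting such a stratification with $Z_{m-1}=Z_{m-2}$ and $Z\setminus Z_{m-1}$ dense. Unless said otherwise, ''stratification'' refers to the intrinsic stratification: the top stratum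 is the largest open submanifold, and one proceeds inductively on the dimension of the strata. **Local flatness.** Let $Y=\bigsqcup_\alpha S_\alpha$ and $R=\bigsqcup_\beta T_\beta$ be topologically stratified spaces with $R\subseteq Y$. The inclusion $R\hookrightarrow Y$ is locally flat at $r\in S_\alpha\cap T_\beta$ with $\dim S_\alpha\le\dim T_\beta$ if there are distinguished neighborhoods $U\subset R$ and $U'\subset Y$ of $r$ with $U\subset U'$ such that there are homeomorphisms $U'\cap S_\alpha\to\mathbb{R}^{\dim S_\alpha}$ and $U\cap T_\beta\to\mathbb{R}^{\dim T_\beta}$ making the square with the inclusion $U'\cap S_\alpha\hookrightarrow U\cap T_\beta$ and the standard inclusion $\mathbb{R}^{\dim S_\alpha}\hookrightarrow\mathbb{R}^{\dim T_\beta}$ commute. If $\dim S_\alpha\ge\dim T_\beta$ the condition is the same with roles exchanged (inclusion $U\cap T_\beta\hookrightarrow U'\cap S_\alpha$ and standard inclusion $\mathbb{R}^{\dim T_\beta}\hookrightarrow\mathbb{R}^{\dim S_\alpha}$). The inclusion is locally flat if it is so at every $r\in R$. A branched covering $f:X\to Y$ of topological pseudomanifolds with branch locus $R$ is locally flat if $R\hookrightarrow Y$ and $f^{-1}(R)\hookrightarrow X$ are locally flat. **Associated local system.** For the finite covering $f|:X\setminus B\to Y\setminus R$, $\mathcal{L}$ is the local system on $Y\setminus R$ with $(f|)_\ast\underline{\mathbb{Q}}_{X\setminus B}\cong\underline{\mathbb{Q}}_{Y\setminus R}\oplus\mathcal{L}$, namely the kernel of the trace map $(f|)_\ast\underline{\mathbb{Q}}_{X\setminus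 B}\to\underline{\mathbb{Q}}_{Y\setminus R}$ given by summation over the sheets; its rank is one less than the degree. **Deligne's sheaf complex.** The lower and upper middle perversities are $\overline m(k)=\lfloor (k-2)/2\rfloor$ and $\overline n(k)=\lfloor (k-1)/2\rfloor$. For an $n$-dimensional pseudomanifold $Y$ with filtration $Y=Y_n\supseteq Y_{n-2}\supseteq\cdots\supseteq Y_0\supseteq\emptyset$, put $U_k=Y\setminus Y_{n-k}$ for $k\ge2$, with inclusions $j_k:U_k\hookrightarrow U_{k+1}$ (so $U_{n+1}=Y$). For a local system $\mathcal{L}$ on $U_2$, $$IC^{\overline p}_Y(\mathcal{L})=\tau_{\le\overline p(n)-n}Rj_{n\ast}\cdots\tau_{\le\overline p(3)-n}Rj_{3\ast}\,\tau_{\le\overline p(2)-n}Rj_{2\ast}\mathcal{L}[n].$$ $D^b_c(Y)$ is the bounded derived category of constructible complexes of sheaves of $\mathbb{Q}$-vector spaces. *)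

(* Defs.v *)
From HB Require Import structures.
From mathcomp Require Import all_boot all_order all_algebra.
From mathcomp Require Import all_classical all_reals topology normedtype.

Set Implicit Arguments.
Unset Strict Implicit.
Unset Printing Implicit Defensive.

Import Order.TTheory GRing.Theory Num.Theory.
Import numFieldNormedType.Exports.

Local Open Scope classical_set_scope.
Local Open Scope ring_scope.

Definition homeomorphism (S T : topologicalType) (h : S -> T) :=
  continuous h /\
  exists g : T -> S, [/\ continuous g, cancel h g & cancel g h].

Definition path_connected (R : realType) (T : topologicalType) :=
  [set: T] !=set0 /\
  forall x y : T, exists g : R -> T,
    [/\ {within `[0, 1], continuous g}, g 0 = x & g 1 = y].

Definition paracompact (T : topologicalType) :=
  forall C : set (set T), (forall U, C U -> open U) -> \bigcup_(U in C) U = setT ->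
  exists D : set (set T),
    [/\ forall V, D V -> open V /\ exists2 U, C U & V `<=` U,
        \bigcup_(V in D) V = setT &
        forall x : T, exists2 N, nbhs x N & finite_set [set V | D V /\ V `&` N !=set0]].

Definition closed_manifold (R : realType) (n : nat) (T : topologicalType) :=
  [/\ compact [set: T], hausdorff_space T &
      forall x : T, exists U : set T, [/\ open U, U x &
        exists h : U -> 'rV[R]_n, homeomorphism h]].

Lemma continuous_val (T : topologicalType) (A : set T) :
  continuous (val : A -> T).
Proof. by rewrite -set_valE; exact: initial_continuous. Qed.

Lemma continuous_to_sub (S T : topologicalType) (A : set T) (f : S -> A) :
  continuous (val \o f) -> continuous f.
Proof.
move=> /continuousP cf; apply/continuousP => _ [V oV <-].
by have := cf _ oV; rewrite set_valE.
Qed.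

Definition inclusion (T : topologicalType) (A : set T) : A -> T := val.
HB.instance Definition _ (T : topologicalType) (A : set T) :=
  @isContinuous.Build A T (@inclusion T A) (@continuous_val T A).

Section sub_inclusion.
Variables (T : topologicalType) (A B : set T) (AB : A `<=` B).
Definition sub_inclusion (x : A) : B :=
  exist _ (val x) (mem_set (AB (set_valP x))).
Lemma sub_inclusion_continuous : continuous sub_inclusion.
Proof. by apply: continuous_to_sub; exact: continuous_val. Qed.
HB.instance Definition _ := isContinuous.Build A B sub_inclusion sub_inclusion_continuous.
End sub_inclusion.

Section restrict_over.
Variables (X Y : topologicalType) (f : continuousType X Y) (A : set Y).
Definition restrict_over (x : f @^-1` A) : A :=
  exist _ (f (val x)) (mem_set (set_valP x : (f @^-1` A) (val x))).
Lemma restrict_over_continuous : continuous restrict_over.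
Proof.
apply: continuous_to_sub => x.
by apply: continuous_comp; [exact: continuous_val|exact: cts_fun].
Qed.
HB.instance Definition _ :=
  isContinuous.Build _ _ restrict_over restrict_over_continuous.
End restrict_over.

Section branched.
Variables (R : realType) (X Y : topologicalType).

Definition evenly_covered (f : X -> Y) (V : set Y) :=
  exists (d : nat) (W : 'I_d -> set X),
    [/\ forall i, open (W i),
        trivIset setT W,
        f @^-1` V = \bigcup_i W i &
        forall i, exists2 h : W i -> V,
          homeomorphism h & forall x, val (h x) = f (val x)].

(* bc_cover says that f restricts to a finite covering over the complement
   of Z: as Z is closed, evenly covered neighbourhoods may be taken in Y. *)
Record branched_covering := BranchedCovering {
  bc_map :> continuousType X Y;
  bc_domain : [/\ path_connected R X, locally_compact [set: X] & hausdorff_space X];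
  bc_codomain : [/\ path_connected R Y, locally_compact [set: Y] & hausdorff_space Y];
  bc_open : forall U, open U -> open (bc_map @` U);
  bc_finite : forall y, finite_set (bc_map @^-1` [set y]);
  bc_proper : forall K, compact K -> compact (bc_map @^-1` K);
  bc_surj : forall y, exists x, bc_map x = y;
  bc_cover : exists Z : set Y, [/\ closed Z, interior Z = set0 &
    forall y, ~ Z y -> exists V, [/\ open V, V y & evenly_covered bc_map V]]
}.

Definition branch_locus (f : X -> Y) : set Y :=
  [set y | ~ exists V, [/\ open V, V y & evenly_covered f V]].

End branched.

Record filtration (T : topologicalType) := Filtration {
  fil :> int -> set T;
  fil_closed : forall i, closed (fil i);
  fil_mono : forall i j, i <= j -> fil i `<=` fil j
}.

Section pullback_filtration.
Variables (S T : topologicalType) (g : continuousType S T) (F : filtration T).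
Lemma pullback_closed i : closed (g @^-1` F i).
Proof. by move/continuous_closedP: (@cts_fun _ _ g); apply; exact: fil_closed. Qed.
Lemma pullback_mono i j : i <= j -> g @^-1` F i `<=` g @^-1` F j.
Proof. by move=> ij x; exact: fil_mono. Qed.
Definition pullback_filtration := Filtration pullback_closed pullback_mono.
End pullback_filtration.

Section manifold_filtration.
Variables (T : topologicalType) (n : nat).
Let F (i : int) : set T := [set _ | n%:Z <= i].
Lemma manifold_filtration_closed i : closed (F i).
Proof.
rewrite /F; have [ni|ni] := boolP (n%:Z <= i).
  by rewrite (_ : [set _ | _] = setT) ?closedT //; apply/seteqP; split.
by rewrite (_ : [set _ | _] = set0); [exact: closed0|apply/seteqP; split].
Qed.
Lemma manifold_filtration_mono i j : i <= j -> F i `<=` F j.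
Proof. by move=> ij x /= ni; exact: le_trans ni ij. Qed.
(* The intrinsic stratification of an n-manifold: only the top stratum. *)
Definition manifold_filtration :=
  Filtration manifold_filtration_closed manifold_filtration_mono.
End manifold_filtration.

Definition level (T : topologicalType) (F : filtration T) (i : int) : set T :=
  F i `\` F (i - 1).

Section cone.
Variables (R : realType) (L : topologicalType).

(* The open cone on L. [None] is the vertex, so that the cone on the empty
   space is a point; the topology is the quotient topology of
   (L * [0, 1[) + point. *)
Definition cone : Type := option (L * (`]0, 1[%classic : set R))%type.
HB.instance Definition _ := Choice.on cone.

Definition cone_proj (x : L * (`[0, 1[%classic : set R)) : cone :=
  if insub (val x.2) is Some t then Some (x.1, t) else None.

Definition cone_open (U : set cone) := open (cone_proj @^-1` U).
Lemma cone_openT : cone_open setT.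
Proof. by rewrite /cone_open preimage_setT; exact: openT. Qed.
Lemma cone_openI : setI_closed cone_open.
Proof. by move=> U V oU oV; rewrite /cone_open preimage_setI; exact: openI. Qed.
Lemma cone_open_bigU (I : Type) (U : I -> set cone) :
  (forall i, cone_open (U i)) -> cone_open (\bigcup_i U i).
Proof.
by move=> oU; rewrite /cone_open preimage_bigcup; apply: bigcup_open => i _; exact: oU.
Qed.
HB.instance Definition _ :=
  isOpenTopological.Build cone cone_openT cone_openI cone_open_bigU.

Definition subcone (A : set L) : set cone :=
  [set c | if c is Some x then A x.1 else True].

End cone.

Section stratified.
Variable R : realType.

(* [phi : N -> R^j * C(L)] is a distinguished chart at a point x of the
   j-dimensional part of the m-dimensional filtered space (T, F). *)
Definition distinguished_chart (m : int) (T : topologicalType) (F : filtration T)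
    (j : nat) (x : T) (N : set T) (L : topologicalType) (G : filtration L) :=
  nbhs x N /\
  exists phi : N -> 'rV[R]_j * cone R L,
    [/\ homeomorphism phi,
        forall z, F j%:Z (val z) <-> (phi z).2 = None &
        forall (i : nat) z, i%:Z <= m - j%:Z - 1 ->
          (F (j%:Z + i%:Z + 1) (val z) <-> subcone (G i%:Z) (phi z).2)].

(* The empty space has every negative dimension; it is the link of the points
   of the top stratum. *)
Inductive stratified : int -> forall T : topologicalType, filtration T -> Prop :=
| stratified_empty (m : int) (T : topologicalType) (F : filtration T) : m < 0 -> [set: T] = set0 -> @stratified m T F
| stratified_discrete (T : topologicalType) (F : filtration T) :
    countable [set: T] -> (forall A : set T, open A) ->
    (forall i, i < 0 -> F i = set0) -> (forall i, 0 <= i -> F i = setT) ->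
    @stratified 0 T F
| stratified_pos (m : int) (T : topologicalType) (F : filtration T) :
    0 < m -> paracompact T -> hausdorff_space T ->
    (forall i, i < 0 -> F i = set0) -> (forall i, m <= i -> F i = setT) ->
    (forall (j : nat) (x : T), j%:Z <= m -> level F j%:Z x ->
      exists (N : set T) (L : topologicalType) (G : filtration L),
        [/\ compact [set: L], @stratified (m - j%:Z - 1) L G &
            distinguished_chart m F j x N G]) ->
    @stratified m T F.

Definition distinguished_nbhd (m : int) (T : topologicalType) (F : filtration T)
    (j : nat) (x : T) (N : set T) :=
  exists (L : topologicalType) (G : filtration L),
    [/\ compact [set: L], stratified (m - j%:Z - 1) G &
        distinguished_chart m F j x N G].

(* The standard inclusion R^i -> R^j, for i <= j. *)
Definition std_inclusion (i j : nat) (v : 'rV[R]_i) : 'rV[R]_j :=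
  \row_(k < j) (if insub (val k) is Some l then v 0 l else 0).

Section locally_flat.
Variables (Y : topologicalType) (m : int) (G : filtration Y).
Variables (A : set Y) (q : int) (F : filtration A).

Definition flat_pair (P Q : set Y) (i j : nat) :=
  P `<=` Q /\
  exists (a : P -> 'rV[R]_i) (b : Q -> 'rV[R]_j),
    [/\ homeomorphism a, homeomorphism b &
        forall x y, val x = val y -> b y = std_inclusion j (a x)].

Definition locally_flat_at (r : A) :=
  forall i j : nat, level G i%:Z (val r) -> level F j%:Z r ->
  let S := connected_component (level G i%:Z) (val r) in
  let T := connected_component (level F j%:Z) r in
  let good U' U := [/\ distinguished_nbhd m G i (val r) U',
                       distinguished_nbhd q F j r U & val @` U `<=` U'] in
  ((i <= j)%N -> exists U' U, good U' U /\
     flat_pair (U' `&` S) (val @` (U `&` T)) i j) /\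
  ((j <= i)%N -> exists U' U, good U' U /\
     flat_pair (val @` (U `&` T)) (U' `&` S) j i).

(* (A, F) -> (Y, G) is a locally flat inclusion of stratified spaces of
   dimensions q and m. *)
Definition locally_flat :=
  [/\ stratified m G, stratified q F & forall r, locally_flat_at r].

End locally_flat.

(* A locally flat branched covering of closed n-manifolds whose branch locus is
   the (n-2)-dimensional stratified space G_(n-2) >= G_(n-3) >= ...; its
   preimage is filtered by the preimages of the G_i. *)
Record locally_flat_covering (n : nat) (X Y : topologicalType) (G : filtration Y)
    (f : branched_covering R X Y) : Prop := {
  lfc_domain : closed_manifold R n X;
  lfc_codomain : closed_manifold R n Y;
  lfc_locus : branch_locus f = G (n%:Z - 2);
  lfc_flat : locally_flat n%:Z (manifold_filtration Y n) (n%:Z - 2)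
    (pullback_filtration (@inclusion Y (branch_locus f)) G);
  lfc_flat_preimage : locally_flat n%:Z (manifold_filtration X n) (n%:Z - 2)
    (pullback_filtration (f \o @inclusion X (f @^-1` branch_locus f)) G)
}.

End stratified.

Record submod_closed (V : lmodType rat) (P : V -> Prop) : Prop := SubmodClosed {
  sc0 : P 0;
  scD : forall u v, P u -> P v -> P (u + v);
  scZ : forall a v, P v -> P (a *: v)
}.

Section submod.
Variables (V : lmodType rat) (P : V -> Prop) (cP : submod_closed P).

Definition submod := let _ := cP in {v : V | P v}.
HB.instance Definition _ := gen_eqMixin submod.
HB.instance Definition _ := gen_choiceMixin submod.

Definition smval (x : submod) : V := sval x.
Definition Submod (v : V) (Pv : P v) : submod := exist _ v Pv.
Lemma smvalP (x : submod) : P (smval x). Proof. exact: svalP. Qed.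
Lemma smval_inj : injective smval.
Proof. by move=> [x Px] [y Py] /= xy; apply: eq_exist. Qed.

Lemma submodN v : P v -> P (- v).
Proof. by rewrite -scaleN1r; exact: scZ. Qed.
Let zero := Submod (sc0 cP).
Let opp x := Submod (submodN (smvalP x)).
Let add x y := Submod (scD cP (smvalP x) (smvalP y)).
Let scale a x := Submod (scZ cP a (smvalP x)).

Lemma submod_addA : associative add.
Proof. by move=> x y z; apply: smval_inj; exact: addrA. Qed.
Lemma submod_addC : commutative add.
Proof. by move=> x y; apply: smval_inj; exact: addrC. Qed.
Lemma submod_add0 : left_id zero add.
Proof. by move=> x; apply: smval_inj; exact: add0r. Qed.
Lemma submod_addN : left_inverse zero opp add.
Proof. by move=> x; apply: smval_inj; exact: addNr. Qed.
HB.instance Definition _ :=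
  GRing.isZmodule.Build submod submod_addA submod_addC submod_add0 submod_addN.

Lemma submod_scaleA a b x : scale a (scale b x) = scale (a * b) x.
Proof. by apply: smval_inj; exact: scalerA. Qed.
Lemma submod_scale1 : left_id 1 scale.
Proof. by move=> x; apply: smval_inj; exact: scale1r. Qed.
Lemma submod_scaleDr : right_distributive scale +%R.
Proof. by move=> a x y; apply: smval_inj; exact: scalerDr. Qed.
Lemma submod_scaleDl x : {morph scale^~ x : a b / a + b >-> a + b}.
Proof. by move=> a b; apply: smval_inj; exact: scalerDl. Qed.
HB.instance Definition _ := GRing.Zmodule_isLmodule.Build rat submod
  submod_scaleA submod_scale1 submod_scaleDr submod_scaleDl.

End submod.

Record opens (T : topologicalType) := Opens { oset :> set T; oset_open : open oset }.
Definition in_opens (T : topologicalType) (U : opens T) (x : T) : Prop := oset U x.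
Coercion in_opens : opens >-> Funclass.

Definition open_preimage (S T : topologicalType) (f : continuousType S T)
    (U : opens T) : opens S :=
  Opens ((continuousP _).1 (@cts_fun _ _ f) _ (oset_open U)).

Record sheaf (T : topologicalType) := Sheaf {
  section :> opens T -> lmodType rat;
  res : forall U V : opens T, V `<=` U -> section U -> section V;
  res_linear : forall (U V : opens T) (VU : V `<=` U), linear (res VU);
  res_id : forall (U : opens T) (UU : U `<=` U) s, res UU s = s;
  res_comp : forall (U V W : opens T) (VU : V `<=` U) (WV : W `<=` V)
    (WU : W `<=` U) s, res WV (res VU s) = res WU s;
  sheaf_local : forall (U : opens T) (I : Type) (W : I -> opens T)
    (WU : forall i, W i `<=` U), U `<=` \bigcup_i W i ->
    forall s t, (forall i, res (WU i) s = res (WU i) t) -> s = t;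
  sheaf_glue : forall (U : opens T) (I : Type) (W : I -> opens T)
    (WU : forall i, W i `<=` U), U `<=` \bigcup_i W i ->
    forall s : forall i, section (W i),
    (forall i j (V : opens T) (Vi : V `<=` W i) (Vj : V `<=` W j),
       res Vi (s i) = res Vj (s j)) ->
    exists t, forall i, res (WU i) t = s i
}.

Record sheaf_hom (T : topologicalType) (F G : sheaf T) := SheafHom {
  hom :> forall U : opens T, F U -> G U;
  hom_linear : forall U : opens T, linear (@hom U);
  hom_res : forall (U V : opens T) (VU : V `<=` U) s,
    hom (res VU s) = res VU (hom s)
}.

Definition sheaf_iso (T : topologicalType) (F G : sheaf T) :=
  exists (a : sheaf_hom F G) (b : sheaf_hom G F),
    (forall U s, b U (a U s) = s) /\ (forall U s, a U (b U s) = s).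

Section subsheaf.
Variables (T : topologicalType) (F : sheaf T) (P : forall U : opens T, F U -> Prop).

Record subsheaf_closed : Prop := SubsheafClosed {
  ssc_submod : forall U, submod_closed (@P U);
  ssc_res : forall (U V : opens T) (VU : V `<=` U) s, P s -> P (res VU s);
  ssc_local : forall (U : opens T) (I : Type) (W : I -> opens T)
    (WU : forall i, W i `<=` U), U `<=` \bigcup_i W i ->
    forall s, (forall i, P (res (WU i) s)) -> P s
}.

Variable cP : subsheaf_closed.
Let sec U : lmodType rat := submod (ssc_submod cP U).
Let sres (U V : opens T) (VU : V `<=` U) (s : sec U) : sec V :=
  Submod (ssc_submod cP V) (ssc_res cP VU (smvalP s)).

Lemma subsheaf_res_linear (U V : opens T) (VU : V `<=` U) : linear (@sres U V VU).
Proof. by move=> a u v; apply: smval_inj; exact: res_linear. Qed.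
Lemma subsheaf_res_id (U : opens T) (UU : U `<=` U) s : @sres U U UU s = s.
Proof. by apply: smval_inj; exact: res_id. Qed.
Lemma subsheaf_res_comp (U V W : opens T) (VU : V `<=` U) (WV : W `<=` V)
  (WU : W `<=` U) s : sres WV (sres VU s) = sres WU s.
Proof. by apply: smval_inj; exact: res_comp. Qed.
Lemma subsheaf_local (U : opens T) (I : Type) (W : I -> opens T)
    (WU : forall i, W i `<=` U) : U `<=` \bigcup_i W i ->
    forall s t, (forall i, sres (WU i) s = sres (WU i) t) -> s = t.
Proof.
move=> cov s t st; apply: smval_inj; apply: (@sheaf_local _ F U I W WU cov) => i.
exact: (congr1 (@smval _ _ _) (st i)).
Qed.
Lemma subsheaf_glue (U : opens T) (I : Type) (W : I -> opens T)
    (WU : forall i, W i `<=` U) : U `<=` \bigcup_i W i ->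
    forall s : forall i, sec (W i),
    (forall i j (V : opens T) (Vi : V `<=` W i) (Vj : V `<=` W j),
       sres Vi (s i) = sres Vj (s j)) ->
    exists t, forall i, sres (WU i) t = s i.
Proof.
move=> cov s comp.
have [i j V Vi Vj|t ht] := @sheaf_glue _ F U I W WU cov (fun i => smval (s i)).
  exact: (congr1 (@smval _ _ _) (comp i j V Vi Vj)).
have Pt : P t by apply: (@ssc_local cP U I W WU cov) => i; rewrite ht; exact: smvalP.
by exists (Submod (ssc_submod cP U) Pt) => i; apply: smval_inj; exact: ht.
Qed.
Definition subsheaf := Sheaf subsheaf_res_linear subsheaf_res_id
  subsheaf_res_comp subsheaf_local subsheaf_glue.

End subsheaf.

Section constant_sheaf.
Variable T : topologicalType.

Let sec (U : opens T) : lmodType rat := (U : Type) -> rat^o.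
Let fres (U V : opens T) (VU : V `<=` U) (s : sec U) : sec V :=
  s \o sub_inclusion VU.

Lemma fun_res_linear (U V : opens T) (VU : V `<=` U) : linear (@fres U V VU).
Proof. by []. Qed.
Lemma fun_res_id (U : opens T) (UU : U `<=` U) s : @fres U U UU s = s.
Proof. by apply/funext => x; congr s; exact: val_inj. Qed.
Lemma fun_res_comp (U V W : opens T) (VU : V `<=` U) (WV : W `<=` V)
  (WU : W `<=` U) s : fres WV (fres VU s) = fres WU s.
Proof. by apply/funext => x; congr s; exact: val_inj. Qed.
Lemma fun_local (U : opens T) (I : Type) (W : I -> opens T)
    (WU : forall i, W i `<=` U) : U `<=` \bigcup_i W i ->
    forall s t, (forall i, fres (WU i) s = fres (WU i) t) -> s = t.
Proof.
move=> cov s t st; apply/funext => x.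
have [i _ Wx] := cov _ (set_valP x).
have [x' <-] : exists x' : W i, sub_inclusion (WU i) x' = x.
  by exists (exist _ (val x) (mem_set Wx)); exact: val_inj.
exact: (congr1 (fun g => g x') (st i)).
Qed.
Lemma fun_glue (U : opens T) (I : Type) (W : I -> opens T)
    (WU : forall i, W i `<=` U) : U `<=` \bigcup_i W i ->
    forall s : forall i, sec (W i),
    (forall i j (V : opens T) (Vi : V `<=` W i) (Vj : V `<=` W j),
       fres Vi (s i) = fres Vj (s j)) ->
    exists t, forall i, fres (WU i) t = s i.
Proof.
move=> cov s comp.
have cov' (x : U) : {i : I | W i (val x)}.
  by apply: cid; have [i _ Wx] := cov _ (set_valP x); exists i.
exists (fun x => s (projT1 (cov' x)) (exist _ (val x) (mem_set (projT2 (cov' x))))).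
move=> i; apply/funext => x; rewrite /fres /=.
case: (cov' _) => j /= Wjx.
have oV : open (W i `&` W j) by apply: openI; exact: oset_open.
have Vx : (W i `&` W j) (val x) by split; [exact: set_valP|exact: Wjx].
have := comp i j (Opens oV) (@subIsetl _ _ _) (@subIsetr _ _ _).
move=> /(congr1 (fun g => g (exist _ (val x) (mem_set Vx)))); rewrite /fres /=.
move=> e; transitivity (s i (sub_inclusion (@subIsetl _ (W i) (W j))
  (exist _ (val x) (mem_set Vx)))); last by congr (s i); exact: val_inj.
by rewrite e; congr (s j); exact: val_inj.
Qed.
Definition function_sheaf := Sheaf fun_res_linear fun_res_id fun_res_comp
  fun_local fun_glue.

Definition locally_constant (U : opens T) (s : function_sheaf U) :=
  forall x : U, exists V : opens T,
    V (val x) /\ forall y : U, V (val y) -> s y = s x.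

Lemma locally_constant_closed : subsheaf_closed locally_constant.
Proof.
split=> [U|U V VU s hs x|U I W WU cov s hs x].
- split=> [x|u v hu hv x|a v hv x].
  + by exists (Opens openT).
  + have [A [Ax hA]] := hu x; have [B [Bx hB]] := hv x.
    exists (Opens (openI (oset_open A) (oset_open B))); split=> // y [Ay By].
    by rewrite /GRing.add /= hA // hB.
  + have [A [Ax hA]] := hv x; exists A; split=> // y Ay.
    by rewrite /GRing.scale /= hA.
- have [A [Ax hA]] := hs (sub_inclusion VU x).
  by exists A; split=> // y Ay; exact: hA.
- have [i _ Wx] := cov _ (set_valP x).
  have [A [Ax hA]] := hs i (exist _ (val x) (mem_set Wx)).
  exists (Opens (openI (oset_open A) (oset_open (W i)))); split=> // y [Ay Wy].
  have := hA (exist _ (val y) (mem_set Wy)) Ay.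
  rewrite /res /= /fres /=.
  by move=> e; transitivity (s (sub_inclusion (WU i) (exist _ (val y) (mem_set Wy))));
    [congr s; exact: val_inj|rewrite e; congr s; exact: val_inj].
Qed.

(* The constant sheaf with stalk Q. *)
Definition constant_sheaf := subsheaf locally_constant_closed.
End constant_sheaf.

Section direct_image.
Variables (S T : topologicalType) (f : continuousType S T).

Section obj.
Variable F : sheaf S.
Let pre := open_preimage f.
Let preS (U V : opens T) (VU : V `<=` U) : pre V `<=` pre U.
Proof. by move=> x; exact: VU. Qed.
Let sec (U : opens T) := F (pre U).
Let pres (U V : opens T) (VU : V `<=` U) : sec U -> sec V := res (preS VU).

Lemma direct_image_res_linear (U V : opens T) (VU : V `<=` U) : linear (@pres U V VU).
Proof. exact: res_linear. Qed.
Lemma direct_image_res_id (U : opens T) (UU : U `<=` U) s : @pres U U UU s = s.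
Proof. exact: res_id. Qed.
Lemma direct_image_res_comp (U V W : opens T) (VU : V `<=` U) (WV : W `<=` V)
  (WU : W `<=` U) s : pres WV (pres VU s) = pres WU s.
Proof. exact: res_comp. Qed.
Let precov (U : opens T) (I : Type) (W : I -> opens T) :
  U `<=` \bigcup_i W i -> pre U `<=` \bigcup_i pre (W i).
Proof. by move=> cov x /cov [i _ Wx]; exists i. Qed.
Lemma direct_image_local (U : opens T) (I : Type) (W : I -> opens T)
    (WU : forall i, W i `<=` U) : U `<=` \bigcup_i W i ->
    forall s t, (forall i, pres (WU i) s = pres (WU i) t) -> s = t.
Proof.
move=> cov s t st.
exact: (@sheaf_local _ F (pre U) I (pre \o W) (fun i => preS (WU i)) (precov cov)).
Qed.
Lemma direct_image_glue (U : opens T) (I : Type) (W : I -> opens T)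
    (WU : forall i, W i `<=` U) : U `<=` \bigcup_i W i ->
    forall s : forall i, sec (W i),
    (forall i j (V : opens T) (Vi : V `<=` W i) (Vj : V `<=` W j),
       pres Vi (s i) = pres Vj (s j)) ->
    exists t, forall i, pres (WU i) t = s i.
Proof.
move=> cov s comp.
apply: (@sheaf_glue _ F (pre U) I (pre \o W) (fun i => preS (WU i)) (precov cov)).
move=> i j V Vi Vj.
have oX : open (W i `&` W j) by apply: openI; exact: oset_open.
have := comp i j (Opens oX) (@subIsetl _ _ _) (@subIsetr _ _ _).
have VX : V `<=` pre (Opens oX) by move=> x Vx; split; [exact: Vi|exact: Vj].
by move=> /(congr1 (res VX)); rewrite /pres !(res_comp _ _ Vi, res_comp _ _ Vj).
Qed.
Definition direct_image := Sheaf direct_image_res_linear direct_image_res_id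
  direct_image_res_comp direct_image_local direct_image_glue.
End obj.

Section mor.
Variables (F G : sheaf S) (a : sheaf_hom F G).
Definition direct_image_hom : sheaf_hom (direct_image F) (direct_image G) :=
  @SheafHom T (direct_image F) (direct_image G)
    (fun U => a (open_preimage f U)) (fun U => @hom_linear _ _ _ a _)
    (fun U V VU s => @hom_res _ _ _ a _ _ _ s).
End mor.

End direct_image.

Section trace.
Variables (S T : topologicalType) (q : continuousType S T).
Hypothesis finq : forall t, finite_set (q @^-1` [set t]).

(* The value at x of a section of the constant sheaf, 0 outside its domain. *)
Definition value_at (U : opens S) (s : constant_sheaf S U) (x : S) : rat :=
  if pselect (U x) is left Ux then smval s (exist _ x (mem_set Ux)) else 0.

(* Summation over the sheets. *)
Definition trace (V : opens T) (s : direct_image q (constant_sheaf S) V) (t : T) : rat :=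
  \sum_(x \in q @^-1` [set t]) value_at s x.

Definition traceless (V : opens T) (s : direct_image q (constant_sheaf S) V) :=
  forall t, V t -> trace s t = 0.

Lemma value_at_res (U V : opens S) (VU : V `<=` U) (s : constant_sheaf S U) x :
  V x -> value_at (res VU s) x = value_at s x.
Proof.
move=> Vx; rewrite /value_at.
case: pselect => // Vx'; case: pselect => [Ux|/(_ (VU _ Vx))//].
by rewrite /=; congr (sval s); exact: val_inj.
Qed.
Lemma traceless_closed : subsheaf_closed traceless.
Proof.
have trE (U V : opens T) (VU : V `<=` U) s t : V t -> trace (res VU s) t = trace s t.
  move=> Vt; apply: eq_fsbigr => x; rewrite inE /= => qx.
  by apply: (@value_at_res (open_preimage q U) (open_preimage q V)); rewrite -qx in Vt.
split=> [U|U V VU s hs t Vt|U I W WU cov s hs t Ut].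
- split=> [t _|u v hu hv t Ut|a v hv t Ut].
  + by rewrite /trace fsbig1 // => x _; rewrite /value_at; case: pselect.
  + have -> : trace (u + v) t = trace u t + trace v t.
      rewrite /trace -fsbig_split //=; apply: eq_fsbigr => x _.
      by rewrite /value_at; case: pselect.
    by rewrite (hu t Ut) (hv t Ut) addr0.
  + have -> : trace (a *: v) t = a * trace v t.
      rewrite /trace mulr_fsumr //; apply: eq_fsbigr => x _.
      by rewrite /value_at; case: pselect => //= _; rewrite mulr0.
    by rewrite (hv t Ut) mulr0.
- by rewrite trE //; apply: hs; exact: VU.
- by have [i _ Wt] := cov _ Ut; rewrite -(trE _ _ (WU i)) //; exact: hs.
Qed.

Definition trace_kernel : sheaf T := subsheaf traceless_closed.
End trace.

Section homs.
Variable T : topologicalType.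

Lemma zero_hom_linear (F G : sheaf T) (U : opens T) : linear (fun _ : F U => 0 : G U).
Proof. by move=> a u v; rewrite scaler0 addr0. Qed.
Lemma res0 (G : sheaf T) (U V : opens T) (VU : V `<=` U) : res VU (0 : G U) = 0.
Proof. by have := res_linear VU (- 1) (0 : G U) 0; rewrite scaler0 addr0 scaleN1r addNr. Qed.
Lemma resZ (G : sheaf T) (U V : opens T) (VU : V `<=` U) a (s : G U) :
  res VU (a *: s) = a *: res VU s.
Proof. by have := res_linear VU a s 0; rewrite !addr0 res0 addr0. Qed.
Definition zero_hom (F G : sheaf T) : sheaf_hom F G :=
  SheafHom (@zero_hom_linear F G)
    (fun U V VU s => esym (@res0 G U V VU)).

Variables (F G : sheaf T) (a : sheaf_hom F G).

Lemma hom0 (U : opens T) : a U 0 = 0.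
Proof. by have := @hom_linear _ _ _ a U (- 1) 0 0; rewrite scaler0 addr0 scaleN1r addNr. Qed.
Lemma homZ (U : opens T) c (s : F U) : a U (c *: s) = c *: a U s.
Proof. by have := @hom_linear _ _ _ a U c s 0; rewrite !addr0 hom0 addr0. Qed.
Lemma homD (U : opens T) (s t : F U) : a U (s + t) = a U s + a U t.
Proof. by have := @hom_linear _ _ _ a U 1 s t; rewrite !scale1r. Qed.

Lemma scale_hom_linear c (U : opens T) : linear (fun s : F U => c *: a U s).
Proof.
by move=> d u v; rewrite homD homZ scalerDr !scalerA mulrC.
Qed.
Lemma scale_hom_res c (U V : opens T) (VU : V `<=` U) (s : F U) :
  c *: a V (res VU s) = res VU (c *: a U s).
Proof. by rewrite hom_res resZ. Qed.
Definition scale_hom c := SheafHom (scale_hom_linear c) (@scale_hom_res c).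

Variables (P : forall U : opens T, F U -> Prop) (Q : forall U : opens T, G U -> Prop).
Variables (cP : subsheaf_closed P) (cQ : subsheaf_closed Q).
Hypothesis aPQ : forall (U : opens T) s, P s -> Q (a U s).
Let h (U : opens T) (s : subsheaf cP U) : subsheaf cQ U :=
  Submod (ssc_submod cQ U) (aPQ (smvalP s)).
Lemma subsheaf_hom_linear (U : opens T) : linear (@h U).
Proof. by move=> c u v; apply: smval_inj; exact: hom_linear. Qed.
Lemma subsheaf_hom_res (U V : opens T) (VU : V `<=` U) s :
  h (res VU s) = res VU (h s).
Proof. by apply: smval_inj; exact: hom_res. Qed.
Definition subsheaf_hom : sheaf_hom (subsheaf cP) (subsheaf cQ) :=
  SheafHom subsheaf_hom_linear subsheaf_hom_res.

End homs.

Section direct_sum.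
Variables (T : topologicalType) (F G : sheaf T).
Let sec (U : opens T) : lmodType rat := (F U * G U)%type.
Let dres (U V : opens T) (VU : V `<=` U) (s : sec U) : sec V := (res VU s.1, res VU s.2).
Lemma dsum_res_linear (U V : opens T) (VU : V `<=` U) : linear (@dres U V VU).
Proof.
move=> a [u1 u2] [v1 v2].
by congr pair => /=; exact: res_linear.
Qed.
Lemma dsum_res_id (U : opens T) (UU : U `<=` U) s : @dres U U UU s = s.
Proof. by case: s => u v; rewrite /dres /= !res_id. Qed.
Lemma dsum_res_comp (U V W : opens T) (VU : V `<=` U) (WV : W `<=` V)
  (WU : W `<=` U) s : dres WV (dres VU s) = dres WU s.
Proof. by rewrite /dres /= !(res_comp VU WV WU). Qed.
Lemma dsum_local (U : opens T) (I : Type) (W : I -> opens T)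
    (WU : forall i, W i `<=` U) : U `<=` \bigcup_i W i ->
    forall s t, (forall i, dres (WU i) s = dres (WU i) t) -> s = t.
Proof.
move=> cov [s1 s2] [t1 t2] st; congr pair.
  by apply: (@sheaf_local _ F U I W WU cov) => i; case: (st i).
by apply: (@sheaf_local _ G U I W WU cov) => i; case: (st i).
Qed.
Lemma dsum_glue (U : opens T) (I : Type) (W : I -> opens T)
    (WU : forall i, W i `<=` U) : U `<=` \bigcup_i W i ->
    forall s : forall i, sec (W i),
    (forall i j (V : opens T) (Vi : V `<=` W i) (Vj : V `<=` W j),
       dres Vi (s i) = dres Vj (s j)) ->
    exists t, forall i, dres (WU i) t = s i.
Proof.
move=> cov s comp.
have [i j V Vi Vj|t ht] := @sheaf_glue _ F U I W WU cov (fun i => (s i).1).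
  by case: (comp i j V Vi Vj).
have [i j V Vi Vj|u hu] := @sheaf_glue _ G U I W WU cov (fun i => (s i).2).
  by case: (comp i j V Vi Vj).
by exists (t, u) => i; rewrite /dres /= ht hu -surjective_pairing.
Qed.
Definition dsum_sheaf := Sheaf dsum_res_linear dsum_res_id dsum_res_comp
  dsum_local dsum_glue.
End direct_sum.

Section dsum_hom.
Variables (T : topologicalType) (F F' G G' : sheaf T).
Variables (a : sheaf_hom F F') (b : sheaf_hom G G').
Let h (U : opens T) (s : dsum_sheaf F G U) : dsum_sheaf F' G' U := (a U s.1, b U s.2).
Lemma dsum_hom_linear (U : opens T) : linear (@h U).
Proof. by move=> c [u1 u2] [v1 v2]; congr pair => /=; exact: hom_linear. Qed.
Lemma dsum_hom_res (U V : opens T) (VU : V `<=` U) s : h (res VU s) = res VU (h s).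
Proof. by rewrite /h /= !hom_res. Qed.
Definition dsum_hom := SheafHom dsum_hom_linear dsum_hom_res.
End dsum_hom.

(* The differential is a family indexed by all pairs of degrees, zero unless
   j = i + 1, so that shifts need no transport along equalities of degrees. *)
Record complex (T : topologicalType) := Complex {
  obj :> int -> sheaf T;
  diff : forall i j, sheaf_hom (obj i) (obj j);
  diff_out : forall i j, j <> i + 1 -> forall (U : opens T) s, diff i j U s = 0;
  diff_sq : forall i j k (U : opens T) s, diff j k U (diff i j U s) = 0
}.

Record complex_map (T : topologicalType) (C D : complex T) := ComplexMap {
  cmap :> forall i, sheaf_hom (C i) (D i);
  cmap_diff : forall i j (U : opens T) s, cmap j U (diff C i j U s) = diff D i j U (cmap i U s)
}.

Section complexes.
Variable T : topologicalType.

Section shift.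
Variables (n : nat) (C : complex T).
Let d i j := scale_hom (diff C (i + n%:Z) (j + n%:Z)) ((- 1) ^+ n).
Lemma shift_out i j : j <> i + 1 -> forall (U : opens T) s, d i j U s = 0.
Proof.
move=> ij U s; rewrite /d /= diff_out ?scaler0 // => e; apply: ij.
by apply: (addIr n%:Z); rewrite e addrAC.
Qed.
Lemma shift_sq i j k (U : opens T) s : d j k U (d i j U s) = 0.
Proof. by rewrite /d /= homZ diff_sq !scaler0. Qed.
(* C[n] *)
Definition shift_complex := Complex shift_out shift_sq.
End shift.

Section dsum.
Variables C D : complex T.
Let d i j := dsum_hom (diff C i j) (diff D i j).
Lemma dsum_out i j : j <> i + 1 -> forall (U : opens T) s, d i j U s = 0.
Proof. by move=> ij U s; rewrite /d /= !diff_out. Qed.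
Lemma dsum_sq i j k (U : opens T) s : d j k U (d i j U s) = 0.
Proof. by rewrite /d /= !diff_sq. Qed.
Definition dsum := Complex dsum_out dsum_sq.
End dsum.

Section concentrated.
Variable F : sheaf T.
Let P (i : int) (U : opens T) (s : F U) := i <> 0 -> s = 0.
Lemma concentrated_closed i : subsheaf_closed (@P i).
Proof.
split=> [U|U V VU s hs i0|U I W WU cov s hs i0].
- split=> [//|u v hu hv i0|a v hv i0]; first by rewrite hu // hv // addr0.
  by rewrite hv // scaler0.
- by rewrite hs // res0.
- by apply: (@sheaf_local _ F U I W WU cov) => j; rewrite hs // res0.
Qed.
Let C i := subsheaf (concentrated_closed i).
Let d i j := zero_hom (C i) (C j).
Lemma concentrated_out i j : j <> i + 1 -> forall (U : opens T) s, d i j U s = 0.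
Proof. by []. Qed.
Lemma concentrated_sq i j k (U : opens T) s : d j k U (d i j U s) = 0.
Proof. by []. Qed.
(* F as a complex in degree 0: all sections in degree 0, only 0 elsewhere. *)
Definition concentrated := Complex concentrated_out concentrated_sq.
End concentrated.

Section truncation.
Variables (m : int) (C : complex T).
Let P (i : int) (U : opens T) (s : C i U) :=
  (m < i -> s = 0) /\ (i = m -> diff C i (i + 1) U s = 0).
Lemma truncation_closed i : subsheaf_closed (@P i).
Proof.
split=> [U|U V VU s [h1 h2]|U I W WU cov s hs].
- split=> [|u v [hu hu'] [hv hv']|a v [hv hv']].
  + by split=> // _; rewrite hom0.
  + split=> e; first by rewrite hu // hv // addr0.
    by rewrite homD hu' // hv' // addr0.
  + split=> e; first by rewrite hv // scaler0.
    by rewrite homZ hv' // scaler0.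
- split=> e; first by rewrite h1 // res0.
  by rewrite hom_res h2 // res0.
- split=> e.
    by apply: (@sheaf_local _ (C i) U I W WU cov) => j; rewrite (hs j).1 // res0.
  apply: (@sheaf_local _ (C (i + 1)) U I W WU cov) => j.
  by rewrite -hom_res (hs j).2 // res0.
Qed.
Lemma truncation_diff i j (U : opens T) s : @P i U s -> @P j U (diff C i j U s).
Proof.
move=> [h1 h2]; split=> [mj|_]; last by rewrite diff_sq.
have [e|ne] := pselect (j = i + 1); last by rewrite diff_out.
subst j; move: mj; rewrite ltzD1 le_eqVlt => /orP[/eqP mi|mi]; first exact: h2.
by rewrite h1 // hom0.
Qed.
Let d i j := subsheaf_hom (truncation_closed i) (truncation_closed j)
  (@truncation_diff i j).
Lemma truncation_out i j : j <> i + 1 -> forall (U : opens T) s, d i j U s = 0.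
Proof. by move=> ij U s; apply: smval_inj; exact: diff_out. Qed.
Lemma truncation_sq i j k (U : opens T) s : d j k U (d i j U s) = 0.
Proof. by apply: smval_inj; exact: diff_sq. Qed.
(* tau_(<= m) C: C^i for i < m, ker d in degree m, 0 above. *)
Definition truncation := Complex truncation_out truncation_sq.
End truncation.

(* The section s of C^i becomes a coboundary near every point of U. *)
Definition locally_coboundary (C : complex T) (i : int) (U : opens T) (s : C i U) :=
  forall x, U x -> exists (V : opens T) (VU : V `<=` U) (t : C (i - 1) V),
    V x /\ diff C (i - 1) i V t = res VU s.

(* The maps H^i(u) of cohomology sheaves are injective (first clause) and
   surjective (second clause). *)
Definition quasi_iso (C D : complex T) (u : complex_map C D) :=
  forall (i : int) (U : opens T),
    (forall s, diff C i (i + 1) U s = 0 ->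
       locally_coboundary (u i U s) -> locally_coboundary s) /\
    (forall t, diff D i (i + 1) U t = 0 -> forall x, U x ->
       exists (V : opens T) (VU : V `<=` U) (s : C i V),
         [/\ V x, diff C i (i + 1) V s = 0 &
             locally_coboundary (res VU t - u i V s)]).

(* Isomorphism in the derived category: a roof of quasi-isomorphisms. *)
Definition derived_iso (C D : complex T) :=
  exists (E : complex T) (u : complex_map E C) (v : complex_map E D),
    quasi_iso u /\ quasi_iso v.

Section cocycles.
Variables (C : complex T) (i : int).
Let P (U : opens T) (s : C i U) := diff C i (i + 1) U s = 0.
Lemma cocycles_closed : subsheaf_closed P.
Proof.
split=> [U|U V VU s hs|U I W WU cov s hs].
- split=> [|u v hu hv|a v hv]; rewrite /P; first exact: hom0.
    by rewrite homD hu hv addr0.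
  by rewrite homZ hv scaler0.
- by rewrite /P hom_res hs res0.
- apply: (@sheaf_local _ (C (i + 1)) U I W WU cov) => j.
  by rewrite -hom_res (hs j) res0.
Qed.
Definition cocycles := subsheaf cocycles_closed.

(* H is the cokernel, in the category of sheaves, of C^(i-1) -> ker d^i. *)
Definition is_cohomology_sheaf (H : sheaf T) := exists p : sheaf_hom cocycles H,
  (forall (U : opens T) z, p U z = 0 <-> locally_coboundary (smval z)) /\
  (forall (U : opens T) h x, U x -> exists (V : opens T) (VU : V `<=` U) (z : cocycles V),
     V x /\ p V z = res VU h).

(* The cohomology sheaf H^i(C), chosen up to isomorphism (it always exists). *)
Definition cohomology_sheaf : sheaf T :=
  if pselect (exists H, is_cohomology_sheaf H) is left ex then projT1 (cid ex)
  else cocycles.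
End cocycles.

Definition injective_sheaf (I : sheaf T) :=
  forall (A B : sheaf T) (m : sheaf_hom A B) (g : sheaf_hom A I),
    (forall U : opens T, injective (m U)) ->
    exists h : sheaf_hom B I, forall U s, h U (m U s) = g U s.

Definition bounded_below (C : complex T) :=
  exists a : int, forall i, i < a -> forall (U : opens T) (s : C i U), s = 0.

Definition is_injective_resolution (C I : complex T) :=
  [/\ bounded_below I, forall i, injective_sheaf (I i) &
      exists u : complex_map C I, quasi_iso u].

(* A choice of injective resolution. One exists whenever the cohomology of C is
   bounded below; the fallback is irrelevant. *)
Definition injective_resolution (C : complex T) : complex T :=
  if pselect (exists I, is_injective_resolution C I) is left ex
  then projT1 (cid ex) else C.

End complexes.

Section direct_image_complex.
Variables (S T : topologicalType) (f : continuousType S T) (C : complex S).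
Let d i j := direct_image_hom f (diff C i j).
Lemma direct_image_out i j : j <> i + 1 -> forall (U : opens T) s, d i j U s = 0.
Proof. by move=> ij U s; exact: diff_out. Qed.
Lemma direct_image_sq i j k (U : opens T) s : d j k U (d i j U s) = 0.
Proof. exact: diff_sq. Qed.
Definition direct_image_complex := Complex direct_image_out direct_image_sq.
End direct_image_complex.

Definition derived_direct_image (S T : topologicalType) (f : continuousType S T)
    (C : complex S) : complex T :=
  direct_image_complex f (injective_resolution C).

(* R^i f_* F *)
Definition higher_direct_image (S T : topologicalType) (f : continuousType S T)
    (i : int) (F : sheaf S) : sheaf T :=
  cohomology_sheaf (derived_direct_image f (concentrated F)) i.

Section constructible.
Variables (T : topologicalType) (G : filtration T).

(* The stalks of F at the points of A are finite dimensional, and F restricted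
   to A is locally constant: near each point of A, there are sections e_k of F
   whose germs at each y in A form a basis of the stalk F_y. *)
Definition locally_constant_on (F : sheaf T) (A : set T) :=
  forall x, A x -> exists (V : opens T) (r : nat) (e : 'I_r -> F V), V x /\
    forall y, A y -> V y ->
      (forall c : 'I_r -> rat,
         (exists (W : opens T) (WV : W `<=` V), W y /\ res WV (\sum_k c k *: e k) = 0) ->
         forall k, c k = 0) /\
      (forall (U : opens T) (s : F U), U y ->
         exists (c : 'I_r -> rat) (W : opens T) (WU : W `<=` U) (WV : W `<=` V),
           W y /\ res WU s = res WV (\sum_k c k *: e k)).

Definition constructible_sheaf (F : sheaf T) :=
  forall i : int, locally_constant_on F (level G i).

(* Membership in D^b_c, with respect to the stratification G. *)
Definition bounded_constructible (C : complex T) :=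
  (exists a b : int, forall i, i < a \/ b < i ->
     forall (U : opens T) (s : cohomology_sheaf C i U), s = 0) /\
  forall i, constructible_sheaf (cohomology_sheaf C i).
End constructible.

Definition lower_middle (k : nat) : nat := (k - 2)./2.
Definition upper_middle (k : nat) : nat := (k - 1)./2.

Section deligne.
Variables (Y : topologicalType) (n : nat) (G : filtration Y).

(* U_k = Y \ Y_(n-k) *)
Definition open_part (k : nat) : set Y := ~` G (n%:Z - k%:Z).

Lemma open_part_sub k : open_part k `<=` open_part k.+1.
Proof.
by apply: subsetC; apply: fil_mono; rewrite lerD2l lerN2 lez_nat.
Qed.

Variables (p : nat -> nat) (L : sheaf (open_part 2)).

(* [deligne_step i] lives on U_(i+2); the successor clause is
   tau_(<= p(k) - n) R(j_k)_* with k = i + 2. *)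
Fixpoint deligne_step (i : nat) : complex (open_part i.+2) :=
  match i with
  | 0 => shift_complex n (concentrated L)
  | i'.+1 => truncation ((p i'.+2)%:Z - n%:Z)
      (derived_direct_image (sub_inclusion (@open_part_sub i'.+2)) (deligne_step i'))
  end.

(* The last step lives on U_(n+1) = Y \ Y_(-1) = Y, and is transported to Y
   along the inclusion, which is then a homeomorphism; for n <= 1 there are no steps, and
   U_2 is already all of Y. *)
Definition IC : complex Y :=
  direct_image_complex (@inclusion Y (open_part n.-1.+2)) (deligne_step n.-1).

End deligne.

Section local_system.
Variables (R : realType) (X Y : topologicalType) (f : branched_covering R X Y).
Variable A : set Y.

Lemma restrict_over_finite (y : A) : finite_set (restrict_over (f := f) (A := A) @^-1` [set y]).
Proof.
apply: (@sub_finite_set _ _ ((val : f @^-1` A -> X) @^-1` (f @^-1` [set val y]))).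
  by move=> x /= <-.
by apply: finite_preimage; [move=> u v _ _; exact: val_inj|exact: bc_finite].
Qed.

(* The kernel of the trace map (f|)_* Q -> Q over A. *)
Definition local_system : sheaf A := trace_kernel restrict_over_finite.

End local_system.

(* Main.v *)
Require Import Defs.
From HB Require Import structures.
From mathcomp Require Import all_boot all_order all_algebra.
From mathcomp Require Import all_classical all_reals topology normedtype.
From mathcomp Require Import zify lra ring.

Set Implicit Arguments.
Unset Strict Implicit.
Unset Printing Implicit Defensive.

Import Order.TTheory GRing.Theory Num.Theory.
Import numFieldNormedType.Exports.

Local Open Scope classical_set_scope.
Local Open Scope ring_scope.

(* Let U_k be the complement of G_(n-k), let A_k be the direct image of the
   constant sheaf along the restriction of f over U_k, and let K_k be the direct
   image on U_k of the local system L on U_2. All complexes in the statement have a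
   single cohomology sheaf, and two such complexes with isomorphic cohomology
   sheaves are isomorphic in the derived category; hence it is enough to show that
   IC is K = R^0 j_* L placed in degree -n, and that f_* Q = Q + K.

   Local flatness of f^-1 R makes each stratum upstairs a coordinate subspace of
   codimension k >= 2 in a chart of X, so its complement in small balls is non-empty
   and connected and has no cohomology in degrees 1, ..., k - 2. Consequently
   locally constant functions extend uniquely across the strata upstairs, and
   averaging over the fibres of f splits A_k as Q + K_k. Since f is finite, the
   vanishing passes to A_k and to its retract K_k; as p(k) <= k - 2, every truncated
   direct image in the construction of IC only retains K_(k+1).

   For constructibility, f is a covering over each stratum: injectivity of f on
   the preimage of a stratum near a point follows by descending induction on the
   dimension, lifting over the next higher stratum a contraction that comes from
   the cone structure of R (or, when R is a manifold nearby, from a flat chart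
   of Y). *)

(** * Sheaves of rational vector spaces *)

(** [injective_resolution] and [cohomology_sheaf] are arbitrary choices, so nothing can be computed
    inside them. Every statement is carried by the relation [pure C c K], which is stable under
    quasi-isomorphism, shift, direct sum and suitable truncation, and complexes are compared with
    resolutions that vanish below degree [c]. The obstacle is the passage from upstairs to
    downstairs: vanishing is known for a resolution of the constant sheaf on the preimage of U_k,
    whereas [IC] pushes forward an unrelated resolution of K_k. The splitting of sheaves lifts to
    resolutions only up to homotopy; what survives is injectivity on the cohomology of sections, and
    the mapping cone serves to prove that. Stalks and sheafification are never formed: morphisms are
    glued from local relations, injectives come from linear forms on germs, and spheres are treated
    by Mayer-Vietoris on unions of boxes. The same subdivision of boxes later lifts homotopies. *)

Section sheaf_basics.
Variables (T : topologicalType) (F : sheaf T).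

Lemma res_irr (U V : opens T) (VU VU' : V `<=` U) (s : F U) : res VU s = res VU' s.
Proof. by rewrite (Prop_irrelevance VU VU'). Qed.

Lemma resD (U V : opens T) (VU : V `<=` U) (s t : F U) :
  res VU (s + t) = res VU s + res VU t.
Proof. by have := res_linear VU 1 s t; rewrite !scale1r. Qed.

Lemma resN (U V : opens T) (VU : V `<=` U) (s : F U) : res VU (- s) = - res VU s.
Proof. by rewrite -scaleN1r resZ scaleN1r. Qed.

Lemma resB (U V : opens T) (VU : V `<=` U) (s t : F U) :
  res VU (s - t) = res VU s - res VU t.
Proof. by rewrite resD resN. Qed.

Definition opensI (U V : opens T) : opens T :=
  Opens (openI (oset_open U) (oset_open V)).
Lemma opensIl (U V : opens T) : opensI U V `<=` U. Proof. by move=> x []. Qed.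
Lemma opensIr (U V : opens T) : opensI U V `<=` V. Proof. by move=> x []. Qed.

Lemma sheaf_eq (U : opens T) (s t : F U) :
  (forall x, U x -> exists (V : opens T) (VU : V `<=` U),
     V x /\ res VU s = res VU t) -> s = t.
Proof.
move=> st.
have /choice[W hW] : forall i : {x | U x}, exists V : opens T,
    exists VU : V `<=` U, V (sval i) /\ res VU s = res VU t.
  by move=> [x Ux]; exact: st.
have WU i : W i `<=` U by case: (hW i).
apply: (@sheaf_local _ F U _ W WU).
  by move=> x Ux; exists (exist _ x Ux) => //; case: (hW (exist _ x Ux)) => ? [].
by move=> i; case: (hW i) => VU [_]; rewrite (Prop_irrelevance VU (WU i)).
Qed.

(** Sections singled out by a property that is stable under restriction and has at most one solution
    on each open set agree on overlaps automatically, so local existence is all that gluing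
    requires. *)
Lemma glue_unique (U : opens T) (Q : forall V : opens T, F V -> Prop) :
  (forall (V W : opens T) (WV : W `<=` V) s, V `<=` U -> Q V s -> Q W (res WV s)) ->
  (forall (V : opens T) s s', V `<=` U -> Q V s -> Q V s' -> s = s') ->
  (forall x, U x -> exists (V : opens T) (s : F V), [/\ V `<=` U, V x & Q V s]) ->
  exists t : F U, forall (V : opens T) (VU : V `<=` U) s, Q V s -> res VU t = s.
Proof.
move=> Qres Quniq Qex.
have /choice[W hW] : forall i : {x | U x}, exists V : opens T,
    exists s : F V, [/\ V `<=` U, V (sval i) & Q V s].
  by move=> [x Ux]; exact: Qex.
have /all_tag[s hs] : forall i, {s : F (W i) | [/\ W i `<=` U, W i (sval i) & Q _ s]}.
  by move=> i; exact: cid.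
have WU i : W i `<=` U by case: (hs i).
have Qs i : Q _ (s i) by case: (hs i).
have [|i j V Vi Vj|t ht] := @sheaf_glue _ F U _ W WU _ s.
- by move=> x Ux; exists (exist _ x Ux) => //; case: (hs (exist _ x Ux)).
- by apply: (Quniq V); [move=> x /Vi /WU|exact: Qres|exact: Qres].
exists t => V VU r Qr; apply: sheaf_eq => x Vx.
have Wx : W (exist _ x (VU _ Vx)) x by case: (hs (exist _ x (VU _ Vx))).
set i := exist _ x _ in Wx.
exists (opensI V (W i)), (@opensIl _ _); split=> //.
have WiU : opensI V (W i) `<=` U by move=> z [/VU].
rewrite (res_comp _ _ WiU) -(res_comp (WU i) (@opensIr _ _) WiU) ht.
by apply: (Quniq _ _ _ WiU); exact: Qres.
Qed.

End sheaf_basics.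

Lemma homN (T : topologicalType) (F G : sheaf T) (a : sheaf_hom F G) U s :
  a U (- s) = - a U s.
Proof. by rewrite -scaleN1r homZ scaleN1r. Qed.

Lemma homB (T : topologicalType) (F G : sheaf T) (a : sheaf_hom F G) U s t :
  a U (s - t) = a U s - a U t.
Proof. by rewrite homD homN. Qed.

(** Stands in for sheafification: class maps of cocycles and the maps of the trace splitting are
    first known only as relations between sections, single-valued but just locally total. *)
Lemma hom_of_local_rel (T : topologicalType) (F G : sheaf T)
    (r : forall U : opens T, F U -> G U -> Prop) :
  (forall (U : opens T) s t t', r U s t -> r U s t' -> t = t') ->
  (forall (U : opens T) s t s' t' a, r U s t -> r U s' t' -> r U (a *: s + s') (a *: t + t')) ->
  (forall (U V : opens T) (VU : V `<=` U) s t, r U s t -> r V (res VU s) (res VU t)) ->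
  (forall (U : opens T) s x, U x -> exists (V : opens T) (VU : V `<=` U) t, V x /\ r V (res VU s) t) ->
  exists h : sheaf_hom F G, forall (U : opens T) s t, r U s t -> h U s = t.
Proof.
move=> runiq rlin rres rex.
have /all_tag[h hh] : forall Us : {U : opens T & F U}, {t : G (projT1 Us) |
    forall (V : opens T) (VU : V `<=` projT1 Us) t', r V (res VU (projT2 Us)) t' -> res VU t = t'}.
  move=> [U s] /=; apply: cid.
  have [V W WV t VU [VU' rt]|V t t' VU [VU1 rt] [VU2 rt']|x Ux|t ht] := @glue_unique _ G U
      (fun V t => exists VU : V `<=` U, r V (res VU s) t).
  - exists (fun x Wx => VU _ (WV _ Wx)).
    by rewrite -(res_comp VU' WV); exact: rres.
  - by apply: (runiq V (res VU s)); [rewrite (res_irr VU VU1)|rewrite (res_irr VU VU2)].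
  - have [V [VU [t [Vx rt]]]] := rex U s x Ux.
    by exists V, t; split=> //; exists VU.
  - by exists t => V VU t' rt; apply: ht; exists VU.
pose H (U : opens T) (s : F U) : G U := h (existT _ U s).
have HE (U : opens T) s (V : opens T) (VU : V `<=` U) t : r V (res VU s) t -> res VU (H U s) = t.
  exact: (hh (existT _ U s)).
have Hlin (U : opens T) : linear (@H U).
  move=> a u v; apply: sheaf_eq => x Ux.
  have [V [VU [t [Vx rt]]]] := rex U u x Ux.
  have [W [WU [t' [Wx rt']]]] := rex U v x Ux.
  have IU : opensI V W `<=` U by move=> z [/VU].
  exists (opensI V W), IU; split=> //; rewrite resD resZ.
  rewrite (HE _ _ _ IU _ (eq_ind _ (fun z => r _ z _) (rres _ _ (@opensIl _ V W) _ _ rt) _ (res_comp _ _ IU _))).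
  rewrite (HE _ _ _ IU _ (eq_ind _ (fun z => r _ z _) (rres _ _ (@opensIr _ V W) _ _ rt') _ (res_comp _ _ IU _))).
  apply: HE; rewrite resD resZ; apply: rlin.
    by rewrite -(res_comp VU (@opensIl _ V W)); exact: rres.
  by rewrite -(res_comp WU (@opensIr _ V W)); exact: rres.
have Hres (U V : opens T) (VU : V `<=` U) s : H V (res VU s) = res VU (H U s).
  apply: sheaf_eq => x Vx.
  have [W [WV [t [Wx rt]]]] := rex V (res VU s) x Vx.
  exists W, WV; split=> //; rewrite (HE _ _ _ _ _ rt).
  have WU : W `<=` U by move=> z /WV/VU.
  by rewrite (res_comp _ _ WU); apply/esym/HE; rewrite -(res_comp VU WV).
exists (SheafHom Hlin Hres) => U s t rt /=.
have UU : U `<=` U by [].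
by rewrite -(res_id UU (H U s)); apply: HE; rewrite res_id.
Qed.

(** Universal property of a quotient, for a [p] that is surjective only locally: send [p z] to [g z]
    and glue. *)
Lemma hom_factor (T : topologicalType) (Z H H' : sheaf T)
    (p : sheaf_hom Z H) (g : sheaf_hom Z H') :
  (forall (U : opens T) h x, U x -> exists (V : opens T) (VU : V `<=` U) (z : Z V),
     V x /\ p V z = res VU h) ->
  (forall (U : opens T) z, p U z = 0 -> g U z = 0) ->
  exists h : sheaf_hom H H', forall U z, h U (p U z) = g U z.
Proof.
move=> psurj pg.
have [U s t t' [z [pz <-]] [z' [pz' <-]]|U s t s' t' a [z [pz <-]] [z' [pz' <-]]
  |U V VU s t [z [pz <-]]|U s x Ux|h hh] :=
  @hom_of_local_rel T H H' (fun U s t => exists z, p U z = s /\ g U z = t).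
- by apply/eqP; rewrite -subr_eq0 -homB pg // homB pz pz' subrr.
- by exists (a *: z + z'); rewrite !homD !homZ pz pz'.
- by exists (res VU z); rewrite !hom_res pz.
- have [V [VU [z [Vx pz]]]] := psurj U s x Ux.
  by exists V, VU, (g V z); split=> //; exists z.
- by exists h => U z; apply: hh; exists z.
Qed.

Lemma loc_surj_iso (T : topologicalType) (Z H H' : sheaf T)
    (p : sheaf_hom Z H) (p' : sheaf_hom Z H') :
  (forall (U : opens T) h x, U x -> exists (V : opens T) (VU : V `<=` U) (z : Z V),
     V x /\ p V z = res VU h) ->
  (forall (U : opens T) h x, U x -> exists (V : opens T) (VU : V `<=` U) (z : Z V),
     V x /\ p' V z = res VU h) ->
  (forall (U : opens T) z, p U z = 0 <-> p' U z = 0) -> sheaf_iso H H'.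
Proof.
move=> ps ps' pp'.
have [a ha] := hom_factor ps (fun U z => (pp' U z).1).
have [b hb] := hom_factor ps' (fun U z => (pp' U z).2).
exists a, b; split=> U s; apply: sheaf_eq => x Ux.
  have [V [VU [z [Vx pz]]]] := ps U s x Ux; exists V, VU; split=> //.
  by rewrite -!hom_res -pz ha hb.
have [V [VU [z [Vx pz]]]] := ps' U s x Ux; exists V, VU; split=> //.
by rewrite -!hom_res -pz hb ha.
Qed.

Section hom_constructions.
Variable T : topologicalType.

Lemma id_hom_linear (F : sheaf T) (U : opens T) : linear (@idfun (F U)).
Proof. by []. Qed.
Definition id_hom (F : sheaf T) : sheaf_hom F F :=
  SheafHom (@id_hom_linear F) (fun U V VU s => erefl).

Section comp.
Variables (F G H : sheaf T) (b : sheaf_hom G H) (a : sheaf_hom F G).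
Lemma comp_hom_linear (U : opens T) : linear (fun s => b U (a U s)).
Proof. by move=> c u v; rewrite !(homD, homZ). Qed.
Lemma comp_hom_res (U V : opens T) (VU : V `<=` U) s :
  b V (a V (res VU s)) = res VU (b U (a U s)).
Proof. by rewrite !hom_res. Qed.
Definition comp_hom := SheafHom comp_hom_linear comp_hom_res.
End comp.

Section add.
Variables (F G : sheaf T) (a b : sheaf_hom F G).
Lemma add_hom_linear (U : opens T) : linear (fun s => a U s + b U s).
Proof. by move=> c u v; rewrite !(homD, homZ) scalerDr addrACA. Qed.
Lemma add_hom_res (U V : opens T) (VU : V `<=` U) s :
  a V (res VU s) + b V (res VU s) = res VU (a U s + b U s).
Proof. by rewrite !hom_res resD. Qed.
Definition add_hom := SheafHom add_hom_linear add_hom_res.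
End add.

Section subsheaf_val.
Variables (F : sheaf T) (P : forall U : opens T, F U -> Prop) (cP : subsheaf_closed P).
Definition val_hom : sheaf_hom (subsheaf cP) F :=
  @SheafHom _ (subsheaf cP) F (fun U s => smval s) (fun U a u v => erefl)
    (fun U V VU s => erefl).

Lemma val_hom_inj (U : opens T) : injective (val_hom U).
Proof. by move=> x y; exact: smval_inj. Qed.

Section corestrict.
Variables (E : sheaf T) (a : sheaf_hom E F) (aP : forall U s, P (a U s)).
Let h (U : opens T) (s : E U) : subsheaf cP U := Submod (ssc_submod cP U) (aP s).
Lemma corestrict_linear (U : opens T) : linear (@h U).
Proof. by move=> c u v; apply: smval_inj => /=; rewrite homD homZ. Qed.
Lemma corestrict_res (U V : opens T) (VU : V `<=` U) s : h (res VU s) = res VU (h s).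
Proof. by apply: smval_inj => /=; rewrite hom_res. Qed.
Definition corestrict : sheaf_hom E (subsheaf cP) := SheafHom corestrict_linear corestrict_res.
End corestrict.
End subsheaf_val.

Lemma kernel_closed (F G : sheaf T) (a : sheaf_hom F G) :
  subsheaf_closed (fun U (s : F U) => a U s = 0).
Proof.
split=> [U|U V VU s hs|U I W WU cov s hs].
- split=> [|u v hu hv|c v hv]; first exact: hom0.
    by rewrite homD hu hv addr0.
  by rewrite homZ hv scaler0.
- by rewrite hom_res hs res0.
- by apply: (@sheaf_local _ G U I W WU cov) => j; rewrite -hom_res (hs j) res0.
Qed.

Definition locally_image (F G : sheaf T) (a : sheaf_hom F G) (U : opens T) (s : G U) :=
  forall x, U x -> exists (V : opens T) (VU : V `<=` U) (t : F V), V x /\ a V t = res VU s.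

Lemma locally_image_closed (F G : sheaf T) (a : sheaf_hom F G) :
  subsheaf_closed (@locally_image F G a).
Proof.
split=> [U|U V VU s hs x Vx|U I W WU cov s hs x Ux].
- split=> [x Ux|u v hu hv x Ux|c v hv x Ux].
  + have UU : U `<=` U by [].
    by exists U, UU, 0; rewrite hom0 res0.
  + have [V [VU [t [Vx at_]]]] := hu x Ux; have [W [WU [r [Wx ar]]]] := hv x Ux.
    have IU : opensI V W `<=` U by move=> z [/VU].
    exists (opensI V W), IU, (res (@opensIl _ V W) t + res (@opensIr _ V W) r).
    split=> //; rewrite homD !hom_res at_ ar resD.
    by rewrite !(res_comp _ _ IU).
  + have [V [VU [t [Vx at_]]]] := hv x Ux.
    by exists V, VU, (c *: t); split=> //; rewrite homZ at_ resZ.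
- have [W [WU [t [Wx at_]]]] := hs x (VU _ Vx).
  exists (opensI V W), (@opensIl _ V W), (res (@opensIr _ V W) t); split=> //.
  have IU : opensI V W `<=` U by move=> z [/VU].
  by rewrite hom_res at_ !(res_comp _ _ IU).
- have [i _ Wx] := cov _ Ux; have [V [VW [t [Vx at_]]]] := hs i x Wx.
  have VU : V `<=` U by move=> z /VW/WU.
  by exists V, VU, t; split=> //; rewrite at_ (res_comp _ _ VU).
Qed.

End hom_constructions.

Section injectives.
Variable T : topologicalType.

Lemma injective_retract (I J : sheaf T) (a : sheaf_hom I J) (b : sheaf_hom J I) :
  (forall U s, b U (a U s) = s) -> injective_sheaf J -> injective_sheaf I.
Proof.
move=> ba injJ A B m g minj.
have [h hm] := injJ A B m (comp_hom a g) minj.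
by exists (comp_hom b h) => U s /=; rewrite hm /= ba.
Qed.

Lemma injective_dsum (I J : sheaf T) :
  injective_sheaf I -> injective_sheaf J -> injective_sheaf (dsum_sheaf I J).
Proof.
move=> injI injJ A B m g minj.
pose fstl : sheaf_hom (dsum_sheaf I J) I := @SheafHom _ (dsum_sheaf I J) I (fun U s => s.1)
  (fun U a u v => erefl) (fun U V VU s => erefl).
pose sndl : sheaf_hom (dsum_sheaf I J) J := @SheafHom _ (dsum_sheaf I J) J (fun U s => s.2)
  (fun U a u v => erefl) (fun U V VU s => erefl).
have [h hm] := injI A B m (comp_hom fstl g) minj.
have [k km] := injJ A B m (comp_hom sndl g) minj.
have lin (U : opens T) : linear (fun s => (h U s, k U s) : dsum_sheaf I J U).
  by move=> a u v; rewrite !(homD, homZ).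
have rs (U V : opens T) (VU : V `<=` U) s :
    (h V (res VU s), k V (res VU s)) = res VU ((h U s, k U s) : dsum_sheaf I J U).
  by rewrite !hom_res.
exists (SheafHom lin rs) => U s /=.
by rewrite hm km /= -surjective_pairing.
Qed.

End injectives.

(** * Enough injectives *)

Section germ_functionals.
Variables (T : topologicalType) (F : sheaf T) (x : T).

(* A linear form on the stalk of F at x. *)
Record germ_functional := GermFunctional {
  gf :> forall U : opens T, F U -> rat;
  gf_linear : forall (U : opens T) a s t, U x -> @gf U (a *: s + t) = a * @gf U s + @gf U t;
  gf_res : forall (U V : opens T) (VU : V `<=` U) s, V x -> @gf V (res VU s) = @gf U s
}.

Let graph := set ({U : opens T & F U} * rat).
Let pt (U : opens T) (s : F U) (q : rat) : {U : opens T & F U} * rat := (existT _ U s, q).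

Definition germ_based (G : graph) :=
  forall (U : opens T) (s : F U) q, G (pt s q) -> U x.

Definition germ_linear (G : graph) :=
  forall (U V W : opens T) (WU : W `<=` U) (WV : W `<=` V) (s : F U) (t : F V) p q a, W x ->
    G (pt s p) -> G (pt t q) -> G (pt (a *: res WU s + res WV t) (a * p + q)).

Definition germ_univalent (G : graph) :=
  forall (U V : opens T) (VU : V `<=` U) (s : F U) q, V x -> res VU s = 0 ->
    G (pt s q) -> q = 0.

(* Zorn's lemma on germ-linear univalent relations: no quotient space of germs
   is needed. *)
Lemma germ_functional_extension (B : graph) :
  germ_based B -> germ_linear B -> germ_univalent B -> B !=set0 ->
  exists l : germ_functional, forall (U : opens T) (s : F U) q, B (pt s q) -> l U s = q.
Proof.
move=> Bx Blin Buni [[[U0 s0] q0] Bs0].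
pose good (G : graph) := [/\ B `<=` G, germ_based G, germ_linear G & germ_univalent G].
have goodB : good B by split.
have [F0 F0good F0tot|G [[G0|[BG Gx Glin Guni]] Gmax]] :=
  @Zorn_bigcup _ (fun G : graph => G = set0 \/ good G).
- have [[A [FA [BA Ax Alin Auni]]]|none] := pselect (exists A, F0 A /\ good A); last first.
    left; apply/seteqP; split=> // z [A FA Az].
    by case: (F0good A FA) => [A0|gA]; [rewrite A0 in Az|case: none; exists A].
  right; split.
  + by move=> z Bz; exists A => //; exact: BA.
  + move=> U s q [C FC Cs].
    by case: (F0good C FC) => [C0|[_ Cx _ _]]; [rewrite C0 in Cs|exact: Cx Cs].
  + move=> U V W WU WV s t p q a Wx [C FC Cs] [D FD Dt].
    have gC : good C by case: (F0good C FC) => // C0; rewrite C0 in Cs.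
    have gD : good D by case: (F0good D FD) => // D0; rewrite D0 in Dt.
    case: (F0tot _ _ FC FD) => CD.
      by exists D => //; case: gD => _ _ Dlin _; apply: Dlin => //; exact: CD.
    by exists C => //; case: gC => _ _ Clin _; apply: Clin => //; exact: CD.
  + move=> U V VU s q Vx rs [C FC Cs].
    case: (F0good C FC) => [C0|[_ _ _ Cuni]]; first by rewrite C0 in Cs.
    exact: (Cuni _ _ VU s q Vx rs Cs).
- case: (Gmax B); last by right.
  by rewrite G0; split=> // /(_ _ Bs0).
have G00 (W : opens T) : W x -> exists V : opens T, [/\ V `<=` W, V x & G (pt (0 : F V) 0)].
  move=> Wx; have U0x : U0 x by exact: Bx Bs0.
  exists (opensI W U0); split=> //; first exact: opensIl.
  have := Glin _ _ _ (@opensIr _ W U0) (@opensIr _ W U0) s0 s0 q0 q0 (- 1).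
  by rewrite scaleN1r addNr mulN1r addNr; apply => //; exact: BG.
have Gtot (U : opens T) (s : F U) : U x -> exists q (V : opens T) (VU : V `<=` U),
    V x /\ G (pt (res VU s) q).
  move=> Ux; apply: contrapT => nex.
  (* The candidate extension gives [s] the value 0: a section equal to [a *: s + v] near [x]
     receives the value of [v]. *)
  pose G' : graph := [set z : {U : opens T & F U} * rat | exists a (V W : opens T) (v : F V) (WV : W `<=` V)
    (WU : W `<=` U) (Wz : W `<=` projT1 z.1), [/\ W x, G (pt v z.2) &
      res Wz (projT2 z.1) = a *: res WU s + res WV v]].
  have [|nGG'] := pselect (G' `<=` G).
    have [V [VU Vx GV]] := G00 U Ux.
    move=> /(_ (pt s 0)) G's; apply: nex; exists 0, U, (fun z h => h).
    rewrite res_id; split=> //; apply: G's.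
    exists 1, V, V, 0, (fun z h => h), VU, VU; split=> //=.
    by rewrite res0 scale1r addr0.
  apply: (Gmax G'); first split=> //.
    move=> [[V v] q] Gv; have Vx : V x by exact: Gx Gv.
    exists 0, V, (opensI V U), v, (@opensIl _ _ _), (@opensIr _ _ _), (@opensIl _ _ _).
    by split=> //; rewrite scale0r add0r.
  right; split.
  - move=> z /BG Gz; move: z Gz => [[V v] q] Gv; have Vx : V x by exact: Gx Gv.
    exists 0, V, (opensI V U), v, (@opensIl _ _ _), (@opensIr _ _ _), (@opensIl _ _ _).
    by split=> //; rewrite scale0r add0r.
  - by move=> V v q [a [V1 [W [v1 [WV1 [WU [Wz [Wx _ _]]]]]]]]; exact: Wz.
  - move=> U1 U2 W WU1 WU2 t1 t2 p1 p2 c Wx.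
    move=> [a1 [V1 [W1 [v1 [WV1 [W1U [W1z [W1x Gv1 e1]]]]]]]].
    move=> [a2 [V2 [W2 [v2 [WV2 [W2U [W2z [W2x Gv2 e2]]]]]]]].
    rewrite /= in W1z e1 W2z e2.
    pose W' := opensI W (opensI W1 W2).
    have W'W : W' `<=` W by move=> z [].
    have W'1 : W' `<=` W1 by move=> z [_ []].
    have W'2 : W' `<=` W2 by move=> z [_ []].
    have W'U : W' `<=` U by move=> z /W'1/W1U.
    have W'V : W' `<=` opensI V1 V2 by move=> z [_ [/WV1 ? /WV2 ?]].
    have W'U1 : W' `<=` U1 by move=> z /W'1/W1z.
    have W'U2 : W' `<=` U2 by move=> z /W'2/W2z.
    have W'V1 : W' `<=` V1 by move=> z /W'1/WV1.
    have W'V2 : W' `<=` V2 by move=> z /W'2/WV2.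
    exists (c * a1 + a2), (opensI V1 V2), W',
      (c *: res (@opensIl _ V1 V2) v1 + res (@opensIr _ V1 V2) v2), W'V, W'U, W'W.
    split=> //=.
      by apply: Glin => //; split; [exact: (WV1 _ W1x)|exact: (WV2 _ W2x)].
    have /(congr1 (res W'1)) := e1; have /(congr1 (res W'2)) := e2.
    rewrite !resD !resZ (res_comp W2z W'2 W'U2) (res_comp W2U W'2 W'U) (res_comp WV2 W'2 W'V2).
    rewrite (res_comp W1z W'1 W'U1) (res_comp W1U W'1 W'U) (res_comp WV1 W'1 W'V1).
    rewrite (res_comp _ W'W W'U1) (res_comp _ W'W W'U2).
    rewrite (res_comp _ W'V W'V1) (res_comp _ W'V W'V2).
    by move=> -> ->; rewrite scalerDr scalerDl scalerA addrACA.
  - move=> V V' V'V t q V'x t0 [a [V1 [W [v [WV1 [WU [Wz [Wx Gv e]]]]]]]].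
    rewrite /= in Wz e.
    pose W' := opensI W V'.
    have W'W : W' `<=` W by exact: opensIl.
    have W'V' : W' `<=` V' by exact: opensIr.
    have W'V : W' `<=` V by move=> z /W'V'/V'V.
    have W'U : W' `<=` U by move=> z /W'W/WU.
    have W'V1 : W' `<=` V1 by move=> z /W'W/WV1.
    have W'x : W' x by [].
    move: e => /(congr1 (res W'W)).
    rewrite resD resZ !(res_comp _ _ W'V) (res_comp _ _ W'U) (res_comp _ _ W'V1).
    rewrite -(res_comp V'V W'V') t0 res0.
    have [->|a0] := eqVneq a 0.
      by rewrite scale0r add0r => /esym v0; exact: Guni v0 Gv.
    move=> /esym/eqP; rewrite addr_eq0 => /eqP sv; case: nex.
    (* Near [x], [s] is [- a^-1 *: v]. As [germ_linear] only yields combinations [b *: v + w], this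
       multiple is written with [v] itself as the second term. *)
    exists ((- a^-1 - 1) * q + q), W', W'U; split=> //.
    have -> : res W'U s = (- a^-1 - 1) *: res W'V1 v + res W'V1 v.
      rewrite scalerBl scale1r subrK scaleNr -scalerN -sv.
      by rewrite scalerA mulVf // scale1r.
    exact: Glin.
have Guniq (U : opens T) (s : F U) q q' (V V' : opens T) (VU : V `<=` U) (V'U : V' `<=` U) :
    G (pt (res VU s) q) -> G (pt (res V'U s) q') -> q = q'.
  move=> Gs Gs'; have Vx := Gx _ _ _ Gs; have Vx' := Gx _ _ _ Gs'.
  have := Glin _ _ _ (@opensIl _ V V') (@opensIr _ V V') _ _ _ _ (- 1) (conj Vx Vx') Gs Gs'.
  have IU : opensI V V' `<=` U by move=> z [/VU].
  rewrite !(res_comp _ _ IU) scaleN1r addNr => G0.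
  have Ix : opensI V V' x by [].
  have /eqP := Guni _ _ (fun z h => h) _ _ Ix (res0 _ _) G0.
  by rewrite mulN1r addrC subr_eq0 => /eqP.
pose l (U : opens T) (s : F U) : rat :=
  xget 0 [set q | exists (V : opens T) (VU : V `<=` U), G (pt (res VU s) q)].
have lE (U V : opens T) (VU : V `<=` U) (s : F U) q : G (pt (res VU s) q) -> l U s = q.
  rewrite /l => Gq; case: xgetP => [q' _ [V' [V'U Gq']]|/(_ q)[]]; last by exists V, VU.
  exact: Guniq Gq' Gq.
have lD (U : opens T) a s t : U x -> l U (a *: s + t) = a * l U s + l U t.
  move=> Ux; have [p [V [VU [Vx Gp]]]] := Gtot U s Ux.
  have [q [W [WU [Wx Gq]]]] := Gtot U t Ux.
  rewrite (lE _ _ _ _ _ Gp) (lE _ _ _ _ _ Gq).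
  have IU : opensI V W `<=` U by move=> z [/VU].
  apply: (lE _ _ IU); rewrite resD resZ.
  rewrite -(res_comp VU (@opensIl _ V W)) -(res_comp WU (@opensIr _ V W)).
  exact: Glin.
have lR (U V : opens T) (VU : V `<=` U) s : V x -> l V (res VU s) = l U s.
  move=> Vx; have [p [W [WV [Wx Gp]]]] := Gtot V (res VU s) Vx.
  have WU : W `<=` U by move=> z /WV/VU.
  by rewrite (lE _ _ _ _ _ Gp); apply/esym/(lE _ _ WU); rewrite -(res_comp VU WV).
exists (GermFunctional lD lR) => U s q Bs /=.
by apply: (lE _ _ (fun z h => h)); rewrite res_id; exact: BG.
Qed.

End germ_functionals.

Section function_injectives.
Variables (T : topologicalType) (A : Type) (a : A -> T).

(* The product over A of the skyscraper sheaves with stalk Q at the points a i. *)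
Let sec (U : opens T) : lmodType rat := {i : A | U (a i)} -> rat^o.
Let fres (U V : opens T) (VU : V `<=` U) (s : sec U) : sec V :=
  fun i => let: exist j Vj := i in s (exist _ j (VU _ Vj)).

Lemma skyscraper_irr (U : opens T) (s : sec U) i (p q : U (a i)) :
  s (exist _ i p) = s (exist _ i q).
Proof. by congr s; exact: eq_exist. Qed.
Lemma skyscraper_res_linear (U V : opens T) (VU : V `<=` U) : linear (@fres U V VU).
Proof. by move=> c u v; apply/funext => -[]. Qed.
Lemma skyscraper_res_id (U : opens T) (UU : U `<=` U) s : @fres U U UU s = s.
Proof. by apply/funext => -[i Ui]; congr s; exact: eq_exist. Qed.
Lemma skyscraper_res_comp (U V W : opens T) (VU : V `<=` U) (WV : W `<=` V)
  (WU : W `<=` U) s : fres WV (fres VU s) = fres WU s.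
Proof. by apply/funext => -[i Wi]; exact: (skyscraper_irr s). Qed.
Lemma skyscraper_local (U : opens T) (I : Type) (W : I -> opens T)
    (WU : forall i, W i `<=` U) : U `<=` \bigcup_i W i ->
    forall s t, (forall i, fres (WU i) s = fres (WU i) t) -> s = t.
Proof.
move=> cov s t st; apply/funext => -[i Ui].
have [k _ Wx] := cov _ Ui.
have := congr1 (fun g : sec (W k) => g (exist _ i Wx)) (st k); rewrite /fres /=.
by rewrite (skyscraper_irr s _ Ui) (skyscraper_irr t _ Ui).
Qed.
Lemma skyscraper_glue (U : opens T) (I : Type) (W : I -> opens T)
    (WU : forall i, W i `<=` U) : U `<=` \bigcup_i W i ->
    forall s : forall i, sec (W i),
    (forall i j (V : opens T) (Vi : V `<=` W i) (Vj : V `<=` W j),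
       fres Vi (s i) = fres Vj (s j)) ->
    exists t, forall i, fres (WU i) t = s i.
Proof.
move=> cov s comp.
have cov' (i : {i : A | U (a i)}) : {k : I | W k (a (sval i))}.
  by apply: cid; have [k _ Wx] := cov _ (svalP i); exists k.
exists (fun i => s (projT1 (cov' i)) (exist _ (sval i) (projT2 (cov' i)))).
move=> k; apply/funext => -[i Wki]; rewrite /fres /=.
case: (cov' _) => j /= Wji.
have Vi : opensI (W k) (W j) (a i) by [].
have /(congr1 (fun g : sec (opensI (W k) (W j)) => g (exist _ i Vi))) :=
  comp k j _ (@opensIl _ (W k) (W j)) (@opensIr _ (W k) (W j)).
rewrite /fres /= (skyscraper_irr (s k) _ Wki) => ->.
exact: skyscraper_irr.
Qed.
Definition skyscrapers := Sheaf skyscraper_res_linear skyscraper_res_id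
  skyscraper_res_comp skyscraper_local skyscraper_glue.

Lemma skyscrapers_flasque (U V : opens T) (VU : V `<=` U) (s : skyscrapers V) :
  exists t : skyscrapers U, res VU t = s.
Proof.
exists (fun i => if pselect (V (a (sval i))) is left Vi then s (exist _ (sval i) Vi) else 0).
apply/funext => -[i Vi]; rewrite /res /= /fres /=.
by case: pselect => // Vi'; exact: skyscraper_irr.
Qed.

Section into.
Variables (F : sheaf T) (l : forall i, germ_functional F (a i)).
Let h (U : opens T) (s : F U) : skyscrapers U := fun i => l (sval i) U s.
Lemma to_skyscrapers_linear (U : opens T) : linear (@h U).
Proof. by move=> c u v; apply/funext => -[i Ui]; exact: gf_linear. Qed.
Lemma to_skyscrapers_res (U V : opens T) (VU : V `<=` U) s : h (res VU s) = res VU (h s).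
Proof. by apply/funext => -[i Vi]; exact: gf_res. Qed.
Definition to_skyscrapers : sheaf_hom F skyscrapers :=
  SheafHom to_skyscrapers_linear to_skyscrapers_res.
End into.

(** A morphism into the product is a family of linear forms on germs, one per index. On the image of
    [m] such a form is single-valued because [m] is injective on sections, and it extends to all
    germs of [B]. *)
Lemma skyscrapers_injective : injective_sheaf skyscrapers.
Proof.
move=> E B m g minj.
pose gi i (U : opens T) (s : E U) : rat :=
  if pselect (U (a i)) is left Ui then g U s (exist _ i Ui) else 0.
have giE i (U : opens T) (s : E U) (Ui : U (a i)) : gi i U s = g U s (exist _ i Ui).
  by rewrite /gi; case: pselect => // Ui'; congr (g U s _); exact: eq_exist.
have gires i (U V : opens T) (VU : V `<=` U) (s : E U) :
    V (a i) -> gi i V (res VU s) = gi i U s.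
  move=> Vi; rewrite !giE; first exact: VU.
  by move=> Ui; rewrite hom_res; congr (g U s _); exact: eq_exist.
have ex i : exists l : germ_functional B (a i), forall (U : opens T) (s : E U),
    U (a i) -> l U (m U s) = gi i U s.
  have [| | | |l hl] := @germ_functional_extension T B (a i)
    [set z : {U : opens T & B U} * rat | projT1 z.1 (a i) /\ exists (W : opens T) (WU : W `<=` projT1 z.1) (t : E W),
      [/\ W (a i), m W t = res WU (projT2 z.1) & gi i W t = z.2]].
  - by move=> U s q [].
  - move=> U V W WU WV s t p q c Wi [/= Ui [U' [U'U [s' [U'i ms' gs']]]]].
    move=> [/= Vi [V' [V'V [t' [V'i mt' gt']]]]]; split=> //=.
    pose W' := opensI W (opensI U' V').
    have W'W : W' `<=` W by move=> z [].
    have W'U' : W' `<=` U' by move=> z [_ []].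
    have W'V' : W' `<=` V' by move=> z [_ []].
    have W'U : W' `<=` U by move=> z /W'W/WU.
    have W'V : W' `<=` V by move=> z /W'W/WV.
    have W'i : W' (a i) by [].
    exists W', W'W, (c *: res W'U' s' + res W'V' t'); split=> //.
      rewrite homD homZ !hom_res ms' mt' resD resZ.
      by rewrite (res_comp _ _ W'U) (res_comp _ _ W'V) (res_comp _ _ W'U) (res_comp _ _ W'V).
    rewrite giE homD homZ !hom_res -gs' -gt' !giE.
    by congr (c * _ + _); [exact: (skyscraper_irr (g U' s'))|exact: (skyscraper_irr (g V' t'))].
  - move=> U V VU s q Vi s0 [/= Ui [W [WU [t [Wi mt <-]]]]].
    have IU : opensI W V `<=` U by move=> z [/WU].
    have t0 : res (@opensIl _ W V) t = 0.
      apply: minj; rewrite hom_res mt hom0 (res_comp _ _ IU).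
      by rewrite -(res_comp VU (@opensIr _ W V)) s0 res0.
    have Ii : opensI W V (a i) by [].
    by rewrite -(gires _ _ _ (@opensIl _ W V)) // t0 giE hom0.
  - have oT : open [set: T] by exact: openT.
    exists (existT _ (Opens oT) (0 : B (Opens oT)), 0 : rat); split=> //=.
    exists (Opens oT), (fun z h => h), 0; rewrite hom0 res0; split=> //.
    by rewrite giE // hom0.
  exists l => U s Ui; apply: hl; split=> //=.
  by exists U, (fun z h => h), s; rewrite res_id.
have [l hl] : {l : forall i, germ_functional B (a i) |
    forall i (U : opens T) (s : E U), U (a i) -> l i U (m U s) = gi i U s}.
  by have /all_tag[l hl] := fun i => cid (ex i); exists l.
exists (to_skyscrapers l) => U s; apply/funext => -[i Ui] /=.
by rewrite hl // giE.
Qed.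

End function_injectives.

(* Index by all linear forms on all stalks of F that vanish on P. *)
Lemma embed_quotient (T : topologicalType) (F : sheaf T)
    (P : forall U : opens T, F U -> Prop) :
  subsheaf_closed P -> exists (A : Type) (a : A -> T) (h : sheaf_hom F (skyscrapers a)),
    forall (U : opens T) s, h U s = 0 <-> P U s.
Proof.
move=> cP.
pose A := {x : T & {l : germ_functional F x | forall (U : opens T) s, U x -> P U s -> l U s = 0}}.
exists A, (@projT1 _ _), (to_skyscrapers (fun i : A => sval (projT2 i))) => U s; split; last first.
  by move=> Ps; apply/funext => -[[x [l hl]] /= Ux]; exact: hl.
move=> h0; have P0 (V : opens T) : P V 0 by exact: sc0 (ssc_submod cP V).
have loc x : U x -> exists (V : opens T) (VU : V `<=` U), V x /\ P V (res VU s).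
  move=> Ux; apply: contrapT => nex.
  (* If no restriction of [s] near [x] lies in [P], the relation [t = q *: s] modulo [P] is
     single-valued; it extends to a form that kills [P] and takes the value 1 at [s], contrary to
     [h U s = 0]. *)
  have [| | | |l hl] := @germ_functional_extension T F x
    [set z : {U : opens T & F U} * rat | projT1 z.1 x /\ exists (W : opens T) (WU : W `<=` U) (Wz : W `<=` projT1 z.1),
      W x /\ P W (res Wz (projT2 z.1) - z.2 *: res WU s)].
  - by move=> V t q [].
  - move=> V1 V2 W WV1 WV2 t1 t2 q1 q2 c Wx [/= V1x [W1 [W1U [W1V [W1x P1]]]]].
    move=> [/= V2x [W2 [W2U [W2V [W2x P2]]]]]; split=> //=.
    pose W' := opensI W (opensI W1 W2).
    have W'W : W' `<=` W by move=> z [].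
    have W'1 : W' `<=` W1 by move=> z [_ []].
    have W'2 : W' `<=` W2 by move=> z [_ []].
    have W'U : W' `<=` U by move=> z /W'1/W1U.
    have W'V1 : W' `<=` V1 by move=> z /W'W/WV1.
    have W'V2 : W' `<=` V2 by move=> z /W'W/WV2.
    exists W', W'U, W'W; split=> //.
    have := scD (ssc_submod cP W') (scZ (ssc_submod cP W') c (ssc_res cP W'1 P1))
      (ssc_res cP W'2 P2).
    rewrite !resB !resZ resD resZ !(res_comp _ _ W'U) (res_comp _ _ W'V1) (res_comp _ _ W'V2).
    rewrite (res_comp _ _ W'V1) (res_comp _ _ W'V2).
    by rewrite scalerBr scalerA addrACA -opprD -scalerDl.
  - move=> V V' V'V t q V'x t0 [/= Vx [W [WU [WV [Wx Pt]]]]].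
    apply: contrapT => /eqP q0; apply: nex.
    pose W' := opensI W V'.
    have W'W : W' `<=` W by exact: opensIl.
    have W'V' : W' `<=` V' by exact: opensIr.
    have W'U : W' `<=` U by move=> z /W'W/WU.
    have W'V : W' `<=` V by move=> z /W'W/WV.
    exists W', W'U; split=> //.
    have := ssc_res cP W'W Pt; rewrite resB resZ (res_comp _ _ W'U) (res_comp _ _ W'V).
    rewrite -(res_comp V'V W'V') t0 res0 sub0r => /(scZ (ssc_submod cP W') (- q^-1)).
    by rewrite scalerN scaleNr opprK scalerA mulVf // scale1r.
  - exists (existT _ U (0 : F U), 0 : rat); split=> //=; exists U, (fun z h => h), (fun z h => h).
    by rewrite res0 scale0r subr0.
  have ker (V : opens T) t : V x -> P V t -> l V t = 0.
    move=> Vx Pt; apply: hl; split=> //=.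
    exists (opensI U V), (@opensIl _ _ _), (@opensIr _ _ _); split=> //.
    by rewrite scale0r subr0; exact: ssc_res.
  have : l U s = 1.
    apply: hl; split=> //=; exists U, (fun z h => h), (fun z h => h).
    by rewrite !res_id scale1r subrr.
  move: h0 => /(congr1 (fun k => k (exist _ (existT _ x (exist _ l ker) : A) Ux))) /= ->.
  by move/eqP; rewrite eq_sym oner_eq0.
have /choice[W hW] : forall i : {x | U x}, exists V : opens T,
    exists VU : V `<=` U, V (sval i) /\ P V (res VU s).
  by move=> [x Ux]; exact: loc.
have WU i : W i `<=` U by case: (hW i).
apply: (@ssc_local _ _ _ cP U _ W WU).
  by move=> x Ux; exists (exist _ x Ux) => //; case: (hW (exist _ x Ux)) => ? [].
by move=> i; case: (hW i) => VU [_]; rewrite (Prop_irrelevance VU (WU i)).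
Qed.

(** An injective sheaf is a retract of a product of skyscrapers, where sections extend by zero. *)
Lemma injective_flasque (T : topologicalType) (I : sheaf T) (U V : opens T)
    (VU : V `<=` U) (s : I V) : injective_sheaf I -> exists t : I U, res VU t = s.
Proof.
move=> injI.
have [|A [a [h h0]]] := @embed_quotient T I (fun U s => s = 0).
  split=> [W|W W' W'W r ->|W J Wj WW cov r hr].
  - by split=> [//|u v -> ->|c v ->]; rewrite ?addr0 ?scaler0.
  - exact: res0.
  - by apply: (@sheaf_local _ I W J Wj WW cov) => j; rewrite hr res0.
have [|k hk] := injI _ _ h (id_hom I).
  by move=> W r r' e; apply/eqP; rewrite -subr_eq0; apply/eqP/h0; rewrite homB e subrr.
have [t ht] := skyscrapers_flasque VU (h V s).
by exists (k U t); rewrite -hom_res ht hk.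
Qed.

(** By retraction again: the direct image of the skyscrapers at the points [a i] consists of the
    skyscrapers at [f (a i)], with literally the same sections. This takes the place of the argument
    by the exact left adjoint. *)
Lemma injective_direct_image (S T : topologicalType) (f : continuousType S T) (I : sheaf S) :
  injective_sheaf I -> injective_sheaf (direct_image f I).
Proof.
move=> injI.
have [|A [a [h h0]]] := @embed_quotient S I (fun U s => s = 0).
  split=> [W|W W' W'W r ->|W J Wj WW cov r hr].
  - by split=> [//|u v -> ->|c v ->]; rewrite ?addr0 ?scaler0.
  - exact: res0.
  - by apply: (@sheaf_local _ I W J Wj WW cov) => j; rewrite hr res0.
have [|k hk] := injI _ _ h (id_hom I).
  by move=> W r r' e; apply/eqP; rewrite -subr_eq0; apply/eqP/h0; rewrite homB e subrr.
apply: (@injective_retract _ _ (direct_image f (skyscrapers a)) (direct_image_hom f h)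
  (direct_image_hom f k)); first by move=> U s; exact: hk.
have resE (U V : opens T) (VU : V `<=` U) s :
    @res _ (direct_image f (skyscrapers a)) U V VU s = @res _ (skyscrapers (f \o a)) U V VU s.
  by apply/funext => -[i Vi]; rewrite /res /=; exact: skyscraper_irr.
pose fwd : sheaf_hom (direct_image f (skyscrapers a)) (skyscrapers (f \o a)) :=
  @SheafHom _ (direct_image f (skyscrapers a)) (skyscrapers (f \o a))
    (fun U s => s) (fun U c u v => erefl) (fun U V VU s => resE U V VU s).
pose bwd : sheaf_hom (skyscrapers (f \o a)) (direct_image f (skyscrapers a)) :=
  @SheafHom _ (skyscrapers (f \o a)) (direct_image f (skyscrapers a))
    (fun U s => s) (fun U c u v => erefl) (fun U V VU s => esym (resE U V VU s)).
by apply: (@injective_retract _ _ _ fwd bwd) => //; exact: skyscrapers_injective.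
Qed.

(** * Complexes with a single cohomology sheaf *)

(** Prescribes a graded family in one degree by an equation that can be rewritten; the transport
    along [c = i] stays inside this proof. *)
Lemma family_at (I : Type) (X : I -> Type) (d : forall i, X i) (c : I) (x : X c) :
  exists f : forall i, X i, f c = x /\ forall i, i <> c -> f i = d i.
Proof.
exists (fun i => match pselect (c = i) with
  | left e => eq_rect c X x i e | right _ => d i end).
split=> [|i ic]; case: pselect => // e; last by case: ic.
by rewrite (Prop_irrelevance e erefl).
Qed.

(** Integers offer no structural recursion upwards from [c]; the distance to [c] serves as fuel. *)
Lemma int_recursion (X : int -> Type) (c : int) (base : forall i, X i)
    (E : forall i, X (i - 1) -> X i) :
  exists f : forall i, X i, (forall i, i <= c -> f i = base i) /\
    (forall i, c < i -> f i = E i (f (i - 1))).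
Proof.
pose Phi := fix Phi (m : nat) : forall i, X i :=
  if m is m'.+1 then fun i => if i <= c then base i else E i (Phi m' (i - 1)) else base.
exists (fun i => Phi `|i - c|%N i); split=> i ic.
  by case: `|_|%N => //= m; rewrite ic.
have -> : `|(i - c)%R|%N = `|(i - 1 - c)%R|%N.+1.
  by clear -ic; move: (i : int) ic => {}i ic; lia.
by rewrite /= leNgt ic.
Qed.

Section cocycles_coboundaries.
Variables (T : topologicalType) (C : complex T).

(** All target degrees are allowed at once, so that degrees which agree only by arithmetic need no
    transport. By [diff_out] this is the condition in degree [i + 1]. *)
Definition cocycle (i : int) (U : opens T) (s : C i U) := forall j, diff C i j U s = 0.

Lemma cocycleP (i : int) (U : opens T) (s : C i U) :
  diff C i (i + 1) U s = 0 <-> cocycle s.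
Proof.
split=> [s0 j|]; last exact.
by have [->|/eqP ij] := eqVneq j (i + 1); [|exact: diff_out].
Qed.

Lemma cocycle0 i (U : opens T) : cocycle (0 : C i U).
Proof. by move=> j; exact: hom0. Qed.

Lemma cocycleB i (U : opens T) (s t : C i U) : cocycle s -> cocycle t -> cocycle (s - t).
Proof. by move=> hs ht j; rewrite homB hs ht subr0. Qed.

Lemma cocycle_res i (U V : opens T) (VU : V `<=` U) (s : C i U) :
  cocycle s -> cocycle (res VU s).
Proof. by move=> hs j; rewrite hom_res hs res0. Qed.

Lemma cocycle_diff i j (U : opens T) (s : C i U) : cocycle (diff C i j U s).
Proof. by move=> k; exact: diff_sq. Qed.

Lemma cocycle_local i (U : opens T) (s : C i U) :
  (forall x, U x -> exists (V : opens T) (VU : V `<=` U), V x /\ cocycle (res VU s)) ->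
  cocycle s.
Proof.
move=> loc j; apply: sheaf_eq => x /loc[V [VU [Vx hs]]].
by exists V, VU; split=> //; rewrite res0 -hom_res.
Qed.

Definition Cocycle i (U : opens T) (s : C i U) (hs : cocycle s) : cocycles C i U :=
  Submod (ssc_submod (cocycles_closed C i) U) ((cocycleP s).2 hs).

Lemma cocycles_cocycle i (U : opens T) (z : cocycles C i U) : cocycle (smval z).
Proof. by apply/cocycleP; exact: (smvalP z). Qed.

Lemma loc_cobP i (U : opens T) (s : C i U) :
  locally_coboundary s <-> forall x, U x -> exists (V : opens T) (VU : V `<=` U)
    (k : int) (t : C k V), V x /\ diff C k i V t = res VU s.
Proof.
split=> h x /h; first by move=> [V [VU [t ht]]]; exists V, VU, (i - 1), t.
move=> [V [VU [k [t [Vx dt]]]]]; exists V, VU.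
have [ki|/eqP ki] := eqVneq k (i - 1); first by subst k; exists t.
exists 0; split=> //; rewrite hom0 -dt diff_out // => e; apply: ki.
by rewrite e addrK.
Qed.

Lemma loc_cob_diff k i (U : opens T) (t : C k U) : locally_coboundary (diff C k i U t).
Proof.
by apply/loc_cobP => x Ux; exists U, (fun z h => h), k, t; rewrite res_id.
Qed.

Lemma loc_cob0 i (U : opens T) : locally_coboundary (0 : C i U).
Proof. by rewrite -(hom0 (diff C i i) U); exact: loc_cob_diff. Qed.

Lemma loc_cob_res i (U V : opens T) (VU : V `<=` U) (s : C i U) :
  locally_coboundary s -> locally_coboundary (res VU s).
Proof. exact: (ssc_res (locally_image_closed (diff C (i - 1) i))). Qed.

Lemma loc_cob_local i (U : opens T) (s : C i U) :
  (forall x, U x -> exists (V : opens T) (VU : V `<=` U), V x /\ locally_coboundary (res VU s)) ->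
  locally_coboundary s.
Proof.
move=> loc x /loc[V [VU [Vx /(_ x Vx)[W [WV [t [Wx dt]]]]]]].
have WU : W `<=` U by move=> z /WV/VU.
by exists W, WU, t; split=> //; rewrite dt (res_comp _ _ WU).
Qed.

Lemma loc_cobD i (U : opens T) (s t : C i U) :
  locally_coboundary s -> locally_coboundary t -> locally_coboundary (s + t).
Proof. exact: (scD (ssc_submod (locally_image_closed (diff C (i - 1) i)) U)). Qed.

Lemma loc_cobZ i (U : opens T) a (s : C i U) :
  locally_coboundary s -> locally_coboundary (a *: s).
Proof. exact: (scZ (ssc_submod (locally_image_closed (diff C (i - 1) i)) U)). Qed.

Lemma loc_cobB i (U : opens T) (s t : C i U) :
  locally_coboundary s -> locally_coboundary t -> locally_coboundary (s - t).
Proof. by move=> hs ht; apply: loc_cobD => //; rewrite -scaleN1r; exact: loc_cobZ. Qed.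

Definition acyclic_at (i : int) :=
  forall (U : opens T) (s : C i U), cocycle s -> locally_coboundary s.

End cocycles_coboundaries.

Definition zero_sheaf (T : topologicalType) (F : sheaf T) : sheaf T :=
  subsheaf (kernel_closed (id_hom F)).

Lemma zero_sheafP (T : topologicalType) (F : sheaf T) (U : opens T) (s : zero_sheaf F U) : s = 0.
Proof. by apply: smval_inj; exact: (smvalP s). Qed.

Section pure.
Variable T : topologicalType.

(* The only cohomology sheaf of C is K, in degree c, through p. *)
Record pure_via (C : complex T) (c : int) (K : sheaf T) (p : sheaf_hom (cocycles C c) K) : Prop := PureVia {
  pure_ker : forall (U : opens T) z, p U z = 0 <-> locally_coboundary (smval z);
  pure_surj : forall (U : opens T) h x, U x -> exists (V : opens T) (VU : V `<=` U) (z : cocycles C c V),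
    V x /\ p V z = res VU h;
  pure_acyclic : forall i, i <> c -> acyclic_at C i
}.

Definition pure (C : complex T) (c : int) (K : sheaf T) := exists p, @pure_via C c K p.

Lemma pureE (C : complex T) c (K : sheaf T) :
  pure C c K <-> is_cohomology_sheaf C c K /\ forall i, i <> c -> acyclic_at C i.
Proof.
by split=> [[p [h1 h2 h3]]|[[p [h1 h2]] h3]]; [split=> //|]; exists p; split.
Qed.

Lemma pure_iso (C : complex T) c (K K' : sheaf T) :
  pure C c K -> sheaf_iso K K' -> pure C c K'.
Proof.
move=> [p [pk ps pa]] [a [b [ba ab]]]; exists (comp_hom a p); split=> //= U.
- move=> z; rewrite -pk; split=> [apz|->]; last exact: hom0.
  by rewrite -(ba _ (p U z)) apz hom0.
- move=> h x Ux; have [V [VU [z [Vx pz]]]] := ps U (b U h) x Ux.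
  by exists V, VU, z; split=> //; rewrite pz hom_res ab.
Qed.

Lemma cohomology_sheaf_iso (C : complex T) c (K : sheaf T) :
  is_cohomology_sheaf C c K -> sheaf_iso (cohomology_sheaf C c) K.
Proof.
move=> CK; rewrite /cohomology_sheaf; case: pselect => [ex|[]]; last by exists K.
move: CK (projT2 (cid ex)) => [p [pk ps]] [q [qk qs]].
by apply: (loc_surj_iso qs ps) => U z; rewrite pk qk.
Qed.

Lemma cohomology_sheaf0 (C : complex T) i : acyclic_at C i ->
  forall (U : opens T) (s : cohomology_sheaf C i U), s = 0.
Proof.
move=> Ci; rewrite /cohomology_sheaf; case: pselect => [ex|nex].
  move: (projT2 (cid ex)) => [p [pk ps]] U s; apply: sheaf_eq => x Ux.
  have [V [VU [z [Vx pz]]]] := ps U s x Ux; exists V, VU; split=> //.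
  by rewrite res0 -pz; apply/pk/Ci; exact: cocycles_cocycle.
case: nex; exists (zero_sheaf (C i)), (zero_hom _ _).
split=> [U z|U h x Ux]; first by split=> // _; apply: Ci; exact: cocycles_cocycle.
by exists U, (fun z h => h), 0; split=> //; apply/esym/zero_sheafP.
Qed.

Lemma sheaf_iso_sym (F G : sheaf T) : sheaf_iso F G -> sheaf_iso G F.
Proof. by move=> [a [b [ba ab]]]; exists b, a. Qed.

Lemma sheaf_iso_trans (F G H : sheaf T) : sheaf_iso F G -> sheaf_iso G H -> sheaf_iso F H.
Proof.
move=> [a [b [ba ab]]] [a' [b' [ba' ab']]]; exists (comp_hom a' a), (comp_hom b b').
by split=> U s /=; rewrite ?ba' ?ba ?ab ?ab'.
Qed.

Section map.
Variables (C D : complex T) (u : complex_map C D).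

Lemma cmap_cocycle i (U : opens T) (s : C i U) : cocycle s -> cocycle (u i U s).
Proof. by move=> hs j; rewrite -cmap_diff hs hom0. Qed.

Lemma cmap_loc_cob i (U : opens T) (s : C i U) :
  locally_coboundary s -> locally_coboundary (u i U s).
Proof.
move=> h x /h[V [VU [t [Vx dt]]]]; exists V, VU, (u _ V t); split=> //.
by rewrite -cmap_diff dt hom_res.
Qed.

Lemma pure_quasi_iso c (K K' : sheaf T) p q (g : sheaf_hom K K') :
  @pure_via C c K p -> @pure_via D c K' q ->
  (forall (U : opens T) (z : cocycles C c U) (w : cocycles D c U),
     smval w = u c U (smval z) -> q U w = g U (p U z)) ->
  (forall (U : opens T) k, g U k = 0 -> k = 0) ->
  (forall (U : opens T) k', exists k, g U k = k') -> quasi_iso u.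
Proof.
move=> [pk ps pa] [qk qs qa] qg ginj gsurj i U; split=> [s /cocycleP hs us|t /cocycleP ht x Ux].
  have [ic|/eqP ic] := eqVneq i c; last exact: pa.
  subst i; apply/(pk U (Cocycle hs))/ginj.
  rewrite -(qg _ _ (Cocycle (cmap_cocycle hs))) //.
  by apply/qk.
have [ic|/eqP ic] := eqVneq i c; last first.
  exists U, (fun z h => h), 0; rewrite !hom0 res_id subr0; split=> //; exact: qa.
subst i; have [k gk] := gsurj U (q U (Cocycle ht)).
have [V [VU [z [Vx pz]]]] := ps U k x Ux.
exists V, VU, (smval z); split=> //; first exact: (smvalP z).
have hd : cocycle (res VU t - u c V (smval z)).
  apply: cocycleB; first exact: cocycle_res.
  by apply: cmap_cocycle; exact: cocycles_cocycle.
apply/(qk V (Cocycle hd)).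
have hz := cmap_cocycle (cocycles_cocycle z).
have -> : Cocycle hd = res VU (Cocycle ht) - Cocycle hz by apply: smval_inj.
by rewrite homB hom_res -gk (qg _ z) // pz hom_res subrr.
Qed.

(** The class of a cocycle [w] of [D] is [p z] for any [z] such that [w - u z] is locally a
    coboundary: injectivity on cohomology makes this single-valued, surjectivity makes it locally
    defined. *)
Lemma quasi_iso_pure c (K : sheaf T) : pure C c K -> quasi_iso u -> pure D c K.
Proof.
move=> [p [pk ps pa]] qu.
have uinj i (U : opens T) (s : C i U) : cocycle s -> locally_coboundary (u i U s) -> locally_coboundary s.
  by move=> /cocycleP hs; exact: (qu i U).1.
have usurj i (U : opens T) (t : D i U) : cocycle t -> forall x, U x ->
    exists (V : opens T) (VU : V `<=` U) (s : C i V),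
      [/\ V x, cocycle s & locally_coboundary (res VU t - u i V s)].
  move=> /cocycleP ht x Ux; have [V [VU [s [Vx hs h]]]] := (qu i U).2 t ht x Ux.
  by exists V, VU, s; split=> //; apply/cocycleP.
have [U w k k' [z [pz hz]] [z' [pz' hz']]|U w k w' k' a [z [pz hz]] [z' [pz' hz']]
  |U V VU w k [z [pz hz]]|U w x Ux|q hq] :=
  @hom_of_local_rel T (cocycles D c) K (fun U w k => exists z : cocycles C c U,
     p U z = k /\ locally_coboundary (smval w - u c U (smval z))).
- rewrite -pz -pz'; apply/eqP; rewrite -subr_eq0 -homB; apply/eqP/pk.
  apply: uinj; first exact: cocycles_cocycle.
  have -> : u c U (smval (z - z')) = (smval w - u c U (smval z')) - (smval w - u c U (smval z)).
    by rewrite (_ : smval (z - z') = smval z - smval z') // homB opprB [RHS]addrC addrA subrK.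
  exact: loc_cobB.
- exists (a *: z + z'); rewrite homD homZ pz pz'; split=> //.
  have -> : smval (a *: w + w') - u c U (smval (a *: z + z')) =
      a *: (smval w - u c U (smval z)) + (smval w' - u c U (smval z')).
    rewrite (_ : smval (a *: w + w') = a *: smval w + smval w') //.
    rewrite (_ : smval (a *: z + z') = a *: smval z + smval z') //.
    by rewrite homD homZ scalerBr addrACA -opprD.
  by apply: loc_cobD => //; exact: loc_cobZ.
- exists (res VU z); rewrite hom_res pz; split=> //.
  have -> : smval (res VU w) - u c V (smval (res VU z)) = res VU (smval w - u c U (smval z)).
    by rewrite resB -hom_res.
  exact: loc_cob_res.
- have [V [VU [s [Vx hs h]]]] := usurj _ _ _ (cocycles_cocycle w) x Ux.
  by exists V, VU, (p V (Cocycle hs)); split=> //; exists (Cocycle hs).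
have hq' (U : opens T) w : forall x, U x -> exists (V : opens T) (VU : V `<=` U) (z : cocycles C c V),
    [/\ V x, q V (res VU w) = p V z & locally_coboundary (smval (res VU w) - u c V (smval z))].
  move=> x Ux; have [V [VU [s [Vx hs h]]]] := usurj _ _ _ (cocycles_cocycle w) x Ux.
  exists V, VU, (Cocycle hs); split=> //.
  by apply: hq; exists (Cocycle hs).
exists q; split=> [U w|U h x Ux|i ic U w hw].
- split=> [qw|hw].
    apply: loc_cob_local => x Ux; have [V [VU [z [Vx qz h]]]] := hq' U w x Ux.
    exists V, VU; split=> //.
    have /pk hz : p V z = 0 by rewrite -qz hom_res qw res0.
    rewrite -[res VU _](subrK (u c V (smval z))).
    by apply: loc_cobD; [exact: h|exact: cmap_loc_cob].
  apply: sheaf_eq => x Ux; have [V [VU [z [Vx qz h]]]] := hq' U w x Ux.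
  exists V, VU; split=> //; rewrite -hom_res qz res0; apply/pk.
  apply: uinj; first exact: cocycles_cocycle.
  have -> : u c V (smval z) = smval (res VU w) - (smval (res VU w) - u c V (smval z)).
    by rewrite opprB addrCA subrr addr0.
  by apply: loc_cobB => //; exact: (loc_cob_res VU hw).
- have [V [VU [z [Vx pz]]]] := ps U h x Ux; exists V, VU.
  exists (Cocycle (cmap_cocycle (cocycles_cocycle z))); split=> //.
  by rewrite -pz; apply: hq; exists z; split=> //; rewrite subrr; exact: loc_cob0.
- apply: loc_cob_local => x Ux; have [V [VU [s [Vx hs h]]]] := usurj i U w hw x Ux.
  exists V, VU; split=> //; rewrite -[res VU w](subrK (u i V s)).
  by apply: loc_cobD => //; apply: cmap_loc_cob; exact: pa.
Qed.

End map.

(** * Injective resolutions *)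

Section resolutions.

(** An injective resolution of [K] placed in degree [c]. The augmentation identifies sections of [K]
    with cocycles of degree [c] over every open set, not merely on germs. *)
Record resolution (J : complex T) (c : int) (K : sheaf T) (e : sheaf_hom K (J c)) : Prop :=
  Resolution {
  rs_low : forall i, i < c -> forall (U : opens T) (s : J i U), s = 0;
  rs_injective : forall i, injective_sheaf (J i);
  rs_cocycle : forall (U : opens T) k, cocycle (e U k);
  rs_mono : forall (U : opens T) k, e U k = 0 -> k = 0;
  rs_exact : forall (U : opens T) (z : J c U), cocycle z -> exists k, e U k = z;
  rs_acyclic : forall i, i <> c -> acyclic_at J i
}.

Lemma resolution_pure (J : complex T) c (K : sheaf T) (e : sheaf_hom K (J c)) :
  resolution e -> exists p, @pure_via J c K p /\
    forall (U : opens T) z, e U (p U z) = smval z.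
Proof.
move=> [Jlow _ ec em ee ea].
have einj (U : opens T) : injective (e U).
  by move=> k k' h; apply/eqP; rewrite -subr_eq0; apply/eqP/em; rewrite homB h subrr.
have [U z k k' <- /einj|U z k z' k' a hz hz'|U V VU z k hz|U z x Ux|p hp] :=
  @hom_of_local_rel T (cocycles J c) K (fun U z k => e U k = smval z).
- by [].
- by rewrite homD homZ hz hz'.
- by rewrite hom_res hz.
- have [k hk] := ee U (smval z) (cocycles_cocycle z).
  by exists U, (fun z h => h), k; rewrite res_id.
have ep (U : opens T) z : e U (p U z) = smval z.
  by have [k hk] := ee U (smval z) (cocycles_cocycle z); rewrite (hp _ _ _ hk).
exists p; split=> //; split=> // U.
- move=> z; split=> [pz|hz]; first by rewrite -ep pz hom0; exact: loc_cob0.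
  apply: em; rewrite ep; apply: sheaf_eq => x /hz[V [VU [t [Vx dt]]]].
  have t0 : t = 0 by apply: Jlow; rewrite ltrBlDr ltrDl.
  by exists V, VU; split=> //; rewrite -dt t0 hom0 res0.
- move=> k x Ux; exists U, (fun z h => h), (Cocycle (ec U k)); split=> //.
  by rewrite res_id; exact: hp.
Qed.

(** Preimages under a monomorphism are unique, hence glue. *)
Lemma loc_image_global (F G : sheaf T) (a : sheaf_hom F G) (U : opens T) (s : G U) :
  (forall (U : opens T) k, a U k = 0 -> k = 0) -> locally_image a s -> exists k, a U k = s.
Proof.
move=> a0 hs.
have ainj (V : opens T) : injective (a V).
  by move=> k k' h; apply/eqP; rewrite -subr_eq0; apply/eqP/a0; rewrite homB h subrr.
have [V W WV t VU [VU' at_]|V t t' VU [VU1 h1] [VU2 h2]|x Ux|k hk] :=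
  @glue_unique T F U (fun V t => exists VU : V `<=` U, a V t = res VU s).
- exists (fun x Wx => VU _ (WV _ Wx)).
  by rewrite hom_res at_ (res_comp _ _ (fun x Wx => VU _ (WV _ Wx))).
- by apply: ainj; rewrite h1 h2 (res_irr VU1 VU2).
- by have [V [VU [t [Vx at_]]]] := hs x Ux; exists V, t; split=> //; exists VU.
exists k; apply: sheaf_eq => x Ux; have [V [VU [t [Vx at_]]]] := hs x Ux.
by exists V, VU; split=> //; rewrite -hom_res (hk _ _ t) //; exists VU.
Qed.

(** A sheaf with a subsheaf, standing for their quotient: [embed_quotient] maps the quotient into an
    injective sheaf without constructing it. *)
Record stage := Stage {
  stage_sheaf :> sheaf T;
  stage_pred : forall U : opens T, stage_sheaf U -> Prop;
  stage_closed : subsheaf_closed stage_pred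
}.

Lemma next_stage_ex (s : stage) : exists (I : sheaf T) (h : sheaf_hom s I),
  injective_sheaf I /\ forall (U : opens T) k, h U k = 0 <-> @stage_pred s U k.
Proof.
have [A [a [h h0]]] := embed_quotient (stage_closed s).
by exists (skyscrapers a), h; split=> //; exact: skyscrapers_injective.
Qed.

Let nextI (s : stage) : sheaf T := projT1 (cid (next_stage_ex s)).
Let nexth (s : stage) : sheaf_hom s (nextI s) := projT1 (cid (projT2 (cid (next_stage_ex s)))).
Let nextP (s : stage) : injective_sheaf (nextI s) /\
  forall (U : opens T) k, nexth s U k = 0 <-> @stage_pred s U k :=
  projT2 (cid (projT2 (cid (next_stage_ex s)))).
Let next (s : stage) : stage := Stage (locally_image_closed (nexth s)).

Section construction.
Variable K : sheaf T.
Let st (m : nat) : stage := iter m next (Stage (kernel_closed (id_hom K))).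
(** [st 0] is [K] itself, whence the offset: degree [m] of the resolution is stage [m.+1]. *)
Let X (z : int) : sheaf T :=
  match z with Posz m => st m.+1 | Negz _ => zero_sheaf K end.

Lemma standard_diff_ex : exists d : forall i j, sheaf_hom (X i) (X j),
  (forall m : nat, d m m.+1 = nexth (st m.+1)) /\
  forall i j, j <> i + 1 -> forall (U : opens T) s, d i j U s = 0.
Proof.
have ex i : exists d : forall j, sheaf_hom (X i) (X j),
    (forall m : nat, i = m -> forall e : i = m, eq_rect i (fun i => sheaf_hom (X i) (X m.+1)) (d m.+1) m e = nexth (st m.+1)) /\
    forall j, j <> i + 1 -> forall (U : opens T) s, d j U s = 0.
  case: i => m.
    have [d [dm d0]] := @family_at int (fun j => sheaf_hom (X m) (X j))
      (fun j => zero_hom (X m) (X j)) m.+1 (nexth (st m.+1)).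
    exists d; split=> [m' [mm'] e|j jm U s]; last by rewrite d0 // => e; apply: jm; rewrite e intS addrC.
    by subst m'; rewrite (Prop_irrelevance e erefl) /= dm.
  by exists (fun j => zero_hom _ _).
have /all_tag[d hd] := fun i => cid (ex i).
exists d; split=> [m|i j]; last exact: (hd i).2.
exact: ((hd m).1 m erefl erefl).
Qed.

Lemma resolution_at0 : exists (J : complex T) (e : sheaf_hom K (J 0)), resolution e.
Proof.
have [d [dS d0]] := standard_diff_ex.
have sq i j k (U : opens T) s : d j k U (d i j U s) = 0.
  have [->|/eqP ij] := eqVneq j (i + 1); last by rewrite (d0 i j) // hom0.
  have [->|/eqP jk] := eqVneq k (i + 1 + 1); last by rewrite (d0 _ k).
  case: i s => [m|m] s; last by rewrite (zero_sheafP s) !hom0.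
  rewrite -!PoszD !addn1 !dS; apply/(nextP _).2 => x Ux.
  by exists U, (fun z h => h), s; rewrite res_id.
have dE (m : nat) (U : opens T) (s : X m U) :
    d m (m%:Z + 1) U s = 0 <-> locally_image (nexth (st m)) s.
  by rewrite -PoszD addn1 dS; exact: (nextP _).2.
exists (Complex d0 sq), (nexth (st 0)); split.
- by case=> // m _ U s; exact: zero_sheafP.
- case=> [m|m]; first exact: (nextP (st m)).1.
  move=> A B a g _; exists (zero_hom _ _) => U s.
  exact/esym/zero_sheafP.
- move=> U k; apply/cocycleP/(dE 0) => x Ux.
  by exists U, (fun z h => h), k; rewrite res_id.
- by move=> U k /(nextP _).2.
- move=> U z /cocycleP/(dE 0).
  by apply: loc_image_global => V k /(nextP _).2.
- case=> [[|m]|m] // _ U s; last first.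
    by move=> _ x Ux; exists U, (fun z h => h), 0; rewrite hom0; split=> //; apply/esym/zero_sheafP.
  move=> /cocycleP/(dE m.+1) hs.
  apply/loc_cobP => x /hs[V [VU [t [Vx dt]]]].
  by exists V, VU, m, t; split=> //; rewrite /diff dS.
Qed.

End construction.

Section reindex.
Variables (C : complex T) (c : int).
Let d i j := diff C (i - c) (j - c).
Lemma reindex_out i j : j <> i + 1 -> forall (U : opens T) s, d i j U s = 0.
Proof.
move=> ij U s; apply: diff_out => e; apply: ij.
by apply: (addIr (- c)); rewrite e addrAC.
Qed.
Lemma reindex_sq i j k (U : opens T) s : d j k U (d i j U s) = 0.
Proof. exact: diff_sq. Qed.
Definition reindex := Complex reindex_out reindex_sq.

Lemma reindex_cocycle i (U : opens T) (s : C (i - c) U) :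
  @cocycle T reindex i U s <-> cocycle s.
Proof. by split=> h j; [have := h (j + c); rewrite /= /d addrK|exact: h]. Qed.

Lemma reindex_loc_cob i (U : opens T) (s : C (i - c) U) :
  @locally_coboundary T reindex i U s <-> locally_coboundary s.
Proof.
split=> /loc_cobP h; apply/loc_cobP => x /h[V [VU [k [t [Vx dt]]]]]; exists V, VU.
  by exists (k - c), t.
exists (k + c) => /=.
have [t' dt'] : exists t' : C (k + c - c) V, diff C (k + c - c) (i - c) V t' = res VU s.
  by rewrite addrK; exists t.
by exists t'.
Qed.
End reindex.

Lemma resolution_exists (K : sheaf T) (c : int) :
  exists (J : complex T) (e : sheaf_hom K (J c)), resolution e.
Proof.
have [J [e [Jl Ji Jc Jm Je Ja]]] := resolution_at0 K.
exists (reindex J c).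
(* Reindexing puts the augmentation in degree [c - c]; the existential statement lets [subrr] turn
   this into [0] without a transport. *)
have [e' [ec em ee]] : exists e' : sheaf_hom K (J (c - c)),
    [/\ forall (U : opens T) k, cocycle (e' U k), forall (U : opens T) k, e' U k = 0 -> k = 0 &
     forall (U : opens T) (z : J (c - c) U), cocycle z -> exists k, e' U k = z].
  by rewrite subrr; exists e.
exists e'; split=> //.
- by move=> i ic U s; apply: Jl; rewrite subr_lt0.
- by move=> i; exact: Ji.
- by move=> U k; apply/reindex_cocycle.
- by move=> U z /reindex_cocycle; exact: ee.
- move=> i ic U s /reindex_cocycle hs; apply/reindex_loc_cob/Ja => //.
  by move=> /eqP; rewrite subr_eq0 => /eqP.
Qed.

End resolutions.
End pure.

(** * Comparison of injective resolutions *)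

Section comparison.
Variable T : topologicalType.

(** As [C] is acyclic in degree [i], the differential maps onto the cocycles locally, and the
    composite of [phi] with the differential of [J] descends to them; injectivity of [J i] extends
    it to [C i]. Preservation of cocycles is what the next degree asks for. *)
Lemma extend_to_injective (C J : complex T) (i : int)
    (phi : sheaf_hom (C (i - 1)) (J (i - 1))) :
  injective_sheaf (J i) -> acyclic_at C i ->
  (forall (U : opens T) s, cocycle s -> cocycle (phi U s)) ->
  exists psi : sheaf_hom (C i) (J i),
    (forall (U : opens T) s, psi U (diff C (i - 1) i U s) = diff J (i - 1) i U (phi U s)) /\
    (forall (U : opens T) s, cocycle s -> cocycle (psi U s)).
Proof.
move=> injJ Ci phic.
have dcoc (U : opens T) s : diff C i (i + 1) U (diff C (i - 1) i U s) = 0 by exact: diff_sq.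
pose p : sheaf_hom (C (i - 1)) (cocycles C i) := corestrict (cocycles_closed C i) dcoc.
have [U z x Ux|U s ps|h hp] := @hom_factor _ _ _ _ p (comp_hom (diff J (i - 1) i) phi).
- have [V [VU [t [Vx dt]]]] := Ci _ _ (cocycles_cocycle z) x Ux.
  by exists V, VU, t; split=> //; apply: smval_inj.
- rewrite /=; have : cocycle s.
    by apply/cocycleP; rewrite subrK; exact: (congr1 (@smval _ _ _) ps).
  by move=> /phic.
have [psi hpsi] := injJ _ _ (val_hom (cocycles_closed C i)) h (@val_hom_inj _ _ _ _).
have psid (U : opens T) s : psi U (diff C (i - 1) i U s) = diff J (i - 1) i U (phi U s).
  by have := hpsi U (p U s); rewrite hp.
exists psi; split=> // U s hs; apply: cocycle_local => x Ux.
have [V [VU [t [Vx dt]]]] := Ci _ _ hs x Ux.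
by exists V, VU; split=> //; rewrite -hom_res -dt psid; exact: cocycle_diff.
Qed.

(** Zero below [c], an extension of [e \o g \o p] from the cocycles in degree [c], then one
    extension step per degree. *)
Lemma map_to_resolution (C J : complex T) c (K K' : sheaf T) p (g : sheaf_hom K K')
    (e : sheaf_hom K' (J c)) :
  @pure_via _ C c K p -> resolution e ->
  exists phi : complex_map C J, forall (U : opens T) z,
    phi c U (smval z) = e U (g U (p U z)).
Proof.
move=> [pk ps pa] [Jl Ji Jc Jm Je Ja].
have [f0 hf0] := Ji c _ _ (val_hom (cocycles_closed C c)) (comp_hom e (comp_hom g p))
  (@val_hom_inj _ _ _ _).
have [base [basec base0]] := @family_at int (fun i => sheaf_hom (C i) (J i))
  (fun i => zero_hom (C i) (J i)) c f0.
pose good i (phi : sheaf_hom (C (i - 1)) (J (i - 1))) (psi : sheaf_hom (C i) (J i)) :=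
  (forall (U : opens T) s, psi U (diff C (i - 1) i U s) = diff J (i - 1) i U (phi U s)) /\
  (forall (U : opens T) s, cocycle s -> cocycle (psi U s)).
(* The zero default keeps the recursion total; since [f] preserves cocycles, an extension exists at
   every step above [c]. *)
pose E i phi := if pselect (exists psi, good i phi psi) is left ex
  then projT1 (cid ex) else zero_hom _ _.
have [f [flow fE]] := @int_recursion (fun i => sheaf_hom (C i) (J i)) c base E.
have fc : f c = f0 by rewrite flow.
have f0c (U : opens T) s : cocycle s -> cocycle (f0 U s).
  by move=> hs; rewrite (hf0 U (Cocycle hs)) /=; exact: Jc.
have coc (m : nat) : forall i, i <= c + m%:Z -> forall (U : opens T) s, cocycle s -> cocycle (f i U s).
  elim: m => [|m IH] i im.
    have [ic|/eqP ic] := eqVneq i c; first by subst i; rewrite fc.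
    have im' : i <= c by rewrite addr0 in im.
    by move=> U s _; rewrite flow // base0 //=; exact: cocycle0.
  have [ic|ic] := leP i (c + m%:Z); first exact: IH.
  have ci : c < i by lia.
  rewrite fE // /E; case: pselect => [ex|]; first by case: (projT2 (cid ex)).
  by move=> _ U s _; exact: cocycle0.
have coc' i (U : opens T) s : cocycle s -> cocycle (f i U s).
  by apply: (coc `|(i - c)%R|%N); lia.
have chain i j (U : opens T) s : f j U (diff C i j U s) = diff J i j U (f i U s).
  have [ij|/eqP ij] := eqVneq i (j - 1); last first.
    by rewrite !diff_out ?hom0 // => ij'; apply: ij; rewrite ij' addrK.
  subst i; have [jc|cj] := leP j c; last first.
    rewrite fE // /E; case: pselect => [ex|nex]; first by rewrite (projT2 (cid ex)).1.
    case: nex; apply: extend_to_injective => //; first by apply: pa; lia.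
    exact: coc'.
  have -> : f (j - 1) = base (j - 1) by apply: flow; lia.
  have jc1 : j - 1 <> c by lia.
  rewrite base0 // hom0.
  have [jc'|/eqP jc'] := eqVneq j c; last by rewrite flow // base0.
  (* [C] may be non-zero below [c] whereas the map vanishes there; the square still commutes because
     [p] kills coboundaries. *)
  subst j; rewrite fc; have hd := @cocycle_diff _ C (c - 1) c U s.
  rewrite (hf0 U (Cocycle hd)) /=; have /pk -> : locally_coboundary (smval (Cocycle hd)).
    exact: loc_cob_diff.
  by rewrite !hom0.
by exists (ComplexMap chain) => U z /=; rewrite fc hf0.
Qed.

Lemma resolution_inj (J : complex T) c (K : sheaf T) (e : sheaf_hom K (J c)) (U : opens T) :
  resolution e -> injective (e U).
Proof.
move=> rJ k k' h; apply/eqP; rewrite -subr_eq0; apply/eqP/(rs_mono rJ).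
by rewrite homB h subrr.
Qed.

Lemma quasi_iso_to_resolution (C J : complex T) c (K : sheaf T) (e : sheaf_hom K (J c)) :
  pure C c K -> resolution e -> exists phi : complex_map C J, quasi_iso phi.
Proof.
move=> [p Cp] rJ; have [phi hphi] := map_to_resolution (id_hom K) Cp rJ.
have [q [Jq eq]] := resolution_pure rJ.
exists phi; apply: (pure_quasi_iso (g := id_hom K) Cp Jq) => //= [U z w e1|U k'].
  by apply: (resolution_inj rJ); rewrite eq e1 hphi.
by exists k'.
Qed.

Lemma injective_resolutionP (C : complex T) c (K : sheaf T) :
  pure C c K -> is_injective_resolution C (injective_resolution C).
Proof.
move=> CK; rewrite /injective_resolution; case: pselect => [ex|[]].
  exact: (projT2 (cid ex)).
have [J [e rJ]] := resolution_exists K c.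
have [phi qphi] := quasi_iso_to_resolution CK rJ.
exists J; split; last by exists phi.
- by exists c => i ic U s; exact: (rs_low rJ).
- exact: (rs_injective rJ).
Qed.

(** An exact complex of injectives that is bounded below splits from the bottom up: if [r] retracts
    [M (i - 1)] onto its cocycles, then [id - r] factors through the differential and exhibits the
    cocycles of degree [i] as a retract of [M (i - 1)]. *)
Lemma cocycles_injective (M : complex T) :
  bounded_below M -> (forall i, injective_sheaf (M i)) -> (forall i, acyclic_at M i) ->
  forall i, injective_sheaf (cocycles M i).
Proof.
move=> [a Ma] injM exM.
suff H (m : nat) : forall i, i < a + m%:Z -> injective_sheaf (cocycles M i).
  by move=> i; apply: (H `|(i - a + 1)%R|%N); lia.
elim: m => [|m IH] i im.
  move=> A B h g _; exists (zero_hom _ _) => U s; apply: smval_inj.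
  by apply/esym/(Ma i); rewrite addr0 in im.
have {}IH : injective_sheaf (cocycles M (i - 1)) by apply: IH; lia.
have [r hr] := IH _ _ (val_hom (cocycles_closed M (i - 1))) (id_hom _) (@val_hom_inj _ _ _ _).
have dcoc (U : opens T) s : diff M i (i + 1) U (diff M (i - 1) i U s) = 0 by exact: diff_sq.
pose p : sheaf_hom (M (i - 1)) (cocycles M i) := corestrict (cocycles_closed M i) dcoc.
pose g := add_hom (id_hom (M (i - 1)))
  (scale_hom (comp_hom (val_hom (cocycles_closed M (i - 1))) r) (- 1)).
have psurj (U : opens T) (z : cocycles M i U) x : U x -> exists (V : opens T) (VU : V `<=` U)
    (t : M (i - 1) V), V x /\ p V t = res VU z.
  move=> Ux; have [V [VU [t [Vx dt]]]] := exM _ _ _ (cocycles_cocycle z) x Ux.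
  by exists V, VU, t; split=> //; apply: smval_inj.
have [|U s ps|h hp] := @hom_factor _ _ _ _ p g; first exact: psurj.
  have cs : cocycle s by apply/cocycleP; rewrite subrK; exact: (congr1 (@smval _ _ _) ps).
  by rewrite /= scaleN1r -{2}[s]/(smval (Cocycle cs)) (hr U (Cocycle cs)) /= subrr.
apply: (@injective_retract _ _ _ h p) => // U z; apply: sheaf_eq => x Ux.
have [V [VU [t [Vx pt]]]] := psurj U z x Ux; exists V, VU; split=> //.
rewrite -!hom_res -pt hp; apply: smval_inj => /=.
rewrite homD homZ; have := cocycles_cocycle (r V t); move=> ->.
by rewrite scaler0 addr0.
Qed.

(** A primitive normalised by [r t = 0], with [r] a retraction onto the cocycles, is unique; local
    primitives therefore glue. *)
Lemma injective_exact_sections (M : complex T) :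
  bounded_below M -> (forall i, injective_sheaf (M i)) -> (forall i, acyclic_at M i) ->
  forall i (U : opens T) (s : M i U), cocycle s -> exists t, diff M (i - 1) i U t = s.
Proof.
move=> bM injM exM i U s hs.
have injZ := cocycles_injective bM injM exM (i := i - 1).
have [r hr] := injZ _ _ (val_hom (cocycles_closed M (i - 1))) (id_hom _) (@val_hom_inj _ _ _ _).
have [V W WV t VU [VU' [dt rt]]|V t t' VU [VU1 [d1 r1]] [VU2 [d2 r2]]|x Ux|t ht] :=
  @glue_unique T (M (i - 1)) U (fun V t => exists VU : V `<=` U,
     diff M (i - 1) i V t = res VU s /\ r V t = 0).
- exists (fun x Wx => VU _ (WV _ Wx)).
  rewrite !hom_res dt rt res0; split=> //.
  by rewrite (res_comp _ _ (fun x Wx => VU _ (WV _ Wx))).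
- have ctt : cocycle (t - t').
    by apply/cocycleP; rewrite subrK homB d1 d2 (res_irr VU1 VU2) subrr.
  have := hr V (Cocycle ctt); rewrite /= homB r1 r2 subrr => /(congr1 (@smval _ _ _)) /= e.
  by apply/eqP; rewrite -subr_eq0 -e.
- have [V [VU [t [Vx dt]]]] := exM _ _ _ hs x Ux.
  exists V, (t - smval (r V t)); split=> //; exists VU.
  rewrite !homB dt (cocycles_cocycle (r V t)) subr0; split=> //.
  by have := hr V (r V t) => /= ->; rewrite subrr.
exists t; apply: sheaf_eq => x Ux.
have [V [VU [t' [Vx dt]]]] := exM _ _ _ hs x Ux.
exists V, VU; split=> //.
rewrite -hom_res (ht V VU (t' - smval (r V t'))).
  by rewrite homB dt (cocycles_cocycle (r V t')) subr0.
exists VU; rewrite !homB dt (cocycles_cocycle (r V t')) subr0; split=> //.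
by have := hr V (r V t') => /= ->; rewrite subrr.
Qed.

(** * Mapping cones *)

Section cone_complex.
Variables (C J : complex T) (phi : complex_map C J).

(** The cone differential from degree [i] to degree [j] involves a map from [C i] to [J (j - 1)] for
    arbitrary [i] and [j]: this is [phi] on the diagonal and zero elsewhere, in keeping with the
    two-index form of [diff]. *)
Lemma spread_ex : exists sp : forall i l, sheaf_hom (C i) (J l),
  (forall i, sp i i = phi i) /\
  (forall i l, l <> i -> sp i l = zero_hom _ _).
Proof.
have ex i : exists d : forall l, sheaf_hom (C i) (J l),
    d i = phi i /\ forall l, l <> i -> d l = zero_hom _ _.
  exact: (@family_at int (fun l => sheaf_hom (C i) (J l)) (fun l => zero_hom _ _)).
have /all_tag[d hd] := fun i => cid (ex i).
by exists d; split=> [i|i l]; [exact: (hd i).1|exact: (hd i).2].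
Qed.

Let sp := projT1 (cid spread_ex).
Let spE i : sp i i = phi i. Proof. exact: (projT2 (cid spread_ex)).1. Qed.
Let sp0 i l : l <> i -> sp i l = zero_hom _ _.
Proof. exact: (projT2 (cid spread_ex)).2. Qed.

Let M i := dsum_sheaf (C i) (J (i - 1)).
Let d0 i j (U : opens T) (s : M i U) : M j U :=
  (- diff C i j U s.1, sp i (j - 1) U s.1 + diff J (i - 1) (j - 1) U s.2).
Let d_linear i j (U : opens T) : linear (@d0 i j U).
Proof.
move=> a [u1 u2] [v1 v2]; congr pair => /=.
  by rewrite homD homZ opprD scalerN.
by rewrite !(homD, homZ) scalerDr addrACA.
Qed.
Let d_res i j (U V : opens T) (VU : V `<=` U) s : @d0 i j V (res VU s) = res VU (@d0 i j U s).
Proof. by congr pair; rewrite /= !hom_res ?resN // resD. Qed.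
Let d i j : sheaf_hom (M i) (M j) := SheafHom (@d_linear i j) (@d_res i j).
Let d_out i j : j <> i + 1 -> forall (U : opens T) s, d i j U s = 0.
Proof.
move=> ij U s; rewrite /d /= /d0 diff_out // oppr0 sp0; last first.
  by move=> e; apply: ij; rewrite -e subrK.
rewrite diff_out /= ?addr0 // => e; apply: ij.
by apply: (addIr (- 1)); rewrite e addrAC.
Qed.
Let d_sq i j k (U : opens T) s : d j k U (d i j U s) = 0.
Proof.
rewrite /d /= /d0 /= homN diff_sq !oppr0; congr pair.
rewrite homD diff_sq addr0 homN.
have [kj|/eqP kj] := eqVneq (k - 1) j; last first.
  have J0 t : diff J (j - 1) (k - 1) U t = 0 by apply: diff_out; rewrite subrK.
  by rewrite sp0 // J0 /= oppr0 addr0.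
rewrite kj spE; have [ij|/eqP ij] := eqVneq (j - 1) i; last first.
  by rewrite (sp0 ij) diff_out /= ?hom0 ?oppr0 ?addr0 // => e; apply: ij; rewrite e addrK.
by rewrite ij spE cmap_diff addNr.
Qed.
Let cone := Complex d_out d_sq.

Hypotheses (bC : bounded_below C) (injC : forall i, injective_sheaf (C i)).
Hypotheses (bJ : bounded_below J) (injJ : forall i, injective_sheaf (J i)).
Hypothesis qphi : quasi_iso phi.

Let cone_cocycle i (U : opens T) (s : M i U) : @cocycle _ cone i U s ->
  cocycle s.1 /\ phi i U s.1 + diff J (i - 1) i U s.2 = 0.
Proof.
move=> hs; split=> [j|].
  by have := congr1 fst (hs j) => /= /eqP; rewrite oppr_eq0 => /eqP.
by have := congr1 snd (hs (i + 1)) => /=; rewrite addrK spE.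
Qed.

Let cone_acyclic i : acyclic_at cone i.
Proof.
move=> U s /cone_cocycle[ct cs] x Ux.
have [|V [VU [a [Vx da]]]] := (qphi i U).1 s.1 ((cocycleP s.1).2 ct) _ x Ux.
  apply/loc_cobP => y Uy; exists U, (fun z h => h), (i - 1), (- s.2); split=> //.
  by rewrite homN res_id; apply/eqP; rewrite eq_sym -addr_eq0 cs.
have hsa : cocycle (res VU s.2 + phi (i - 1) V a).
  apply/cocycleP; rewrite subrK homD -cmap_diff da.
  by rewrite !hom_res -resD addrC cs res0.
have [W [WV [b [Wx cb /(_ x Wx)[W' [W'W [r [W'x dr]]]]]]]] :=
  (qphi (i - 1) V).2 _ ((cocycleP _).2 hsa) x Vx.
have W'V : W' `<=` V by move=> z /W'W/WV.
have W'U : W' `<=` U by move=> z /W'V/VU.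
have {}cb := (cocycleP b).1 cb.
exists W', W'U, (res W'W b - res W'V a, r); split=> //; congr pair => /=.
  by rewrite homB !hom_res cb da res0 sub0r opprK (res_comp _ _ W'U).
rewrite spE dr homB !hom_res !resB !resD (res_comp _ _ W'V) (res_comp _ _ W'V).
by rewrite (res_comp VU W'V W'U) [LHS]addrC addrA addrNK addrK.
Qed.

Let cone_sections i (U : opens T) (s : M i U) : @cocycle _ cone i U s ->
  exists t, diff cone (i - 1) i U t = s.
Proof.
apply: injective_exact_sections; last exact: cone_acyclic.
  have [a ha] := bC; have [b hb] := bJ; exists (Num.min a b) => k kab V [t r].
  by congr pair; [apply: ha|apply: hb]; lia.
by move=> k; apply: injective_dsum.
Qed.

(** The cone of a quasi-isomorphism between bounded below complexes of injectives is exact on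
    sections, so its cocycle [(0, s)] bounds. Injectivity below uses the cocycle [(t, - r)] in the
    same way. *)
Lemma qis_sections_surj i (U : opens T) (s : J i U) : cocycle s ->
  exists (t : C i U) (r : J (i - 1) U), cocycle t /\ s = phi i U t + diff J (i - 1) i U r.
Proof.
(* The cone holds [J (k - 1)] in degree [k]; the claim is restated in that degree to match its
   type. *)
suff H k : forall s : J (k - 1) U, cocycle s -> exists (t : C (k - 1) U) (r : J (k - 1 - 1) U),
    cocycle t /\ s = phi (k - 1) U t + diff J (k - 1 - 1) (k - 1) U r.
  by have := H (i + 1); rewrite addrK; exact.
move=> {}s hs; have [|[t r] htr] := @cone_sections k U (0, s).
  by move=> j; rewrite /diff /= /d0 /= !hom0 hs oppr0 addr0.
exists t, r; have := congr1 snd htr; have := congr1 fst htr => /=.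
rewrite spE => /eqP; rewrite oppr_eq0 => /eqP dt <-; split=> //.
by apply/cocycleP; rewrite subrK.
Qed.

Lemma qis_sections_inj i (U : opens T) (t : C i U) (r : J (i - 1) U) : cocycle t ->
  phi i U t = diff J (i - 1) i U r -> exists t', diff C (i - 1) i U t' = t.
Proof.
move=> ht tr; have [|[t' r'] htr] := @cone_sections i U (t, - r).
  move=> j; rewrite /diff /= /d0 /= ht oppr0; congr pair; rewrite homN.
  have [ij|/eqP ij] := eqVneq (j - 1) i; last first.
    by rewrite sp0 // diff_out ?oppr0 ?addr0 // subrK.
  by rewrite ij spE tr subrr.
exists (- t'); have := congr1 fst htr => /= <-.
by rewrite homN.
Qed.
End cone_complex.

(** Compared with a resolution that vanishes below [c], every cocycle of lower degree has image
    0. *)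
Lemma exact_sections_low (C : complex T) c (K : sheaf T) i (U : opens T) (z : C i U) :
  bounded_below C -> (forall i, injective_sheaf (C i)) -> pure C c K ->
  i < c -> cocycle z -> exists t, diff C (i - 1) i U t = z.
Proof.
move=> bC iC CK ic hz; have [J [e rJ]] := resolution_exists K c.
have [phi qphi] := quasi_iso_to_resolution CK rJ.
apply: (@qis_sections_inj _ _ phi _ _ _ _ qphi _ _ _ 0) => //.
- by exists c => k kc V s; exact: (rs_low rJ).
- exact: (rs_injective rJ).
- by rewrite hom0; exact: (rs_low rJ).
Qed.

End comparison.

(** * Direct images of complexes *)

Section push.
Variables (S T : topologicalType) (f : continuousType S T).

Lemma direct_image_cocycle (C : complex S) i (U : opens T) (s : C i (open_preimage f U)) :
  @cocycle _ (direct_image_complex f C) i U s <-> cocycle s.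
Proof. by []. Qed.

Section push_cocycles.
Variables (C : complex S) (i : int).
Definition push_cocycle (U : opens T) (z : cocycles (direct_image_complex f C) i U) :
    direct_image f (cocycles C i) U :=
  Cocycle ((direct_image_cocycle _).1 (cocycles_cocycle z)).
Lemma push_cocycle_linear (U : opens T) : linear (@push_cocycle U).
Proof. by move=> a u v; exact: smval_inj. Qed.
Lemma push_cocycle_res (U V : opens T) (VU : V `<=` U) z :
  push_cocycle (res VU z) = res VU (push_cocycle z).
Proof. exact: smval_inj. Qed.
Definition push_cocycles := SheafHom push_cocycle_linear push_cocycle_res.
End push_cocycles.

(** Left exactness of the direct image, for an arbitrary [f]: sections over a preimage have the same
    cohomology for [I] as for the resolution [J], where cocycles of degree [c] are sections of [K]
    and no lower term gives coboundaries. *)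
Lemma direct_image_cohomology (I : complex S) c (K : sheaf S) :
  bounded_below I -> (forall i, injective_sheaf (I i)) -> pure I c K ->
  is_cohomology_sheaf (direct_image_complex f I) c (direct_image f K).
Proof.
move=> bI iI IK; have [J [e rJ]] := resolution_exists K c.
have [p Ip] := IK; have [phi hphi] := map_to_resolution (id_hom K) Ip rJ.
have qphi : quasi_iso phi.
  have [q [Jq eq]] := resolution_pure rJ.
  apply: (pure_quasi_iso (g := id_hom K) Ip Jq) => //= [U z w e1|U k'].
    by apply: (resolution_inj rJ); rewrite eq e1 hphi.
  by exists k'.
have bJ : bounded_below J by exists c => k kc V s; exact: (rs_low rJ).
exists (comp_hom (direct_image_hom f p) (push_cocycles I c)); split=> [U z|U k x Ux] /=.
  set z' := push_cocycle z; split=> [pz'|hz].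
    have [|t dt] := qis_sections_inj bI iI bJ (rs_injective rJ) qphi (t := smval z') (r := 0) (cocycles_cocycle _).
      by rewrite hphi pz' !hom0.
    have -> : smval z = diff (direct_image_complex f I) (c - 1) c U t by rewrite /= dt.
    exact: loc_cob_diff.
  apply: (rs_mono rJ); rewrite -[p _ z']/(id_hom K _ (p _ z')) -hphi.
  apply: (@sheaf_eq _ (direct_image f (J c)) U) => x Ux.
  have [V [VU [t [Vx dt]]]] := hz x Ux; exists V, VU; split=> //.
  rewrite res0 -[RHS](hom0 (diff J (c - 1) c) (open_preimage f V)).
  rewrite -(rs_low rJ _ (phi _ _ t)) ?ltrBlDr ?ltrDl // -cmap_diff.
  by rewrite [diff I (c - 1) c _ t]dt hom_res.
have [t [r [ct et]]] := qis_sections_surj bI iI bJ (rs_injective rJ) qphi (rs_cocycle rJ k).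
exists U, (fun z h => h).
have ct' : @cocycle _ (direct_image_complex f I) c U t by [].
exists (Cocycle ct'); split=> //; rewrite res_id /=.
apply: (resolution_inj rJ); rewrite -[p _ _]/(id_hom K _ (p _ _)) -hphi et.
by rewrite (rs_low rJ _ r) ?ltrBlDr ?ltrDl // hom0 addr0.
Qed.

End push.

(* q is closed with finite fibres, in the form used to compute stalks of direct
   images: neighbourhoods of the points of a fibre can be shrunk to disjoint
   ones that contain the preimage of a neighbourhood. *)
Definition finite_separated (S T : topologicalType) (q : S -> T) :=
  forall y (O : S -> opens S), (forall x, q x = y -> O x x) ->
  exists (W : opens T) (O' : S -> opens S),
    [/\ W y, forall x, q x = y -> O' x x /\ O' x `<=` O x,
        forall z, W (q z) -> exists2 x, q x = y & O' x z &
        forall x x' z, q x = y -> q x' = y -> O' x z -> O' x' z -> x = x'].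

Section finite_direct_image.
Variables (S T : topologicalType) (q : continuousType S T).
Hypothesis finq : finite_separated q.

(** The stalk of a direct image is the product of the stalks along the fibre: lifts near the points
    of the fibre are restricted to the disjoint neighbourhoods [O'] and glued over the preimage of
    [W]. *)
Lemma finite_lift (A B : sheaf S) (a : sheaf_hom A B) (U : opens T)
    (b : direct_image q B U) (y : T) : U y ->
  (forall x, q x = y -> exists (V : opens S) (VU : V `<=` open_preimage q U) (t : A V),
     V x /\ a V t = res VU b) ->
  exists (W : opens T) (WU : W `<=` U) (t : direct_image q A W),
    W y /\ direct_image_hom q a W t = res WU b.
Proof.
move=> Uy loc.
have /all_tag[Vt hVt] : forall i : {x | q x = y}, {Vt : {V : opens S & A V} |
    exists VU : projT1 Vt `<=` open_preimage q U,
      projT1 Vt (sval i) /\ a _ (projT2 Vt) = res VU b}.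
  move=> [x qx]; apply: cid; have [V [VU [t ht]]] := loc x qx.
  by exists (existT _ V t), VU.
pose O x := if pselect (q x = y) is left e then projT1 (Vt (exist _ x e)) else Opens (@openT S).
have [|W0 [O' [W0y O'O O'cov O'dis]]] := finq (y := y) (O := O).
  move=> x qx; rewrite /O; case: pselect => // e.
  by have [VU []] := hVt (exist _ x e).
have {}O'O x (e : q x = y) : O' x x /\ O' x `<=` projT1 (Vt (exist _ x e)).
  by have := O'O x e; rewrite /O; case: pselect => // e'; rewrite (Prop_irrelevance e' e).
pose W := opensI W0 U.
have [V V' V'V t VW [x [e [VV [VO ->]]]]|V t t' VW [x [e [VV [VO ->]]]] [x' [e' [VV' [VO' ->]]]]|z [Wz Uz]|t ht] :=
  @glue_unique S A (open_preimage q W) (fun V t => exists x (e : q x = y)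
    (VV : V `<=` projT1 (Vt (exist _ x e))), V `<=` O' x /\ t = res VV (projT2 (Vt (exist _ x e)))).
- exists x, e, (fun z h => VV _ (V'V _ h)); split; first by move=> z /V'V/VO.
  by rewrite (res_comp _ _ (fun z h => VV _ (V'V _ h))).
- apply: sheaf_eq => z Vz; exists V, (fun z h => h); split=> //.
  have xx' : x = x' by apply: (O'dis _ _ z) => //; [exact: VO|exact: VO'].
  subst x'; move: VV'; rewrite (Prop_irrelevance e' e) => VV'.
  by rewrite (res_irr VV VV').
- have [x qx O'z] := O'cov _ Wz; have [O'x O'V] := O'O x qx.
  exists (opensI (O' x) (open_preimage q W)), (res (fun z h => O'V _ (opensIl h)) (projT2 (Vt (exist _ x qx)))).
  split=> //; first exact: opensIr.
  exists x, qx, (fun z h => O'V _ (opensIl h)); split=> //; exact: opensIl.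
exists W, (@opensIr _ _ _), t; split=> //=.
apply: sheaf_eq => z [Wz Uz].
have [x qx O'z] := O'cov _ Wz; have [O'x O'V] := O'O x qx.
pose V := opensI (O' x) (open_preimage q W).
have VV : V `<=` projT1 (Vt (exist _ x qx)) by move=> w [/O'V].
exists V, (@opensIr _ _ _); split=> //.
rewrite -hom_res (ht V _ (res VV (projT2 (Vt (exist _ x qx))))); last first.
  by exists x, qx, VV; split=> //; exact: opensIl.
have [VU [_ at_]] := hVt (exist _ x qx).
have Vpre : V `<=` open_preimage q U by move=> w /VV/VU.
rewrite hom_res at_ (res_comp _ _ Vpre) [RHS](res_comp _ _ Vpre) //.
Qed.

Lemma finite_direct_image_acyclic (C : complex S) i :
  acyclic_at C i -> acyclic_at (direct_image_complex q C) i.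
Proof.
move=> Ci U s hs y Uy.
have [|W [WU [t [Wy dt]]]] := @finite_lift _ _ (diff C (i - 1) i) U s y Uy.
  by move=> x qx; apply: (Ci _ s) => //; rewrite /= /in_opens /= /preimage /= qx.
by exists W, WU, t.
Qed.

Lemma pure_finite_direct_image (C : complex S) c (K : sheaf S) :
  pure C c K -> pure (direct_image_complex q C) c (direct_image q K).
Proof.
move=> [p [pk ps pa]].
exists (comp_hom (direct_image_hom q p) (push_cocycles q C c)); split.
- move=> U z; rewrite /=; split=> [/pk hz y Uy|hz].
    have [|W [WU [t [Wy dt]]]] := @finite_lift _ _ (diff C (c - 1) c) U (smval z) y Uy.
      by move=> x qx; apply: hz; rewrite /= /in_opens /= /preimage /= qx.
    by exists W, WU, t.
  apply/pk => x Ux; have [V [VU [t [Vx dt]]]] := hz _ Ux.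
  exists (open_preimage q V), (fun z h => VU _ h), t; split=> //.
  rewrite [LHS]dt; exact: res_irr.
- move=> U h y Uy; have [|W [WU [z [Wy pz]]]] := @finite_lift _ _ p U h y Uy.
    by move=> x qx; apply: ps; rewrite /= /in_opens /= /preimage /= qx.
  have cz : @cocycle _ (direct_image_complex q C) c W (smval z).
    exact: (cocycles_cocycle z).
  exists W, WU, (Cocycle cz); split=> //; rewrite -pz /=; congr (p _ _).
  exact: smval_inj.
- by move=> i ic; apply: finite_direct_image_acyclic; exact: pa.
Qed.

End finite_direct_image.

(** * Shifts, sums and truncations *)

Section pure_constructions.
Variable T : topologicalType.

Lemma pure_shift (C : complex T) c (K : sheaf T) (n : nat) :
  pure C c K -> pure (shift_complex n C) (c - n%:Z) K.
Proof.
move=> CK.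
have coc i (U : opens T) (s : C (i + n%:Z) U) : @cocycle _ (shift_complex n C) i U s <-> cocycle s.
  split=> hs j; last by rewrite /= hs scaler0.
  have := hs (j - n%:Z); rewrite /= subrK => /eqP; rewrite scaler_eq0 signr_eq0 /=.
  by move=> /eqP.
have cob i (U : opens T) (s : C (i + n%:Z) U) :
    @locally_coboundary _ (shift_complex n C) i U s <-> locally_coboundary s.
  split=> /loc_cobP h; apply/loc_cobP => x /h[V [VU [k [t [Vx dt]]]]]; exists V, VU.
    by exists (k + n%:Z), ((- 1) ^+ n *: t); split=> //; rewrite homZ.
  have [t' dt'] : exists t' : C (k - n%:Z + n%:Z) V, diff C (k - n%:Z + n%:Z) (i + n%:Z) V t' = res VU s.
    by rewrite subrK; exists t.
  exists (k - n%:Z), ((- 1) ^+ n *: t'); split=> //=.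
  by rewrite homZ scalerA -expr2 sqrr_sign scale1r.
have [p [pk ps pa]] : pure C (c - n%:Z + n%:Z) K by rewrite subrK.
pose h (U : opens T) (z : cocycles (shift_complex n C) (c - n%:Z) U) : cocycles C (c - n%:Z + n%:Z) U :=
  Cocycle ((coc _ _ _).1 (cocycles_cocycle z)).
have hl (U : opens T) : linear (@h U) by move=> a u v; exact: smval_inj.
have hr (U V : opens T) (VU : V `<=` U) z : h V (res VU z) = res VU (h U z) by exact: smval_inj.
exists (comp_hom p (SheafHom hl hr)); split=> //=.
- by move=> U z; rewrite pk cob.
- move=> U k x Ux; have [V [VU [z [Vx pz]]]] := ps U k x Ux; exists V, VU.
  exists (Cocycle ((coc _ _ _).2 (cocycles_cocycle z))); split=> //.
  by rewrite -pz; congr (p _ _); exact: smval_inj.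
- move=> i ic U s /coc hs; apply/cob/pa => // e; apply: ic.
  by apply: (addIr n%:Z).
Qed.

Lemma pure_concentrated (F : sheaf T) : pure (concentrated F) 0 F.
Proof.
exists (comp_hom (val_hom (concentrated_closed F 0)) (val_hom (cocycles_closed (concentrated F) 0))).
split=> /=.
- move=> U z; split=> [z0|hz].
    have -> : smval z = 0 by exact: smval_inj.
    exact: loc_cob0.
  suff -> : smval z = 0 by [].
  by apply: (@sheaf_eq _ (concentrated F 0)) => x /hz[V [VU [t [Vx dt]]]]; exists V, VU; rewrite -dt res0.
- move=> U h x Ux; have h0 : (0 : int) <> 0 -> h = 0 by [].
  pose h' : concentrated F 0 U := Submod (ssc_submod (concentrated_closed F 0) U) h0.
  have ch : cocycle h' by [].
  by exists U, (fun z h => h), (Cocycle ch); split=> //; rewrite res_id.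
- move=> i i0 U s _; have -> : s = 0 by apply: smval_inj; exact: (smvalP s).
  exact: loc_cob0.
Qed.

Lemma pure_dsum (C D : complex T) c (K L : sheaf T) :
  pure C c K -> pure D c L -> pure (dsum C D) c (dsum_sheaf K L).
Proof.
move=> [p [pk ps pa]] [q [qk qs qa]].
have coc i (U : opens T) (s : dsum C D i U) : cocycle s <-> cocycle s.1 /\ cocycle s.2.
  split=> [hs|[h1 h2] j]; last by rewrite /= h1 h2.
  by split=> j; [exact: (congr1 fst (hs j))|exact: (congr1 snd (hs j))].
have cob i (U : opens T) (s : dsum C D i U) :
    locally_coboundary s <-> locally_coboundary s.1 /\ locally_coboundary s.2.
  split=> [hs|[h1 h2] x Ux].
    split=> x /hs[V [VU [t [Vx dt]]]].
      by exists V, VU, t.1; split=> //; exact: (congr1 fst dt).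
    by exists V, VU, t.2; split=> //; exact: (congr1 snd dt).
  have [V [VU [t [Vx dt]]]] := h1 x Ux; have [W [WU [r [Wx dr]]]] := h2 x Ux.
  have IU : opensI V W `<=` U by move=> z [/VU].
  exists (opensI V W), IU, (res (@opensIl _ V W) t, res (@opensIr _ V W) r).
  split=> //=; congr pair; rewrite hom_res ?dt ?dr; exact: res_comp.
pose h1 (U : opens T) (z : cocycles (dsum C D) c U) : cocycles C c U :=
  Cocycle ((coc _ _ _).1 (cocycles_cocycle z)).1.
pose h2 (U : opens T) (z : cocycles (dsum C D) c U) : cocycles D c U :=
  Cocycle ((coc _ _ _).1 (cocycles_cocycle z)).2.
have h1l (U : opens T) : linear (@h1 U) by move=> a u v; exact: smval_inj.
have h1r (U V : opens T) (VU : V `<=` U) z : h1 V (res VU z) = res VU (h1 U z) by exact: smval_inj.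
have h2l (U : opens T) : linear (@h2 U) by move=> a u v; exact: smval_inj.
have h2r (U V : opens T) (VU : V `<=` U) z : h2 V (res VU z) = res VU (h2 U z) by exact: smval_inj.
pose r (U : opens T) (z : cocycles (dsum C D) c U) : dsum_sheaf K L U := (p U (h1 U z), q U (h2 U z)).
have rl (U : opens T) : linear (@r U).
  by move=> a u v; rewrite /r h1l h2l !homD !homZ.
have rr (U V : opens T) (VU : V `<=` U) z : r V (res VU z) = res VU (r U z).
  by rewrite /r h1r h2r !hom_res.
exists (SheafHom rl rr); split=> /=.
- move=> U z; rewrite cob; split=> [[/pk hz /qk hz']//|[hz hz']].
  by congr pair; [apply/pk|apply/qk].
- move=> U [k l] x Ux; have [V [VU [z [Vx pz]]]] := ps U k x Ux.
  have [W [WU [w [Wx qw]]]] := qs U l x Ux.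
  have IU : opensI V W `<=` U by move=> y [/VU].
  have czw : @cocycle _ (dsum C D) c (opensI V W) (res (@opensIl _ V W) (smval z), res (@opensIr _ V W) (smval w)).
    by apply/coc; split; apply: cocycle_res; exact: cocycles_cocycle.
  exists (opensI V W), IU, (Cocycle czw); split=> //; congr pair => /=.
    rewrite (_ : h1 _ _ = res (@opensIl _ V W) z) ?hom_res ?pz; last exact: smval_inj.
    exact: res_comp.
  rewrite (_ : h2 _ _ = res (@opensIr _ V W) w) ?hom_res ?qw; last exact: smval_inj.
  exact: res_comp.
- move=> i ic U s /coc[h h']; apply/cob; split; [exact: pa|exact: qa].
Qed.

(** Truncation discards the cohomology above [m], so acyclicity is asked only up to [m]. This is how
    the higher direct images beyond the vanishing range disappear from Deligne's complex. *)
Lemma pure_truncation (m : int) (C : complex T) c (K : sheaf T) :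
  c <= m -> is_cohomology_sheaf C c K -> (forall i, i <= m -> i <> c -> acyclic_at C i) ->
  pure (truncation m C) c K.
Proof.
move=> cm [p [pk ps]] aC.
have coc i (U : opens T) (s : truncation m C i U) : cocycle s <-> cocycle (smval s).
  by split=> hs j; [exact: (congr1 (@smval _ _ _) (hs j))|apply: smval_inj; exact: hs].
have mk i (U : opens T) (s : C i U) : i <= m -> cocycle s ->
    exists s' : truncation m C i U, smval s' = s.
  move=> im hs; have Ps : (m < i -> s = 0) /\ (i = m -> diff C i (i + 1) U s = 0).
    by split=> [mi|_]; [rewrite leNgt mi in im|exact: hs].
  by exists (Submod (ssc_submod (truncation_closed m C i) U) Ps).
have cob i (U : opens T) (s : truncation m C i U) : i <= m ->
    locally_coboundary s <-> locally_coboundary (smval s).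
  move=> im; split=> hs x /hs[V [VU [t [Vx dt]]]].
    by exists V, VU, (smval t); split=> //; exact: (congr1 (@smval _ _ _) dt).
  have Pt : (m < i - 1 -> t = 0) /\ (i - 1 = m -> diff C (i - 1) (i - 1 + 1) V t = 0).
    by split=> h; exfalso; lia.
  exists V, VU, (Submod (ssc_submod (truncation_closed m C (i - 1)) V) Pt).
  by split=> //; apply: smval_inj.
pose h (U : opens T) (z : cocycles (truncation m C) c U) : cocycles C c U :=
  Cocycle ((coc _ _ _).1 (cocycles_cocycle z)).
have hl (U : opens T) : linear (@h U) by move=> a u v; exact: smval_inj.
have hr (U V : opens T) (VU : V `<=` U) z : h V (res VU z) = res VU (h U z) by exact: smval_inj.
exists (comp_hom p (SheafHom hl hr)); split=> /=.
- by move=> U z; rewrite pk cob.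
- move=> U k x Ux; have [V [VU [z [Vx pz]]]] := ps U k x Ux.
  have [s' es'] := mk c V (smval z) cm (cocycles_cocycle z).
  have cs' : cocycle s' by apply/coc; rewrite es'; exact: cocycles_cocycle.
  exists V, VU, (Cocycle cs'); split=> //; rewrite -pz; congr (p _ _).
  exact: smval_inj.
- move=> i ic U s /coc hs; have [im|mi] := leP i m; first by apply/cob => //; exact: aC.
  have -> : s = 0 by apply: smval_inj; exact: ((smvalP s).1 mi).
  exact: loc_cob0.
Qed.

End pure_constructions.

(** * Isomorphism in the derived category *)

Section roof.
Variables (T : topologicalType) (C D : complex T) (c : int) (K : sheaf T).
Variables (p : sheaf_hom (cocycles C c) K) (q : sheaf_hom (cocycles D c) K).
Hypotheses (Cp : pure_via p) (Dq : pure_via q).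

Let tau := truncation c (dsum C D).

Let fst_cocycle (U : opens T) (s : tau c U) : cocycle (smval s).1.
Proof. by apply/cocycleP; exact: (congr1 fst ((smvalP s).2 erefl)). Qed.
Let snd_cocycle (U : opens T) (s : tau c U) : cocycle (smval s).2.
Proof. by apply/cocycleP; exact: (congr1 snd ((smvalP s).2 erefl)). Qed.

(* Pairs of cocycles with different classes; its kernel in degree c makes the
   roof. *)
Let k0 (U : opens T) (s : tau c U) : K U := p U (Cocycle (fst_cocycle s)) - q U (Cocycle (snd_cocycle s)).
Let k0_linear (U : opens T) : linear (@k0 U).
Proof.
move=> a u v; rewrite /k0.
have -> : Cocycle (fst_cocycle (a *: u + v)) = a *: Cocycle (fst_cocycle u) + Cocycle (fst_cocycle v).
  exact: smval_inj.
have -> : Cocycle (snd_cocycle (a *: u + v)) = a *: Cocycle (snd_cocycle u) + Cocycle (snd_cocycle v).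
  exact: smval_inj.
by rewrite !homD !homZ scalerBr opprD addrACA.
Qed.
Let k0_res (U V : opens T) (VU : V `<=` U) s : k0 (res VU s) = res VU (k0 s).
Proof.
rewrite /k0 resB -!hom_res.
by congr (p _ _ - q _ _); exact: smval_inj.
Qed.

Let k_ex : exists k : forall i, sheaf_hom (tau i) K,
  k c = SheafHom k0_linear k0_res /\ forall i, i <> c -> k i = zero_hom (tau i) K.
Proof. exact: (@family_at int (fun i => sheaf_hom (tau i) K) (fun i => zero_hom (tau i) K)). Qed.
Let k := projT1 (cid k_ex).
Let kc : k c = SheafHom k0_linear k0_res. Proof. exact: (projT2 (cid k_ex)).1. Qed.
Let kn i : i <> c -> k i = zero_hom (tau i) K. Proof. exact: (projT2 (cid k_ex)).2. Qed.

Let kd i j (U : opens T) (s : tau i U) : k i U s = 0 -> k j U (diff tau i j U s) = 0.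
Proof.
move=> _; have [jc|/eqP jc] := eqVneq j c; last by rewrite kn.
subst j; rewrite kc /= /k0.
have -> : p U (Cocycle (fst_cocycle (diff tau i c U s))) = 0.
  by apply/(pure_ker Cp); exact: loc_cob_diff.
have -> : q U (Cocycle (snd_cocycle (diff tau i c U s))) = 0.
  by apply/(pure_ker Dq); exact: loc_cob_diff.
by rewrite subrr.
Qed.

Let E i := subsheaf (kernel_closed (k i)).
Let dE i j : sheaf_hom (E i) (E j) := subsheaf_hom (kernel_closed (k i)) (kernel_closed (k j)) (@kd i j).
Let dE_out i j : j <> i + 1 -> forall (U : opens T) s, dE i j U s = 0.
Proof. by move=> ij U s; apply: smval_inj; exact: diff_out. Qed.
Let dE_sq i j l (U : opens T) s : dE j l U (dE i j U s) = 0.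
Proof. by apply: smval_inj; exact: diff_sq. Qed.
Let roof := Complex dE_out dE_sq.

Let mkE i (U : opens T) (s : dsum C D i U) : i < c -> exists s' : E i U, smval (smval s') = s.
Proof.
move=> ic; have Ps : (c < i -> s = 0) /\ (i = c -> diff (dsum C D) i (i + 1) U s = 0).
  by split=> h; exfalso; lia.
pose s1 : tau i U := Submod (ssc_submod (truncation_closed c (dsum C D) i) U) Ps.
have k1 : k i U s1 = 0 by rewrite kn //; lia.
by exists (Submod (ssc_submod (kernel_closed (k i)) U) k1).
Qed.

Let mkEc (U : opens T) (z : cocycles C c U) (w : cocycles D c U) : p U z = q U w ->
  exists s' : E c U, smval (smval s') = (smval z, smval w).
Proof.
move=> zw; pose s : dsum C D c U := (smval z, smval w).
have Ps : (c < c -> s = 0) /\ (c = c -> diff (dsum C D) c (c + 1) U s = 0).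
  by split=> [|_]; [rewrite ltxx|rewrite /= !cocycles_cocycle].
pose s1 : tau c U := Submod (ssc_submod (truncation_closed c (dsum C D) c) U) Ps.
have k1 : k c U s1 = 0.
  rewrite kc /= /k0 (_ : Cocycle _ = z); last exact: smval_inj.
  by rewrite (_ : Cocycle (snd_cocycle s1) = w) ?zw ?subrr //; exact: smval_inj.
by exists (Submod (ssc_submod (kernel_closed (k c)) U) k1).
Qed.

Let E_high i (U : opens T) (s : E i U) : c < i -> s = 0.
Proof. by move=> ci; do 2!apply: smval_inj; exact: ((smvalP (smval s)).1 ci). Qed.

Let E_cocycle i (U : opens T) (s : E i U) : @cocycle _ roof i U s <->
  cocycle (smval (smval s)).1 /\ cocycle (smval (smval s)).2.
Proof.
split=> [hs|[h1 h2] j].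
  have hs' j : diff (dsum C D) i j U (smval (smval s)) = 0.
    exact: (congr1 (fun z : E j U => smval (smval z)) (hs j)).
  by split=> j; [exact: (congr1 fst (hs' j))|exact: (congr1 snd (hs' j))].
by do 2!apply: smval_inj; congr pair; [exact: h1|exact: h2].
Qed.

Let E_loc_cob i (U : opens T) (s : E i U) : locally_coboundary (smval (smval s)).1 ->
  locally_coboundary (smval (smval s)).2 -> @locally_coboundary _ roof i U s.
Proof.
move=> h1 h2; have [ic|ci] := leP i c; last first.
  by rewrite (E_high s ci); exact: loc_cob0.
move=> x Ux; have [V [VU [t [Vx dt]]]] := h1 x Ux; have [W [WU [r [Wx dr]]]] := h2 x Ux.
have IU : opensI V W `<=` U by move=> z [/VU].
have ic1 : i - 1 < c by lia.
have [s' es'] := mkE ((res (@opensIl _ V W) t, res (@opensIr _ V W) r) : dsum C D (i - 1) _) ic1.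
exists (opensI V W), IU, s'; split=> //; do 2!apply: smval_inj => /=.
rewrite es' /=; congr pair; rewrite hom_res ?dt ?dr; exact: res_comp.
Qed.

Let E_eq (U : opens T) (s : E c U) : p U (Cocycle (fst_cocycle (smval s))) = q U (Cocycle (snd_cocycle (smval s))).
Proof. by have := smvalP s; move: (smval s) => s1; rewrite kc => /eqP; rewrite subr_eq0 => /eqP. Qed.

Let f1 i (U : opens T) (s : E i U) : C i U := (smval (smval s)).1.
Let f1_linear i (U : opens T) : linear (@f1 i U). Proof. by []. Qed.
Let f1_res i (U V : opens T) (VU : V `<=` U) s : f1 (res VU s) = res VU (@f1 i U s).
Proof. by []. Qed.
Let f1_hom i : sheaf_hom (E i) (C i) := SheafHom (@f1_linear i) (@f1_res i).
Let f1_diff i j (U : opens T) s : f1_hom j U (diff roof i j U s) = diff C i j U (f1_hom i U s).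
Proof. by []. Qed.
Let f2 i (U : opens T) (s : E i U) : D i U := (smval (smval s)).2.
Let f2_linear i (U : opens T) : linear (@f2 i U). Proof. by []. Qed.
Let f2_res i (U V : opens T) (VU : V `<=` U) s : f2 (res VU s) = res VU (@f2 i U s).
Proof. by []. Qed.
Let f2_hom i : sheaf_hom (E i) (D i) := SheafHom (@f2_linear i) (@f2_res i).
Let f2_diff i j (U : opens T) s : f2_hom j U (diff roof i j U s) = diff D i j U (f2_hom i U s).
Proof. by []. Qed.

(** The roof is the fibre product of the truncations of [C] and [D] at [c] over [K] in degree [c].
    Truncating first leaves only cocycles in degree [c], on which the class maps [p] and [q] are
    defined. *)
Lemma pure_derived_iso : derived_iso C D.
Proof.
exists roof, (ComplexMap f1_diff), (ComplexMap f2_diff).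
have trivial_case (B : complex T) i (U : opens T) (t : B i U) (f : sheaf_hom (E i) (B i)) :
    acyclic_at B i -> diff B i (i + 1) U t = 0 -> forall x, U x ->
    exists (V : opens T) (VU : V `<=` U) (s : roof i V),
      [/\ V x, diff roof i (i + 1) V s = 0 & locally_coboundary (res VU t - f V s)].
  move=> Bi /cocycleP ht x Ux; exists U, (fun z h => h), 0.
  rewrite !hom0 res_id subr0; split=> //; exact: Bi.
split=> i U; split=> [s /cocycleP/E_cocycle[h1 h2] hc|t ht x Ux].
- apply: E_loc_cob => //; have [ic|/eqP ic] := eqVneq i c; last exact: (pure_acyclic Dq ic).
  subst i; apply/(pure_ker Dq (Cocycle (snd_cocycle (smval s)))).
  by rewrite -E_eq; apply/(pure_ker Cp).
- have [ic|/eqP ic] := eqVneq i c; last first.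
    by apply: trivial_case => //; exact: (pure_acyclic Cp ic).
  subst i; have {}ht := (cocycleP t).1 ht.
  have [V [VU [w [Vx qw]]]] := pure_surj Dq (p U (Cocycle ht)) Ux.
  have [s es] : exists s' : E c V, smval (smval s') = (smval (res VU (Cocycle ht)), smval w).
    by apply: mkEc; rewrite hom_res qw.
  exists V, VU, s; split=> //.
    by apply/cocycleP/E_cocycle; rewrite es; split; exact: cocycles_cocycle.
  by rewrite /= /f1 es subrr; exact: loc_cob0.
- apply: E_loc_cob => //; have [ic|/eqP ic] := eqVneq i c; last exact: (pure_acyclic Cp ic).
  subst i; apply/(pure_ker Cp (Cocycle (fst_cocycle (smval s)))).
  by rewrite E_eq; apply/(pure_ker Dq).
- have [ic|/eqP ic] := eqVneq i c; last first.
    by apply: trivial_case => //; exact: (pure_acyclic Dq ic).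
  subst i; have {}ht := (cocycleP t).1 ht.
  have [V [VU [w [Vx qw]]]] := pure_surj Cp (q U (Cocycle ht)) Ux.
  have [s es] : exists s' : E c V, smval (smval s') = (smval w, smval (res VU (Cocycle ht))).
    by apply: mkEc; rewrite hom_res qw.
  exists V, VU, s; split=> //.
    by apply/cocycleP/E_cocycle; rewrite es; split; exact: cocycles_cocycle.
  by rewrite /= /f2 es subrr; exact: loc_cob0.
Qed.

End roof.

Lemma opens_eq (T : topologicalType) (U V : opens T) : oset U = oset V -> U = V.
Proof. by case: U V => U oU [V oV] /= UV; subst V; rewrite (Prop_irrelevance oU oV). Qed.

Definition opensU (T : topologicalType) (U V : opens T) : opens T :=
  Opens (openU (oset_open U) (oset_open V)).

(** * Cohomology of boxes and punctured boxes *)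

Section vanishing.
Variables (T : topologicalType) (N : complex T) (D : opens T) (e : N 0 D).
Hypothesis flasqueN : forall (i : int) (U V : opens T) (VU : V `<=` U) (s : N i V),
  exists t : N i U, res VU t = s.
Hypothesis cocycle_e : cocycle e.
Hypothesis e_faithful : forall (P : opens T) (PD : P `<=` D) c x, P x ->
  c *: res PD e = 0 -> c = 0.

(* The augmented complex Q -> N^0 -> N^1 -> ..., with Q in level 0. *)
Definition cochain (m : nat) (P : opens T) : Type :=
  match m with 0 => rat | m'.+1 => N m'%:Z P end.

Definition cores (m : nat) (P P' : opens T) (P'P : P' `<=` P) : cochain m P -> cochain m P' :=
  match m with 0 => id | m'.+1 => res P'P end.

Definition delta (m : nat) (P : opens T) (PD : P `<=` D) : cochain m P -> N m%:Z P :=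
  match m with 0 => fun c : rat => c *: res PD e | m'.+1 => diff N m'%:Z m'.+1%:Z P end.
Arguments delta m {P} PD t.

(* Reduced cohomology vanishes: vanish 0 is non-emptiness, vanish 1 says that
   cocycles of degree 0 are constants, vanish m.+1 that H^m is zero. *)
Definition vanish (m : nat) (P : opens T) (PD : P `<=` D) : Prop :=
  match m with
  | 0 => exists x, P x
  | m'.+1 => forall s : N m'%:Z P, cocycle s -> exists t, delta m' PD t = s
  end.
Arguments vanish m {P} PD.

Lemma delta_cores m (P P' : opens T) (PD : P `<=` D) (P'D : P' `<=` D) (P'P : P' `<=` P)
    (t : cochain m P) : delta m P'D (cores P'P t) = res P'P (delta m PD t).
Proof.
case: m t => [|m] t /=; last exact: hom_res.
by rewrite resZ (res_comp _ _ P'D).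
Qed.

Lemma delta_cocycle m (P : opens T) (PD : P `<=` D) t : cocycle (delta m PD t).
Proof.
case: m t => [|m] t /=; last exact: cocycle_diff.
by move=> j; rewrite homZ hom_res cocycle_e res0 scaler0.
Qed.

Lemma cores_surj m (P P' : opens T) (P'P : P' `<=` P) (t : cochain m P') :
  exists t', cores P'P t' = t.
Proof. by case: m t => [|m] t; [exists t|exact: flasqueN]. Qed.

Lemma vanish_ext m (P P' : opens T) (PD : P `<=` D) (P'D : P' `<=` D) :
  oset P = oset P' -> vanish m PD -> vanish m P'D.
Proof. by move=> /opens_eq PP'; subst P'; rewrite (Prop_irrelevance PD P'D). Qed.

(** The two primitives differ on the overlap by a cocycle, hence by some [delta r]; flasqueness
    extends [r] to [B], where it corrects [tB]. *)
Lemma correct_primitive m (P : opens T) (s : N m.+1%:Z P) (A B : opens T)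
    (AP : A `<=` P) (BP : B `<=` P) (PD : P `<=` D) (ID : opensI A B `<=` D)
    (tA : N m%:Z A) (tB : N m%:Z B) : vanish m.+1 ID ->
  diff N m%:Z m.+1%:Z A tA = res AP s -> diff N m%:Z m.+1%:Z B tB = res BP s ->
  exists tB', diff N m%:Z m.+1%:Z B tB' = res BP s /\
    res (@opensIr _ A B) tB' = res (@opensIl _ A B) tA.
Proof.
move=> vI dA dB.
have IP : opensI A B `<=` P by move=> z [/AP].
have BD : B `<=` D by move=> z /BP/PD.
have cI : cocycle (res (@opensIl _ A B) tA - res (@opensIr _ A B) tB).
  apply/cocycleP; rewrite -PoszD addn1 homB !hom_res dA dB.
  by rewrite !(res_comp _ _ IP) subrr.
have [r dr] := vI _ cI; have [r' hr'] := cores_surj (@opensIr _ A B) r.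
exists (tB + delta m BD r'); rewrite homD (delta_cocycle BD r') addr0; split=> //.
by rewrite resD -(delta_cores BD ID) hr' dr addrCA subrr addr0.
Qed.

(** Mayer-Vietoris for one section. At the bottom level the primitives are two constants, which
    agree because the overlap is non-empty. *)
Lemma primitive_union m (P : opens T) (PD : P `<=` D) (s : N m%:Z P) (A B : opens T)
    (AP : A `<=` P) (BP : B `<=` P) (AD : A `<=` D) (BD : B `<=` D) (ID : opensI A B `<=` D) :
  P `<=` A `|` B -> vanish m ID ->
  (exists t, delta m AD t = res AP s) -> (exists t, delta m BD t = res BP s) ->
  exists t, delta m PD t = s.
Proof.
move=> cov; case: m s => [|m] s vI [tA dA] [tB dB].
  have [x Ix] := vI; exists tA; apply: sheaf_eq => y /cov[Ay|By].
    by exists A, AP; split=> //; rewrite -dA /= resZ (res_comp _ _ AD).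
  exists B, BP; split=> //; rewrite -dB /= resZ (res_comp _ _ BD).
  suff -> : tA = tB by [].
  apply/eqP; rewrite -subr_eq0; apply/eqP.
  apply: (@e_faithful _ ID _ x) => //; rewrite scalerBl.
  have IP : opensI A B `<=` P by move=> z [/AP].
  have eA := congr1 (res (@opensIl _ A B)) dA; have eB := congr1 (res (@opensIr _ A B)) dB.
  rewrite /= !resZ !(res_comp _ _ ID) !(res_comp _ _ IP) in eA eB.
  by rewrite eA eB subrr.
have [tB' [dB' tAB]] := @correct_primitive m P s A B AP BP PD ID tA tB vI dA dB.
have cov' : P `<=` \bigcup_(b : bool) (if b then A else B).
  by move=> z /cov[Az|Bz]; [exists true|exists false].
have WP (b : bool) : (if b then A else B) `<=` P by case: b.
pose tt (b : bool) : N m%:Z (if b then A else B) :=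
  if b return N m%:Z (if b then A else B) then tA else tB'.
have [i j V Vi Vj|t ht] := @sheaf_glue _ (N m%:Z) P bool (fun b => if b then A else B) WP cov' tt.
  have same : forall (V : opens T) (VA : V `<=` A) (VB : V `<=` B), res VA tA = res VB tB'.
    move=> V' VA VB; have VI : V' `<=` opensI A B by move=> z zV; split; [exact: VA|exact: VB].
    by rewrite -(res_comp (@opensIl _ A B) VI) -tAB (res_comp _ VI VB).
  by case: i j Vi Vj => [] [] Vi Vj /=; rewrite ?(res_irr Vi Vj) //; rewrite same.
exists t; apply: sheaf_eq => y /cov[Ay|By].
  exists A, AP; split=> //=; rewrite -hom_res -dA /=; congr (diff _ _ _ _ _).
  exact: (etrans (res_irr AP (WP true) t) (ht true)).
exists B, BP; split=> //=; rewrite -hom_res -dB' /=; congr (diff _ _ _ _ _).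
exact: (etrans (res_irr BP (WP false) t) (ht false)).
Qed.

Lemma vanish_union m (A B : opens T) (AD : A `<=` D) (BD : B `<=` D)
    (ID : opensI A B `<=` D) (UD : opensU A B `<=` D) :
  vanish m.+1 AD -> vanish m.+1 BD -> vanish m ID -> vanish m.+1 UD.
Proof.
move=> vA vB vI s cs.
have AU : A `<=` opensU A B by move=> z ?; left.
have BU : B `<=` opensU A B by move=> z ?; right.
apply: (@primitive_union m _ UD s A B AU BU AD BD ID) => //.
  by apply: vA; exact: cocycle_res.
by apply: vB; exact: cocycle_res.
Qed.

(** Each primitive is corrected to extend the previous one, so that the sequence glues; the
    correction rests on the vanishing for [A q], the overlap of consecutive terms. *)
Lemma primitive_exhaustion m (P : opens T) (PD : P `<=` D) (s : N m%:Z P) (A : nat -> opens T)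
    (AP : forall q, A q `<=` P) (AD : forall q, A q `<=` D) :
  (forall q, A q `<=` A q.+1) -> P `<=` \bigcup_q A q ->
  (forall q, vanish m (AD q)) -> (forall q, exists t, delta m (AD q) t = res (AP q) s) ->
  exists t, delta m PD t = s.
Proof.
move=> Aincr cov vA prim.
have Amono i j : (i <= j)%N -> A i `<=` A j.
  move=> /subnK <-; elim: (j - i)%N => // k IH z /IH; rewrite addSn; exact: Aincr.
case: m s vA prim => [|m] s vA prim.
  have [c0 hc0] := prim 0%N; exists c0; apply: sheaf_eq => y /cov[q _ Aqy].
  have [c hc] := prim q; have [x A0x] := vA 0%N.
  exists (A q), (AP q); split=> //; rewrite -hc /= resZ (res_comp _ _ (AD q)).
  suff -> : c0 = c by [].
  apply/eqP; rewrite -subr_eq0; apply/eqP; apply: (@e_faithful _ (AD 0%N) _ x) => //.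
  rewrite scalerBl; move: hc0 => /= ->.
  have := congr1 (res (Amono _ _ (leq0n q))) hc; rewrite /= resZ (res_comp _ _ (AD 0%N)) => ->.
  by rewrite (res_comp _ _ (AP 0%N)) subrr.
pose good q (t : N m%:Z (A q)) := diff N m%:Z m.+1%:Z (A q) t = res (AP q) s.
have step q (t : {t : N m%:Z (A q) | good q t}) : {t' : {t : N m%:Z (A q.+1) | good q.+1 t} |
    res (Aincr q) (sval t') = sval t}.
  apply: cid; case: t => t gt; have [t1 ht1] := prim q.+1.
  have ID : opensI (A q) (A q.+1) `<=` D by move=> z [/AD].
  have vI : vanish m.+1 ID.
    apply: (vanish_ext ID _ (vA q)); apply/seteqP; split=> z; last by case.
    by move=> Az; split=> //; exact: Aincr.
  have [t2 [dt2 tt2]] := correct_primitive PD vI gt ht1.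
  exists (exist _ t2 dt2) => /=.
  have AI : A q `<=` opensI (A q) (A q.+1) by move=> z Az; split=> //; exact: Aincr.
  have AA : A q `<=` A q by [].
  by rewrite -(res_comp (@opensIr _ (A q) (A q.+1)) AI (Aincr q)) tt2 (res_comp _ AI AA) res_id.
pose t0 := cid (prim 0%N : exists t, good 0%N t).
pose f := fix f q : {t : N m%:Z (A q) | good q t} :=
  match q with 0 => t0 | q'.+1 => sval (step q' (f q')) end.
have fS q : res (Aincr q) (sval (f q.+1)) = sval (f q) by exact: (svalP (step q (f q))).
have fcomp i k (V : opens T) (Vi : V `<=` A i) (Vk : V `<=` A (k + i)%N) :
    res Vk (sval (f (k + i)%N)) = res Vi (sval (f i)).
  elim: k Vk => [|k IH] Vk; first exact: res_irr.
  have Vk' : V `<=` A (k + i)%N by move=> z /Vi; apply: Amono; exact: leq_addl.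
  by rewrite -(IH Vk') -(fS (k + i)%N) (res_comp _ _ Vk).
have [i j V Vi Vj|t ht] := @sheaf_glue _ (N m%:Z) P nat A AP cov (fun q => sval (f q)).
  case: (leqP i j) => ij.
    by move: Vj; rewrite -(subnK ij) => Vj; rewrite (fcomp _ _ _ Vi).
  by move: Vi; rewrite -(subnK (ltnW ij)) => Vi; rewrite (fcomp _ _ _ Vj).
exists t; apply: sheaf_eq => y /cov[q _ Aqy]; exists (A q), (AP q); split=> //=.
rewrite -hom_res -(svalP (f q)); congr (diff _ _ _ _ _).
by rewrite ht.
Qed.

End vanishing.
Arguments delta {T N D} e m {P} PD t.
Arguments vanish {T N D} e m {P} PD.

Section boxes.
Variables (R : realType) (n : nat).
Implicit Types a b : 'I_n -> R.

Definition box a b : set 'rV[R]_n := [set v | forall l, a l < v 0 l < b l].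

Lemma box_open a b : open (box a b).
Proof.
rewrite openE => v vab; exists (fun _ l => `]a l, b l[%classic).
  move=> i l; have -> : i = 0 by exact: ord1.
  by apply: near_in_itvoo; rewrite in_itv; exact: vab.
by move=> w ww l; have := ww 0 l; rewrite /= in_itv.
Qed.

Definition boxo a b : opens 'rV[R]_n := Opens (@box_open a b).

Definition upd a (l : 'I_n) (c : R) : 'I_n -> R := fun i => if i == l then c else a i.

Lemma nbhs_rV (v : 'rV[R]_n) (A : set 'rV[R]_n) : nbhs v A ->
  exists2 e : R, 0 < e & forall w : 'rV[R]_n, (forall l, `|w 0 l - v 0 l| < e) -> A w.
Proof.
move=> /nbhs_ballP[e /= e0 vA]; exists e => // w wv; apply: vA; split=> // i l.
have -> : i = 0 by exact: ord1.
by rewrite /ball /= distrC.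
Qed.

Lemma rV_nbhs (v : 'rV[R]_n) (e : R) : 0 < e ->
  nbhs v [set w : 'rV[R]_n | forall l, `|w 0 l - v 0 l| < e].
Proof.
move=> e0; apply/nbhs_ballP; exists e => //= w vw l.
by have [_ /(_ 0 l)] := vw; rewrite /ball /= distrC.
Qed.

(** Covering induction for boxes, applied both to primitives and to lifts. A closed inner box has a
    Lebesgue number by compactness; slicing it along one coordinate after another gives pieces of
    that size, which are merged through their overlaps. Exhaustion then reaches the open box. *)
Lemma box_induction (A B : 'I_n -> R) (S : ('I_n -> R) -> ('I_n -> R) -> Prop) :
  (forall l, A l < B l) ->
  (forall v, box A B v -> exists2 e : R, 0 < e & forall a b,
     (forall l, [/\ A l < a l, a l < b l & b l < B l]) ->
     (forall l, v 0 l - e < a l /\ b l < v 0 l + e) -> S a b) ->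
  (forall a b l c d, (forall l, [/\ A l < a l, a l < b l & b l < B l]) ->
     a l < c -> c < d -> d < b l -> S a (upd b l d) -> S (upd a l c) b -> S a b) ->
  (forall a b : nat -> 'I_n -> R, (forall q l, [/\ A l < a q l, a q l < b q l & b q l < B l]) ->
     (forall q l, a q.+1 l <= a q l /\ b q l <= b q.+1 l) ->
     (forall v, box A B v -> exists q, box (a q) (b q) v) ->
     (forall q, S (a q) (b q)) -> S A B) ->
  S A B.
Proof.
move=> AB loc merge exh.
(* The margin is at most a third of each side, so that all inner boxes are non-empty. *)
pose h (q : nat) (l : 'I_n) := (B l - A l) / q.+3%:R.
have h0 q l : 0 < h q l by rewrite divr_gt0 ?subr_gt0.
have h3 q l : h q l * 3%:R <= B l - A l.
  rewrite /h -mulrA ger_pMr ?subr_gt0 // mulrC ler_pdivrMr // mul1r ler_nat //.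
pose a (q : nat) l := A l + h q l; pose b (q : nat) l := B l - h q l.
have hS q l : h q.+1 l <= h q l.
  by rewrite /h ler_pM2l ?subr_gt0 // lef_pV2 ?posrE // ler_nat.
have ab q l : [/\ A l < a q l, a q l < b q l & b q l < B l].
  have := h0 q l; have := h3 q l; rewrite /a /b => H1 H2; split; lra.
apply: (exh a b ab) => [q l|v vAB|q].
- by have := hS q l; rewrite /a /b => ?; split; lra.
- have hmono q q' l : (q <= q')%N -> h q' l <= h q l.
    by move=> qq'; rewrite /h ler_pM2l ?subr_gt0 // lef_pV2 ?posrE // ler_nat.
  pose r l := Num.truncn ((B l - A l) / Num.min (v 0 l - A l) (B l - v 0 l)).
  exists (\max_l r l) => l; set q := \max_l _.
  have /andP[v1 v2] := vAB l; have rq : (r l <= q)%N by exact: leq_bigmax.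
  have m0 : 0 < Num.min (v 0 l - A l) (B l - v 0 l) by rewrite lt_min !subr_gt0 v1.
  have : h q l < Num.min (v 0 l - A l) (B l - v 0 l).
    apply: le_lt_trans (hmono _ _ l rq) _.
    rewrite /h ltr_pdivrMr // mulrC -ltr_pdivrMr //; apply: lt_le_trans (truncnS_gt _) _.
    by rewrite ler_nat -/(r l); lia.
  by rewrite lt_min /a /b => /andP[? ?]; apply/andP; split; lra.
pose K : set 'rV[R]_n := [set v | forall l, `[a q l, b q l]%classic (v ord0 l)].
have cK : compact K.
  by apply: (@rV_compact (R : ptopologicalType) n (fun l => `[a q l, b q l]%classic)) => l; exact: segment_compact.
(* [d] is a Lebesgue number of [K]; radii are halved so that one radius serves all nearby
   centres. *)
have [d d0 hd] : exists2 d : R, 0 < d & forall v, K v -> forall a' b',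
     (forall l, [/\ A l < a' l, a' l < b' l & b' l < B l]) ->
     (forall l, v 0 l - d < a' l /\ b' l < v 0 l + d) -> S a' b'.
  have /compact_near_coveringP ncK := cK.
  pose Q (d : R) (v : 'rV[R]_n) := forall a' b',
     (forall l, [/\ A l < a' l, a' l < b' l & b' l < B l]) ->
     (forall l, v 0 l - d < a' l /\ b' l < v 0 l + d) -> S a' b'.
  have [|e /= e0 he] := ncK R (0^'+) Q _ _.
    move=> v Kv; have [|e e0 he] := loc v.
      move=> l; have := Kv l; rewrite /= in_itv /= => /andP[v1 v2].
      by have [? ? ?] := ab q l; apply/andP; split; lra.
    have e20 : 0 < e / 2 by rewrite divr_gt0.
    exists ([set w : 'rV[R]_n | forall l, `|w 0 l - v 0 l| < e / 2], [set d | d < e / 2]) => /=.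
      by split; [exact: rV_nbhs|exact: nbhs_right_lt].
    move=> [w d] /= [wv de] a' b' ab' wab; apply: he => // l.
    have [w1 w2] := wab l; have := wv l; rewrite ltr_norml => /andP[v1 v2].
    by split; lra.
  have e20 : 0 < e / 2 by rewrite divr_gt0.
  exists (e / 2) => // v Kv; apply: (he (e / 2)) => //=.
  rewrite sub0r normrN gtr0_norm //; lra.
have small a' b' : (forall l, [/\ a q l <= a' l, a' l < b' l & b' l <= b q l]) ->
    (forall l, b' l - a' l < d) -> S a' b'.
  move=> in' sm; apply: (hd (\row_l a' l)).
  - by move=> l; rewrite /= in_itv /= mxE; have [? ? ?] := in' l; apply/andP; split; lra.
  - by move=> l; have [? ? ?] := in' l; have [? ? ?] := ab q l; split; lra.
  - by move=> l; rewrite mxE; have := sm l => ?; split; lra.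
(* In [claim m] the coordinates from [m] on are already shorter than [d]. The step to [m.+1] slices
   coordinate [m]; at [m = n] no smallness remains as a hypothesis. *)
suff claim (m : nat) : (m <= n)%N -> forall a' b',
    (forall l, [/\ a q l <= a' l, a' l < b' l & b' l <= b q l]) ->
    (forall l : 'I_n, (m <= l)%N -> b' l - a' l < d) -> S a' b'.
  apply: (claim n) => // l; first by have [_ ? _] := ab q l.
  by rewrite leqNgt ltn_ord.
elim: m => [_ a' b' in' sm|m IH mn a' b']; first by apply: small => // l; exact: sm.
pose l0 := Ordinal mn.
have [k] : exists k : nat, b' l0 - a' l0 < k%:R * (d / 2).
  have d20 : 0 < d / 2 by rewrite divr_gt0.
  exists (Num.truncn ((b' l0 - a' l0) / (d / 2))).+1.
  by rewrite -ltr_pdivrMr // truncnS_gt.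
elim: k a' b' => [|k IHk] a' b' hk in' sm.
  by have [_ ? _] := in' l0; exfalso; lra.
have [lt_d|ge_d] := ltP (b' l0 - a' l0) d.
  apply: IH => //; first exact: ltnW.
  move=> l; rewrite leq_eqVlt => /orP[/eqP ml|]; last exact: sm.
  by have -> : l = l0 by apply: val_inj; rewrite /= ml.
(* The last slice has length [3 d / 4 < d], the rest is shortened by [d / 2], and the two overlap in
   a slab of width [d / 4]. *)
apply: (merge a' b' l0 (b' l0 - d * 3 / 4) (b' l0 - d / 2)).
- by move=> l; have [? ? ?] := in' l; have [? ? ?] := ab q l; split; lra.
- lra.
- lra.
- lra.
- apply: IHk.
  + rewrite /upd eqxx; move: hk; rewrite -addn1 natrD mulrDl mul1r; lra.
  + move=> l; rewrite /upd; case: eqP => [->|_]; last exact: in'.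
    by have [? ? ?] := in' l0; split; lra.
  + move=> l ml; rewrite /upd; case: eqP => [ll0|_]; last exact: sm.
    by move: ml; rewrite ll0 /= ltnn.
- apply: IH; first exact: ltnW.
  + move=> l; rewrite /upd; case: eqP => [->|_]; last exact: in'.
    by have [? ? ?] := in' l0; split; lra.
  + move=> l; rewrite leq_eqVlt => /orP[/eqP ml|].
      have -> : l = l0 by apply: val_inj; rewrite /= ml.
      by rewrite /upd eqxx; lra.
    move=> ml; rewrite /upd; case: eqP => [ll0|_]; last exact: sm.
    by move: ml; rewrite ll0 /= ltnn.
Qed.

End boxes.

Section punctured_boxes.
Variables (R : realType) (n : nat) (N : complex 'rV[R]_n) (D : opens 'rV[R]_n) (e : N 0 D).
Hypothesis flasqueN : forall (i : int) (U V : opens 'rV[R]_n) (VU : V `<=` U) (s : N i V),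
  exists t : N i U, res VU t = s.
Hypothesis cocycle_e : cocycle e.
Hypothesis e_faithful : forall (P : opens 'rV[R]_n) (PD : P `<=` D) c x, P x ->
  c *: res PD e = 0 -> c = 0.
Hypothesis local_primitive : forall m (P : opens 'rV[R]_n) (PD : P `<=` D) (s : N m%:Z P),
  cocycle s -> forall x, P x -> exists (V : opens 'rV[R]_n) (VP : V `<=` P) (VD : V `<=` D) t,
    V x /\ delta e m VD t = res VP s.

Lemma box_sub (a b a' b' : 'I_n -> R) : (forall l, a l <= a' l) -> (forall l, b' l <= b l) ->
  boxo a' b' `<=` boxo a b.
Proof.
move=> aa bb v va l; have /andP[h1 h2] := va l.
by rewrite (le_lt_trans (aa l)) // (lt_le_trans h2).
Qed.

(** Overlaps of boxes are boxes, so the previous level supplies the hypothesis of Mayer-Vietoris on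
    the overlap, and [local_primitive] starts the covering induction. *)
Lemma vanish_box m (a b : 'I_n -> R) (BD : boxo a b `<=` D) :
  (forall l, a l < b l) -> vanish e m BD.
Proof.
elim: m a b BD => [|m IH] a b BD ab.
  exists (\row_l ((a l + b l) / 2)) => l; rewrite mxE; have := ab l => ?.
  by apply/andP; split; lra.
move=> s cs.
pose S a' b' := exists (H : boxo a' b' `<=` boxo a b) (HD : boxo a' b' `<=` D) t,
  delta e m HD t = res H s.
suff [H [HD [t dt]]] : S a b.
  by exists t; rewrite (Prop_irrelevance BD HD) dt res_id.
apply: (box_induction (A := a) (B := b)) => //.
- move=> v vab; have [V [VP [VD [t [Vv dt]]]]] := local_primitive BD cs vab.
  have [d d0 hd] : exists2 d : R, 0 < d & forall w : 'rV[R]_n, (forall l, `|w 0 l - v 0 l| < d) -> V w.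
    by apply: nbhs_rV; apply: open_nbhs_nbhs; split=> //; exact: oset_open.
  exists d => // a' b' ab' vab'.
  have BV : boxo a' b' `<=` V.
    move=> w wab; apply: hd => l; have /andP[h1 h2] := wab l; have [h3 h4] := vab' l.
    by rewrite ltr_norml; apply/andP; split; lra.
  exists (fun w h => VP _ (BV w h)), (fun w h => VD _ (BV w h)), (cores BV t).
  by rewrite (delta_cores e VD) dt; exact: res_comp.
- move=> a' b' l c d ab' ac cd db [H1 [HD1 pr1]] [H2 [HD2 pr2]].
  have H : boxo a' b' `<=` boxo a b by apply: box_sub => k; have [? ? ?] := ab' k; lra.
  have HD : boxo a' b' `<=` D by move=> w /H/BD.
  have ID : opensI (boxo a' (upd b' l d)) (boxo (upd a' l c) b') `<=` D by move=> w [/HD1].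
  have s1 : boxo a' (upd b' l d) `<=` boxo a' b'.
    by apply: box_sub => // k; rewrite /upd; case: eqP => // ->; lra.
  have s2 : boxo (upd a' l c) b' `<=` boxo a' b'.
    by apply: box_sub => // k; rewrite /upd; case: eqP => // ->; lra.
  have s3 : boxo (upd a' l c) (upd b' l d) `<=` boxo a' b'.
    by apply: box_sub => // k; rewrite /upd; case: eqP => // ->; lra.
  exists H, HD; apply: (@primitive_union _ N D e flasqueN cocycle_e e_faithful m _ HD _ _ _ s1 s2 HD1 HD2 ID).
  + move=> w wab; have /andP[h1 h2] := wab l; have [wd|dw] := ltP (w 0 l) d.
      left=> k; rewrite /upd; case: eqP => [->|_]; last exact: wab.
      by rewrite h1.
    right=> k; rewrite /upd; case: eqP => [->|_]; last exact: wab.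
    by rewrite h2 andbT; lra.
  + have BD3 : boxo (upd a' l c) (upd b' l d) `<=` D by move=> w /s3/HD.
    apply: (vanish_ext (PD := BD3)); last first.
      apply: IH => k; rewrite /upd; by case: eqP => _ //; have [] := ab' k.
    apply/seteqP; split=> w.
      move=> ww; split=> k; have := ww k; rewrite /upd; case: eqP => [->|] //.
        by move=> /andP[? ?]; apply/andP; split; lra.
      by move=> /andP[? ?]; apply/andP; split; lra.
    move=> [w1 w2] k; have := w1 k; have := w2 k; rewrite /upd; case: eqP => [->|] //.
    by move=> /andP[-> _] /andP[_ ->].
  + by have [t dt] := pr1; exists t; rewrite dt; symmetry; exact: res_comp.
  + by have [t dt] := pr2; exists t; rewrite dt; symmetry; exact: res_comp.
- move=> a' b' ab' mono cov prim.
  have H q : boxo (a' q) (b' q) `<=` boxo a b by apply: box_sub => k; have [? ? ?] := ab' q k; lra.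
  have HD q : boxo (a' q) (b' q) `<=` D by move=> w /H/BD.
  have UU : boxo a b `<=` boxo a b by [].
  exists UU, BD; rewrite res_id.
  apply: (@primitive_exhaustion _ N D e flasqueN cocycle_e e_faithful m _ BD _ _ H HD).
  + by move=> q; apply: box_sub => l; have [] := mono q l.
  + by move=> v /cov[q hq]; exists q.
  + by move=> q; apply: IH => l; have [] := ab' q l.
  + move=> q; have [H' [HD' [t dt]]] := prim q; exists t.
    by rewrite (Prop_irrelevance (HD q) HD') dt; exact: res_irr.
Qed.

Lemma coord_open (l : 'I_n) (A : set R) : open A -> open [set v : 'rV[R]_n | A (v 0 l)].
Proof.
move=> oA; have /continuousP := @coord_continuous R 1 n 0 l; exact.
Qed.

Definition punctured_set (Q : set 'rV[R]_n) (ls : seq 'I_n) : set 'rV[R]_n :=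
  [set v | Q v /\ exists2 l, l \in ls & v 0 l != 0].

(** What is removed from [Q] is the half-subspace [v_h <= 0] with [v_l = 0] for [l] in [ls]. The
    result plays the part of one hemisphere of the sphere around the subspace. *)
Definition half_set (Q : set 'rV[R]_n) (h : 'I_n) (ls : seq 'I_n) : set 'rV[R]_n :=
  [set v | Q v /\ (0 < v 0 h \/ exists2 l, l \in ls & v 0 l != 0)].

Lemma neq0_open (ls : seq 'I_n) : open [set v : 'rV[R]_n | exists2 l, l \in ls & v 0 l != 0].
Proof.
have -> : [set v : 'rV[R]_n | exists2 l, l \in ls & v 0 l != 0] =
    \bigcup_(l in [set l | l \in ls]) [set v | [set x : R | x != 0] (v 0 l)].
  by apply/seteqP; split=> v [l ll vl]; exists l.
apply: bigcup_open => l _; apply: coord_open.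
have -> : [set x : R | x != 0] = ~` [set 0].
  by apply/seteqP; split=> x /eqP.
exact: closed_openC.
Qed.

Lemma punctured_open Q ls : open Q -> open (punctured_set Q ls).
Proof. by move=> oQ; apply: openI => //; exact: neq0_open. Qed.

Lemma half_open Q h ls : open Q -> open (half_set Q h ls).
Proof.
move=> oQ; apply: openI => //; apply: openU; last exact: neq0_open.
by apply: (@coord_open h [set x | 0 < x]); exact: open_gt.
Qed.

Definition puncturedo a b ls := Opens (@punctured_open (box a b) ls (@box_open R n a b)).
Definition halfo a b h ls := Opens (@half_open (box a b) h ls (@box_open R n a b)).

(* A closed half-space of the coordinate subspace is removed: acyclic in all
   degrees. *)
Lemma vanish_half m h ls : forall a b (HD : halfo a b h ls `<=` D),
  uniq (h :: ls) -> (forall l, a l < b l) -> (forall l, l \in h :: ls -> a l < 0 < b l) ->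
  vanish e m HD.
Proof.
elim: ls m => [|l ls IH] m a b HD.
  move=> _ ab h0; have eB : oset (boxo (upd a h 0) b) = oset (halfo a b h [::]).
    have /andP[ah bh] := h0 h (mem_head _ _).
    apply/seteqP; split=> v.
      move=> vb; have /andP[] := vb h; rewrite /upd eqxx => v0 v1; split; last by left.
      by move=> k; have := vb k; rewrite /upd; case: eqP => // -> /andP[? ?]; apply/andP; split; lra.
    move=> [vb [v0|[k]]] // k; rewrite /upd; case: eqP => [->|_]; last exact: vb.
    by rewrite v0; have /andP[] := vb h.
  have BD : boxo (upd a h 0) b `<=` D by rewrite /boxo /= [box _ _]eB.
  apply: (vanish_ext (PD := BD)) => //; apply: vanish_box => k.
  rewrite /upd; case: eqP => [->|_]; last exact: ab.
  by have /andP[] := h0 h (mem_head _ _).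
move=> uls ab ls0.
have /andP[al bl] : a l < 0 < b l by apply: ls0; rewrite !inE eqxx orbT.
have uls' : uniq (h :: ls) by move: uls; rewrite /= inE negb_or -andbA => /and4P[_ -> _ ->].
have lls : l \notin h :: ls.
  by move: uls; rewrite /= !inE negb_or eq_sym => /and3P[/andP[/negPf -> _] -> _].
have ls0' k : k \in h :: ls -> a k < 0 < b k.
  by move=> kl; apply: ls0; move: kl; rewrite !inE => /orP[] ->; rewrite ?orbT.
have subH : halfo a b h ls `<=` halfo a b h (l :: ls).
  by move=> v [vb [v0|[k kl vk]]]; split=> //; [left|right; exists k => //; rewrite inE kl orbT].
have subP : boxo (upd a l 0) b `<=` halfo a b h (l :: ls).
  move=> v vb; have /andP[] := vb l; rewrite /upd eqxx => v0 v1; split.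
    by move=> k; have := vb k; rewrite /upd; case: eqP => // -> /andP[? ?]; apply/andP; split; lra.
  by right; exists l; rewrite ?mem_head // gt_eqF.
have subM : boxo a (upd b l 0) `<=` halfo a b h (l :: ls).
  move=> v vb; have /andP[] := vb l; rewrite /upd eqxx => v0 v1; split.
    by move=> k; have := vb k; rewrite /upd; case: eqP => // -> /andP[? ?]; apply/andP; split; lra.
  by right; exists l; rewrite ?mem_head // lt_eqF.
have HD1 : halfo a b h ls `<=` D by move=> v /subH/HD.
have PD : boxo (upd a l 0) b `<=` D by move=> v /subP/HD.
have MD : boxo a (upd b l 0) `<=` D by move=> v /subM/HD.
have abP k : upd a l 0 k < b k by rewrite /upd; case: eqP => [->|].
have abM k : a k < upd b l 0 k by rewrite /upd; case: eqP => [->|].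
case: m => [|m]; first by have [x Px] := vanish_box 0%N PD abP; exists x; exact: subP.
have I1D : opensI (halfo a b h ls) (boxo (upd a l 0) b) `<=` D by move=> v [/HD1].
have UD : opensU (halfo a b h ls) (boxo (upd a l 0) b) `<=` D by move=> v [/HD1|/PD].
have I2D : opensI (opensU (halfo a b h ls) (boxo (upd a l 0) b)) (boxo a (upd b l 0)) `<=` D.
  by move=> v [/UD].
have U2D : opensU (opensU (halfo a b h ls) (boxo (upd a l 0) b)) (boxo a (upd b l 0)) `<=` D.
  by move=> v [/UD|/MD].
apply: (vanish_ext (PD := U2D)).
  apply/seteqP; split=> [v [[|]|]|v [vb [v0|[k]]]]; [exact: subH|exact: subP|exact: subM| |].
    by left; left; split=> //; left.
  rewrite inE => /orP[/eqP ->|kl] vk; last by left; left; split=> //; right; exists k.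
  have [v0|v0|v0] := ltgtP (v 0 l) 0; last by rewrite v0 eqxx in vk.
    right=> i; rewrite /upd; case: eqP => [->|_]; last exact: vb.
    by rewrite v0; have /andP[->] := vb l.
  left; right=> i; rewrite /upd; case: eqP => [->|_]; last exact: vb.
  by rewrite v0; have /andP[_ ->] := vb l.
(* The cover consists of [halfo] for [ls] and the two sides of the hyperplane [v_l = 0]. Each side
   meets the preceding pieces in a half box again, to which the induction applies in every
   degree. *)
apply: (@vanish_union _ N D e flasqueN cocycle_e e_faithful _ _ _ UD MD I2D).
- apply: (@vanish_union _ N D e flasqueN cocycle_e e_faithful _ _ _ HD1 PD I1D).
  + exact: IH.
  + exact: vanish_box.
  + have H'D : halfo (upd a l 0) b h ls `<=` D.
      move=> v [vb hv]; apply: HD; have [vb' _] := subP _ vb; split=> //.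
      by case: hv => [|[k kl vk]]; [left|right; exists k; rewrite // inE kl orbT].
    apply: (vanish_ext (PD := H'D)); last first.
      apply: IH => // k kl; rewrite /upd; case: eqP => [kll|_]; last exact: ls0'.
      by rewrite -kll kl in lls.
    apply/seteqP; split=> v; last by move=> [[_ hv] vb].
    by move=> [vb hv]; split=> //; split=> //; have [] := subP _ vb.
- exact: vanish_box.
- have H'D : halfo a (upd b l 0) h ls `<=` D.
    move=> v [vb hv]; apply: HD; have [vb' _] := subM _ vb; split=> //.
    by case: hv => [|[k kl vk]]; [left|right; exists k; rewrite // inE kl orbT].
  apply: (vanish_ext (PD := H'D)); last first.
    apply: IH => // k kl; rewrite /upd; case: eqP => [kll|_]; last exact: ls0'.
    by rewrite -kll kl in lls.
  apply/seteqP; split=> v.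
    by move=> [vb hv]; split=> //; left; split=> //; have [] := subM _ vb.
  move=> [[[_ hv]|vP] vM]; first by split.
  by have := vP l; have := vM l; rewrite /upd eqxx => /andP[_ v1] /andP[v0 _]; exfalso; lra.
Qed.

(** The complement has the homotopy type of a sphere of dimension [size ls - 1]. It is covered by
    the two acyclic pieces [halfo] and [v_l < 0], which meet in a punctured box for the remaining
    coordinates; each coordinate thus raises the range of vanishing by one. *)
Lemma vanish_punctured m ls : forall a b (PD : puncturedo a b ls `<=` D),
  uniq ls -> (m < size ls)%N -> (forall l, a l < b l) -> (forall l, l \in ls -> a l < 0 < b l) ->
  vanish e m PD.
Proof.
elim: ls m => // l ls IH m a b PD uls mls ab ls0.
have /andP[al bl] : a l < 0 < b l by apply: ls0; rewrite mem_head.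
have lls : l \notin ls by move: uls => /= /andP[].
have ls0' k : k \in ls -> a k < 0 < b k by move=> kl; apply: ls0; rewrite inE kl orbT.
have subH : halfo a b l ls `<=` puncturedo a b (l :: ls).
  move=> v [vb [v0|[k kl vk]]]; split=> //; last by exists k; rewrite // inE kl orbT.
  by exists l; rewrite ?mem_head // gt_eqF.
have subM : boxo a (upd b l 0) `<=` puncturedo a b (l :: ls).
  move=> v vb; have /andP[] := vb l; rewrite /upd eqxx => v0 v1; split.
    by move=> k; have := vb k; rewrite /upd; case: eqP => // -> /andP[? ?]; apply/andP; split; lra.
  by exists l; rewrite ?mem_head // lt_eqF.
have HD : halfo a b l ls `<=` D by move=> v /subH/PD.
have MD : boxo a (upd b l 0) `<=` D by move=> v /subM/PD.
have abM k : a k < upd b l 0 k by rewrite /upd; case: eqP => [->|].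
case: m mls => [|m] mls; first by have [x Px] := vanish_box 0%N MD abM; exists x; exact: subM.
have ID : opensI (halfo a b l ls) (boxo a (upd b l 0)) `<=` D by move=> v [/HD].
have UD : opensU (halfo a b l ls) (boxo a (upd b l 0)) `<=` D by move=> v [/HD|/MD].
apply: (vanish_ext (PD := UD)).
  apply/seteqP; split=> [v []|v [vb [k]]]; [exact: subH|exact: subM|].
  rewrite inE => /orP[/eqP ->|kl] vk; last by left; split=> //; right; exists k.
  have [v0|v0|v0] := ltgtP (v 0 l) 0; last by rewrite v0 eqxx in vk.
    right=> i; rewrite /upd; case: eqP => [->|_]; last exact: vb.
    by rewrite v0; have /andP[->] := vb l.
  by left; split=> //; left.
apply: (@vanish_union _ N D e flasqueN cocycle_e e_faithful _ _ _ HD MD ID).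
- by apply: vanish_half.
- exact: vanish_box.
- have P'D : puncturedo a (upd b l 0) ls `<=` D.
    move=> v [vb [k kl vk]]; apply: PD; have [vb' _] := subM _ vb; split=> //.
    by exists k; rewrite // inE kl orbT.
  apply: (vanish_ext (PD := P'D)); last first.
    apply: IH => //; first by move: uls => /= /andP[].
    move=> k kl; rewrite /upd; case: eqP => [kll|_]; last exact: ls0'.
    by rewrite -kll kl in lls.
  apply/seteqP; split=> v.
    move=> [vb hv]; split=> //; split; last by right.
    by have [] := subM _ vb.
  move=> [[_ [v0|hv]] vb]; last by split.
  by have := vb l; rewrite /upd eqxx => /andP[_ v1]; exfalso; lra.
Qed.

End punctured_boxes.

(** * Subspaces and maps with finite fibres *)

Lemma sub_openP (T : topologicalType) (A : set T) (V : set A) :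
  open V <-> exists2 U : set T, open U & forall z : A, V z <-> U (val z).
Proof.
split=> [[U oU UV]|[U oU UV]].
  by exists U => // z; rewrite -UV set_valE.
exists U => //; rewrite set_valE; apply/seteqP; split=> z /=; exact: (UV z).2 || exact: (UV z).1.
Qed.

Lemma sub_point (T : topologicalType) (A : set T) (x : T) : A x -> exists z : A, val z = x.
Proof. by move=> Ax; exists (exist _ x (mem_set Ax)). Qed.

Lemma bigcap_seq_open (T : topologicalType) (I : eqType) (r : seq I) (A : I -> set T) :
  (forall i, i \in r -> open (A i)) -> open [set x | forall i, i \in r -> A i x].
Proof.
elim: r => [_|i r IH oA]; first by rewrite (_ : [set x | _] = setT :> set T); [exact: openT|exact/seteqP].
have -> : [set x | forall k, k \in i :: r -> A k x] = A i `&` [set x | forall k, k \in r -> A k x].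
  apply/seteqP; split=> x /=.
    by move=> h; split=> [|k kr]; apply: h; rewrite inE ?eqxx ?kr ?orbT.
  by move=> [h1 h2] k; rewrite inE => /orP[/eqP ->|]; [|exact: h2].
apply: openI; first by apply: oA; rewrite mem_head.
by apply: IH => k kr; apply: oA; rewrite inE kr orbT.
Qed.

Lemma continuous_pairl (S T : topologicalType) (b : T) : continuous (fun a : S => (a, b)).
Proof.
move=> a B [[B1 B2] [/= nB1 nB2] B12]; apply: filterS nB1 => v B1v.
exact: (B12 (v, b) (conj B1v (nbhs_singleton nB2))).
Qed.

(** Compactness makes [f] closed: [W] is the complement of the image of everything outside the
    chosen neighbourhoods of the fibre. *)
Lemma finite_separated_compact (S T : topologicalType) (f : continuousType S T) :
  compact [set: S] -> hausdorff_space S -> hausdorff_space T ->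
  (forall y, finite_set (f @^-1` [set y])) -> finite_separated f.
Proof.
move=> cS hS hT fin y O Oy.
have /finite_seqP[r fr] := fin y.
have rP x : x \in r <-> f x = y.
  by have := congr1 (fun A => A x) fr; rewrite /preimage /= => ->.
have sep x : exists PQ : S -> opens S * opens S, forall x', x <> x' ->
    [/\ (PQ x').1 x, (PQ x').2 x' & forall z, (PQ x').1 z -> (PQ x').2 z -> False].
  have ex x' : exists PQ : opens S * opens S, x <> x' ->
      [/\ PQ.1 x, PQ.2 x' & forall z, PQ.1 z -> PQ.2 z -> False]; last first.
    by have /choice[PQ hPQ] := ex; exists PQ.
  have [xx'|xx'] := pselect (x = x').
    by exists (Opens openT, Opens openT) => /(_ xx').
  have := hS; rewrite open_hausdorff => /(_ x x')[]; first exact/eqP.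
  move=> [P Q] /= [xP x'Q] [oP oQ PQ]; exists (Opens oP, Opens oQ) => _; split.
  - exact: set_mem.
  - exact: set_mem.
  - by move=> z Pz Qz; have : (P `&` Q) z by []; rewrite (eqP PQ).
have /choice[PQ hPQ] := sep.
(* [PQ x x'] and [PQ x' x] are chosen independently; taking one side of each makes the
   neighbourhoods of [x] and [x'] disjoint. *)
pose A x x' : set S := [set z | x <> x' -> (PQ x x').1 z /\ (PQ x' x).2 z].
have oA x x' : open (A x x').
  have [xx'|xx'] := pselect (x = x').
    rewrite (_ : A x x' = setT :> set S); first exact: openT.
    by apply/seteqP; split=> // z _ /(_ xx').
  rewrite (_ : A x x' = (PQ x x').1 `&` (PQ x' x).2); first by apply: openI; exact: oset_open.
  by apply/seteqP; split=> z /= h; [exact: h|move=> _; exact: h].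
pose O' x := opensI (O x) (Opens (@bigcap_seq_open _ _ r (A x) (fun x' _ => oA x x'))).
have O'x x : f x = y -> O' x x.
  move=> fx; split; first exact: Oy.
  by move=> x' _ xx'; have [h _ _] := hPQ _ _ xx'; have [_ h' _] := hPQ x' x (fun e => xx' (esym e)).
pose B : set S := \bigcup_(x in f @^-1` [set y]) O' x.
have oB : open B by apply: bigcup_open => x _; exact: oset_open.
have clB : closed (f @` ~` B).
  apply: compact_closed => //; apply: continuous_compact.
    by apply: continuous_subspaceT => z; exact: cts_fun.
  by apply: subclosed_compact cS _ => //; exact: open_closedC.
exists (Opens (closed_openC clB)), O'; split.
- by move=> [z Bz fz]; apply: Bz; exists z => //; exact: O'x.
- by move=> x fx; split; [exact: O'x|move=> z []].
- move=> z Wz; apply: contrapT => h; by apply: Wz; exists z.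
- move=> x x' z fx fx' [_ h] [_ h']; apply: contrapT => xx'.
  have [_ Q1] := h x' ((rP x').2 fx') xx'.
  have [P1 _] := h' x ((rP x).2 fx) (fun e => xx' (esym e)).
  by have [_ _ /(_ z P1 Q1)] := hPQ x' x (fun e => xx' (esym e)).
Qed.

Lemma finite_separated_restrict (S T : topologicalType) (f : continuousType S T) (A : set T) :
  finite_separated f -> finite_separated (@restrict_over _ _ f A).
Proof.
move=> finf y O Oy.
have ex x : exists P : opens S, f x = val y -> forall z : f @^-1` A, val z = x ->
    P x /\ forall w : f @^-1` A, P (val w) -> O z w.
  have [fx|] := pselect (f x = val y); last by exists (Opens openT).
  have Ax : (f @^-1` A) x by rewrite /preimage /= fx; exact: set_valP.
  have [z zx] := sub_point Ax; have [U oU UO] := (sub_openP _).1 (oset_open (O z)).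
  exists (Opens oU) => _ z' z'x; have -> : z' = z by apply: val_inj; rewrite zx.
  split=> [|w]; last by move/UO.
  by rewrite -zx; apply/UO/Oy; apply: val_inj; rewrite /= zx.
have /choice[P hP] := ex.
have [|W [P' [Wy P'P Pcov Pdis]]] := finf (val y) P.
  move=> x fx; have Ax : (f @^-1` A) x by rewrite /preimage /= fx; exact: set_valP.
  by have [z zx] := sub_point Ax; have [] := hP x fx z zx.
exists (open_preimage (@inclusion _ A) W),
  (fun x => open_preimage (@inclusion _ (f @^-1` A)) (P' (val x))); split=> //.
- move=> x fx; have fx' : f (val x) = val y by rewrite -fx.
  have [P'x P'Px] := P'P _ fx'; split=> // w /P'Px.
  by have [_] := hP _ fx' x erefl; apply.
- move=> z Wz; have [x fx P'z] := Pcov _ Wz.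
  have Ax : (f @^-1` A) x by rewrite /preimage /= fx; exact: set_valP.
  have [x' x'x] := sub_point Ax; exists x'; first by apply: val_inj; rewrite /= x'x.
  by rewrite /in_opens /= /preimage /= x'x.
- move=> x x' z fx fx' h h'; apply: val_inj; apply: (Pdis _ _ (val z)) => //.
    by rewrite -fx.
  by rewrite -fx'.
Qed.

(** * Flat charts *)

Section star_shaped.
Variables (R : realType) (n : nat).

Lemma cvg_rV (S : Type) (F : set_system S) (FF : Filter F) (g : S -> 'rV[R]_n) (v : 'rV[R]_n) :
  (forall l, g x 0 l @[x --> F] --> v 0 l) -> g @ F --> v.
Proof.
move=> h A /nbhs_rV[e e0 eA].
have : \forall x \near F, forall l, `|g x 0 l - v 0 l| < e.
  by apply: filter_forall => l; move/cvgrPdist_lt: (h l) => /(_ _ e0); apply: filterS => x; rewrite distrC.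
by apply: filterS => x; exact: eA.
Qed.

Lemma continuous_coord (l : 'I_n) : continuous (fun v : 'rV[R]_n => v 0 l).
Proof. by apply/continuousP => A oA; exact: coord_open. Qed.

Lemma segment_rV_continuous (v w : 'rV[R]_n) :
  continuous (fun t : R => v + t *: (w - v) : 'rV[R]_n).
Proof.
move=> t; apply: cvg_rV => l; rewrite (_ : (fun x : R => _) = fun x => v 0 l + x * (w 0 l - v 0 l)).
  rewrite !mxE; apply: cvgD; first exact: cvg_cst.
  by apply: cvgM; [exact: cvg_id|exact: cvg_cst].
by apply/funext => x; rewrite !mxE.
Qed.

Lemma star_connected (A : set 'rV[R]_n) (v : 'rV[R]_n) :
  (forall w, A w -> forall t : R, 0 <= t <= 1 -> A (v + t *: (w - v))) -> connected A.
Proof.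
move=> star.
have -> : A = \bigcup_(w in A) ((fun t : R => v + t *: (w - v)) @` `[0, 1]).
  apply/seteqP; split=> w.
    move=> Aw; exists w => //; exists 1; first by rewrite /= in_itv /= ler01 lexx.
    by rewrite scale1r addrC subrK.
  by move=> [w' Aw' [t]]; rewrite /= in_itv /= => t01 <-; exact: star.
have [[w0 Aw0]|A0] := pselect (A !=set0); last first.
  have -> : A = set0 by apply/seteqP; split=> w // Aw; case: A0; exists w.
  by rewrite bigcup_set0; exact: connected0.
apply: bigcup_connected.
  exists v => w Aw; exists 0; first by rewrite /= in_itv /= ler01 lexx.
  by rewrite scale0r addr0.
move=> w Aw; apply: connected_continuous_connected; first exact: segment_connected.
by apply: continuous_subspaceT; exact: segment_rV_continuous.
Qed.

Definition cube (c : 'rV[R]_n) (d : R) : set 'rV[R]_n :=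
  box (fun l => c 0 l - d) (fun l => c 0 l + d).

Lemma cubeP (c : 'rV[R]_n) d v : cube c d v <-> forall l, `|v 0 l - c 0 l| < d.
Proof.
split=> h l; have := h l; rewrite ltr_norml => /andP[h1 h2]; apply/andP; split; lra.
Qed.

Lemma cube_nbhs (c : 'rV[R]_n) (A : set 'rV[R]_n) : nbhs c A ->
  exists2 d : R, 0 < d & cube c d `<=` A.
Proof.
by move=> /nbhs_rV[d d0 h]; exists d => // v /cubeP; exact: h.
Qed.

Lemma cube_connected (c : 'rV[R]_n) d : connected (cube c d).
Proof.
apply: (@star_connected _ c) => w /cubeP cw t /andP[t0 t1]; apply/cubeP => l.
rewrite !mxE addrAC subrr add0r normrM ger0_norm //.
by apply: le_lt_trans (cw l); rewrite ler_piMl.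
Qed.

Lemma cube_center (c : 'rV[R]_n) d : 0 < d -> cube c d c.
Proof. by move=> d0; apply/cubeP => l; rewrite subrr normr0. Qed.

Lemma cube_le (c : 'rV[R]_n) d d' : d <= d' -> cube c d `<=` cube c d'.
Proof. by move=> dd' v /cubeP h; apply/cubeP => l; exact: lt_le_trans (h l) dd'. Qed.

End star_shaped.

(* A chart of T around x in which S is the coordinate subspace R^j of R^n. *)
Definition flat_chart (R : realType) (n j : nat) (T : topologicalType) (S : set T) (x : T)
    (e : 'rV[R]_n -> T) (c : 'rV[R]_n) (d : R) :=
  [/\ 0 < d /\ e c = x, continuous e, injective e,
      forall P : set 'rV[R]_n, open P -> P `<=` cube c d -> open (e @` P) &
      forall v, cube c d v -> (S (e v) <-> forall l : 'I_n, (j <= l)%N -> v 0 l = 0)].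

Lemma flat_chart_le (R : realType) (n j : nat) (T : topologicalType) (S : set T) (x : T)
    (e : 'rV[R]_n -> T) (c : 'rV[R]_n) (d d' : R) :
  0 < d' -> d' <= d -> flat_chart j S x e c d -> flat_chart j S x e c d'.
Proof.
move=> d'0 dd' [[d0 ec] ce ie oe Se]; split=> //.
- by move=> P oP Pc; apply: oe => // v /Pc; exact: cube_le.
- by move=> v /(cube_le dd'); exact: Se.
Qed.

Section flat_charts.
Variables (R : realType) (n : nat) (T : topologicalType) (A : set T) (q : int) (F : filtration A).
Hypothesis mT : closed_manifold R n T.
Hypothesis flat : locally_flat R n%:Z (manifold_filtration T n) q F.

(** Local flatness only concerns connected components of strata. Near [r] nothing is lost: a
    Euclidean chart lies in the component of the manifold, and the part of the stratum near [r] lies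
    in the component of [r]. *)
Lemma flat_chart_exists (j : nat) (r : A) : (j <= n)%N -> level F j%:Z r ->
  exists (e : 'rV[R]_n -> T) c d,
    flat_chart j [set x | exists2 z : A, val z = x & level F j%:Z z] (val r) e c d.
Proof.
move=> jn Fr; have [_ _ /(_ r n j)] := flat.
have levT : level (manifold_filtration T n) n%:Z = setT.
  by apply/seteqP; split=> // x _; split=> /=; [exact: lexx|lia].
rewrite levT => /(_ I Fr) /= [_ /(_ jn)].
set S := connected_component setT (val r); set CT := connected_component (level F j%:Z) r.
move=> [U' [U [[[L' [G' [_ _ [nU' _]]]] [L [G [_ _ [nU [phi [[cphi [psi [cpsi phiK psiK]]] phiF _]]]]]] UU']]]].
move=> [PQ [a [b [[ca [a' [ca' aK a'K]]] [cb [b' [cb' bK b'K]]] ab]]]].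
set P := val @` (U `&` CT) in PQ a ca a' ca' aK a'K ab; set Q := U' `&` S in PQ b cb b' cb' bK b'K ab.
have Ur : U r by exact: nbhs_singleton.
have [ru eru] := sub_point Ur.
(* The vertices of the distinguished chart form a copy of [R^j]; a small cube of them is connected
   and avoids [F (j - 1)], so it stays in the component of [r]. *)
have [O oO [Or OP]] : exists2 O : set T, open O & O (val r) /\
    forall z : A, O (val z) -> level F j%:Z z -> P (val z).
  have phir : (phi ru).2 = None by apply/phiF; rewrite eru; case: Fr.
  have ck : continuous (fun w : 'rV[R]_j => val (psi (w, None)) : A).
    move=> w; apply: continuous_comp; last exact: continuous_val.
    apply: (@continuous_comp _ _ _ (fun w => (w, None : cone R L)) psi); last exact: cpsi.
    exact: continuous_pairl.
  have er : val (psi ((phi ru).1, None)) = r.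
    by rewrite -phir -surjective_pairing phiK.
  have oF : open (~` F (j%:Z - 1)) by apply: closed_openC; exact: fil_closed.
  have [d d0 cd] : exists2 d : R, 0 < d & cube (phi ru).1 d `<=`
      (fun w => val (psi (w, None)) : A) @^-1` (~` F (j%:Z - 1)).
    apply: cube_nbhs; apply: ck; rewrite er; apply: open_nbhs_nbhs; split=> //.
    by case: Fr.
  pose M : set U := [set z | cube (phi ru).1 d (phi z).1].
  have oM : open M.
    have c1 : continuous (fst \o phi).
      by move=> z; apply: continuous_comp; [exact: cphi|exact: cvg_fst].
    by move/continuousP: c1; apply; exact: box_open.
  have [O1 oO1 MO1] := (sub_openP _).1 oM.
  have [O2 oO2 hO2] := (sub_openP _).1 (openI (open_interior U) oO1).
  exists O2 => //; split.
    by apply/hO2; split; [exact: nU|rewrite -eru; apply/MO1; exact: cube_center].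
  move=> z /hO2[/interior_subset Uz O1z] Fz; have [zu ezu] := sub_point Uz.
  have Mz : M zu by apply/MO1; rewrite ezu.
  exists z => //; split=> //.
  have phiz : (phi zu).2 = None by apply/phiF; rewrite ezu; case: Fz.
  exists ((fun w => val (psi (w, None)) : A) @` cube (phi ru).1 d); last first.
    by exists (phi zu).1 => //; rewrite -phiz -surjective_pairing phiK.
  split.
  - by exists (phi ru).1 => //; exact: cube_center.
  - move=> _ [w cw <-]; split; last exact: cd.
    by apply/phiF; rewrite psiK.
  - apply: connected_continuous_connected; first exact: cube_connected.
    by apply: continuous_subspaceT.
have nQ : nbhs (val r) Q.
  apply: filterI => //; have [_ _ /(_ (val r))[V [oV Vr [h [ch [h' [ch' hK h'K]]]]]]] := mT.
  apply: filterS (open_nbhs_nbhs (conj oV Vr)) => y Vy.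
  exists (range (fun w : 'rV[R]_n => val (h' w) : T)); last first.
    by have [y' <-] := sub_point Vy; exists (h y') => //; rewrite hK.
  split=> //.
    by have [r' <-] := sub_point Vr; exists (h r') => //; rewrite hK.
  apply: connected_continuous_connected; first by apply: (@star_connected _ _ _ 0).
  apply: continuous_subspaceT => w; apply: continuous_comp; [exact: ch'|exact: continuous_val].
have [rq erq] := sub_point (nbhs_singleton nQ).
pose e (v : 'rV[R]_n) : T := val (b' v).
have ce : continuous e by move=> v; apply: continuous_comp; [exact: cb'|exact: continuous_val].
have ie : injective e by move=> v w /val_inj h; rewrite -(b'K v) h b'K.
have ec : e (b rq) = val r by rewrite /e bK.
have [d d0 cd] : exists2 d : R, 0 < d & cube (b rq) d `<=` e @^-1` (interior Q `&` O).
  apply: cube_nbhs; apply: ce; rewrite ec; apply: filterI; first exact: nbhs_interior.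
  by apply: open_nbhs_nbhs.
exists e, (b rq), d; split=> //.
- move=> W oW Wc; have oW' : open (b @^-1` W) by move/continuousP: cb; apply.
  have [O1 oO1 WO1] := (sub_openP _).1 oW'.
  have -> : e @` W = O1 `&` interior Q.
    apply/seteqP; split=> [_ [w Ww <-]|x [O1x iQx]].
      by split; [apply/WO1; rewrite /preimage /= b'K|case: (cd _ (Wc _ Ww))].
    have [x' ex'] := sub_point (interior_subset iQx).
    by exists (b x'); [apply/WO1; rewrite ex'|rewrite /e bK].
  by apply: openI => //; exact: open_interior.
- move=> v cv; split=> [[z ez Fz] l jl|v0].
    have [iQ Oz] := cd v cv; have Pz : P (e v) by have := OP z; rewrite [val z]ez => /(_ Oz Fz).
    have [x ex] := sub_point Pz.
    have <- : b (b' v) = v by exact: b'K.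
    rewrite (ab x (b' v)) ?ex // /std_inclusion mxE.
    by case: insubP => //= i; rewrite ltnNge jl.
  pose w : 'rV[R]_j := \row_(i < j) v 0 (widen_ord jn i).
  have vw : v = std_inclusion n w.
    apply/rowP => l; rewrite mxE; case: insubP => [i _ il|]; last first.
      by rewrite -leqNgt => jl; rewrite v0.
    by rewrite mxE; congr (v _ _); apply: val_inj.
  have [y ey] := sub_point (PQ _ (set_valP (a' w))).
  have by_ : b y = v by rewrite (ab (a' w) y) // a'K.
  have [z [_ CTz] ez] := set_valP (a' w).
  exists z; first by rewrite ez /e -by_ bK ey.
  exact: (connected_component_sub CTz).
Qed.

End flat_charts.

(** * Punctured flat charts *)

Section pull_sheaf.
Variables (S T : topologicalType) (h : opens S -> opens T).
Hypothesis hS : forall U V : opens S, V `<=` U -> h V `<=` h U.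
Hypothesis hcov : forall (U : opens S) (I : Type) (W : I -> opens S),
  U `<=` \bigcup_i W i -> h U `<=` \bigcup_i h (W i).
Hypothesis hI : forall U V : opens S, h U `&` h V `<=` h (opensI U V).

Section obj.
Variable F : sheaf T.
Let sec (U : opens S) := F (h U).
Let pres (U V : opens S) (VU : V `<=` U) : sec U -> sec V := res (hS VU).

Lemma pull_res_linear (U V : opens S) (VU : V `<=` U) : linear (@pres U V VU).
Proof. exact: res_linear. Qed.
Lemma pull_res_id (U : opens S) (UU : U `<=` U) s : @pres U U UU s = s.
Proof. exact: res_id. Qed.
Lemma pull_res_comp (U V W : opens S) (VU : V `<=` U) (WV : W `<=` V)
  (WU : W `<=` U) s : pres WV (pres VU s) = pres WU s.
Proof. exact: res_comp. Qed.
Lemma pull_local (U : opens S) (I : Type) (W : I -> opens S)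
    (WU : forall i, W i `<=` U) : U `<=` \bigcup_i W i ->
    forall s t, (forall i, pres (WU i) s = pres (WU i) t) -> s = t.
Proof.
move=> cov s t st.
exact: (@sheaf_local _ F (h U) I (h \o W) (fun i => hS (WU i)) (hcov cov)).
Qed.
Lemma pull_glue (U : opens S) (I : Type) (W : I -> opens S)
    (WU : forall i, W i `<=` U) : U `<=` \bigcup_i W i ->
    forall s : forall i, sec (W i),
    (forall i j (V : opens S) (Vi : V `<=` W i) (Vj : V `<=` W j),
       pres Vi (s i) = pres Vj (s j)) ->
    exists t, forall i, pres (WU i) t = s i.
Proof.
move=> cov s comp.
apply: (@sheaf_glue _ F (h U) I (h \o W) (fun i => hS (WU i)) (hcov cov)).
move=> i j V Vi Vj.
have := comp i j (opensI (W i) (W j)) (@opensIl _ _ _) (@opensIr _ _ _).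
have VX : V `<=` h (opensI (W i) (W j)) by move=> x Vx; apply: hI; split; [exact: Vi|exact: Vj].
by move=> /(congr1 (res VX)); rewrite /pres !(res_comp _ _ Vi, res_comp _ _ Vj).
Qed.
(** Inverse image described by an operation [h] on open sets. In the application [h P] is the part
    in [Z] of the image of [P], which carries a resolution on [Z] over to [R^n], where boxes
    live. *)
Definition pull_sheaf := Sheaf pull_res_linear pull_res_id pull_res_comp pull_local pull_glue.
End obj.

Definition pull_hom (F G : sheaf T) (a : sheaf_hom F G) : sheaf_hom (pull_sheaf F) (pull_sheaf G) :=
  @SheafHom S (pull_sheaf F) (pull_sheaf G) (fun U => a (h U))
    (fun U => @hom_linear _ _ _ a _) (fun U V VU s => @hom_res _ _ _ a _ _ _ s).

Section cpx.
Variable C : complex T.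
Let d i j := pull_hom (diff C i j).
Lemma pull_out i j : j <> i + 1 -> forall (U : opens S) s, d i j U s = 0.
Proof. by move=> ij U s; exact: diff_out. Qed.
Lemma pull_sq i j k (U : opens S) s : d j k U (d i j U s) = 0.
Proof. exact: diff_sq. Qed.
Definition pull_complex := Complex pull_out pull_sq.
End cpx.
End pull_sheaf.

Section constant_sections.
Variable T : topologicalType.

Lemma constant_section_locally_constant (U : opens T) (a : rat) :
  @locally_constant T U (fun=> a).
Proof. by move=> x; exists (Opens openT). Qed.

Definition constant_section (U : opens T) (a : rat) : constant_sheaf T U :=
  Submod (ssc_submod (locally_constant_closed T) U) (@constant_section_locally_constant U a).

Lemma constant_section_res (U V : opens T) (VU : V `<=` U) a :
  res VU (constant_section U a) = constant_section V a.
Proof. exact: smval_inj. Qed.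

Lemma constant_sectionZ (U : opens T) a b :
  a *: constant_section U b = constant_section U (a * b).
Proof. exact: smval_inj. Qed.

End constant_sections.

Section punctured_chart.
Variables (R : realType) (n j : nat) (T : topologicalType) (S : set T) (x : T).
Variables (e : 'rV[R]_n -> T) (c : 'rV[R]_n) (d : R).
Hypothesis chart : flat_chart j S x e c d.
Variables (Z : set T).
Hypothesis ZE : forall v, cube c d v -> (Z (e v) <-> ~ S (e v)).
Hypothesis Sx : S x.

Let he (P : opens 'rV[R]_n) : set Z := [set z | exists2 v, (P `&` cube c d) v & e v = val z].
Let he_open P : open (he P).
Proof.
have [_ ce ie oe _] := chart.
apply/sub_openP; exists (e @` (P `&` cube c d)) => [|z]; last by split=> -[v Pv ev]; exists v.
by apply: oe => [|v []//]; apply: openI; [exact: oset_open|exact: box_open].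
Qed.
Let h (P : opens 'rV[R]_n) : opens Z := Opens (@he_open P).
Let hS (U V : opens 'rV[R]_n) : V `<=` U -> h V `<=` h U.
Proof. by move=> VU z [v [Vv cv] ev]; exists v => //; split=> //; exact: VU. Qed.
Let hcov (U : opens 'rV[R]_n) (I : Type) (W : I -> opens 'rV[R]_n) :
  U `<=` \bigcup_i W i -> h U `<=` \bigcup_i h (W i).
Proof. by move=> UW z [v [Vv cv] ev]; have [i _ Wv] := UW v Vv; exists i => //; exists v. Qed.
Let hI (U V : opens 'rV[R]_n) : h U `&` h V `<=` h (opensI U V).
Proof.
have [_ _ ie _ _] := chart.
move=> z [[v [Uv cv] ev] [w [Vw _] ew]]; exists v => //; split=> //; split=> //.
by rewrite (ie v w) // ev ew.
Qed.

Variables (J : complex Z) (e0 : sheaf_hom (constant_sheaf Z) (J 0)).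
Hypothesis rJ : resolution e0.

Let N := pull_complex hS hcov hI J.
Let ls := [seq l : 'I_n <- enum 'I_n | (j <= l)%N].
Let D := puncturedo (fun l => c 0 l - d) (fun l => c 0 l + d) ls.
Let one : N 0 D := e0 (h D) (constant_section (h D) 1).

Let flasqueN (i : int) (U V : opens 'rV[R]_n) (VU : V `<=` U) (s : N i V) :
  exists t : N i U, res VU t = s.
Proof. have iJ : injective_sheaf (J i) by exact: (rs_injective rJ).
have [t ht] := @injective_flasque _ (J i) (h U) (h V) (hS VU) s iJ.
by exists t; exact: ht. Qed.

Let NcocycleP i (U : opens 'rV[R]_n) (s : J i (h U)) : @cocycle _ N i U s <-> cocycle s.
Proof. by split=> hs k; exact: hs. Qed.

Let cocycle_one : cocycle one.
Proof. by apply/NcocycleP; exact: (rs_cocycle rJ). Qed.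

Let res_one (P : opens 'rV[R]_n) (PD : P `<=` D) a :
  a *: res PD one = e0 (h P) (constant_section (h P) a).
Proof.
transitivity (a *: res (hS PD) one) => //.
by rewrite /one -hom_res -homZ constant_section_res constant_sectionZ mulr1.
Qed.

Let Zcube v : cube c d v -> (Z (e v) <-> exists2 l, l \in ls & v 0 l != 0).
Proof.
have [_ _ _ _ Se] := chart.
move=> cv; split=> [/(ZE cv) h1|[l]].
  apply: contrapT => h2; apply/h1/Se => // l jl; apply: contrapT => vl; apply: h2.
  by exists l; [rewrite mem_filter jl mem_enum|exact/eqP].
rewrite mem_filter => /andP[jl _] vl; apply/(ZE cv) => /(Se _ cv)/(_ l jl) vl0.
by rewrite vl0 eqxx in vl.
Qed.

Let one_faithful (P : opens 'rV[R]_n) (PD : P `<=` D) a v : P v ->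
  a *: res PD one = 0 -> a = 0.
Proof.
move=> Pv; rewrite res_one => /(rs_mono rJ) a0; have [cv lv] := PD v Pv.
have [z ez] := sub_point ((Zcube cv).2 lv).
have hz : h P z by exists v.
by have [z' _] := sub_point hz; have := congr1 (fun s => smval s z') a0.
Qed.

Let local_primitive m (P : opens 'rV[R]_n) (PD : P `<=` D) (s : N m%:Z P) :
  cocycle s -> forall v, P v -> exists (V : opens 'rV[R]_n) (VP : V `<=` P) (VD : V `<=` D) t,
    V v /\ delta one m VD t = res VP s.
Proof.
have [_ ce ie _ _] := chart.
move=> /NcocycleP cs v Pv; have [cv lv] := PD v Pv.
have [z ez] := sub_point ((Zcube cv).2 lv).
have hz : h P z by exists v.
have shrink (V : opens Z) : V z -> exists (Q : opens 'rV[R]_n), [/\ Q `<=` P, Q v & h Q `<=` V].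
  move=> Vz; have [O oO OV] := (sub_openP _).1 (oset_open V).
  have oQ : open (P `&` e @^-1` O).
    by apply: openI; [exact: oset_open|move/continuousP: ce; exact].
  exists (Opens oQ); split=> /= [w []//||z' [w [[_ Ow] _] ew]].
    by split=> //; rewrite /preimage /= -ez; apply/OV.
  by apply/OV; rewrite -ew.
case: m s cs => [|m] s cs.
  (* In degree 0 a cocycle is a section of the constant sheaf, hence a multiple of [one] near
     [v]. *)
  have [k ks] := rs_exact rJ cs.
  have [z' ez'] := sub_point hz.
  have [V [Vz hV]] := smvalP k z'.
  rewrite ez' in Vz; have [Q [QP Qv QV]] := shrink V Vz.
  have QD : Q `<=` D by move=> w /QP/PD.
  exists Q, QP, QD, (smval k z'); split=> //.
  transitivity (res (hS QP) s) => //.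
  rewrite /= (res_one QD (smval k z')) -ks -hom_res; congr (e0 _ _).
  apply: smval_inj; apply/funext => w /=; apply/esym/hV.
  exact: (QV _ (set_valP w)).
have acJ : acyclic_at J m.+1%:Z by exact: (rs_acyclic rJ).
have [V [VP [t [Vz dt]]]] := acJ _ s cs z hz.
have [Q [QP Qv QV]] := shrink V Vz.
have QD : Q `<=` D by move=> w /QP/PD.
have em : m.+1%:Z - 1 = m%:Z by rewrite intS; lia.
move: t dt; rewrite em => t dt.
exists Q, QP, QD, (res QV t); split=> //.
transitivity (res (hS QP) s) => //.
by rewrite /= -[LHS]/(diff J m%:Z m.+1%:Z (h Q) (res QV t)) hom_res dt (res_comp _ _ (hS QP)).
Qed.

Let size_ls : size ls = (n - j)%N.
Proof.
rewrite size_filter -sum1_count big_enum_cond /=.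
by rewrite -(big_geq_mkord j n xpredT (fun=> 1%N)) sum_nat_const_nat muln1.
Qed.

Let c0 l : l \in ls -> c 0 l = 0.
Proof.
have [[d0 ec] _ _ _ Se] := chart; rewrite mem_filter => /andP[jl _].
by move: l jl; apply/(Se c (cube_center c d0)); rewrite ec.
Qed.

Let vanish_chart m (d' : R) (PD : puncturedo (fun l => c 0 l - d') (fun l => c 0 l + d') ls `<=` D) :
  0 < d' -> (m < n - j)%N -> vanish one m PD.
Proof.
move=> d'0 mj; apply: (vanish_punctured flasqueN cocycle_one one_faithful local_primitive).
- by rewrite filter_uniq ?enum_uniq.
- by rewrite size_ls.
- by move=> l; lra.
- by move=> l /c0 ->; lra.
Qed.

(** The three final clauses are [vanish] at levels 0, 1 and [m.+2] for a cube punctured along a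
    subspace of codimension [n - j]; codimension at least 2 gives the second one. *)
Lemma punctured_chart (O : set T) : nbhs x O -> (1 < n - j)%N ->
  exists (E : set T) (EZ : opens Z),
    [/\ open E, E x, E `<=` O & forall z, EZ z <-> E (val z)] /\
    [/\ exists z, EZ z,
        forall s : constant_sheaf Z EZ, exists a, s = constant_section EZ a &
        forall m, (m.+2 < n - j)%N -> forall s : J m.+1%:Z EZ, cocycle s ->
          exists t, diff J m%:Z m.+1%:Z EZ t = s].
Proof.
have [[d0 ec] ce ie oe Se] := chart.
move=> nO nj; have [d1 d10 d1O] : exists2 d1 : R, 0 < d1 & cube c d1 `<=` e @^-1` O.
  by apply: cube_nbhs; apply: ce; rewrite ec.
pose d' := Num.min d d1.
have d'0 : 0 < d' by rewrite lt_min d0.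
have d'd : d' <= d by rewrite ge_min lexx.
have d'd1 : d' <= d1 by rewrite ge_min lexx orbT.
pose Q := puncturedo (fun l => c 0 l - d') (fun l => c 0 l + d') ls.
have QD : Q `<=` D by move=> v [cv lv]; split=> //; exact: (cube_le d'd).
exists (e @` cube c d'), (h Q); split.
  split.
  - by apply: oe; [exact: box_open|exact: cube_le].
  - by exists c => //; exact: cube_center.
  - by move=> _ [v cv <-]; apply: d1O; exact: (cube_le d'd1).
  - move=> z; split=> [[v [[cv _] _] ev]|[v cv ev]]; first by exists v.
    exists v => //; have cdv := cube_le d'd cv; split=> //; split=> //.
    by apply/Zcube => //; rewrite ev; exact: set_valP.
split.
- have [v Qv] := vanish_chart QD d'0 (ltnW nj).
  have [cv lv] := QD v Qv; have [z ez] := sub_point ((Zcube cv).2 lv).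
  by exists z; exists v.
- move=> s; have := vanish_chart QD d'0 nj => /(_ (e0 _ s)).
  case; first by apply/NcocycleP; exact: (rs_cocycle rJ).
  move=> a; rewrite /= res_one => /(resolution_inj rJ) <-; by exists a.
- move=> m mj s /NcocycleP cs; have [t ht] := vanish_chart QD d'0 mj s cs.
  by exists t.
Qed.

End punctured_chart.

(** * Open cones *)

Section cone_topology.
Variables (R : realType) (L : topologicalType).
Implicit Types (c : cone R L) (t : R).

Definition cone_point (l : L) t : cone R L := if insub t is Some t' then Some (l, t') else None.

Definition cone_height c : R := if c is Some x then val x.2 else 0.

Definition cone_scale (a : R) c : cone R L := if c is Some x then cone_point x.1 (a * val x.2) else None.

Lemma mem_itv01 t : (t \in (`]0, 1[%classic : set R)) = (0 < t < 1).
Proof.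
by apply/idP/idP => [/set_mem|h]; [rewrite /= in_itv|apply/mem_set; rewrite /= in_itv].
Qed.

Lemma cone_pointE l t : 0 < t < 1 -> exists t' : (`]0, 1[%classic : set R),
  val t' = t /\ cone_point l t = Some (l, t').
Proof.
move=> t01; rewrite /cone_point; case: insubP => [t' _ ht'|]; first by exists t'.
by rewrite mem_itv01 t01.
Qed.

Lemma cone_height_point l t : 0 < t < 1 -> cone_height (cone_point l t) = t.
Proof. by move=> /(cone_pointE l)[t' [<- ->]]. Qed.

Lemma cone_heightP (t : (`]0, 1[%classic : set R)) : 0 < val t < 1.
Proof. by have := set_valP t; rewrite /= in_itv. Qed.

Lemma cone_some l (t : (`]0, 1[%classic : set R)) : Some (l, t) = cone_point l (val t).
Proof.
have [t' [ett' ->]] := cone_pointE l (cone_heightP t).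
by congr (Some (_, _)); apply: val_inj.
Qed.

Lemma cone_height_bound c : 0 <= cone_height c < 1.
Proof.
case: c => [[l t]|] /=; last by rewrite lexx ltr01.
by have /andP[/ltW -> ->] := cone_heightP t.
Qed.

Lemma cone_scale_height a c : 0 < a <= 1 -> cone_height (cone_scale a c) = a * cone_height c.
Proof.
move=> /andP[a0 a1]; case: c => [[l t]|] /=; last by rewrite mulr0.
have /andP[t0 t1] := cone_heightP t.
by rewrite cone_height_point // mulr_gt0 //= (le_lt_trans _ t1) // ler_piMl // ltW.
Qed.

Lemma cone_scale1 c : cone_scale 1 c = c.
Proof. by case: c => [[l t]|] //=; rewrite mul1r -cone_some. Qed.

Lemma cone_proj_height (x : L * (`[0, 1[%classic : set R)) : cone_height (cone_proj x) = val x.2.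
Proof.
case: x => l t; rewrite /cone_proj /=; case: insubP => [t' _ <- //|] /=.
have := set_valP t; rewrite /= in_itv /= => /andP[t0 t1].
rewrite mem_itv01 t1 andbT -leNgt => t0'.
by apply/eqP; rewrite eq_le t0 t0'.
Qed.

Lemma cone_projE (x : L * (`[0, 1[%classic : set R)) : cone_proj x = cone_point x.1 (val x.2).
Proof. by []. Qed.

Lemma cone_openE (U : set (cone R L)) : open U = open (@cone_proj R L @^-1` U).
Proof. by []. Qed.

Lemma cone_nbhs (c : cone R L) (A : set (cone R L)) : nbhs c A ->
  exists2 U : set (cone R L), cone_open U & U c /\ U `<=` A.
Proof. by rewrite nbhsE => -[U [oU Uc] UA]; exists U. Qed.

Lemma cone_height_open (U : set R) : open U -> open (cone_height @^-1` U).
Proof.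
move=> oU; rewrite cone_openE.
rewrite (_ : _ @^-1` _ = (fun x : L * (`[0, 1[%classic : set R) => val x.2) @^-1` U).
  have cv : continuous (fun x : L * (`[0, 1[%classic : set R) => val x.2).
    by move=> x; apply: continuous_comp; [exact: cvg_snd|exact: continuous_val].
  by move/continuousP: cv; apply.
by apply/seteqP; split=> x; rewrite /preimage /= cone_proj_height.
Qed.

Lemma cone_sides_open (V : set L) : open V ->
  open [set c : cone R L | exists l t, [/\ V l, 0 < t < 1 & c = cone_point l t]].
Proof.
move=> oV; rewrite cone_openE.
rewrite (_ : _ @^-1` _ = (fst @^-1` V) `&` ((fun x : L * (`[0, 1[%classic : set R) => val x.2) @^-1` [set t | 0 < t])).
  have cv : continuous (fun x : L * (`[0, 1[%classic : set R) => val x.2).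
    by move=> x; apply: continuous_comp; [exact: cvg_snd|exact: continuous_val].
  apply: openI; last by move/continuousP: cv; apply; exact: open_gt.
  have cf : continuous (fst : L * (`[0, 1[%classic : set R) -> L) by move=> x; exact: cvg_fst.
  by move/continuousP: cf; apply.
apply/seteqP; split=> -[l t]; rewrite /preimage /=.
  move=> [l' [t' [Vl' t01 e]]]; have h := cone_proj_height (l, t).
  rewrite e cone_height_point // in h; move: e; rewrite cone_projE /= -h.
  have [t1 [_ ->]] := cone_pointE l t01; have [t2 [_ ->]] := cone_pointE l' t01.
  by move=> [-> _]; split=> //; case/andP: t01.
move=> [Vl t0]; exists l, (val t); split=> //; rewrite t0 /=.
by have := set_valP t; rewrite /= in_itv /= => /andP[].
Qed.

Lemma cone_point_near l t (A : set (cone R L)) : 0 < t < 1 -> nbhs (cone_point l t) A ->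
  exists2 V : set L, nbhs l V & exists2 e : R, 0 < e &
    forall l' t', V l' -> `|t' - t| < e -> 0 < t' < 1 -> A (cone_point l' t').
Proof.
move=> t01 /cone_nbhs[U oU [Ux UA]].
have t01' : (`[0, 1[%classic : set R) t.
  by rewrite /= in_itv /=; case/andP: t01 => /ltW -> ->.
have [t' et'] := sub_point t01'.
have : nbhs (l, t') (@cone_proj R L @^-1` U).
  apply: open_nbhs_nbhs; split; first exact: oU.
  by rewrite /preimage /= cone_projE /= et'.
case=> -[V B] [/= nV nB] VB.
rewrite nbhsE in nB; case: nB => [B' [oB' B't'] B'B].
have [P oP BP] := (sub_openP _).1 oB'.
have : nbhs t P by apply: open_nbhs_nbhs; split=> //; rewrite -et'; apply/BP.
move=> /nbhs_ballP[e /= e0 eP]; exists V; first exact: nV.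
exists e => // l1 t1 Vl1 t1e t101.
have : (`[0, 1[%classic : set R) t1.
  by rewrite /= in_itv /=; case/andP: t101 => /ltW -> ->.
move=> /sub_point[t2 et2]; apply: UA; rewrite -et2 -[cone_point _ _]/(cone_proj (l1, t2)).
apply: (VB (l1, t2)); split=> //=; apply: B'B; apply/BP; rewrite et2; apply: eP.
by rewrite /ball /= distrC.
Qed.

(** Tube lemma: compactness of the link makes the height allowed above each of its points
    uniform. *)
Lemma cone_vertex_near (A : set (cone R L)) : compact [set: L] -> nbhs (None : cone R L) A ->
  exists2 e : R, 0 < e & forall c, cone_height c < e -> A c.
Proof.
move=> cL /cone_nbhs[U oU [U0 UA]].
have z01 : (`[0, 1[%classic : set R) 0 by rewrite /= in_itv /= lexx ltr01.
have [z ez] := sub_point z01.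
have loc (l : L) : exists VE : set L * R, [/\ nbhs l VE.1, 0 < VE.2 & forall l' t', VE.1 l' ->
    0 < t' < 1 -> t' < VE.2 -> U (cone_point l' t')].
  have : nbhs (l, z) (@cone_proj R L @^-1` U).
    apply: open_nbhs_nbhs; split; first exact: oU.
    rewrite /preimage /= cone_projE /= ez /cone_point.
    by case: insubP => //= t'; rewrite mem_itv01 ltxx.
  case=> -[V B] [/= nV nB] VB.
  rewrite nbhsE in nB; case: nB => [B' [oB' B'z] B'B].
  have [P oP BP] := (sub_openP _).1 oB'.
  have : nbhs (0 : R) P by apply: open_nbhs_nbhs; split=> //; rewrite -ez; apply/BP.
  move=> /nbhs_ballP[e /= e0 eP]; exists (V, e); split=> //= l1 t1 Vl1 t101 t1e.
  have : (`[0, 1[%classic : set R) t1.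
    by rewrite /= in_itv /=; case/andP: t101 => /ltW -> ->.
  move=> /sub_point[t2 et2]; rewrite -et2 -[cone_point _ _]/(cone_proj (l1, t2)).
  apply: (VB (l1, t2)); split=> //=; apply: B'B; apply/BP; rewrite et2; apply: eP.
  by rewrite /ball /= sub0r normrN gtr0_norm //; case/andP: t101.
have /choice[VE hVE] := loc.
have /compact_near_coveringP/(_ R (nbhs (0 : R)) (fun e l => forall t, 0 < t < 1 -> t < e ->
  U (cone_point l t))) := cL; case.
  move=> l _; have [nV e0 hV] := hVE l.
  exists ((VE l).1, ball 0 (VE l).2).
    by split=> //; exact: nbhsx_ballx.
  move=> [l' e] /= [Vl' e'] t t01 te; apply: hV => //; apply: (lt_trans te).
  by move: e'; rewrite /ball /= sub0r normrN; apply: le_lt_trans; exact: ler_norm.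
move=> e /= e0 he; exists (e / 2); first lra.
have {}he := he (e / 2); rewrite /ball_ /= sub0r normrN gtr0_norm in he; last lra.
case=> [[l t]|] /= ht; last exact: UA.
rewrite cone_some; apply: UA; apply: he => //; first lra.
exact: cone_heightP.
Qed.

(** Joint continuity of radial scaling away from the vertex, which is where the points of a higher
    stratum lie. *)
Lemma cone_scale_near a c (A : set (cone R L)) : 0 < a <= 1 -> c <> None ->
  nbhs (cone_scale a c) A -> exists2 B : set (cone R L), nbhs c B & exists2 e : R, 0 < e &
    forall a' c', `|a' - a| < e -> 0 < a' <= 1 -> B c' -> A (cone_scale a' c').
Proof.
move=> /andP[a0 a1]; case: c => [[l t]|] // _ /=.
have /andP[t0 t1] := cone_heightP t; set r := val t in t0 t1 *.
have at01 : 0 < a * r < 1 by rewrite mulr_gt0 //= (le_lt_trans _ t1) // ler_piMl // ltW.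
move=> /(cone_point_near at01)[V nV [e e0 hA]].
exists ([set c : cone R L | exists l t, [/\ (interior V) l, 0 < t < 1 & c = cone_point l t]] `&`
    cone_height @^-1` (ball r (e / 2))).
  apply: open_nbhs_nbhs; split.
    apply: openI; first exact: (cone_sides_open (open_interior _)).
    by apply: cone_height_open; exact: ball_open.
  split; last by rewrite /preimage /=; apply: ballxx; lra.
  by exists l, r; rewrite t0 t1 /r -cone_some.
exists (e / 2); first lra.
move=> a' c' aa' /andP[a'0 a'1] [[l' [t' [Vl' /andP[t'0 t'1] ec']]]].
rewrite /preimage /= ec' cone_height_point ?t'0 // /ball /= => rt'.
have [t2 [et2 ->]] := cone_pointE l' (introT andP (conj t'0 t'1)); rewrite /= et2.
apply: hA; first exact: interior_subset.
- have -> : a' * t' - a * r = a' * (t' - r) + (a' - a) * r by ring.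
  apply: (le_lt_trans (ler_normD _ _)); rewrite !normrM.
  have -> : e = e / 2 + e / 2 by field.
  apply: ltr_leD.
    rewrite distrC in rt'; apply: le_lt_trans rt'; rewrite ler_piMl // ger0_norm // ltW //.
  by rewrite (@le_trans _ _ `|a' - a|) ?(ltW aa') // ler_piMr // gtr0_norm // ltW.
- by rewrite mulr_gt0 //= (le_lt_trans _ t'1) // ler_piMl // ltW.
Qed.

End cone_topology.

Lemma connected_ind (V : topologicalType) (A : set V) (P : V -> Prop) (v0 : V) :
  connected A -> A v0 -> P v0 ->
  (forall v, A v -> P v -> exists2 N, nbhs v N & forall w, N w -> A w -> P w) ->
  (forall v, A v -> ~ P v -> exists2 N, nbhs v N & forall w, N w -> A w -> ~ P w) ->
  forall v, A v -> P v.
Proof.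
move=> cA Av0 Pv0 oP oQ.
suff <- : [set v | A v /\ P v] = A by move=> v [].
apply: cA; first by exists v0.
- exists (interior [set w | A w -> P w]); first exact: open_interior.
  apply/seteqP; split=> v [Av].
    move=> Pv; split=> //; have [N nN NP] := oP v Av Pv.
    by apply: filterS nN => w Nw; exact: NP.
  by move=> /interior_subset h; split=> //; exact: h.
- exists (~` interior [set w | A w -> ~ P w]); first exact: open_closedC (open_interior _).
  apply/seteqP; split=> v [Av].
    by move=> Pv; split=> // /interior_subset h; exact: h.
  move=> h; split=> //; apply: contrapT => nPv; apply: h; have [N nN NP] := oQ v Av nPv.
  by apply: filterS nN => w Nw; exact: NP.
Qed.

Lemma segment_gt (R : realFieldType) (a v w t : R) :
  a < v -> a < w -> 0 <= t <= 1 -> a < v + t * (w - v).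
Proof.
move=> av aw /andP[t0 t1].
have h1 : 0 <= t * (w - a) by rewrite mulr_ge0 // subr_ge0 ltW.
have [t1'|t1'] := ltrP t 1; last first.
  by have -> : t = 1; lra.
have h2 : 0 < (1 - t) * (v - a) by rewrite mulr_gt0 // subr_gt0.
lra.
Qed.

Lemma segment_lt (R : realFieldType) (a v w t : R) :
  v < a -> w < a -> 0 <= t <= 1 -> v + t * (w - v) < a.
Proof.
move=> va wa t01; have := @segment_gt R (- a) (- v) (- w) t.
by rewrite !ltrN2 => /(_ va wa t01); lra.
Qed.

(** * Lifting along strata *)

Section clamp.
Variables (R : realFieldType) (a0 : R).
Hypothesis a01 : 0 < a0 <= 1.

(** Contraction factor as a function of time, from 1 at [t = 0] to [a0] at [t = 1]. It is defined
    and Lipschitz on all of [R], because homotopies are lifted over an open box around the unit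
    square. *)
Definition clamp (t : R) : R := if t <= 0 then 1 else if 1 - t <= a0 then a0 else 1 - t.

Lemma clamp01 t : 0 < clamp t <= 1.
Proof.
rewrite /clamp; case/andP: a01 => h1 h2; case: (lerP t 0) => h3; first by apply/andP; split; lra.
by case: (lerP (1 - t) a0) => h4; apply/andP; split; lra.
Qed.

Lemma clamp0 : clamp 0 = 1. Proof. by rewrite /clamp lexx. Qed.

Lemma clamp1 : clamp 1 = a0.
Proof. by rewrite /clamp subrr; case/andP: a01 => /ltW -> _; rewrite lt_geF // ltr01. Qed.

Lemma clamp_lipschitz t t' : `|clamp t' - clamp t| <= `|t' - t|.
Proof.
rewrite /clamp; case/andP: a01 => k1 k2; rewrite ler_norml.
case: (ger0P (t' - t)) => h5; case: (lerP t 0) => h1; case: (lerP t' 0) => h2;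
  try case: (lerP (1 - t) a0) => h3; try case: (lerP (1 - t') a0) => h4; apply/andP; split; lra.
Qed.

End clamp.

Lemma box_connected (R : realType) (n : nat) (a b : 'I_n -> R) : connected (box a b).
Proof.
have [[v v0]|e] := pselect (box a b !=set0); last first.
  rewrite (_ : box a b = set0); first exact: connected0.
  by apply/seteqP; split=> // v bv; apply: e; exists v.
apply: (@star_connected _ _ _ v) => w w0 t t01 l; rewrite !mxE.
have /andP[av vb] := v0 l; have /andP[aw wb] := w0 l.
by rewrite segment_gt // segment_lt.
Qed.

(** Injectivity is tested over one stratum only: near a point of [f^-1 M], the map may still
    identify points over the higher strata. *)
Definition injective_over (S T : Type) (f : S -> T) (M : set T) (O : set S) :=
  forall z z', O z -> O z' -> M (f z) -> f z = f z' -> z = z'.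

Definition locally_injective_over (S T : topologicalType) (f : S -> T) (M : set T) :=
  forall x, M (f x) -> exists O : opens S, O x /\ injective_over f M O.

Section coverings.
Variables (S T : topologicalType) (f : continuousType S T) (M : set T).
Hypothesis finf : finite_separated f.
Hypothesis fibre_finite : forall y, finite_set (f @^-1` [set y]).
Hypothesis open_f : forall U, open U -> open (f @` U).
Hypothesis injM : locally_injective_over f M.

(** Over [W] and [M] the sets [O x] are the sheets of a trivial covering. Each of them covers all of
    [W] because [f] is open and the fibre is finite. *)
Lemma sheets (y : T) (O0 : S -> opens S) : M y -> (forall x, f x = y -> O0 x x) ->
  exists (W : opens T) (O : S -> opens S),
  [/\ W y, forall x, f x = y -> O x x /\ O x `<=` O0 x,
      forall z, W (f z) -> exists2 x, f x = y & O x z &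
      forall x x' z, f x = y -> f x' = y -> O x z -> O x' z -> x = x'] /\
  [/\ forall x, f x = y -> injective_over f M (O x) &
      forall x y', f x = y -> W y' -> exists2 z, O x z & f z = y'].
Proof.
move=> My O0x.
have ex x : exists O : opens S, f x = y -> [/\ O x, O `<=` O0 x & injective_over f M O].
  have [fx|fx] := pselect (f x = y); last by exists (Opens openT).
  have [|O [Ox injO]] := injM (x := x); first by rewrite fx.
  exists (opensI O (O0 x)) => _; split; [by split=> //; exact: O0x|exact: opensIr|].
  by move=> z z' [Oz _] [Oz' _]; exact: injO.
have /choice[O hO] := ex.
have [x fx|W [O' [Wy O'O cov dis]]] := finf (y := y) (O := O); first by case: (hO x fx).
have /finite_seqP[r fr] := fibre_finite y.
have rP x : x \in r <-> f x = y.
  by have := congr1 (fun A => A x) fr; rewrite /preimage /= => ->.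
have oW : open (W `&` [set y' | forall x, x \in r -> (f @` O' x) y']).
  apply: openI; first exact: oset_open.
  by apply: bigcap_seq_open => x _; apply: open_f; exact: oset_open.
exists (Opens oW), O'; split; split=> //.
- by split=> // x /rP fx; exists x => //; have [] := O'O x fx.
- move=> x fx; have [Ox OO] := O'O x fx; have [_ OO0 _] := hO x fx.
  by split=> // z /OO/OO0.
- by move=> z [Wz _]; exact: cov.
- move=> x fx z z' Oz Oz'; have [_ O'x] := O'O x fx; have [_ _] := hO x fx; apply; exact: O'x.
- by move=> x y' fx [_ /(_ x ((rP x).2 fx))[z Oz fz]]; exists z.
Qed.

Lemma stays_in_sheet (V : topologicalType) (A : set V) (k : V -> S) (W : opens T)
    (O : S -> opens S) (y : T) (x : S) (v0 : V) :
  connected A -> A v0 -> (forall v, A v -> {for v, continuous k}) -> (forall v, A v -> W (f (k v))) ->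
  (forall z, W (f z) -> exists2 x, f x = y & O x z) ->
  (forall x x' z, f x = y -> f x' = y -> O x z -> O x' z -> x = x') ->
  f x = y -> O x (k v0) -> forall v, A v -> O x (k v).
Proof.
move=> cA Av0 ck Wk cov dis fx Ox; apply: (connected_ind cA Av0) => //.
  move=> v Av Oxv; exists (k @^-1` O x) => //; apply: (ck v Av).
  by apply: open_nbhs_nbhs; split=> //; exact: oset_open.
move=> v Av Oxv; have [x' fx' Ox'] := cov _ (Wk v Av).
exists (k @^-1` O x').
  by apply: (ck v Av); apply: open_nbhs_nbhs; split=> //; exact: oset_open.
by move=> w Ow Aw Oxw; apply: Oxv; rewrite (dis x x' (k w)).
Qed.

Hypothesis hausS : hausdorff_space S.

Lemma lift_unique (V : topologicalType) (A : set V) (g g' : V -> S) (v0 : V) :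
  connected A -> A v0 -> (forall v, A v -> {for v, continuous g}) ->
  (forall v, A v -> {for v, continuous g'}) -> (forall v, A v -> M (f (g v))) ->
  (forall v, A v -> f (g v) = f (g' v)) -> g v0 = g' v0 -> forall v, A v -> g v = g' v.
Proof.
move=> cA Av0 cg cg' Mg fg gv0; apply: (connected_ind cA Av0) => //.
  move=> v Av gv; have [O [Og injO]] := injM (Mg v Av).
  have nO : nbhs (g v) O by apply: open_nbhs_nbhs; split=> //; exact: oset_open.
  exists ((g @^-1` O) `&` (g' @^-1` O)).
    by apply: filterI; [exact: cg|apply: cg' => //; rewrite -gv].
  by move=> w [Ow O'w] Aw; apply: injO => //; [exact: Mg|exact: fg].
move=> v Av gv; have := hausS; rewrite open_hausdorff => /(_ (g v) (g' v))[]; first exact/eqP.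
move=> [P Q] /= [Pv Qv] [oP oQ PQ].
exists ((g @^-1` P) `&` (g' @^-1` Q)).
  apply: filterI; [apply: cg => //|apply: cg' => //]; apply: open_nbhs_nbhs; split=> //; exact: set_mem.
move=> w [Pw Qw] Aw gw; have : (P `&` Q) (g w) by split=> //; rewrite gw.
by rewrite (eqP PQ).
Qed.

Section lifts.
Variables (R : realType) (n : nat) (H : 'rV[R]_n -> T).

Definition is_lift (Q : set 'rV[R]_n) (g : 'rV[R]_n -> S) :=
  forall v, Q v -> {for v, continuous g} /\ f (g v) = H v.

Definition lifts (Q : set 'rV[R]_n) := forall v0 z0, Q v0 -> f z0 = H v0 ->
  exists2 g, g v0 = z0 & is_lift Q g.

Variable Q : set 'rV[R]_n.
Hypothesis contH : forall v, Q v -> {for v, continuous H}.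
Hypothesis HM : forall v, Q v -> M (H v).

Lemma is_lift_sub (Q1 Q2 : set 'rV[R]_n) g : Q1 `<=` Q2 -> is_lift Q2 g -> is_lift Q1 g.
Proof. by move=> Q12 hg v /Q12; exact: hg. Qed.

Lemma is_lift_eq (Q1 : set 'rV[R]_n) g g' v0 : Q1 `<=` Q -> connected Q1 -> Q1 v0 ->
  is_lift Q1 g -> is_lift Q1 g' -> g v0 = g' v0 -> forall v, Q1 v -> g v = g' v.
Proof.
move=> Q1Q cQ1 Qv0 lg lg'; apply: lift_unique => //.
- by move=> v /lg[].
- by move=> v /lg'[].
- by move=> v Qv; have [_ ->] := lg v Qv; apply: HM; exact: Q1Q.
- by move=> v Qv; have [_ ->] := lg v Qv; have [_ ->] := lg' v Qv.
Qed.

Lemma is_lift_local (Q1 : set 'rV[R]_n) g : open Q1 ->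
  (forall v, Q1 v -> exists g' P, [/\ open P, P v, is_lift P g' & forall w, P w -> Q1 w -> g w = g' w]) ->
  is_lift Q1 g.
Proof.
move=> oQ1 loc v Qv; have [g' [P [oP Pv lg' gg']]] := loc v Qv.
have [cg' fg'] := lg' v Pv; split; last by rewrite gg'.
move=> B; rewrite gg' // => nB.
have nv : nbhs v (g' @^-1` B `&` (P `&` Q1)).
  by apply: filterI; [exact: cg'|apply: open_nbhs_nbhs; split=> //; exact: openI].
suff : nbhs v (g @^-1` B) by [].
by apply: filterS nv => w [Bw [Pw Qw]]; rewrite /preimage /= gg'.
Qed.

Lemma lifts_local (v : 'rV[R]_n) : Q v ->
  exists2 e : R, 0 < e & forall Q1 : set 'rV[R]_n, open Q1 -> Q1 `<=` Q ->
    (forall w, Q1 w -> forall l, `|w 0 l - v 0 l| < e) -> lifts Q1.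
Proof.
move=> Qv; have [W [O [[Wy Ox cov dis] [inj sur]]]] := sheets (O0 := fun=> Opens openT) (HM Qv) (fun _ _ => I).
have : nbhs v (H @^-1` W).
  by apply: (contH Qv); apply: open_nbhs_nbhs; split=> //; exact: oset_open.
move=> /nbhs_rV[e e0 eW]; exists e => // Q1 oQ1 Q1Q Q1e v0 z0 Q1v0 fz0.
have WH w : Q1 w -> W (H w) by move=> /Q1e; exact: eW.
have [x fx Oz0] : exists2 x, f x = H v & O x z0 by apply: cov; rewrite fz0; exact: WH.
have ex w : exists z, Q1 w -> O x z /\ f z = H w.
  have [Q1w|] := pselect (Q1 w); last by exists z0.
  by have [z Oz fz] := sur x _ fx (WH _ Q1w); exists z.
have /choice[g hg] := ex.
have gE w z : Q1 w -> O x z -> f z = H w -> g w = z.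
  move=> Q1w Oz fz; have [Og fg] := hg w Q1w.
  by apply: (inj x fx) => //; rewrite fg ?fz //; exact: HM (Q1Q _ Q1w).
exists g; first exact: gE.
move=> w Q1w; have [Og fg] := hg w Q1w; split=> // B.
rewrite nbhsE => -[B' [oB' B'g] B'B].
have oP : open (f @` (B' `&` O x)) by apply: open_f; apply: openI => //; exact: oset_open.
have : nbhs w (H @^-1` (f @` (B' `&` O x))).
  by apply: (contH (Q1Q _ Q1w)); apply: open_nbhs_nbhs; split=> //; exists (g w).
move=> nP; apply: filterS (filterI nP (open_nbhs_nbhs (conj oQ1 Q1w))).
by move=> w' [[z [B'z Oz] fz] Q1w']; rewrite /preimage /= (gE _ z) //; exact: B'B.
Qed.

Lemma lifts_union (Q1 Q2 : set 'rV[R]_n) : open Q1 -> open Q2 -> Q1 `|` Q2 `<=` Q ->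
  connected (Q1 `&` Q2) -> (Q1 `&` Q2) !=set0 -> lifts Q1 -> lifts Q2 -> lifts (Q1 `|` Q2).
Proof.
move=> oQ1 oQ2 Q12 cQ ne h1 h2.
suff key (A B : set 'rV[R]_n) : open A -> open B -> A `|` B `<=` Q -> connected (A `&` B) ->
    (A `&` B) !=set0 -> lifts A -> lifts B ->
    forall v0 z0, A v0 -> f z0 = H v0 -> exists2 g, g v0 = z0 & is_lift (A `|` B) g.
  move=> v0 z0 [Q1v0|Q2v0] fz0; first exact: key.
  by rewrite setUC; apply: key => //; rewrite 1?setUC // setIC.
move=> oA oB ABQ cAB [v1 [Av1 Bv1]] hA hB v0 z0 Av0 fz0.
have [gA gA0 lA] := hA _ _ Av0 fz0; have [_ fgA] := lA _ Av1.
have [gB gB1 lB] := hB _ _ Bv1 fgA.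
have AB w : A w -> B w -> gB w = gA w.
  move=> Aw Bw; apply: (@is_lift_eq (A `&` B) _ _ v1) => //.
  - by move=> v [Av _]; apply: ABQ; left.
  - by apply: is_lift_sub lB => v [].
  - by apply: is_lift_sub lA => v [].
exists (fun w => if pselect (A w) then gA w else gB w); first by case: pselect.
apply: is_lift_local; first exact: openU.
move=> v [Av|Bv]; first by exists gA, A; split=> // w Aw _; case: pselect.
by exists gB, B; split=> // w Bw _; case: pselect => // Aw; rewrite AB.
Qed.

Lemma lifts_exhaustion (A : nat -> set 'rV[R]_n) : (forall q, open (A q)) ->
  (forall q, connected (A q)) -> (forall q, A q `<=` A q.+1) -> (forall q, A q `<=` Q) ->
  Q `<=` \bigcup_q A q -> (forall q, lifts (A q)) -> lifts Q.
Proof.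
move=> oA cA mA AQ QA hA v0 z0 Qv0 fz0.
have AS p q : (p <= q)%N -> A p `<=` A q.
  move=> /subnK <-; elim: (q - p)%N => // k IH.
  by apply: subset_trans IH _; rewrite addSn; exact: mA.
have [q0 _ Aq0] := QA _ Qv0.
have ex q : exists g, (q0 <= q)%N -> g v0 = z0 /\ is_lift (A q) g.
  have [qq|_] := boolP (q0 <= q)%N; last by exists (fun=> z0).
  by have [g g0 lg] := hA q v0 z0 (AS _ _ qq _ Aq0) fz0; exists g.
have /choice[g hg] := ex.
have agree p q w : (q0 <= p)%N -> (p <= q)%N -> A p w -> g p w = g q w.
  move=> qp pq Aw; have [gp0 lp] := hg p qp; have [gq0 lq] := hg q (leq_trans qp pq).
  apply: (@is_lift_eq (A p) _ _ v0) => //; first exact: (AS _ _ qp).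
    by apply: is_lift_sub lq; exact: AS.
  by rewrite gp0.
have ex2 w : exists q, (q0 <= q)%N /\ (Q w -> A q w).
  have [/QA[q _ Aw]|] := pselect (Q w); last by exists q0.
  exists (maxn q0 q); split=> [|_]; first exact: leq_maxl.
  by apply: AS Aw; exact: leq_maxr.
have /choice[k hk] := ex2.
have gk q w : (q0 <= q)%N -> A q w -> g (k w) w = g q w.
  move=> qq Aw; have [qk kw] := hk w; have {}kw := kw (AQ _ _ Aw).
  by have [kq|qk'] := leqP (k w) q; [apply: agree|apply/esym; apply: agree => //; exact: ltnW].
exists (fun w => g (k w) w); first by rewrite (gk q0) //; case: (hg q0 (leqnn _)).
have oQ : open Q.
  rewrite (_ : Q = \bigcup_q A q); first by apply: bigcup_open => q _.
  by apply/seteqP; split=> // w [q _]; exact: AQ.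
apply: is_lift_local => // v Qv; have [qk kv] := hk v; have {}kv := kv Qv.
exists (g (k v)), (A (k v)); split=> //; first by case: (hg _ qk).
by move=> w Aw _; exact: gk.
Qed.

End lifts.

(** Lifting for coverings over a box. Overlaps of sub-boxes are boxes, hence connected, so that
    lifts agreeing at one point of the overlap agree on all of it. *)
Lemma lifts_box (R : realType) (n : nat) (H : 'rV[R]_n -> T) (A B : 'I_n -> R) :
  (forall l, A l < B l) -> (forall v, box A B v -> {for v, continuous H}) ->
  (forall v, box A B v -> M (H v)) -> lifts H (box A B).
Proof.
move=> AB cH HM.
have sub a b : (forall l, [/\ A l < a l, a l < b l & b l < B l]) -> box a b `<=` box A B.
  move=> ab v bv l; have [Aa _ bB] := ab l; have /andP[av vb] := bv l.
  by rewrite (lt_trans Aa av) (lt_trans vb bB).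
apply: (@box_induction _ _ A B (fun a b => lifts H (box a b))) => //.
- move=> v bv; have [e e0 he] := lifts_local cH HM bv; exists e => // a b ab abe.
  apply: he; [exact: box_open|exact: sub|].
  move=> w bw l; have /andP[aw wb] := bw l; have [va bv'] := abe l.
  by rewrite ltr_norml; apply/andP; split; lra.
- move=> a b l c d ab ac cd db h1 h2.
  have -> : box a b = box a (upd b l d) `|` box (upd a l c) b.
    apply/seteqP; split=> v; last first.
      case=> h i; have := h i; rewrite /upd; case: eqP => // ->; move=> /andP[h1' h2']; apply/andP; split; lra.
    move=> bv; have [vd|dv] := ltrP (v 0 l) d; [left|right] => i; have /andP[avi vbi] := bv i;
      rewrite /upd; case: eqP => [->|_]; rewrite ?avi ?vbi //.
      by rewrite vd andbT; have /andP[] := bv l.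
    by have /andP[_ ->] := bv l; rewrite andbT (lt_le_trans cd).
  have IE : box a (upd b l d) `&` box (upd a l c) b = box (upd a l c) (upd b l d).
    apply/seteqP; split=> v; first by move=> [h h'] i; have /andP[_ ->] := h i; have /andP[-> _] := h' i.
    move=> h; split=> i; have := h i; rewrite /upd; case: eqP => // ->; move=> /andP[h1' h2']; apply/andP; split; lra.
  apply: (lifts_union HM) => //; try exact: box_open.
  + move=> v [h|h]; apply: (sub a b) => // i; have := h i; rewrite /upd; case: eqP => // -> /andP[h1' h2']; apply/andP; split; lra.
  + by rewrite IE; exact: box_connected.
  + rewrite IE; exists (\row_i if i == l then (c + d) / 2 else (a i + b i) / 2) => i.
    rewrite mxE /upd; case: eqP => _; first by apply/andP; split; lra.
    by have [_ aib _] := ab i; apply/andP; split; lra.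
- move=> a b ab mon cov hS; apply: (lifts_exhaustion HM (A := fun q => box (a q) (b q))) => //.
  + by move=> q; exact: box_open.
  + by move=> q; exact: box_connected.
  + move=> q v bv l; have /andP[av vb] := bv l; have [h1 h2] := mon q l.
    by rewrite (le_lt_trans h1 av) (lt_le_trans vb h2).
  + by move=> q; apply: sub; exact: ab.
  + by move=> v /cov[q bq]; exists q.
Qed.


Variable Sg : set T.

(* Near y, the part over M retracts towards each point of Sg. *)
Definition contracts (R : realType) (y : T) := exists2 N : set T, nbhs y N &
  forall y', interior N y' -> Sg y' -> forall W, nbhs y' W ->
  exists (W' : set T) (D : R -> T -> T) (a0 : R),
    [/\ nbhs y' W', W' `<=` W, W' `<=` N & 0 < a0 <= 1] /\
    [/\ forall p, N p -> M p -> D 1 p = p,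
        forall p a, N p -> M p -> 0 < a <= 1 -> M (D a p),
        forall p a, W' p -> M p -> 0 < a <= 1 -> W' (D a p),
        forall p, N p -> M p -> W' (D a0 p) &
        forall p a Q, N p -> M p -> 0 < a <= 1 -> nbhs (D a p) Q ->
          exists2 P, nbhs p P & exists2 e : R, 0 < e & forall p' a',
            P p' -> N p' -> M p' -> `|a' - a| < e -> 0 < a' <= 1 -> Q (D a' p')].

(* Points of f^-1 Sg near x are joined by paths in f^-1 M. *)
Definition linked (R : realType) (x : S) := forall N, nbhs x N -> exists2 O, nbhs x O &
  forall z1 z2, O z1 -> O z2 -> Sg (f z1) -> Sg (f z2) ->
  forall O1 O2, nbhs z1 O1 -> nbhs z2 O2 -> exists g : R -> S,
    [/\ O1 (g 0), O2 (g 1) & forall s, - 1 < s < 2 ->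
      [/\ {for s, continuous g}, N (g s) & M (f (g s))]].

(* Suppose that z1 and z2 lie over the same point y' of Sg. A path over M from
   near z1 to near z2 is pushed down, its image is contracted towards y', and the
   contraction is lifted through the covering over M; this moves the path into the
   union of the disjoint sheets around the points over y'. *)
Lemma stratum_injective (R : realType) (x : S) :
  contracts R (f x) -> linked R x ->
  exists O : opens S, O x /\ injective_over f Sg O.
Proof.
move=> [N nN ctr] lnk.
have nfN : nbhs x (f @^-1` interior N) by exact: (@cts_fun _ _ f _ _ (nbhs_interior nN)).
have [O nO hO] := lnk _ nfN.
have nO' : nbhs x (interior O `&` f @^-1` interior N).
  by apply: filterI; [exact: nbhs_interior|].
exists (Opens (open_interior (interior O `&` f @^-1` interior N))); split; first exact: nO'.
move=> z1 z2 /interior_subset[/interior_subset Oz1 Nz1] /interior_subset[/interior_subset Oz2 _] Sz1 fz.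
have Sz2 : Sg (f z2) by rewrite -fz.
set y := f z1 in fz Nz1 Sz1 *.
have [W [O' [Wy O'x cov dis]]] := finf (y := y) (O := fun=> Opens openT) (fun _ _ => I).
have nW : nbhs y W by apply: open_nbhs_nbhs; split=> //; exact: oset_open.
have [W' [D [a0 [[nW' W'W W'N /andP[a00 a01]] [D1 DM DW DW0 Dc]]]]] := ctr y Nz1 Sz1 W nW.
have nz z : f z = y -> nbhs z (O' z `&` f @^-1` W').
  move=> fz'; apply: filterI.
    by apply: open_nbhs_nbhs; split; [exact: oset_open|case: (O'x z fz')].
  by apply: (@cts_fun _ _ f); rewrite fz'.
have [g [[Og0 Wg0] [Og1 Wg1] cg]] := hO z1 z2 Oz1 Oz2 Sz1 Sz2 _ _ (nz z1 erefl) (nz z2 (esym fz)).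
have a001 : 0 < a0 <= 1 by rewrite a00.
pose lam := clamp a0; have lam01 := clamp01 a001.
pose i0 : 'I_2 := ord0; pose i1 : 'I_2 := lift ord0 ord0.
(* The first coordinate runs along the path, the second is the time of the contraction: [H] is
   [f \o g] at time 0 and lies in [W'] at time 1. *)
pose H (v : 'rV[R]_2) := D (lam (v 0 i1)) (f (g (v 0 i0))).
pose B := box (fun _ : 'I_2 => - 1 : R) (fun _ => 2).
have Bg v i : B v -> [/\ {for v 0 i, continuous g}, N (f (g (v 0 i))) & M (f (g (v 0 i)))].
  by move=> /(_ i)/cg[h1 h2 h3]; split=> //; exact: interior_subset.
have cH v : B v -> {for v, continuous H}.
  move=> Bv Q nQ; have [cgv Nv Mv] := Bg v i0 Bv.
  have [P nP [e e0 hP]] := Dc _ _ _ Nv Mv (lam01 _) nQ.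
  have n1 : nbhs v ((fun w : 'rV[R]_2 => f (g (w 0 i0))) @^-1` P).
    apply: (@continuous_coord R 2 i0 v (fun r => P (f (g r)))).
    exact: (cgv _ (@cts_fun _ _ f _ _ nP)).
  have n2 := rV_nbhs v e0.
  have n3 : nbhs v B by apply: open_nbhs_nbhs; split=> //; exact: box_open.
  suff : nbhs v (H @^-1` Q) by [].
  apply: filterS (filterI n1 (filterI n2 n3)) => w [Pw [we Bw]].
  have [_ Nw Mw] := Bg w i0 Bw.
  apply: hP => //; exact: le_lt_trans (clamp_lipschitz a001 _ _) (we i1).
have HM v : B v -> M (H v) by move=> /(Bg v i0)[_ Nv Mv]; exact: DM.
pose pt (s t : R) : 'rV[R]_2 := \row_i (if i == i0 then s else t).
have pt0 s t : pt s t 0 i0 = s by rewrite mxE.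
have pt1 s t : pt s t 0 i1 = t by rewrite mxE.
have ptB s t : - 1 < s < 2 -> - 1 < t < 2 -> B (pt s t).
  by move=> hs ht i; rewrite mxE; case: ifP.
have i01 : `[0, 1]%classic `<=` [set s : R | - 1 < s < 2].
  by move=> s; rewrite /= in_itv /= => /andP[h1 h2]; apply/andP; split; lra.
have z01 : - 1 < (0 : R) < 2 by apply/andP; split; lra.
have o01 : - 1 < (1 : R) < 2 by apply/andP; split; lra.
have bnd (l : 'I_2) : - 1 < (2 : R) by lra.
have fgH : f (g 0) = H (pt 0 0).
  by rewrite /H pt0 pt1 /lam clamp0 D1 //; have [_ /interior_subset] := cg 0 z01.
have [k k00 lk] := lifts_box bnd cH HM (ptB _ _ z01 z01) fgH.
have cpt0 s : continuous (fun t => pt s t).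
  move=> t; apply: cvg_rV => i; rewrite (_ : (fun x => _) = fun x => if i == i0 then s else x).
    by rewrite mxE; case: ifP => _; [exact: cvg_cst|exact: cvg_id].
  by apply/funext => u; rewrite mxE.
have cpt1 t : continuous (fun s => pt s t).
  move=> s; apply: cvg_rV => i; rewrite (_ : (fun x => _) = fun x => if i == i0 then x else t).
    by rewrite mxE; case: ifP => _; [exact: cvg_id|exact: cvg_cst].
  by apply/funext => u; rewrite mxE.
have ck0 s t : - 1 < s < 2 -> - 1 < t < 2 -> {for t, continuous (fun t => k (pt s t))}.
  move=> hs ht; apply: (@continuous_comp _ _ _ (fun t => pt s t) k); first exact: cpt0.
  by have [] := lk _ (ptB s t hs ht).
have ck1 s t : - 1 < s < 2 -> - 1 < t < 2 -> {for s, continuous (fun s => k (pt s t))}.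
  move=> hs ht; apply: (@continuous_comp _ _ _ (fun s => pt s t) k); first exact: cpt1.
  by have [] := lk _ (ptB s t hs ht).
have fk s t : - 1 < s < 2 -> - 1 < t < 2 -> f (k (pt s t)) = D (lam t) (f (g s)).
  by move=> hs ht; have [_ ->] := lk _ (ptB s t hs ht); rewrite /H pt0 pt1.
have kg : forall s : R, `[0, 1]%classic s -> k (pt s 0) = g s.
  apply: (@lift_unique _ (`[0, 1]%classic : set R) (fun s : R => k (pt s 0)) g 0) => //.
  - exact: segment_connected.
  - by rewrite /= in_itv /= lexx ler01.
  - by move=> v /i01 hv; exact: ck1.
  - by move=> v /i01/cg[].
  - by move=> v /i01 hv; rewrite fk //; have [_ /interior_subset Nv Mv] := cg v hv; exact: DM.
  - by move=> v /i01 hv; rewrite fk // /lam clamp0 D1 //; have [_ /interior_subset Nv Mv] := cg v hv.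
have c01 := @segment_connected R 0 1.
have in0 : `[0, 1]%classic (0 : R) by rewrite /= in_itv /= lexx ler01.
have in1 : `[0, 1]%classic (1 : R) by rewrite /= in_itv /= lexx ler01.
(* The contraction preserves [W'], so a vertical edge that starts near [z] stays over [W] and
   remains in the sheet of [z]. *)
have side (s : R) z : `[0, 1]%classic s -> f z = y -> O' z (g s) -> W' (f (g s)) ->
    forall t, `[0, 1]%classic t -> O' z (k (pt s t)).
  move=> s01 fz' Oz Wz; have hs := i01 _ s01; have [_ Ngs Mgs] := cg s hs.
  apply: (@stays_in_sheet _ (`[0, 1]%classic : set R) (fun t => k (pt s t)) W O' y z 0) => //.
  - by move=> t /i01; exact: ck0.
  - by move=> t /i01 ht; rewrite fk //; apply: W'W; exact: DW.
  - by rewrite kg.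
have l0 := side 0 z1 in0 erefl Og0 Wg0 1 in1.
have l1 := side 1 z2 in1 (esym fz) Og1 Wg1 1 in1.
(* The far corner of the square is in the sheet of [z2] by its vertical edge, and in that of [z1]
   because the top edge lies over [W]; the sheets are disjoint. *)
apply: (dis z1 z2 (k (pt 1 1))) => //.
apply: (@stays_in_sheet _ (`[0, 1]%classic : set R) (fun s => k (pt s 1)) W O' y z1 0) => //.
- by move=> s /i01 hs; exact: ck1.
- move=> s /i01 hs; rewrite fk // /lam (clamp1 a001); apply: W'W; have [_ /interior_subset Ns Ms] := cg s hs; exact: DW0.
Qed.

End coverings.

Lemma sub_nbhs (T : topologicalType) (A : set T) (z : A) (V : set A) : nbhs z V ->
  exists2 O : set T, open O /\ O (val z) & forall w : A, O (val w) -> V w.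
Proof.
rewrite nbhsE => -[V' [oV' V'z] V'V]; have [O oO VO] := (sub_openP _).1 oV'.
by exists O => [|w /VO/V'V //]; split=> //; apply/VO.
Qed.

Lemma sub_nbhs_image (T : topologicalType) (A : set T) (z : A) (V : set A) :
  nbhs (val z) A -> nbhs z V -> nbhs (val z) (val @` V).
Proof.
move=> nA /sub_nbhs[O [oO Oz] OV].
apply: filterS (filterI nA (open_nbhs_nbhs (conj oO Oz))) => x [Ax Ox].
by have [w ew] := sub_point Ax; exists w => //; apply: OV; rewrite ew.
Qed.

Lemma prod_nbhs (S T : topologicalType) (x : S) (y : T) (V : set (S * T)) : nbhs (x, y) V ->
  exists A B, [/\ nbhs x A, nbhs y B & forall a b, A a -> B b -> V (a, b)].
Proof. by case=> -[A B] [/= nA nB] AB; exists A, B; split=> // a b Aa Bb; apply: AB. Qed.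

Lemma contraction_near (R : realFieldType) (u w w' a a' e K : R) :
  0 < K -> `|w - u| <= K -> `|w' - w| < e / 2 -> `|a' - a| * K <= e / 2 -> 0 < a' <= 1 ->
  `|(u + a' * (w' - u)) - (u + a * (w - u))| < e.
Proof.
move=> K0 wu ww aa /andP[a0 a1].
have -> : (u + a' * (w' - u)) - (u + a * (w - u)) = a' * (w' - w) + (a' - a) * (w - u) by ring.
apply: (le_lt_trans (ler_normD _ _)); rewrite !normrM (gtr0_norm a0).
have -> : e = e / 2 + e / 2 by field.
apply: ltr_leD.
  by apply: le_lt_trans ww; rewrite ler_piMl.
by apply: le_trans aa; rewrite ler_wpM2l.
Qed.

(** * Contractions and paths in cone charts *)

Section cone_chart.
Variables (R : realType) (m : int) (A : topologicalType) (F : filtration A) (j : nat) (y : A).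
Variables (N0 : set A) (L : topologicalType) (GL : filtration L).
Hypothesis cL : compact [set: L].
Hypothesis chart : distinguished_chart R m F j y N0 GL.
Variable i0 : nat.
Hypothesis i0m : i0%:Z <= m - j%:Z - 1.

Let M : set A := level F (j%:Z + i0%:Z + 1).
Let Sg : set A := level F j%:Z.

Lemma cone_chart_inside (phi : N0 -> 'rV[R]_j * cone R L) z :
  (forall z, F j%:Z (val z) <-> (phi z).2 = None) ->
  (forall (i : nat) z, i%:Z <= m - j%:Z - 1 ->
          (F (j%:Z + i%:Z + 1) (val z) <-> subcone (GL i%:Z) (phi z).2)) ->
  M (val z) -> exists l t, [/\ (phi z).2 = Some (l, t), GL i0%:Z l &
     forall i, i0 = i.+1 -> ~ GL i%:Z l].
Proof.
move=> phiF phiG [Fz nFz]; have := (phiG i0 z i0m).1 Fz.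
case e : (phi z).2 => [[l t]|] /= h; last first.
  case: nFz; apply: (@fil_mono _ F j%:Z); first lia.
  by apply/phiF.
exists l, t; split=> // i ei Gl; apply: nFz.
have -> : j%:Z + i0%:Z + 1 - 1 = j%:Z + i%:Z + 1 by rewrite ei; lia.
by apply/phiG; [lia|rewrite e].
Qed.

Lemma cone_chart_level (phi : N0 -> 'rV[R]_j * cone R L) z l t :
  (forall z, F j%:Z (val z) <-> (phi z).2 = None) ->
  (forall (i : nat) z, i%:Z <= m - j%:Z - 1 ->
          (F (j%:Z + i%:Z + 1) (val z) <-> subcone (GL i%:Z) (phi z).2)) ->
  (phi z).2 = Some (l, t) -> GL i0%:Z l -> (forall i, i0 = i.+1 -> ~ GL i%:Z l) -> M (val z).
Proof.
move=> phiF phiG e Gl nGl; split; first by apply/phiG => //; rewrite e.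
case ei : i0 => [|i].
  by rewrite (_ : _ - 1 = j%:Z); [move/phiF; rewrite e|lia].
have -> : j%:Z + i.+1%:Z + 1 - 1 = j%:Z + i%:Z + 1 by lia.
move/phiG; rewrite e => h; apply: (nGl i ei); apply: h; lia.
Qed.

(** [z0] provides a point [l] of the link whose ray lies in [M]. Moving along [R^j] at a small fixed
    height on this ray joins nearby points of the stratum through [M]. *)
Lemma cone_linked (z0 : A) : N0 z0 -> M z0 ->
  forall N, nbhs y N -> exists2 O, nbhs y O &
  forall z1 z2, O z1 -> O z2 -> Sg z1 -> Sg z2 ->
  forall O1 O2, nbhs z1 O1 -> nbhs z2 O2 -> exists g : R -> A,
    [/\ O1 (g 0), O2 (g 1) & forall s, - 1 < s < 2 ->
      [/\ {for s, continuous g}, N (g s) & M (g s)]].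
Proof.
have [nN0 [phi [[cphi [psi [cpsi phiK psiK]]] phiF phiG]]] := chart.
move=> N0z0; have [z0' <-] := sub_point N0z0.
move=> /(cone_chart_inside phiF phiG)[l [t0 [_ Gl nGl]]] N nN.
have [y' ey'] := sub_point (nbhs_singleton nN0).
have cval : continuous (fun w => val (psi w) : A).
  by move=> w; apply: continuous_comp; [exact: cpsi|exact: continuous_val].
have near_psi z O1 : nbhs (val z) O1 -> (phi z).2 = None ->
    exists2 d : R, 0 < d & forall u c, cube (phi z).1 d u -> cone_height c < d -> O1 (val (psi (u, c))).
  move=> nO1 phiz.
  have : nbhs ((phi z).1, None : cone R L) ((fun w => val (psi w) : A) @^-1` O1).
    by apply: cval; rewrite -phiz -surjective_pairing phiK.
  move=> /prod_nbhs[P [Q [/cube_nbhs[d1 d10 d1P] /(cone_vertex_near cL)[d2 d20 d2Q] PQ]]].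
  exists (Num.min d1 d2) => [|u c cu]; first by rewrite lt_min d10.
  rewrite lt_min => /andP[_ c2]; apply: PQ; last exact: d2Q.
  by apply: d1P; apply: cube_le cu; rewrite ge_min lexx.
have fF z : Sg (val z) -> (phi z).2 = None by move=> [Fz _]; apply/phiF.
(* Off the vertices no point of [Sg] is near [y], and the claim is vacuous. *)
have [phiy|phiy] := pselect ((phi y').2 = None); last first.
  have nS : nbhs y [set z | ~ F j%:Z z].
    apply: open_nbhs_nbhs; split; first by apply: closed_openC; exact: fil_closed.
    by rewrite /= -ey' => /phiF.
  by exists [set z | ~ F j%:Z z] => // z1 z2 h1 _ [].
have nN' : nbhs (val y') N by rewrite ey'.
have [d d0 dN] := near_psi y' N nN' phiy.
(* The segment is prolonged to parameters in []-1, 2[], so it stays within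
   [d / 5 + 2 * (2 * d / 5) = d] of the centre. *)
exists (val @` [set z : N0 | cube (phi y').1 (d / 5) (phi z).1]).
  rewrite -ey'; apply: sub_nbhs_image; first by rewrite ey'.
  have c1 : continuous (fun z => (phi z).1).
    by move=> z; apply: continuous_comp; [exact: cphi|exact: cvg_fst].
  apply: c1; apply: open_nbhs_nbhs; split; first exact: box_open.
  by apply: cube_center; lra.
move=> _ _ [z1 /cubeP c1 <-] [z2 /cubeP c2 <-] /fF f1 /fF f2 O1 O2 nO1 nO2.
have [d1 d10 dO1] := near_psi _ _ nO1 f1; have [d2 d20 dO2] := near_psi _ _ nO2 f2.
have [t [td td1 td2 t01]] : exists t : R, [/\ t < d, t < d1, t < d2 & 0 < t < 1].
  exists (Num.min (Num.min (d / 2) (d1 / 2)) (Num.min (d2 / 2) (1 / 2))).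
  rewrite !lt_min !gt_min; split; first by apply/orP; left; apply/orP; left; lra.
  - by apply/orP; left; apply/orP; right; lra.
  - by apply/orP; right; apply/orP; left; lra.
  - by apply/andP; split; [apply/andP; split; apply/andP; split; lra|apply/orP; right; apply/orP; right; lra].
pose g (s : R) := val (psi ((phi z1).1 + s *: ((phi z2).1 - (phi z1).1), cone_point l t)) : A.
exists g; split.
- by apply: dO1; [rewrite scale0r addr0; exact: cube_center|rewrite cone_height_point].
- apply: dO2; last by rewrite cone_height_point.
  by rewrite scale1r addrC subrK; exact: cube_center.
- move=> s /andP[s1 s2]; split.
  + apply: (@continuous_comp _ _ _ (fun s : R => ((phi z1).1 + s *: ((phi z2).1 - (phi z1).1), cone_point l t)) (fun w => val (psi w) : A)); last exact: cval.
    apply: (@continuous_comp _ _ _ (fun s : R => (phi z1).1 + s *: ((phi z2).1 - (phi z1).1)) (fun u => (u, cone_point l t))).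
      exact: segment_rV_continuous.
    exact: continuous_pairl.
  + apply: dN; last by rewrite cone_height_point.
    apply/cubeP => k; rewrite !mxE; have := c1 k; have := c2 k.
    by rewrite !ltr_norml => /andP[a1 a2] /andP[b1 b2]; apply/andP; split; nra.
  + have [t' [_ et']] := cone_pointE l t01.
    by apply: (cone_chart_level phiF phiG (l := l) (t := t')) => //; rewrite psiK et'.
Qed.

Hypothesis lowest : forall i, i0 = i.+1 -> GL i%:Z = set0.

Lemma cone_adherent l : GL i0%:Z l -> F j%:Z y -> forall N, nbhs y N -> exists p, N p /\ M p.
Proof.
have [nN0 [phi [[cphi [psi [cpsi phiK psiK]]] phiF phiG]]] := chart.
move=> Gl Fy N nN; have [y0 ey0] := sub_point (nbhs_singleton nN0).
have phi0 : (phi y0).2 = None by apply/phiF; rewrite ey0.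
have : nbhs ((phi y0).1, None : cone R L) ((fun w => val (psi w) : A) @^-1` N).
  have cval : continuous (fun w => val (psi w) : A).
    by move=> w; apply: continuous_comp; [exact: cpsi|exact: continuous_val].
  by apply: cval; rewrite -phi0 -surjective_pairing phiK ey0.
move=> /prod_nbhs[P [Q [nP /(cone_vertex_near cL)[d d0 dQ] PQ]]].
pose t := Num.min (d / 2) (1 / 2).
have t01 : 0 < t < 1 by rewrite lt_min gt_min; apply/andP; split; [apply/andP; split; lra|apply/orP; right; lra].
exists (val (psi ((phi y0).1, cone_point l t))); split.
  apply: (PQ _ _ (nbhs_singleton nP)); apply: dQ; rewrite cone_height_point // gt_min.
  by apply/orP; left; lra.
have [t' [_ et']] := cone_pointE l t01.
apply: (cone_chart_level phiF phiG (l := l) (t := t')) => //; first by rewrite psiK et'.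
by move=> i /lowest ->.
Qed.

(** Both factors of the chart are shrunk towards the vertex above [u']. Scaling by a positive factor
    keeps the link coordinate, and with it the stratum. *)
Lemma cone_contracts : contracts M Sg R y.
Proof.
have [nN0 [phi [[cphi [psi [cpsi phiK psiK]]] phiF phiG]]] := chart.
have [y0 ey0] := sub_point (nbhs_singleton nN0).
have c1 : continuous (fun z => (phi z).1).
  by move=> z; apply: continuous_comp; [exact: cphi|exact: cvg_fst].
have c2 : continuous (fun z => (phi z).2).
  by move=> z; apply: continuous_comp; [exact: cphi|exact: cvg_snd].
have cval : continuous (fun w => val (psi w) : A).
  by move=> w; apply: continuous_comp; [exact: cpsi|exact: continuous_val].
pose V := [set z : N0 | cube (phi y0).1 1 (phi z).1].
exists (val @` V).
  rewrite -ey0; apply: sub_nbhs_image; first by rewrite ey0.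
  apply: c1; apply: open_nbhs_nbhs; split; first exact: box_open.
  by apply: cube_center; lra.
move=> y' iNy' Sy' W nW.
have nN0' : nbhs y' N0 by apply: filterS iNy' => _ [z _ <-]; exact: set_valP.
have [y1 ey1] := sub_point (nbhs_singleton nN0').
have phi1 : (phi y1).2 = None by apply/phiF; rewrite ey1; case: Sy'.
set u' := (phi y1).1.
have Vy1 : V y1.
  by have [z Vz ez] := interior_subset iNy'; have <- : z = y1 by apply: val_inj; rewrite ez ey1.
have : nbhs (u', None : cone R L) ((fun w => val (psi w) : A) @^-1` (W `&` val @` V)).
  apply: cval; rewrite /u' -phi1 -surjective_pairing phiK ey1; exact: filterI.
move=> /prod_nbhs[P [Q [/cube_nbhs[d1 d10 d1P] /(cone_vertex_near cL)[d2 d20 d2Q] PQ]]].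
pose d := Num.min 1 (Num.min d1 d2).
have d0 : 0 < d by rewrite !lt_min ltr01 d10.
have d1' : d <= 1 by rewrite ge_min lexx.
pose W'0 := [set z : N0 | cube u' d (phi z).1 /\ cone_height (phi z).2 < d].
pose D (a : R) (p : A) := if pselect (N0 p) is left h then
  let z : N0 := exist _ p (mem_set h) in
  val (psi (u' + a *: ((phi z).1 - u'), cone_scale a (phi z).2)) else p.
have DE a (z : N0) : D a (val z) = val (psi (u' + a *: ((phi z).1 - u'), cone_scale a (phi z).2)).
  rewrite /D; case: pselect => [h|]; last by case; exact: set_valP.
  by have -> : exist _ (val z) (mem_set h) = z by apply: val_inj.
have u1 : forall l, `|u' 0 l - (phi y0).1 0 l| < 1 by apply/cubeP; exact: Vy1.
have near_u z : V z -> forall l, `|(phi z).1 0 l - u' 0 l| <= 2.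
  move=> /cubeP h l; have := h l; have := u1 l; rewrite !ltr_norml ler_norml.
  by move=> /andP[? ?] /andP[? ?]; apply/andP; split; lra.
(* On [V] the [R^j] coordinates are within 2 of [u'] and heights are below 1, so the factor [d / 4]
   brings [V] into [W'0]. *)
exists (val @` W'0), D, (d / 4); split.
  split.
  - rewrite -ey1; apply: sub_nbhs_image; first by rewrite ey1.
    apply: filterI.
      by apply: c1; apply: open_nbhs_nbhs; split; [exact: box_open|exact: cube_center].
    apply: (c2 y1 (fun c => cone_height c < d)); apply: open_nbhs_nbhs; split.
      exact: (cone_height_open (@open_lt _ d)).
    by rewrite phi1.
  - move=> _ [z [cz hz] <-]; rewrite -(phiK z) [phi z]surjective_pairing.
    have [] // := PQ (phi z).1 (phi z).2.
      by apply: d1P; apply: cube_le cz; rewrite !ge_min lexx orbT.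
    by apply: d2Q; apply: lt_le_trans hz _; rewrite !ge_min lexx !orbT.
  - move=> _ [z [cz hz] <-]; rewrite -{1}(phiK z) [phi z]surjective_pairing.
    have [] // := PQ (phi z).1 (phi z).2.
      by apply: d1P; apply: cube_le cz; rewrite !ge_min lexx orbT.
    by apply: d2Q; apply: lt_le_trans hz _; rewrite !ge_min lexx !orbT.
  - by apply/andP; split; lra.
split.
- move=> _ [z Vz <-] _; rewrite DE scale1r cone_scale1 addrC subrK.
  by rewrite -surjective_pairing phiK.
- move=> _ a [z Vz <-] Mz a01; rewrite DE.
  have [l [t [ez Gl nGl]]] := cone_chart_inside phiF phiG Mz.
  have at01 : 0 < a * val t < 1.
    have /andP[t0 t1] := cone_heightP t; case/andP: a01 => a0 a1.
    by rewrite mulr_gt0 //= (le_lt_trans _ t1) // ler_piMl // ltW.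
  have [t' [_ et']] := cone_pointE l at01.
  by apply: (cone_chart_level phiF phiG (l := l) (t := t')) => //; rewrite psiK ez /= et'.
- move=> _ a [z [/cubeP cz hz] <-] Mz a01; rewrite DE; set w := (_, _); exists (psi w) => //.
  split; rewrite psiK /w /=.
    apply/cubeP => l; rewrite !mxE addrAC subrr add0r normrM; case/andP: a01 => a0 a1.
    by apply: le_lt_trans (cz l); rewrite ler_piMl // gtr0_norm.
  rewrite cone_scale_height //; apply: le_lt_trans hz; case/andP: a01 => a0 a1.
  by rewrite ler_piMl //; case/andP: (cone_height_bound (phi z).2).
- move=> _ [z Vz <-] Mz; rewrite DE; set w := (_, _); exists (psi w) => //.
  have d4 : 0 < d / 4 <= 1 by apply/andP; split; lra.
  split; rewrite psiK /w /=.
    apply/cubeP => l; rewrite !mxE addrAC subrr add0r normrM gtr0_norm; last lra.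
    have := near_u z Vz l; nra.
  rewrite cone_scale_height //; have /andP[h0 h1] := cone_height_bound (phi z).2; nra.
- move=> _ a B [z Vz <-] Mz a01; rewrite DE => nB.
  have [l [t [ez Gl nGl]]] := cone_chart_inside phiF phiG Mz.
  have : nbhs (u' + a *: ((phi z).1 - u'), cone_scale a (phi z).2) ((fun w => val (psi w) : A) @^-1` B).
    exact: (cval _ _ nB).
  move=> /prod_nbhs[P1 [Q1 [/cube_nbhs[e1 e10 e1P] nQ1 PQ1]]].
  have ne : (phi z).2 <> None by rewrite ez.
  have [B1 nB1 [e2 e20 hB1]] := cone_scale_near a01 ne nQ1.
  have nV1 : nbhs z [set z' : N0 | cube (phi z).1 (e1 / 2) (phi z').1 /\ B1 (phi z').2].
    apply: filterI; last exact: (c2 z _ nB1).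
    apply: c1; apply: open_nbhs_nbhs; split; first exact: box_open.
    by apply: cube_center; lra.
  have [O [oO Oz] OV] := sub_nbhs nV1.
  exists O; first by apply: open_nbhs_nbhs.
  exists (Num.min e2 (e1 / 4)); first by rewrite lt_min e20; lra.
  move=> p' a' Op' [z' Vz' ez'] _ aa a'01; move: Op'; rewrite -ez' DE => /OV[/cubeP cz' Bz'].
  move: aa; rewrite lt_min => /andP[ae2 ae1].
  apply: PQ1; last exact: hB1.
  apply: e1P; apply/cubeP => k; rewrite !mxE.
  by apply: (@contraction_near _ _ _ _ _ _ _ 2) => //; [exact: near_u|lra].
Qed.

End cone_chart.

(** * Contractions and paths in flat charts *)

Section flat_chart_paths.
Variables (R : realType) (n j : nat) (T : topologicalType) (S : set T) (x : T).
Variables (e : 'rV[R]_n -> T) (c : 'rV[R]_n) (d : R).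
Hypothesis chart : flat_chart j S x e c d.
Variables (Sg M : set T).
Hypothesis SgE : forall v, cube c d v -> Sg (e v) -> S (e v).
Hypothesis ME : forall v, cube c d v -> (M (e v) <-> ~ S (e v)).

Let notS (v : 'rV[R]_n) (l : 'I_n) : cube c d v -> (j <= l)%N -> v 0 l != 0 -> M (e v).
Proof.
have [_ _ _ _ Se] := chart.
by move=> cv jl vl; apply/ME => // /(Se v cv) h; rewrite h // eqxx in vl.
Qed.

(** A segment in the stratum is pushed off it by a small amount [t] in the normal coordinate
    [l0]. *)
Lemma flat_linked : (j < n)%N -> forall N, nbhs x N -> exists2 O, nbhs x O &
  forall z1 z2, O z1 -> O z2 -> Sg z1 -> Sg z2 ->
  forall O1 O2, nbhs z1 O1 -> nbhs z2 O2 -> exists g : R -> T,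
    [/\ O1 (g 0), O2 (g 1) & forall s, - 1 < s < 2 ->
      [/\ {for s, continuous g}, N (g s) & M (g s)]].
Proof.
have [[d0 ec] ce ie oe Se] := chart.
move=> jn N nN; have [d1 d10 d1N] : exists2 d1 : R, 0 < d1 & cube c d1 `<=` e @^-1` N.
  by apply: cube_nbhs; apply: ce; rewrite ec.
pose r := Num.min d d1.
have r0 : 0 < r by rewrite lt_min d0.
have rd : r <= d by rewrite ge_min lexx.
have rd1 : r <= d1 by rewrite ge_min lexx orbT.
(* With parameters in []-1, 2[] the segment stays within [r / 2] of [c], and the push adds less than
   [r / 2]. *)
exists (e @` cube c (r / 10)).
  apply: open_nbhs_nbhs; split; last by exists c => //; apply: cube_center; lra.
  by apply: oe; [exact: box_open|apply: cube_le; lra].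
move=> _ _ [v1 cv1 <-] [v2 cv2 <-] S1 S2 O1 O2 nO1 nO2.
have cd v : cube c (r / 10) v -> cube c d v by apply: cube_le; lra.
have v10 := (Se _ (cd _ cv1)).1 (SgE (cd _ cv1) S1).
have v20 := (Se _ (cd _ cv2)).1 (SgE (cd _ cv2) S2).
have [e1 e10 eO1] := cube_nbhs (ce v1 _ nO1); have [e2 e20 eO2] := cube_nbhs (ce v2 _ nO2).
have [t [tr te1 te2 t0]] : exists t : R, [/\ t < r / 2, t < e1, t < e2 & 0 < t].
  exists (Num.min (r / 4) (Num.min (e1 / 2) (e2 / 2))).
  rewrite !lt_min !gt_min; split; first by apply/orP; left; lra.
  - by apply/orP; right; apply/orP; left; lra.
  - by apply/orP; right; apply/orP; right; lra.
  - by apply/andP; split; [lra|apply/andP; split; lra].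
pose l0 := Ordinal jn; pose w : 'rV[R]_n := \row_l (if l == l0 then t else 0).
have wb l : 0 <= w 0 l <= t by rewrite mxE; case: ifP => _; apply/andP; split; lra.
pose a := v1 + w; pose b := v2 + w.
exists (fun s => e (a + s *: (b - a))); split.
- apply: eO1; apply/cubeP => l; rewrite scale0r addr0 !mxE addrAC subrr add0r.
  have := wb l; rewrite mxE => /andP[h1 h2]; rewrite ger0_norm //; exact: le_lt_trans te1.
- apply: eO2; apply/cubeP => l; rewrite scale1r [a + _]addrC subrK !mxE addrAC subrr add0r.
  have := wb l; rewrite mxE => /andP[h1 h2]; rewrite ger0_norm //; exact: le_lt_trans te2.
move=> s /andP[s1 s2].
have cr : cube c r (a + s *: (b - a)).
  apply/cubeP => l; have := (cubeP _ _ _).1 cv1 l; have := (cubeP _ _ _).1 cv2 l.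
  have := wb l; rewrite !mxE !ltr_norml => /andP[w1 w2] /andP[? ?] /andP[? ?].
  by apply/andP; split; nra.
split.
- apply: (@continuous_comp _ _ _ (fun s : R => a + s *: (b - a)) e); last exact: ce.
  exact: segment_rV_continuous.
- by apply: d1N; exact: cube_le cr.
- apply: (@notS _ l0) => //; first exact: cube_le cr.
  by rewrite !mxE v10 // v20 // eqxx !add0r subrr mulr0 addr0 gt_eqF.
Qed.

(** A linear contraction towards a point [u] of the stratum multiplies the normal coordinates by
    [a > 0], so it never reaches the stratum. *)
Lemma flat_contracts : contracts M Sg R x.
Proof.
have [[d0 ec] ce ie oe Se] := chart.
exists (e @` cube c d).
  apply: open_nbhs_nbhs; split; last by exists c => //; exact: cube_center.
  by apply: oe => //; exact: box_open.
move=> y' iNy' Sy' W nW; have [u cu eu] := interior_subset iNy'.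
move: Sy' iNy' nW; rewrite -{}eu => Sy' iNy' nW {y'}.
have u0 : forall l : 'I_n, (j <= l)%N -> u 0 l = 0 by apply/Se => //; exact: SgE.
have [r r0 rWN] := cube_nbhs (ce u _ (filterI nW iNy')).
have rN : cube u r `<=` cube c d.
  by move=> v /rWN[_ [v' cv' /ie <-]].
pose D (a : R) (p : T) := if pselect (exists2 v, cube c d v & e v = p) is left h then
  e (u + a *: (s2val (cid2 h) - u)) else p.
have DE a v : cube c d v -> D a (e v) = e (u + a *: (v - u)).
  move=> cv; rewrite /D; case: pselect => [h|]; last by case; exists v.
  by case: (cid2 h) => v' _ /= /ie ->.
have cub := (cubeP c d u).1 cu.
have conv a v : 0 < a <= 1 -> cube c d v -> cube c d (u + a *: (v - u)).
  move=> /andP[a0 a1] cv l; have := cv l; have := cu l; rewrite !mxE => /andP[h1 h2] /andP[h3 h4].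
  by rewrite segment_gt ?segment_lt // (ltW a0).
(* Points of the cube are within [2 * d] of [u]; this factor brings them within [r / 2]. *)
pose a0 := Num.min 1 (r / (4 * d)).
have a00 : 0 < a0 by rewrite lt_min ltr01 divr_gt0 // mulr_gt0.
have a0r : a0 * (2 * d) < r.
  apply: (@le_lt_trans _ _ (r / (4 * d) * (2 * d))).
    by apply: ler_wpM2r; [lra|rewrite ge_min lexx orbT].
  have -> : r / (4 * d) * (2 * d) = r / 2 by field; lra.
  lra.
have near_u v : cube c d v -> forall l, `|v 0 l - u 0 l| <= 2 * d.
  move=> /cubeP h l; have := h l; have := cub l; rewrite !ltr_norml ler_norml.
  by move=> /andP[? ?] /andP[? ?]; apply/andP; split; lra.
exists (e @` cube u r), D, a0; split.
  split.
  - apply: open_nbhs_nbhs; split; last by exists u => //; exact: cube_center.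
    by apply: oe => //; exact: box_open.
  - by move=> _ [v /rWN[Wv _] <-].
  - by move=> _ [v /rN cv <-]; exists v.
  - by rewrite a00 ge_min lexx.
split.
- by move=> _ [v cv <-] _; rewrite DE // scale1r addrC subrK.
- move=> _ a [v cv <-] /(ME cv) nSv a01; rewrite DE //.
  apply/ME; first exact: conv.
  move=> /Se h; apply: nSv; apply/Se => // l jl; have := h (conv _ _ a01 cv) l jl.
  rewrite !mxE u0 // add0r subr0 => /eqP; rewrite mulf_eq0 => /orP[/eqP a0'|/eqP //].
  by case/andP: a01; rewrite a0' ltxx.
- move=> _ a [v cv <-] _ /andP[a1 a2]; rewrite DE; last exact: rN.
  exists (u + a *: (v - u)) => //; apply/cubeP => l; rewrite !mxE addrAC subrr add0r normrM gtr0_norm //.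
  by apply: le_lt_trans ((cubeP _ _ _).1 cv l); rewrite ler_piMl.
- move=> _ [v cv <-] _; rewrite DE //; exists (u + a0 *: (v - u)) => //.
  apply/cubeP => l; rewrite !mxE addrAC subrr add0r normrM gtr0_norm //.
  by apply: le_lt_trans a0r; rewrite ler_pM2l //; exact: near_u.
- move=> _ a B [v cv <-] _ a01; rewrite DE // => nB.
  have [r1 r10 r1B] := cube_nbhs (ce _ _ nB).
  exists (e @` (cube v (r1 / 2) `&` cube c d)).
    apply: open_nbhs_nbhs; split.
      by apply: oe => [|v' []//]; apply: openI; exact: box_open.
    by exists v => //; split=> //; apply: cube_center; lra.
  exists (r1 / (4 * d)); first by rewrite divr_gt0 // mulr_gt0.
  move=> p' a' [v' [cv' cdv'] <-] _ _ aa a'01; rewrite DE //; apply: r1B; apply/cubeP => l; rewrite !mxE.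
  apply: (@contraction_near _ _ _ _ _ _ _ (2 * d)) => //; [lra|exact: near_u|exact: (cubeP _ _ _).1 cv' l|].
  apply: (@le_trans _ _ (r1 / (4 * d) * (2 * d))); first by apply: ler_wpM2r; [lra|exact: ltW].
  by have -> : r1 / (4 * d) * (2 * d) = r1 / 2 by field; lra.
Qed.

End flat_chart_paths.

(** * The covering over each stratum *)

Lemma stratified_cases (R : realType) (m : int) (T : topologicalType) (F : filtration T) :
  stratified R m F ->
  [/\ forall i, i < 0 -> F i = set0, F m = setT & [\/ [set: T] = set0,
      m = 0 /\ forall A : set T, open A |
      0 < m /\ forall (j : nat) (x : T), j%:Z <= m -> level F j%:Z x ->
      exists (N : set T) (L : topologicalType) (G : filtration L),
        [/\ compact [set: L], stratified R (m - j%:Z - 1) G &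
            distinguished_chart R m F j x N G]]].
Proof.
case=> {m T F}[m T F m0 T0|T F cT oT F0 FT|m T F m0 _ _ F0 FT ch].
- have e (x : T) : False by have : [set: T] x by []; rewrite T0.
  split; [|by apply/seteqP; split=> x; case: (e x)|by apply: Or31].
  by move=> i _; apply/seteqP; split=> x; case: (e x).
- by split=> //; [exact: FT|apply: Or32].
- by split=> //; [exact: FT|apply: Or33].
Qed.

Lemma stratified_nonneg (R : realType) (m : int) (T : topologicalType) (F : filtration T) (x : T) :
  stratified R m F -> 0 <= m.
Proof.
by move=> /stratified_cases[_ _ [T0|[-> //]|[/ltW //]]]; have : [set: T] x by []; rewrite T0.
Qed.

Lemma hausdorff_sub (T : topologicalType) (A : set T) : hausdorff_space T -> hausdorff_space A.
Proof.
rewrite !open_hausdorff => h x y xy.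
have [|[P Q] /= [Px Qy] [oP oQ PQ]] := h (val x) (val y); first by apply: contra xy => /eqP/val_inj ->.
have op (U : set T) : open U -> open (val @^-1` U : set A) by move/continuousP: (@continuous_val T A); apply.
exists ((val @^-1` P : set A), (val @^-1` Q : set A)) => /=.
  by split; apply/mem_set; exact: set_mem.
split; [exact: op|exact: op|apply/eqP/seteqP; split=> // z [Pz Qz]].
by have : ((P : set T) `&` Q) (val z) by []; rewrite (eqP PQ).
Qed.

Lemma restrict_over_open (S T : topologicalType) (f : continuousType S T) (A : set T) :
  (forall U, open U -> open (f @` U)) -> forall U, open U -> open (@restrict_over _ _ f A @` U).
Proof.
move=> of_ U /sub_openP[O oO UO]; apply/sub_openP; exists (f @` O); first exact: of_.
move=> y; split=> [[z Uz <-]|[x Ox fx]]; first by exists (val z) => //; apply/UO.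
have Ax : (f @^-1` A) x by rewrite /preimage /= fx; exact: set_valP.
have [z ez] := sub_point Ax; exists z; first by apply/UO; rewrite ez.
by apply: val_inj; rewrite /= ez.
Qed.

Section strata.
Variables (R : realType) (n : nat) (X Y : topologicalType) (G : filtration Y)
  (f : branched_covering R X Y).
Hypotheses (hGn : G n%:Z = setT) (hGn1 : G (n%:Z - 1) = G (n%:Z - 2)).
Hypothesis hf : locally_flat_covering n G f.

Let A := branch_locus f.
Let F := pullback_filtration (@inclusion Y A) G.
Let F' := pullback_filtration (f \o @inclusion X (f @^-1` A)) G.

Lemma locusE : A = G (n%:Z - 2). Proof. exact: (lfc_locus hf). Qed.

Lemma locus_stratified : stratified R (n%:Z - 2) F.
Proof. by have [] := lfc_flat hf. Qed.

Lemma preimage_stratified : stratified R (n%:Z - 2) F'.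
Proof. by have [] := lfc_flat_preimage hf. Qed.

(** The stratification of the locus controls the levels up to [n - 2]; the only negative level
    beyond that is [n - 1], handled by [hGn1]. *)
Lemma filtration_low i : i < 0 -> G i = set0.
Proof.
move=> i0; have low k : k < 0 -> k <= n%:Z - 2 -> G k = set0.
  move=> k0 kn; apply/seteqP; split=> // y Gy.
  have Ay : A y by rewrite locusE; exact: fil_mono Gy.
  have [r er] := sub_point Ay; have [F0 _ _] := stratified_cases locus_stratified.
  have : F k r by rewrite /F /= /preimage /= [inclusion _]er.
  by rewrite F0.
have [ik|ik] := lerP i (n%:Z - 2); first exact: low.
have -> : i = n%:Z - 1 by lia.
by rewrite hGn1; apply: low; lia.
Qed.

Lemma level_cases i y : level G i y -> i = n%:Z \/ exists2 j : nat, i = j%:Z & (j + 2 <= n)%N.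
Proof.
move=> [Gi nGi]; have [i0|i0] := ltrP i 0; first by rewrite filtration_low in Gi.
have [ni|ni] := lerP (n%:Z + 1) i.
  by case: nGi; apply: (@fil_mono _ G n%:Z); [lia|rewrite hGn].
have [->|ni'] := eqVneq i n%:Z; [by left|right].
have [ei|ei] := eqVneq i (n%:Z - 1).
  by case: nGi; move: Gi; rewrite ei hGn1 (_ : n%:Z - 1 - 1 = n%:Z - 2) //; lia.
by exists `|i|%N; lia.
Qed.

Lemma top_level y : level G n%:Z y <-> ~ A y.
Proof. by rewrite locusE -hGn1 /level; split=> [[]|h] //; rewrite hGn. Qed.

Lemma covering_finite_separated : finite_separated f.
Proof.
have [cX hX _] := lfc_domain hf; have [_ hY _] := lfc_codomain hf.
by apply: finite_separated_compact => // y; exact: bc_finite.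
Qed.

Lemma top_injective : locally_injective_over f (level G n%:Z).
Proof.
move=> x /top_level nA; have : exists V, [/\ open V, V (f x) & evenly_covered f V].
  by apply: contrapT => h; apply: nA.
move=> [V [oV Vx [d [W [oW dW fV hW]]]]].
have : (f @^-1` V) x by [].
rewrite fV => -[i _ Wx]; exists (Opens (oW i)); split=> // z z' Wz Wz' _ fz.
have [h [_ [g [_ hK _]]] hE] := hW i.
have [u eu] := sub_point Wz; have [u' eu'] := sub_point Wz'.
rewrite -eu -eu'; congr val; rewrite -(hK u) -(hK u'); congr g.
by apply: val_inj; rewrite !hE eu eu'.
Qed.

Lemma locus_flat_chart (j : nat) y : (j <= n)%N -> A y -> level G j%:Z y ->
  exists (e : 'rV[R]_n -> Y) c d, flat_chart j (level G j%:Z `&` A) y e c d.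
Proof.
move=> jn Ay Gy; have [r er] := sub_point Ay.
have Fr : level F j%:Z r by move: Gy; rewrite -er.
have [e [c [d ch]]] := flat_chart_exists (lfc_codomain hf) (lfc_flat hf) jn Fr.
exists e, c, d; move: ch; rewrite er; congr flat_chart.
apply/seteqP; split=> y' /=; first by move=> [z <- Fz]; split=> //; exact: set_valP.
by move=> [Gy' /sub_point[z ez]]; exists z => //; move: Gy'; rewrite -ez.
Qed.

Lemma preimage_flat_chart (j : nat) x : (j <= n)%N -> A (f x) -> level G j%:Z (f x) ->
  exists (e : 'rV[R]_n -> X) c d, flat_chart j (f @^-1` (level G j%:Z `&` A)) x e c d.
Proof.
move=> jn Ay Gy; have [r er] := sub_point (Ay : (f @^-1` A) x).
have Fr : level F' j%:Z r by move: Gy; rewrite -er.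
have [e [c [d ch]]] := flat_chart_exists (lfc_domain hf) (lfc_flat_preimage hf) jn Fr.
exists e, c, d; move: ch; rewrite er; congr flat_chart.
apply/seteqP; split=> y' /=; first by move=> [z <- Fz]; split=> //; exact: (set_valP z).
by move=> [Gy' Ay']; have [z ez] := sub_point (Ay' : (f @^-1` A) y'); exists z => //; move: Gy'; rewrite -ez.
Qed.

Lemma level_sub_locus (j : nat) : (j + 2 <= n)%N -> level G j%:Z `<=` A.
Proof. by move=> jn y [Gy _]; rewrite locusE; apply: fil_mono Gy; lia. Qed.

(* If the link is empty, the branch locus is a manifold near f x and the next
   stratum is the top one. *)
Lemma isolated_stratum_injective (j : nat) x (O : set Y) : (j + 2 <= n)%N ->
  level G j%:Z (f x) -> nbhs (f x) O -> (forall y, O y -> A y -> level G j%:Z y) ->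
  exists O : opens X, O x /\ injective_over f (level G j%:Z) O.
Proof.
move=> jn Gx nO OA; have Ax := level_sub_locus jn Gx.
have jn' : (j <= n)%N by lia.
apply: (@stratum_injective _ _ _ _ covering_finite_separated (@bc_finite _ _ _ f)
  (@bc_open _ _ _ f) top_injective _ _ R).
- by have [_ h _] := lfc_domain hf.
- have [e [c [d ch]]] := locus_flat_chart jn' Ax Gx.
  have [[d0 ec] ce _ _ _] := ch.
  have [d1 d10 d1O] : exists2 d1 : R, 0 < d1 & cube c d1 `<=` e @^-1` O.
    by apply: cube_nbhs; apply: ce; rewrite ec.
  have r0 : 0 < Num.min d d1 by rewrite lt_min d0.
  have rd : Num.min d d1 <= d by rewrite ge_min lexx.
  have rd1 : Num.min d d1 <= d1 by rewrite ge_min lexx orbT.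
  apply: (flat_contracts (flat_chart_le r0 rd ch)) => v cv.
    by move=> Gv; split=> //; exact: level_sub_locus Gv.
  split=> [/top_level nA []//|nGA]; apply/top_level => Av; apply: nGA; split=> //.
  by apply: OA => //; apply: d1O; exact: cube_le cv.
- have [e [c [d ch]]] := preimage_flat_chart jn' Ax Gx.
  have [[d0 ec] ce _ _ _] := ch.
  have [d1 d10 d1O] : exists2 d1 : R, 0 < d1 & cube c d1 `<=` e @^-1` (f @^-1` O).
    by apply: cube_nbhs; apply: ce; rewrite ec; exact: (@cts_fun _ _ f _ _ nO).
  have r0 : 0 < Num.min d d1 by rewrite lt_min d0.
  have rd : Num.min d d1 <= d by rewrite ge_min lexx.
  have rd1 : Num.min d d1 <= d1 by rewrite ge_min lexx orbT.
  apply: (flat_linked (flat_chart_le r0 rd ch) (Sg := f @^-1` level G j%:Z)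
    (M := f @^-1` level G n%:Z)) => [v cv|v cv|]; last lia.
    by move=> Gv; split=> //; exact: level_sub_locus Gv.
  split=> [/top_level nA []//|nGA]; apply/top_level => Av; apply: nGA; split=> //.
  by apply: OA => //; apply: d1O; exact: cube_le cv.
Qed.

(** Cone charts are charts of the locus, so the argument is run for the restriction [g] of [f] over
    [A]. The chart downstairs contracts the next stratum [M]; the chart upstairs links points of the
    stratum through the preimage of [M]. Both sides use the same index [i0], as the filtration
    upstairs is pulled back. *)
Lemma strata_injective i : locally_injective_over f (level G i).
Proof.
move=> x Gx; have [ei|[j ei jn]] := level_cases Gx; first by move: Gx; rewrite ei; exact: top_injective.
subst i; move: {2}(n - j)%N (leqnn (n - j)%N) => k; elim: k => [|k IH] in j jn x Gx *; first lia.
move=> jk; have Ax := level_sub_locus jn Gx.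
have [z ez] := sub_point (Ax : (f @^-1` A) x).
have [r er] := sub_point Ax.
pose g := @restrict_over _ _ f A.
have gz : g z = r by apply: val_inj; rewrite /= ez er.
have Fr : level F j%:Z r by move: Gx; rewrite -er.
have F'z : level F' j%:Z z by move: Gx; rewrite -ez.
have [_ _ [T0|[q0 oT]|[q0 ch']]] := stratified_cases preimage_stratified.
- by have : [set: f @^-1` A] z by []; rewrite T0.
(* Zero-dimensional preimage of the locus: its points are isolated, so [f] is trivially injective
   there. *)
- have /sub_openP[O oO Oz] := oT [set z].
  exists (Opens oO); split; first by rewrite -ez; apply/Oz.
  move=> w w' Ow Ow' Gw fw; have Aw := level_sub_locus jn Gw.
  have Aw' : A (f w') by rewrite -fw.
  have [u eu] := sub_point (Aw : (f @^-1` A) w); have [u' eu'] := sub_point (Aw' : (f @^-1` A) w').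
  have -> : w = val z by rewrite -eu; congr val; apply/Oz; rewrite eu.
  by apply/esym; rewrite -eu'; congr val; apply/Oz; rewrite eu'.
have [_ _ [T0|[q0' _]|[_ ch]]] := stratified_cases locus_stratified.
- by have : [set: A] r by []; rewrite T0.
- by rewrite q0' in q0.
have jq : j%:Z <= n%:Z - 2 by lia.
have [N [L [GL [cL sL chL]]]] := ch j r jq Fr.
have [N' [L' [GL' [cL' sL' chL']]]] := ch' j z jq F'z.
have [[l0 _]|Le] := pselect ([set: L] !=set0); last first.
  have [nN [phi [_ phiF _]]] := chL.
  have nN2 : nbhs r (N `&` ~` F (j%:Z - 1)).
    apply: filterI => //; apply: open_nbhs_nbhs; split; last by case: Fr.
    by apply: closed_openC; exact: fil_closed.
  have [O [oO Or] OV] := sub_nbhs nN2.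
  apply: (@isolated_stratum_injective j x O) => //.
    by apply: open_nbhs_nbhs; split=> //; rewrite -er.
  move=> y Oy Ay; have [w ew] := sub_point Ay.
  have [|Nw nFw] := OV w; first by rewrite ew.
  have [u eu] := sub_point Nw.
  have Fw : F j%:Z w.
    rewrite -eu; apply/phiF; case: (phi u).2 => [[l t]|] //.
    by case: Le; exists l.
  by rewrite -ew; split.
have q1 := stratified_nonneg l0 sL.
have [_ GLtop _] := stratified_cases sL.
(* The top part of the link is the whole link, so some part is non-empty; the lowest such [i0] gives
   the next higher stratum near [r]. *)
have exi : exists i : nat, `[< GL i%:Z !=set0 >].
  exists `|(n%:Z - 2 - j%:Z - 1)%R|%N; apply/asboolP; exists l0.
  by rewrite gez0_abs // GLtop.
case: (ex_minnP exi) => i0 /asboolP[l Gl] mini.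
have i0q : i0%:Z <= n%:Z - 2 - j%:Z - 1.
  have : (i0 <= `|(n%:Z - 2 - j%:Z - 1)%R|)%N.
    by apply: mini; apply/asboolP; exists l0; rewrite gez0_abs // GLtop.
  lia.
have lowest i : i0 = i.+1 -> GL i%:Z = set0.
  move=> ei; apply/seteqP; split=> // l1 Gl1.
  have : (i0 <= i)%N by apply: mini; apply/asboolP; exists l1.
  by rewrite ei ltnn.
have ejM : j%:Z + i0%:Z + 1 = (j + i0 + 1)%N%:Z by lia.
pose M : set A := level F (j%:Z + i0%:Z + 1).
have finA : forall y, finite_set (g @^-1` [set y]) by move=> y; exact: restrict_over_finite.
have openA := restrict_over_open (A := A) (@bc_open _ _ _ f).
have injA : locally_injective_over g M.
  move=> w Mw; have Gw : level G (j + i0 + 1)%N%:Z (f (val w)) by rewrite -ejM; exact: Mw.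
  have [||O [Ow injO]] := IH (j + i0 + 1)%N _ (val w) Gw; [lia|lia|].
  exists (open_preimage (@inclusion _ (f @^-1` A)) O); split=> // u u' Ou Ou' Mu gu.
  apply: val_inj; apply: (injO _ _ Ou Ou'); first by move: Mu; rewrite /M ejM.
  exact: (congr1 val gu).
have hausA : hausdorff_space (f @^-1` A) by apply: hausdorff_sub; have [] := lfc_domain hf.
have [||O [Oz injO]] := @stratum_injective _ _ g M (finite_separated_restrict covering_finite_separated)
  finA openA injA hausA (level F j%:Z) R z.
- by have := cone_contracts cL chL i0q; rewrite -gz.
- have [nN' _] := chL'.
  (* As [g] is open, the image of the chart upstairs is a neighbourhood of [r]; [M] accumulates at
     [r], so this chart contains a point over [M], as [cone_linked] demands. *)
  have nW : nbhs r (g @` interior N').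
    rewrite -gz; apply: open_nbhs_nbhs; split; first by apply: openA; exact: open_interior.
    by exists z => //; exact: nbhs_interior.
  have [p [[z0 /interior_subset N'z0 <-] Mp]] := cone_adherent cL chL i0q lowest Gl (Fr.1) nW.
  exact: (cone_linked cL' chL' i0q N'z0 Mp).
have [O2 oO2 OO2] := (sub_openP _).1 (oset_open O).
exists (Opens oO2); split; first by rewrite -ez; apply/OO2.
move=> w w' Ow Ow' Gw fw; have Aw := level_sub_locus jn Gw.
have Aw' : A (f w') by rewrite -fw.
have [u eu] := sub_point (Aw : (f @^-1` A) w); have [u' eu'] := sub_point (Aw' : (f @^-1` A) w').
rewrite -eu -eu'; congr val; apply: injO.
- by apply/OO2; rewrite eu.
- by apply/OO2; rewrite eu'.
- by move: Gw; rewrite -eu.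
- by apply: val_inj; rewrite /= eu eu'.
Qed.

End strata.

(** * Sums over fibres *)

Definition loc_const (T : topologicalType) (V : set T) (g : T -> rat) :=
  forall x, V x -> exists E : opens T, E x /\ forall x', E x' -> V x' -> g x' = g x.

Lemma loc_const_sub (T : topologicalType) (V V' : set T) (g : T -> rat) :
  V' `<=` V -> loc_const V g -> loc_const V' g.
Proof. by move=> V'V h x /V'V/h[E [Ex hE]]; exists E; split=> // x' Ex' /V'V; exact: hE. Qed.

Definition fibre_sum (S T : choiceType) (f : S -> T) (g : S -> rat) (y : T) : rat :=
  \sum_(x \in f @^-1` [set y]) g x.

Lemma eq_fibre_sum (S T : choiceType) (f : S -> T) (g g' : S -> rat) (y : T) :
  (forall x, f x = y -> g x = g' x) -> fibre_sum f g y = fibre_sum f g' y.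
Proof. by move=> e; apply: eq_fsbigr => x; rewrite inE; exact: e. Qed.

Lemma fibre_sumM (S T : choiceType) (f : S -> T) a (g : S -> rat) (y : T) :
  fibre_sum f (fun x => a * g x) y = a * fibre_sum f g y.
Proof. by rewrite /fibre_sum mulr_fsumr. Qed.

Lemma fibre_sumD (S T : choiceType) (f : S -> T) (g g' : S -> rat) (y : T) :
  finite_set (f @^-1` [set y]) ->
  fibre_sum f (fun x => g x + g' x) y = fibre_sum f g y + fibre_sum f g' y.
Proof. by move=> fin; rewrite /fibre_sum fsbig_split. Qed.

Lemma fibre_sum_const (S T : choiceType) (f : S -> T) a (y : T) :
  fibre_sum f (fun=> a) y = a * fibre_sum f (fun=> 1) y.
Proof. by rewrite -fibre_sumM; apply: eq_fibre_sum => x _; rewrite mulr1. Qed.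

Lemma fibre_sum1_neq0 (S T : choiceType) (f : S -> T) (y : T) (x0 : S) :
  finite_set (f @^-1` [set y]) -> f x0 = y -> fibre_sum f (fun=> 1) y != 0.
Proof.
move=> fin fx0; rewrite /fibre_sum fsbig_finite //= big_const_seq count_predT iter_addr_0.
rewrite -[_ *+ _]/((size _)%:R) pnatr_eq0 size_eq0; apply/eqP => e.
have := in_fset_set fin x0; rewrite [RHS]mem_set //.
by rewrite -[LHS]/(x0 \in finmap.enum_fset (fset_set (f @^-1` [set y]))) e.
Qed.

Section sheet_sum.
Variables (S T : topologicalType) (f : continuousType S T) (M : set T).
Hypothesis finf : finite_separated f.
Hypothesis fibre_finite : forall y, finite_set (f @^-1` [set y]).
Hypothesis open_f : forall U, open U -> open (f @` U).
Hypothesis injM : locally_injective_over f M.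

Lemma sheets_bij (y : T) (O0 : S -> opens S) : M y -> (forall x, f x = y -> O0 x x) ->
  exists (W : opens T) (O : S -> opens S),
  [/\ W y, forall x, f x = y -> O x x /\ O x `<=` O0 x,
      forall z, W (f z) -> exists2 x, f x = y & O x z &
      forall x x' z, f x = y -> f x' = y -> O x z -> O x' z -> x = x'] /\
  forall y', W y' -> M y' -> exists2 s : S -> S,
    set_bij (f @^-1` [set y]) (f @^-1` [set y']) s & forall x, f x = y -> O x (s x).
Proof.
move=> My Ox; have [W [O [[Wy OO cov dis] [inj sur]]]] := sheets finf fibre_finite open_f injM My Ox.
exists W, O; split=> // y' Wy' My'.
have ex x : exists z, f x = y -> O x z /\ f z = y'.
  have [fx|fx] := pselect (f x = y); last by exists x.
  by have [z Oz fz] := sur x y' fx Wy'; exists z.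
have /choice[s hs] := ex; exists s; last by move=> x /hs[].
split=> [x /= /hs[]//|x x' /set_mem/= fx /set_mem/= fx' sxx'|z /= fz].
  by have [Osx _] := hs x fx; have [Osx' _] := hs x' fx'; apply: (dis _ _ (s x)) => //; rewrite sxx'.
have [x fx Oz] : exists2 x, f x = y & O x z by apply: cov; rewrite fz.
exists x => //; have [Osx fsx] := hs x fx; apply: (inj x fx) => //; rewrite fsx // fz.
Qed.

(** The bijection [s] between nearby fibres moves each point inside its sheet, where [g] is
    constant. *)
Lemma fibre_sum_loc_const (V : opens T) (g : S -> rat) :
  loc_const (f @^-1` (V `&` M)) g -> loc_const (V `&` M) (fibre_sum f g).
Proof.
move=> cg y [Vy My].
have ex x : exists E : opens S, f x = y -> E x /\ forall x', E x' -> V (f x') -> M (f x') -> g x' = g x.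
  have [fx|fx] := pselect (f x = y); last by exists (Opens openT).
  have [|E [Ex hE]] := cg x; first by rewrite /preimage /= fx.
  by exists E => _; split=> // x' Ex' Vx' Mx'; apply: hE.
have /choice[E hE] := ex.
have [x fx|W [O [[Wy OO cov dis] bij]]] := sheets_bij (O0 := E) My; first by case: (hE x fx).
exists W; split=> // y' Wy' [Vy' My']; have [s bs Os] := bij y' Wy' My'.
rewrite /fibre_sum (@reindex_fsbig _ _ _ _ _ s _ _ g bs).
apply: eq_fsbigr => x; rewrite inE /= => fx; have [_ h] := hE x fx.
have fsx : f (s x) = y' by case: bs => bs _ _; exact: bs.
by apply: h; rewrite ?fsx //; have [_ OE] := OO x fx; exact: OE (Os x fx).
Qed.

End sheet_sum.

(** * Extension of locally constant functions *)

Section extension.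
Variables (R : realType) (n : nat) (X Y : topologicalType) (G : filtration Y)
  (f : branched_covering R X Y).
Hypotheses (hGn : G n%:Z = setT) (hGn1 : G (n%:Z - 1) = G (n%:Z - 2)).
Hypothesis hf : locally_flat_covering n G f.

Let A := branch_locus f.
Let Z (k : nat) : set X := f @^-1` (open_part n G k).

Lemma open_part_open k : open (open_part n G k).
Proof. by apply: closed_openC; exact: fil_closed. Qed.

Lemma open_part_le k k' : (k <= k')%N -> open_part n G k `<=` open_part n G k'.
Proof. by move=> kk'; apply: subsetC; apply: fil_mono; lia. Qed.

Lemma open_part_last : open_part n G n.-1.+2 = setT.
Proof.
apply/seteqP; split=> // y _; rewrite /open_part /setC /= (filtration_low hGn1 hf) //; lia.
Qed.

Lemma open_part2 : open_part n G 2 = level G n%:Z.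
Proof.
apply/seteqP; split=> y; last by move/(top_level hGn hGn1 hf); rewrite (locusE hf).
by move=> h; apply/(top_level hGn hGn1 hf); rewrite (locusE hf).
Qed.

Let Zo k : open (Z k).
Proof. by move/continuousP: (@cts_fun _ _ f); apply; exact: open_part_open. Qed.

Lemma open_part_step k y : (k <= n)%N -> open_part n G k.+1 y -> ~ open_part n G k y ->
  level G (n - k)%N%:Z y.
Proof.
rewrite /open_part /setC /= => kn h1 /contrapT h2; split.
  by have <- : n%:Z - k%:Z = (n - k)%N%:Z by lia.
by have -> : (n - k)%N%:Z - 1 = n%:Z - k.+1%:Z by lia.
Qed.

(** [Z k.+1] is open and adds only the stratum of codimension [k] to [Z k]; in a small flat chart
    upstairs [Z k] is therefore the complement of a coordinate subspace. *)
Lemma stratum_punctured (k : nat) (J : complex (Z k)) (e0 : sheaf_hom (constant_sheaf (Z k)) (J 0))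
    (x : X) (O : set X) : resolution e0 -> (1 < k <= n)%N -> level G (n - k)%N%:Z (f x) -> nbhs x O ->
  exists (E : set X) (EZ : opens (Z k)),
    [/\ open E, E x, E `<=` O & forall z, EZ z <-> E (val z)] /\
    [/\ exists z, EZ z,
        forall s : constant_sheaf (Z k) EZ, exists a, s = constant_section EZ a &
        forall m, (m.+2 < k)%N -> forall s : J m.+1%:Z EZ, cocycle s ->
          exists t, diff J m%:Z m.+1%:Z EZ t = s].
Proof.
move=> rJ /andP[k1 kn] Gx nO; set j := (n - k)%N in Gx.
have kj : k = (n - j)%N by rewrite /j; lia.
have jn : (j + 2 <= n)%N by rewrite /j; lia.
have Ax := level_sub_locus hf jn Gx.
have [|e [c [d ch]]] := preimage_flat_chart hf (j := j) _ Ax Gx; first lia.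
have [[d0 ec] ce _ _ _] := ch.
have nZ : nbhs x (Z k.+1).
  apply: open_nbhs_nbhs; split=> //; rewrite /Z /preimage /open_part /setC /=.
  by case: Gx => _; rewrite (_ : j%:Z - 1 = n%:Z - k.+1%:Z) // /j; lia.
have [d1 d10 d1Z] : exists2 d1 : R, 0 < d1 & cube c d1 `<=` e @^-1` Z k.+1.
  by apply: cube_nbhs; apply: ce; rewrite ec.
have r0 : 0 < Num.min d d1 by rewrite lt_min d0.
have rd : Num.min d d1 <= d by rewrite ge_min lexx.
have rd1 : Num.min d d1 <= d1 by rewrite ge_min lexx orbT.
have ZE v : cube c (Num.min d d1) v -> (Z k (e v) <-> ~ (f @^-1` (level G j%:Z `&` A)) (e v)).
  move=> cv; have Zv := d1Z _ (cube_le rd1 cv).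
  split=> [Zk [[Gv _] _]|h]; first by apply: Zk; rewrite (_ : n%:Z - k%:Z = j%:Z) // /j; lia.
  rewrite /Z /preimage /=; apply: contrapT => nZk; apply: h.
  have Gv := open_part_step kn Zv nZk.
  by split=> //; exact: (level_sub_locus hf jn Gv).
have Sx : (f @^-1` (level G j%:Z `&` A)) x by [].
have := punctured_chart (flat_chart_le r0 rd ch) ZE Sx rJ nO; rewrite -kj; exact.
Qed.

(** Strata are added one at a time: a point of the new stratum has points of [Z i.+2] nearby, since
    the punctured ball is non-empty. *)
Lemma dense_top (E : set X) (x : X) : open E -> E x -> exists2 x', E x' & Z 2 x'.
Proof.
have : forall i, (i <= n.-1)%N -> forall (E : set X) x, open E -> E `<=` Z i.+2 -> E x ->
    exists2 x', E x' & Z 2 x'.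
  elim=> [_ E' x' _ E'Z Ex'|i IH ni E' x' oE' E'Z Ex']; first by exists x' => //; exact: E'Z.
  have IH' x1 : E' x1 -> Z i.+2 x1 -> exists2 x2, E' x2 & Z 2 x2.
    move=> Ex1 Zx1; have [||||x2 [E'x2 _] Zx2] := IH _ (E' `&` Z i.+2) x1 => //; first lia.
      exact: openI.
    by exists x2.
  have [Zx|nZx] := pselect (Z i.+2 x'); first exact: (IH' x').
  have [J [e0 rJ]] := resolution_exists (constant_sheaf (Z i.+2)) 0.
  have ki : (1 < i.+2 <= n)%N by lia.
  have Gx : level G (n - i.+2)%N%:Z (f x') by apply: open_part_step => //; exact: E'Z.
  have [|E1 [EZ [[_ _ E1E EZE] [[z EZz] _ _]]]] := stratum_punctured (O := E') rJ ki Gx.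
    exact: open_nbhs_nbhs.
  by apply: (IH' (val z)); [apply: E1E; apply/EZE|exact: set_valP].
move=> h oE Ex; apply: (h n.-1 (leqnn _) E x oE _ Ex) => x' _.
by rewrite /Z /preimage /= open_part_last.
Qed.

Lemma loc_const_unique (V : opens X) (g g' : X -> rat) :
  loc_const V g -> loc_const V g' -> (forall x, V x -> Z 2 x -> g x = g' x) ->
  forall x, V x -> g x = g' x.
Proof.
move=> cg cg' gg' x Vx; have [E [Ex hE]] := cg x Vx; have [E' [E'x hE']] := cg' x Vx.
have [|x' [[Ex' E'x'] Vx'] Zx'] := @dense_top (E `&` E' `&` V) x _ (conj (conj Ex E'x) Vx).
  by apply: openI; [apply: openI|]; exact: oset_open.
by rewrite -(hE x') // -(hE' x') //; exact: gg'.
Qed.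

(** A punctured ball around a point of the stratum being added carries only constant sections, and
    this constant is the new value. *)
Lemma loc_const_extend (V : opens X) (g : X -> rat) : loc_const (V `&` Z 2) g ->
  exists2 g', loc_const V g' & forall x, V x -> Z 2 x -> g' x = g x.
Proof.
have Zle k k' : (k <= k')%N -> Z k `<=` Z k' by move=> kk' x; exact: open_part_le.
have : forall i, (i <= n.-1)%N -> forall (V : set X), open V -> V `<=` Z i.+2 ->
    loc_const (V `&` Z 2) g ->
    exists2 g', loc_const V g' & forall x, V x -> Z 2 x -> g' x = g x.
  elim=> [_ W _ WZ cg|i IH ni W oW WZ cg].
    by exists g => //; apply: loc_const_sub cg => x Wx; split=> //; exact: WZ.
  have [||||g' cg' gg'] := IH _ (W `&` Z i.+2) => //; [lia|exact: openI| |].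
    by apply: loc_const_sub cg => x [[Wx _] Zx].
  have ki : (1 < i.+2 <= n)%N by lia.
  have [J [e0 rJ]] := resolution_exists (constant_sheaf (Z i.+2)) 0.
  have ex x : exists a, W x -> ~ Z i.+2 x -> exists E : opens X, [/\ E x, E `<=` W &
      forall x', E x' -> Z i.+2 x' -> g' x' = a].
    have [[Wx nZx]|h] := pselect (W x /\ ~ Z i.+2 x); last by exists 0 => Wx nZ; case: h.
    have Gx : level G (n - i.+2)%N%:Z (f x) by apply: open_part_step => //; exact: WZ.
    have [|E1 [EZ [[oE1 E1x E1W EZE] [_ cst _]]]] := stratum_punctured (O := W) rJ ki Gx.
      exact: open_nbhs_nbhs.
    have lc : @locally_constant _ EZ (fun z : EZ => g' (val (val z))).
      move=> z; have Ez := (EZE (val z)).1 (set_valP z).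
      have [|E2 [E2z hE2]] := cg' (val (val z)); first by split; [exact: E1W|exact: set_valP].
      exists (open_preimage (@inclusion _ (Z i.+2)) E2); split=> // w E2w.
      apply: hE2 => //; split; last exact: set_valP.
      by apply: E1W; apply/EZE; exact: set_valP.
    have [a sa] := cst (Submod (ssc_submod (locally_constant_closed (Z i.+2)) EZ) lc).
    exists a => _ _; exists (Opens oE1); split=> // x' E1x' Zx'.
    have [z ez] := sub_point Zx'.
    have EZz : EZ z by apply/EZE; rewrite ez.
    have [w ew] := sub_point EZz.
    by have := congr1 (fun s => smval s w) sa; rewrite /= ew ez.
  have /choice[a ha] := ex.
  pose g2 x := if pselect (Z i.+2 x) then g' x else a x.
  have g2Z x : Z i.+2 x -> g2 x = g' x by rewrite /g2; case: pselect.
  have g2n x : ~ Z i.+2 x -> g2 x = a x by rewrite /g2; case: pselect.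
  exists g2; last by move=> x Wx Zx; rewrite g2Z; [apply: gg' => //; split=> //|]; exact: Zle Zx.
  move=> x Wx; have [Zx|nZx] := pselect (Z i.+2 x).
    have [|E [Ex hE]] := cg' x; first by [].
    exists (opensI E (Opens (Zo i.+2))); split=> // x' [Ex' Zx'] Wx'.
    by rewrite !g2Z //; exact: hE.
  have [E [Ex EW hE]] := ha x Wx nZx; exists E; split=> // x' Ex' Wx'.
  rewrite (g2n x) //; have [Zx'|nZx'] := pselect (Z i.+2 x'); first by rewrite g2Z //; exact: hE.
  have [E' [E'x' E'W hE']] := ha x' Wx' nZx'; rewrite g2n //.
  (* The constants attached to two nearby points of the new stratum are compared at a point of the
     top stratum lying in both balls. *)
  have [|w [Ew E'w] Zw] := @dense_top (E `&` E') x' _ (conj Ex' E'x').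
    by apply: openI; exact: oset_open.
  have Zw' : Z i.+2 w by apply: Zle Zw.
  by rewrite -(hE w) // -(hE' w).
move=> h cg; apply: (h n.-1 (leqnn _) V (oset_open V)) => // x _.
by rewrite /Z /preimage /= open_part_last.
Qed.

End extension.

(** * The trace splitting *)

Section embedded_constant.
Variables (S X : topologicalType) (al : S -> X).
Hypothesis al_inj : injective al.
Hypothesis al_cont : continuous al.
Hypothesis al_open : forall U, open U -> open (al @` U).

Definition image_open (U : opens S) : opens X := Opens (al_open (oset_open U)).

Lemma value_atE (U : opens S) (s : constant_sheaf S U) (z : U) : value_at s (val z) = smval s z.
Proof.
rewrite /value_at; case: pselect => [Uz|]; last by case; exact: set_valP.
by congr (smval s _); apply: val_inj.
Qed.

Lemma value_at_lin (U : opens S) a (s t : constant_sheaf S U) z :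
  value_at (a *: s + t) z = a * value_at s z + value_at t z.
Proof. by rewrite /value_at; case: pselect => //= _; rewrite mulr0 addr0. Qed.

(** Turns sections on [S] into functions on [X], so that sections over different open subspaces can
    be compared pointwise; 0 off the image is a dummy value. *)
Definition ext_value (U : opens S) (s : constant_sheaf S U) (x : X) : rat :=
  if pselect (exists z, al z = x) is left h then value_at s (projT1 (cid h)) else 0.

Lemma ext_valueE (U : opens S) (s : constant_sheaf S U) z : ext_value s (al z) = value_at s z.
Proof.
rewrite /ext_value; case: pselect => [h|]; last by case; exists z.
by congr value_at; apply: al_inj; exact: (projT2 (cid h)).
Qed.

Lemma ext_value_eq (U : opens S) (s t : constant_sheaf S U) :
  (forall x, image_open U x -> ext_value s x = ext_value t x) -> s = t.
Proof.
move=> st; apply: smval_inj; apply/funext => z.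
have : image_open U (al (val z)) by exists (val z) => //; exact: set_valP.
by move/st; rewrite !ext_valueE !value_atE.
Qed.

Lemma ext_value_lin (U : opens S) a (s t : constant_sheaf S U) x :
  ext_value (a *: s + t) x = a * ext_value s x + ext_value t x.
Proof. by rewrite /ext_value; case: pselect => [h|]; rewrite ?value_at_lin // mulr0 addr0. Qed.

Lemma ext_value_res (U V : opens S) (VU : V `<=` U) (s : constant_sheaf S U) x :
  image_open V x -> ext_value (res VU s) x = ext_value s x.
Proof. by move=> [z Vz <-]; rewrite !ext_valueE value_at_res. Qed.

Lemma ext_value_loc_const (U : opens S) (s : constant_sheaf S U) :
  loc_const (image_open U) (ext_value s).
Proof.
move=> _ [z Uz <-]; have [w ew] := sub_point Uz.
have [E [Ew hE]] := smvalP s w; rewrite ew in Ew.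
exists (image_open E); split; first by exists z.
move=> _ [z' Ez' <-] [z2 Uz' /al_inj e]; rewrite e in Uz'.
have [w' ew'] := sub_point Uz'; rewrite !ext_valueE -ew -ew' !value_atE.
by apply: hE; rewrite ew'.
Qed.

Lemma ext_value_exists (U : opens S) (g : X -> rat) : loc_const (image_open U) g ->
  exists s : constant_sheaf S U, forall x, image_open U x -> ext_value s x = g x.
Proof.
move=> cg; have lc : @locally_constant _ U (fun z : U => g (al (val z))).
  move=> z; have [|E [Ez hE]] := cg (al (val z)); first by exists (val z) => //; exact: set_valP.
  exists (Opens ((continuousP _).1 al_cont _ (oset_open E))); split=> // z' Ez'.
  by apply: hE => //; exists (val z') => //; exact: set_valP.
exists (Submod (ssc_submod (locally_constant_closed S) U) lc) => _ [z Uz <-].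
by rewrite ext_valueE; have [w <-] := sub_point Uz; rewrite value_atE.
Qed.

End embedded_constant.

Lemma sub_open_map (T : topologicalType) (A : set T) : open A ->
  forall U : set A, open U -> open (val @` U).
Proof.
move=> oA U /sub_openP[O oO UO]; rewrite (_ : val @` U = O `&` A); first exact: openI.
apply/seteqP; split=> x; first by move=> [z /UO Oz <-]; split=> //; exact: set_valP.
by move=> [Ox /sub_point[z ez]]; exists z => //; apply/UO; rewrite ez.
Qed.

Lemma split_exact_iso (T : topologicalType) (K A Q : sheaf T) (i : sheaf_hom K A)
    (k : sheaf_hom A K) (c : sheaf_hom Q A) :
  (forall V s, k V (i V s) = s) -> (forall V s, k V (c V s) = 0) ->
  (forall V s, c V s = 0 -> s = 0) -> (forall V t, k V t = 0 -> exists s, c V s = t) ->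
  sheaf_iso (dsum_sheaf Q K) A.
Proof.
move=> ki kc c0 kerk.
pose h (V : opens T) (s : dsum_sheaf Q K V) : A V := c V s.1 + i V s.2.
have h_lin (V : opens T) : linear (@h V).
  by move=> a [u1 u2] [v1 v2]; rewrite /h /= !hom_linear scalerDr addrACA.
have h_res (V W : opens T) (WV : W `<=` V) s : h W (res WV s) = res WV (h V s).
  by case: s => s1 s2; rewrite /h resD -!hom_res.
apply: (@loc_surj_iso _ (dsum_sheaf Q K) _ _ (id_hom _) (SheafHom h_lin h_res)).
- by move=> U s x Ux; exists U, (fun _ => id), s; split=> //; rewrite res_id.
- move=> U t x Ux; have [|s hs] := kerk U (t - i U (k U t)); first by rewrite homB ki subrr.
  exists U, (fun _ => id), (s, k U t); split=> //; rewrite res_id /= /h /= hs subrK //.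
move=> U [s1 s2]; split=> /= [[-> ->]|]; first by rewrite /h /= !hom0 addr0.
rewrite /h /= => e; have := congr1 (k U) e; rewrite homD kc ki add0r hom0 => s20.
by move: e; rewrite s20 hom0 addr0 => /c0 ->.
Qed.

Section decomposition.
Variables (R : realType) (n : nat) (X Y : topologicalType) (G : filtration Y)
  (f : branched_covering R X Y).
Hypotheses (hGn : G n%:Z = setT) (hGn1 : G (n%:Z - 1) = G (n%:Z - 2)).
Hypothesis hf : locally_flat_covering n G f.

Let U2 := open_part n G 2.
Let Z2 : set X := f @^-1` U2.

(* S -> X and T -> Y are open embeddings, S is the whole preimage of T, and T
   contains U2. *)
Variables (S T : topologicalType) (q : continuousType S T) (u : continuousType U2 T).
Variables (al : S -> X) (be : T -> Y).
Hypotheses (al_inj : injective al) (al_cont : continuous al).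
Hypothesis al_open : forall U, open U -> open (al @` U).
Hypotheses (be_inj : injective be) (be_cont : continuous be).
Hypothesis be_open : forall U, open U -> open (be @` U).
Hypothesis comm : forall s, f (al s) = be (q s).
Hypothesis full : forall x t, f x = be t -> exists s, al s = x.
Hypothesis ube : forall w, be (u w) = val w.

Let A := direct_image q (constant_sheaf S).
Let K := direct_image u (local_system f U2).
Let Q := constant_sheaf T.

Let imY (V : opens T) : opens Y := image_open be_open V.
Let pre (V : opens T) : opens X := image_open al_open (open_preimage q V).

Let preE V x : pre V x <-> imY V (f x).
Proof.
split=> [[s Vs <-]|[t Vt bt]]; first by exists (q s).
have [s es] := full (esym bt); exists s => //.
by rewrite /open_preimage /in_opens /= /preimage /= (_ : q s = t) //; apply: be_inj; rewrite -comm es bt.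
Qed.

Let oZ2 : open Z2.
Proof. by move/continuousP: (@cts_fun _ _ f); apply; exact: open_part_open. Qed.

Let vA (V : opens T) (s : A V) : X -> rat := ext_value al s.
Let vQ (V : opens T) (s : Q V) : Y -> rat := ext_value be s.

Let vA_eq (V : opens T) (s t : A V) : (forall x, imY V (f x) -> vA s x = vA t x) -> s = t.
Proof. by move=> h; apply: (ext_value_eq al_inj (al_open := al_open)) => x /preE; exact: h. Qed.

Let vA_loc_const (V : opens T) (s : A V) : loc_const (pre V) (vA s).
Proof. exact: ext_value_loc_const. Qed.

Let vA_exists (V : opens T) g : loc_const (pre V) g ->
  exists s : A V, forall x, imY V (f x) -> vA s x = g x.
Proof.
move=> /(ext_value_exists al_inj al_cont)[s hs]; exists s => x Vx; apply: hs.
exact: (preE V x).2.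
Qed.

Let vA_lin (V : opens T) a (s t : A V) x : vA (a *: s + t) x = a * vA s x + vA t x.
Proof. exact: ext_value_lin. Qed.

Let vA_res (V W : opens T) (WV : W `<=` V) (s : A V) x : imY W (f x) -> vA (res WV s) x = vA s x.
Proof. by move=> /preE; exact: ext_value_res. Qed.

Let dom (V : opens T) (x : X) := imY V (f x) /\ U2 (f x).

Let valZ_inj : injective (val : Z2 -> X). Proof. exact: val_inj. Qed.
Let q2 := @restrict_over _ _ f U2.
Let preK (V : opens T) : opens X :=
  image_open (sub_open_map oZ2) (open_preimage q2 (open_preimage u V)).

Let preKE V x : preK V x <-> dom V x.
Proof.
split=> [[z Vz <-]|[[t Vt bt] Ux]].
  split; last exact: (set_valP z).
  by exists (u (q2 z)) => //; rewrite ube.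
have [z ez] := sub_point (Ux : Z2 x); exists z => //.
rewrite /open_preimage /in_opens /= /preimage /= (_ : u (restrict_over z) = t) //.
by apply: be_inj; rewrite ube /= ez.
Qed.

Let vK (V : opens T) (s : K V) : X -> rat := ext_value (val : Z2 -> X) (smval s).

Let vK_eq (V : opens T) (s t : K V) : (forall x, dom V x -> vK s x = vK t x) -> s = t.
Proof.
move=> h; apply: smval_inj; apply: (ext_value_eq valZ_inj (al_open := sub_open_map oZ2)) => x.
by move=> /preKE; exact: h.
Qed.

Let vK_loc_const (V : opens T) (s : K V) : loc_const (dom V) (vK s).
Proof.
move=> x /preKE Vx.
have [E [Ex hE]] := ext_value_loc_const valZ_inj (al_open := sub_open_map oZ2) (smval s) Vx.
by exists E; split=> // x' Ex' /preKE Vx'; exact: hE.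
Qed.

Let traceE (W : opens U2) (s : direct_image q2 (constant_sheaf Z2) W) (w : U2) :
  trace (q := q2) s w = fibre_sum f (ext_value (val : Z2 -> X) s) (val w).
Proof.
have bij : set_bij (q2 @^-1` [set w]) (f @^-1` [set val w]) (val : Z2 -> X).
  split=> [z /= <- //|z z' _ _|x /= fx]; first exact: val_inj.
  have [z ez] : exists z : Z2, val z = x.
    by apply: sub_point; rewrite /Z2 /preimage /= fx; exact: set_valP.
  by exists z => //=; apply: val_inj; rewrite /= ez.
rewrite /fibre_sum (@reindex_fsbig _ _ _ _ _ _ _ _ _ bij).
by apply: eq_fsbigr => z _; rewrite ext_valueE //; exact: val_inj.
Qed.

Let vK_sum0 (V : opens T) (s : K V) y : imY V y -> U2 y -> fibre_sum f (vK s) y = 0.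
Proof.
move=> [t Vt bt] Uy; have [w ew] := sub_point Uy.
rewrite -ew -traceE; apply: (smvalP s).
by rewrite /open_preimage /in_opens /= /preimage /= (_ : u w = t) //; apply: be_inj; rewrite ube ew.
Qed.

Let vK_exists (V : opens T) g : loc_const (dom V) g ->
  (forall y, imY V y -> U2 y -> fibre_sum f g y = 0) ->
  exists s : K V, forall x, dom V x -> vK s x = g x.
Proof.
move=> cg g0; have cg' : loc_const (preK V) g.
  by move=> x /preKE/cg[E [Ex hE]]; exists E; split=> // x' Ex' /preKE; exact: hE.
have [s hs] := ext_value_exists valZ_inj (@continuous_val _ Z2) cg'.
have ts : traceless (q := q2) (V := open_preimage u V) s.
  move=> w Vw; rewrite traceE -(g0 (val w)); last exact: set_valP; last by rewrite -ube; exists (u w).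
  apply: eq_fibre_sum => x fx; apply: hs; apply/preKE; rewrite /dom fx; split; last exact: set_valP.
  by rewrite -ube; exists (u w).
exists (Submod (ssc_submod (traceless_closed _) (open_preimage u V)) ts) => x /preKE; exact: hs.
Qed.

Let vK_lin (V : opens T) a (s t : K V) x : vK (a *: s + t) x = a * vK s x + vK t x.
Proof. exact: ext_value_lin. Qed.

Let vK_res (V W : opens T) (WV : W `<=` V) (s : K V) x : dom W x -> vK (res WV s) x = vK s x.
Proof. by move=> /preKE Wx; apply: (ext_value_res valZ_inj (al_open := sub_open_map oZ2) _ _ Wx). Qed.

Let imY_sub (V W : opens T) : W `<=` V -> imY W `<=` imY V.
Proof. by move=> WV y [t Wt bt]; exists t => //; exact: WV. Qed.

Let A_determined (V : opens T) (s t : A V) : (forall x, dom V x -> vA s x = vA t x) -> s = t.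
Proof.
move=> h; apply: vA_eq => x /preE; apply: (loc_const_unique hGn1 hf) => [||x' /preE Vx' Zx'].
- exact: vA_loc_const.
- exact: vA_loc_const.
- exact: h.
Qed.

(** A section of [K] is a function over [U2] only. [loc_const_extend] carries it across the strata,
    and density makes the extension unique, hence linear and compatible with restriction. *)
Lemma iota_exists : exists i : sheaf_hom K A,
  forall (V : opens T) s x, dom V x -> vA (i V s) x = vK s x.
Proof.
pose r (V : opens T) (s : K V) (t : A V) := forall x, dom V x -> vA t x = vK s x.
have tot (V : opens T) s : exists t, @r V s t.
  have cg : loc_const (pre V `&` Z2) (vK s).
    by apply: loc_const_sub (vK_loc_const s) => x [/preE].
  have [g cg' gs] := loc_const_extend hGn1 hf cg.
  have [t ht] := vA_exists cg'; exists t => x [Vx Ux].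
  by rewrite ht // gs //; apply/preE.
have [|||V s x Vx|i hi] := @hom_of_local_rel _ K A r.
- by move=> V s t t' st st'; apply: A_determined => x Vx; rewrite st // st'.
- by move=> V s t s' t' a st st' x Vx; rewrite vA_lin vK_lin st // st'.
- move=> V W WV s t st x [Wx Ux].
  by rewrite vA_res // vK_res // st //; split=> //; exact: (imY_sub WV).
- have [t st] := tot V s; exists V, (fun _ => id), t; split=> // y Vy.
  by rewrite res_id st.
exists i => V s x Vx; have [t st] := tot V s.
by rewrite (hi V s t st); exact: st.
Qed.

(** Average over the points of the fibre, counted without multiplicity; over [U2] their number is
    locally constant. *)
Let avg (g : X -> rat) (y : Y) := fibre_sum f g y / fibre_sum f (fun=> 1) y.

Let cnt_neq0 y : fibre_sum f (fun=> 1) y != 0.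
Proof. by have [x fx] := @bc_surj _ _ _ f y; apply: (fibre_sum1_neq0 _ fx); exact: bc_finite. Qed.

Let avg_loc_const (V : opens T) g : loc_const (dom V) g -> loc_const (imY V `&` U2) (avg g).
Proof.
move=> cg; have sum_lc g' : loc_const (dom V) g' -> loc_const (imY V `&` U2) (fibre_sum f g').
  have e := open_part2 hGn hGn1 hf; move=> cg'; rewrite /U2 e.
  apply: (fibre_sum_loc_const (covering_finite_separated hf) (@bc_finite _ _ _ f) (@bc_open _ _ _ f)
    (top_injective hGn hGn1 hf)).
  by apply: loc_const_sub cg' => x [Vx Ux]; split=> //; rewrite /U2 e.
move=> y Vy; have [E [Ey hE]] := sum_lc g cg y Vy.
have [|E' [E'y hE']] := sum_lc (fun=> 1) _ y Vy; first by move=> x _; exists (Opens openT).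
exists (opensI E E'); split=> // y' [Ey' E'y'] Vy'.
by rewrite /avg hE // hE'.
Qed.

Let avg_lin a g g' y : avg (fun x => a * g x + g' x) y = a * avg g y + avg g' y.
Proof.
rewrite /avg (@fibre_sumD _ _ f (fun x => a * g x) g' y (@bc_finite _ _ _ f y)).
by rewrite (fibre_sumM f a g y) mulrDl mulrA.
Qed.

Let avg_eq g g' y : (forall x, f x = y -> g x = g' x) -> avg g y = avg g' y.
Proof. by move=> e; rewrite /avg (eq_fibre_sum e). Qed.

Let avg_const a y : avg (fun=> a) y = a.
Proof. by rewrite /avg (fibre_sum_const f a y); apply: mulfK; exact: cnt_neq0. Qed.

Let avgK g y : avg g y * fibre_sum f (fun=> 1) y = fibre_sum f g y.
Proof. by apply: divfK; exact: cnt_neq0. Qed.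

Lemma kappa_exists : exists k : sheaf_hom A K,
  forall (V : opens T) t x, dom V x -> vK (k V t) x = vA t x - avg (vA t) (f x).
Proof.
pose r (V : opens T) (t : A V) (s : K V) := forall x, dom V x -> vK s x = vA t x - avg (vA t) (f x).
have tot (V : opens T) t : exists s, @r V t s.
  have ct : loc_const (dom V) (vA t).
    by apply: loc_const_sub (vA_loc_const t) => x [/preE].
  apply: vK_exists => [x [Vx Ux]|y Vy Uy].
    have [E [Ex hE]] := ct x (conj Vx Ux); have [E' [E'x hE']] := avg_loc_const ct (conj Vx Ux).
    exists (opensI E (open_preimage f E')); split=> // x' [Ex' E'x'] [Vx' Ux'].
    by rewrite hE // hE'.
  rewrite (@eq_fibre_sum _ _ f _ (fun x => -1 * avg (vA t) y + vA t x)); last first.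
    by move=> x ->; rewrite mulN1r addrC.
  rewrite (@fibre_sumD _ _ f (fun=> -1 * avg (vA t) y) (vA t) y (@bc_finite _ _ _ f y)).
  by rewrite (fibre_sum_const f (-1 * avg (vA t) y) y) -mulrA avgK mulN1r addNr.
have [|||V s x Vx|k hk] := @hom_of_local_rel _ A K r.
- by move=> V s t t' st st'; apply: vK_eq => x Vx; rewrite st // st'.
- move=> V s t s' t' a st st' x Vx; rewrite vA_lin vK_lin st // st' //.
  rewrite (_ : vA (a *: s + s') = fun x => a * vA s x + vA s' x); last first.
    by apply/funext => x'; rewrite vA_lin.
  by rewrite avg_lin; ring.
- move=> V W WV s t st x [Wx Ux].
  rewrite vA_res // vK_res // st; last by split=> //; exact: (imY_sub WV).
  by congr (_ - _); apply: avg_eq => x' fx; rewrite vA_res // fx.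
- have [t st] := tot V s; exists V, (fun _ => id), t; split=> // y Vy.
  by rewrite res_id st.
exists k => V s x Vx; have [t st] := tot V s.
by rewrite (hk V s t st); exact: st.
Qed.

Lemma pullback_exists : exists c : sheaf_hom Q A,
  forall (V : opens T) s x, imY V (f x) -> vA (c V s) x = vQ s (f x).
Proof.
pose r (V : opens T) (s : Q V) (t : A V) := forall x, imY V (f x) -> vA t x = vQ s (f x).
have tot (V : opens T) s : exists t, @r V s t.
  have cg : loc_const (pre V) (fun x => vQ s (f x)).
    move=> x /preE Vx.
    have [E [Ex hE]] := ext_value_loc_const be_inj (al_open := be_open) s Vx.
    exists (open_preimage f E); split=> // x' Ex' /preE Vx'; exact: hE.
  by have [t ht] := vA_exists cg; exists t.
have [|||V s x Vx|i hi] := @hom_of_local_rel _ Q A r.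
- by move=> V s t t' st st'; apply: vA_eq => x Vx; rewrite st // st'.
- by move=> V s t s' t' a st st' x Vx; rewrite vA_lin /vQ ext_value_lin st // st'.
- move=> V W WV s t st x Wx.
  rewrite vA_res // st; last exact: (imY_sub WV).
  by rewrite /vQ (ext_value_res be_inj (al_open := be_open)).
- have [t st] := tot V s; exists V, (fun _ => id), t; split=> // y Vy.
  by rewrite res_id st.
exists i => V s x Vx; have [t st] := tot V s.
by rewrite (hi V s t st); exact: st.
Qed.

Lemma trace_splitting : exists (i : sheaf_hom K A) (k : sheaf_hom A K) (c : sheaf_hom Q A),
  [/\ forall V s, k V (i V s) = s,
      forall V a, c V (constant_section V a) = constant_section (open_preimage q V) a,
      forall V s, k V (c V s) = 0,
      forall V s, c V s = 0 -> s = 0 &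
      forall V t, k V t = 0 -> exists s, c V s = t].
Proof.
have [i hi] := iota_exists; have [k hk] := kappa_exists; have [c hc] := pullback_exists.
have c_inj V s : c V s = 0 -> s = 0.
  move=> s0; apply: (ext_value_eq be_inj (al_open := be_open)) => y Vy.
  have [x fx] := @bc_surj _ _ _ f y; rewrite -fx in Vy *.
  rewrite -[ext_value be s _]/(vQ s (f x)) -hc // s0.
  (* Zero is written as a linear combination so that linearity of the values forces the value of the
     zero section to be 0. *)
  rewrite (_ : (0 : Q V) = -1 *: 0 + 0); last by rewrite scaler0 addr0.
  rewrite (_ : (0 : A V) = -1 *: 0 + 0); last by rewrite scaler0 addr0.
  rewrite vA_lin ext_value_lin; lra.
exists i, k, c; split=> //.
- move=> V s; apply: vK_eq => x Vx; rewrite hk // hi //.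
  rewrite (_ : avg _ _ = avg (vK s) (f x)); last first.
    by apply: avg_eq => x' fx; apply: hi; rewrite /dom fx.
  by case: Vx => Vx Ux; rewrite /avg vK_sum0 // mul0r subr0.
- move=> V a; apply: vA_eq => x Vx; rewrite hc //.
  have [s sV es] := (preE V x).2 Vx; rewrite -es /vA /vQ comm !ext_valueE //.
- move=> V s; apply: vK_eq => x [Vx Ux]; rewrite hk // hc //.
  rewrite (_ : avg _ _ = avg (fun=> vQ s (f x)) (f x)); last first.
    by apply: avg_eq => x' fx; rewrite hc fx.
  rewrite avg_const subrr (_ : (0 : K V) = -1 *: 0 + 0); last by rewrite scaler0 addr0.
  rewrite vK_lin; lra.
(* A section killed by [k] equals its average over [U2], hence is constant on those fibres. If [t]
   is constant on [E] around [x0], then over the open set [f E] it is the pullback of the constant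
   [vA t x0]. *)
move=> V t t0; apply: (loc_image_global c_inj) => y0 Vy0.
have [x0 fx0] := @bc_surj _ _ _ f (be y0).
have Vx0 : imY V (f x0) by rewrite fx0; exists y0.
have [E [Ex0 hE]] := vA_loc_const t ((preE V x0).2 Vx0).
have oW : open (V `&` be @^-1` (f @` (E `&` pre V))).
  apply: openI; first exact: oset_open.
  move/continuousP: be_cont; apply; apply: bc_open; apply: openI; exact: oset_open.
exists (Opens oW), (@subIsetl _ _ _), (constant_section _ (vA t x0)); split.
  by split=> //; exists x0 => //; split=> //; apply/preE.
apply: A_determined => x [Vx Ux]; rewrite hc // vA_res //.
have [y Wy ey] := Vx; rewrite /vQ -ey ext_valueE //.
have [w ew] := sub_point (Wy : Opens oW y); rewrite -{1}ew value_atE /=.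
have [_ [x1 [Ex1 Vx1]] fx1] := Wy.
have key x' : f x' = f x -> vA t x' = avg (vA t) (f x).
  move=> fx'; have Vx' : dom V x'.
    by split; rewrite fx' //; apply: (@imY_sub V (Opens oW)) Vx => z [].
  have := hk V t x' Vx'; rewrite t0 fx' => h.
  apply/eqP; rewrite -subr_eq0 -h (_ : (0 : K V) = -1 *: 0 + 0); last by rewrite scaler0 addr0.
  rewrite vK_lin; apply/eqP; lra.
by rewrite (key x) // -(key x1) ?fx1 ?ey // hE.
Qed.

End decomposition.

(** * Deligne's complex *)

Section direct_image_iso.
Variables (S T' T : topologicalType) (a : continuousType S T') (b : continuousType T' T)
  (g : continuousType S T).
Hypothesis ba : forall x, b (a x) = g x.
Variable F : sheaf S.

Let h12 (U : opens T) : open_preimage g U `<=` open_preimage a (open_preimage b U).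
Proof. by move=> x; rewrite /open_preimage /in_opens /= /preimage /= ba. Qed.
Let h21 (U : opens T) : open_preimage a (open_preimage b U) `<=` open_preimage g U.
Proof. by move=> x; rewrite /open_preimage /in_opens /= /preimage /= ba. Qed.

(** The two preimages of an open set have the same points without being convertible, so the
    isomorphism consists of restrictions. *)
Lemma direct_image_comp_iso :
  sheaf_iso (direct_image b (direct_image a F)) (direct_image g F).
Proof.
pose u (U : opens T) (s : direct_image b (direct_image a F) U) : direct_image g F U := res (@h12 U) s.
pose v (U : opens T) (s : direct_image g F U) : direct_image b (direct_image a F) U := res (@h21 U) s.
have lu (U : opens T) : linear (@u U) by move=> c s t; exact: (@res_linear _ F _ _ (@h12 U) c s t).
have lv (U : opens T) : linear (@v U) by move=> c s t; exact: (@res_linear _ F _ _ (@h21 U) c s t).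
have ru (U V : opens T) (VU : V `<=` U) s : u V (res VU s) = res VU (u U s).
  have hVU : open_preimage g V `<=` open_preimage a (open_preimage b U) by move=> x /h12; exact: VU.
  by rewrite /u /= !(res_comp _ _ hVU).
have rv (U V : opens T) (VU : V `<=` U) s : v V (res VU s) = res VU (v U s).
  have hVU : open_preimage a (open_preimage b V) `<=` open_preimage g U by move=> x /h21; exact: VU.
  by rewrite /v /= !(res_comp _ _ hVU).
exists (SheafHom lu ru), (SheafHom lv rv); split=> U s /=.
  by rewrite /u /v (res_comp _ _ (fun x h => h)) res_id.
by rewrite /u /v (res_comp _ _ (fun x h => h)) res_id.
Qed.
End direct_image_iso.

Lemma direct_image_id_iso (T : topologicalType) (g : continuousType T T) (F : sheaf T) :
  (forall x, g x = x) -> sheaf_iso F (direct_image g F).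
Proof.
move=> gx.
have h1 (U : opens T) : open_preimage g U `<=` U by move=> x; rewrite /open_preimage /in_opens /= /preimage /= gx.
have h2 (U : opens T) : U `<=` open_preimage g U by move=> x; rewrite /open_preimage /in_opens /= /preimage /= gx.
pose u (U : opens T) (s : F U) : direct_image g F U := res (h1 U) s.
pose v (U : opens T) (s : direct_image g F U) : F U := res (h2 U) s.
have lu (U : opens T) : linear (@u U) by move=> c s t; exact: (@res_linear _ F _ _ (h1 U) c s t).
have lv (U : opens T) : linear (@v U) by move=> c s t; exact: (@res_linear _ F _ _ (h2 U) c s t).
have ru (U V : opens T) (VU : V `<=` U) s : u V (res VU s) = res VU (u U s).
  have hVU : open_preimage g V `<=` U by move=> x /h1; exact: VU.
  by rewrite /u /= !(res_comp _ _ hVU).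
have rv (U V : opens T) (VU : V `<=` U) s : v V (res VU s) = res VU (v U s).
  have hVU : V `<=` open_preimage g U by move=> x /VU; exact: h2.
  by rewrite /v /= !(res_comp _ _ hVU).
exists (SheafHom lu ru), (SheafHom lv rv); split=> U s /=.
  by rewrite /u /v (res_comp _ _ (fun x h => h)) res_id.
by rewrite /u /v (res_comp _ _ (fun x h => h)) res_id.
Qed.

Section pure_reindex.
Variables (T : topologicalType) (C : complex T) (c k : int) (K : sheaf T).

Let h (U : opens T) (z : cocycles (reindex C k) c U) : cocycles C (c - k) U :=
  Cocycle ((reindex_cocycle (smval z)).1 (cocycles_cocycle z)).
Let h_linear (U : opens T) : linear (@h U).
Proof. by move=> a u v; apply: smval_inj. Qed.
Let h_res (U V : opens T) (VU : V `<=` U) z : h (res VU z) = res VU (h z).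
Proof. exact: smval_inj. Qed.

Lemma pure_reindex : pure C (c - k) K -> pure (reindex C k) c K.
Proof.
move=> [p [pk ps pa]]; exists (comp_hom p (SheafHom h_linear h_res)); split.
- by move=> U z; rewrite /= pk /=; exact: iff_sym (reindex_loc_cob _).
- move=> U x y Uy; have [V [VU [z [Vy pz]]]] := ps U x y Uy.
  exists V, VU, (Cocycle ((@reindex_cocycle _ C k c V (smval z)).2 (cocycles_cocycle z))).
  by split=> //; rewrite -pz /=; congr (p V _); exact: smval_inj.
- move=> i ic U s cs; apply/reindex_loc_cob; apply: pa; last exact/reindex_cocycle.
  by move=> e; apply: ic; lia.
Qed.
End pure_reindex.

Lemma direct_image_resolution (S T : topologicalType) (q : continuousType S T) (J : complex S)
    c (F : sheaf S) (e : sheaf_hom F (J c)) : finite_separated q -> resolution e ->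
  @resolution T (direct_image_complex q J) c (direct_image q F) (direct_image_hom q e).
Proof.
move=> finq [low inj coc mono ex ac]; split.
- by move=> i ic U s; exact: low.
- by move=> i; exact: injective_direct_image.
- by move=> U k j; exact: coc.
- by move=> U k; exact: mono.
- by move=> U z cz; apply: ex => j; exact: cz.
- by move=> i ic; apply: finite_direct_image_acyclic => //; exact: ac.
Qed.

Lemma resolution_bounded_below (T : topologicalType) (J : complex T) c (K : sheaf T) (e : sheaf_hom K (J c)) :
  resolution e -> bounded_below J.
Proof. by move=> rJ; exists c; exact: (rs_low rJ). Qed.

(** [th] lifts [i] and [psi] lifts [k]. Their composite lifts the identity of [K] and is a
    quasi-isomorphism, though not an identity; it is therefore injective on the cohomology of
    sections, and so is [th]. *)
Lemma retract_sections (T : topologicalType) (I N : complex T) c (K A : sheaf T)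
    (i : sheaf_hom K A) (k : sheaf_hom A K) (e : sheaf_hom A (N c)) :
  (forall U s, k U (i U s) = s) -> pure I c K -> bounded_below I ->
  (forall j, injective_sheaf (I j)) -> resolution e ->
  exists th : complex_map I N, forall j (U : opens T) (s : I j U), cocycle s ->
    (exists t, diff N (j - 1) j U t = th j U s) -> exists t, diff I (j - 1) j U t = s.
Proof.
move=> ki [p Ip] bI injI rN.
have [J [eK rJ]] := resolution_exists K c.
have [th hth] := map_to_resolution i Ip rN.
have [pN [Np epN]] := resolution_pure rN; have [pJ [Jp epJ]] := resolution_pure rJ.
have [psi hpsi] := map_to_resolution k Np rJ.
have hu j l (U : opens T) s : comp_hom (psi l) (th l) U (diff I j l U s) =
    diff J j l U (comp_hom (psi j) (th j) U s) by rewrite /= !cmap_diff.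
pose u := ComplexMap hu.
exists th => j U s cs [t ht].
apply: (@qis_sections_inj _ I J u bI injI (resolution_bounded_below rJ) _ _ _ _ _ (psi (j - 1) U t)) => //.
- by move=> l; exact: (rs_injective rJ).
- apply: (@pure_quasi_iso _ _ _ u c K K p pJ (id_hom K)) => //; last by move=> V x; exists x.
  move=> V z w wz; apply: (resolution_inj (e := eK)) => //; rewrite epJ wz /=.
  have cz : cocycle (e V (i V (p V z))) by exact: (rs_cocycle rN).
  rewrite hth -[e V _]/(smval (Cocycle cz)) hpsi.
  have -> : pN V (Cocycle cz) = i V (p V z).
    by apply: (resolution_inj (e := e)) => //; rewrite epN.
  by rewrite ki.
by rewrite /= -ht cmap_diff.
Qed.

Section deligne_steps.
Variables (R : realType) (n : nat) (X Y : topologicalType) (G : filtration Y)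
  (f : branched_covering R X Y).
Hypotheses (hGn : G n%:Z = setT) (hGn1 : G (n%:Z - 1) = G (n%:Z - 2)).
Hypothesis hf : locally_flat_covering n G f.

Let U := open_part n G.
Let Z (k : nat) : set X := f @^-1` U k.
Let L := local_system f (U 2).

Definition extended_system (k : nat) (k2 : (2 <= k)%N) : sheaf (U k) :=
  direct_image (sub_inclusion (@open_part_le n Y G _ _ k2)) L.

Section step.
Variable k : nat.
Hypotheses (k2 : (2 <= k)%N) (kn : (k <= n)%N).

Let ik := sub_inclusion (@open_part_sub Y n G k).
Let qk := @restrict_over _ _ f (U k).
Let K := extended_system k2.

Let oU l : open (U l). Proof. exact: open_part_open. Qed.
Let oZ l : open (Z l).
Proof. by move/continuousP: (@cts_fun _ _ f); apply; exact: oU. Qed.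

Section punctured.
Variables (J : complex (Z k)) (e0 : sheaf_hom (constant_sheaf (Z k)) (J 0)).
Hypothesis rJ : resolution e0.

Let q1 := @restrict_over _ _ f (U k.+1).
Let ZS : Z k `<=` Z k.+1. Proof. by move=> x; exact: open_part_sub. Qed.
Let w := sub_inclusion ZS.

Let V12 (V : opens (U k.+1)) :
  open_preimage w (open_preimage q1 V) `<=` open_preimage qk (open_preimage ik V).
Proof.
move=> z; rewrite /open_preimage /in_opens /= /preimage /=.
by rewrite (_ : restrict_over (sub_inclusion ZS z) = ik (qk z)) //; exact: val_inj.
Qed.
Let V21 (V : opens (U k.+1)) :
  open_preimage qk (open_preimage ik V) `<=` open_preimage w (open_preimage q1 V).
Proof.
move=> z; rewrite /open_preimage /in_opens /= /preimage /=.
by rewrite (_ : restrict_over (sub_inclusion ZS z) = ik (qk z)) //; exact: val_inj.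
Qed.

Let N := direct_image_complex qk J.

(** Each point of the fibre over [y] has a punctured ball on which [s] has a primitive; the
    primitives are assembled over a neighbourhood of [y]. *)
Lemma punctured_primitive (m : nat) (V : opens (U k.+1)) (y : U k.+1)
    (s : N m.+1%:Z (open_preimage ik V)) : (m.+2 < k)%N -> ~ U k (val y) -> V y -> cocycle s ->
  exists (W : opens (U k.+1)) (WV : W `<=` V) (WV' : open_preimage ik W `<=` open_preimage ik V)
    (t : N m%:Z (open_preimage ik W)),
    W y /\ diff N m%:Z m.+1%:Z _ t = res WV' s.
Proof.
move=> mk nUy Vy cs.
have Gy : level G (n - k)%N%:Z (val y) by apply: open_part_step => //; exact: (set_valP y).
have cs' : cocycle (s : J m.+1%:Z (open_preimage qk (open_preimage ik V))) by move=> j; exact: cs.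
have finq1 : finite_separated q1 by apply: finite_separated_restrict; exact: (covering_finite_separated hf).
pose b : direct_image q1 (direct_image w (J m.+1%:Z)) V := res (@V12 V) s.
(* [direct_image w] views [J] on [Z k.+1], so that [finite_lift] applies at [y], which is outside
   [U k]. [V12] and [V21] identify the two ways round the square of inclusions and restrictions of
   [f]. *)
have [x qx|W [WV [t [Wy ht]]]] := @finite_lift _ _ q1 finq1 (direct_image w (J m%:Z)) (direct_image w (J m.+1%:Z))
  (direct_image_hom w (diff J m%:Z m.+1%:Z)) V b y Vy; last first.
- have WV' : open_preimage ik W `<=` open_preimage ik V by move=> z; exact: WV.
  have WV2 : open_preimage qk (open_preimage ik W) `<=` open_preimage qk (open_preimage ik V).
    by move=> z; exact: WV'.
  exists W, WV, WV', (res (@V21 W) t); split=> //.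
  transitivity (res (@V21 W) (diff J m%:Z m.+1%:Z (open_preimage w (open_preimage q1 W)) t)).
    exact: (hom_res (diff J m%:Z m.+1%:Z) (@V21 W) t).
  transitivity (res WV2 (s : J m.+1%:Z (open_preimage qk (open_preimage ik V)))); last first.
    exact: (@res_irr _ (J m.+1%:Z)).
  have W1 : open_preimage w (open_preimage q1 W) `<=` open_preimage w (open_preimage q1 V).
    by move=> z; exact: WV.
  have ht' : diff J m%:Z m.+1%:Z (open_preimage w (open_preimage q1 W)) t = res W1 b.
    by transitivity (res WV b); [exact: ht|exact: (@res_irr _ (J m.+1%:Z))].
  have W3 : open_preimage qk (open_preimage ik W) `<=` open_preimage w (open_preimage q1 V).
    by move=> z /(@V21 W); exact: W1.
  by rewrite ht' (res_comp _ _ W3) /b (res_comp _ _ WV2).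
have Gx : level G (n - k)%N%:Z (f (val x)) by move: Gy; rewrite -qx.
have nO : nbhs (val x) (val @` open_preimage q1 V).
  apply: open_nbhs_nbhs; split.
    by apply: sub_open_map; [exact: oZ|exact: oset_open].
  by exists x => //; rewrite /open_preimage /= /preimage /= qx.
have k2n : (1 < k <= n)%N by rewrite k2.
have [E [EZ [[oE Ex EO EZE] [_ _ ac]]]] := stratum_punctured hf rJ k2n Gx nO.
have EV : open_preimage (@inclusion _ (Z k.+1)) (Opens oE) `<=` open_preimage q1 V.
  by move=> z /EO[z' Vz' /val_inj <-].
have E1 : EZ `<=` open_preimage qk (open_preimage ik V).
  move=> z /EZE Ez; apply: V12; apply: EV.
  by rewrite /open_preimage /in_opens /= /preimage /=.
have E2 : open_preimage w (open_preimage (@inclusion _ (Z k.+1)) (Opens oE)) `<=` EZ.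
  by move=> z Ez; apply/EZE; exact: Ez.
have [t0 ht0] := ac m mk _ (cocycle_res E1 cs').
exists (open_preimage (@inclusion _ (Z k.+1)) (Opens oE)), EV, (res E2 t0); split=> //.
transitivity (res E2 (diff J m%:Z m.+1%:Z EZ t0)).
  exact: (hom_res (diff J m%:Z m.+1%:Z) E2 t0).
have E3 : open_preimage w (open_preimage (@inclusion _ (Z k.+1)) (Opens oE)) `<=`
  open_preimage qk (open_preimage ik V) by move=> z /E2; exact: E1.
have E4 : open_preimage w (open_preimage (@inclusion _ (Z k.+1)) (Opens oE)) `<=`
  open_preimage w (open_preimage q1 V) by move=> z; exact: EV.
rewrite ht0 (res_comp _ _ E3).
transitivity (res E4 (res (@V12 V) (s : J m.+1%:Z (open_preimage qk (open_preimage ik V))))); last first.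
  exact: (@res_irr _ (J m.+1%:Z)).
by rewrite (res_comp _ _ E3).
Qed.

End punctured.

(* K is a retract of the direct image of the constant sheaf, so its cohomology near
   the stratum added to U k is a retract of the cohomology of punctured balls
   upstairs, which vanishes in degrees 1, ..., k - 2. *)
Lemma pure_step (C : complex (U k)) (r : nat) : (r + 2 <= k)%N -> pure C (0 - n%:Z) K ->
  pure (truncation (r%:Z - n%:Z) (derived_direct_image ik C)) (0 - n%:Z)
    (extended_system (leqW k2)).
Proof.
move=> rk pC; set I := injective_resolution C.
have [bI injI [u qu]] := injective_resolutionP pC; rewrite -/I in bI injI u qu.
have pI : pure I (0 - n%:Z) K by exact: quasi_iso_pure pC qu.
have iso : sheaf_iso (direct_image ik K) (extended_system (leqW k2)).
  by apply: direct_image_comp_iso => x; exact: val_inj.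
(* Left exactness gives the lowest cohomology sheaf; what remains is vanishing in the other degrees
   up to [r - n]. *)
apply: pure_iso iso; apply: pure_truncation; first lia.
  exact: direct_image_cohomology.
have [J [e0 rJ]] := resolution_exists (constant_sheaf (Z k)) 0.
have finqk : finite_separated qk by apply: finite_separated_restrict; exact: (covering_finite_separated hf).
have rN := direct_image_resolution finqk rJ.
have full (x : X) (t : U k) : f x = val t -> exists s : Z k, val s = x.
  by move=> e; apply: sub_point; rewrite /Z /preimage /= e; exact: set_valP.
have val_injZ : injective (val : Z k -> X) by exact: val_inj.
have val_injU : injective (val : U k -> Y) by exact: val_inj.
have [io [ka [_ [kio _ _ _ _]]]] := trace_splitting hGn hGn1 hf (u := sub_inclusion (@open_part_le n Y G _ _ k2))
  val_injZ (@continuous_val _ _) (sub_open_map (oZ k)) val_injU (@continuous_val _ _)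
  (sub_open_map (oU k)) (q := qk) (fun _ => erefl) full (fun _ => erefl).
(* Reindexing moves [K] from degree [- n] to degree 0, where the direct image of [J] has its
   cohomology. *)
have bI' : bounded_below (reindex I n%:Z).
  by have [a ha] := bI; exists (a + n%:Z) => i ia V s; apply: ha; lia.
have injI' j : injective_sheaf (reindex I n%:Z j) by exact: injI.
have [th hth] := retract_sections kio (pure_reindex pI) bI' injI' rN.
move=> i ir ic V s cs y Vy.
have cs' : cocycle (s : I i (open_preimage ik V)) by apply/direct_image_cocycle.
have [il|il] := ltrP i (0 - n%:Z).
  have [t ht] := exact_sections_low bI injI pI il cs'.
  exists V, (fun _ => id), t; split=> //.
  by rewrite res_id; exact: ht.
have [m em] : exists m : nat, i = m.+1%:Z - n%:Z by exists `|(i + n%:Z - 1)%R|%N; lia.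
(* Truncation leaves [m + 1 <= r <= k - 2], which is the range of vanishing for punctured balls of
   codimension [k]. *)
subst i; have mk : (m.+2 < k)%N by lia.
have [Uy|nUy] := pselect (U k (val y)).
  have [y0 ey0] := sub_point Uy.
  have ay0 : ik y0 = y by apply: val_inj; rewrite /= ey0.
  have ac : acyclic_at I (m.+1%:Z - n%:Z) by have [p [_ _]] := pI; apply.
  have [|V0 [V0V [t [V0y ht]]]] := ac _ s cs' y0; first by move: Vy; rewrite -ay0.
  pose V' := open_preimage (@inclusion _ (U k.+1)) (Opens (sub_open_map (oU k) (oset_open V0))).
  have V'V : V' `<=` V.
    by move=> z [z' V0z' ez']; have <- : ik z' = z; [exact: val_inj|exact: (V0V z' V0z')].
  have V'0 : open_preimage ik V' `<=` V0 by move=> z [z' V0z' /val_inj <-].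
  have V'1 : open_preimage ik V' `<=` open_preimage ik V by move=> z; exact: V'V.
  exists V', V'V, (res V'0 t); split; first by exists y0.
  transitivity (res V'0 (diff I (m.+1%:Z - n%:Z - 1) (m.+1%:Z - n%:Z) V0 t)).
    exact: (hom_res (diff I (m.+1%:Z - n%:Z - 1) (m.+1%:Z - n%:Z)) V'0 t).
  rewrite ht (res_comp _ _ V'1); exact: (@res_irr _ (I (m.+1%:Z - n%:Z))).
have cths : cocycle (th m.+1%:Z (open_preimage ik V) s).
  by apply: cmap_cocycle; apply/reindex_cocycle.
have [W [WV [WV' [t [Wy ht]]]]] := punctured_primitive rJ mk nUy Vy cths.
have [||t' ht'] := hth m.+1%:Z (open_preimage ik W) (res WV' s).
- by apply/reindex_cocycle; exact: (cocycle_res WV' cs').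
- rewrite (_ : m.+1%:Z - 1 = m%:Z); last by lia.
  by exists t; rewrite hom_res.
have {t' ht'} [t' ht'] : exists t' : I (m.+1%:Z - n%:Z - 1) (open_preimage ik W),
    diff I (m.+1%:Z - n%:Z - 1) (m.+1%:Z - n%:Z) _ t' = res WV' (s : I (m.+1%:Z - n%:Z) _).
  have <- : m.+1%:Z - 1 - n%:Z = m.+1%:Z - n%:Z - 1 by lia.
  by exists t'; exact: ht'.
exists W, WV, t'; split=> //.
transitivity (res WV' (s : I (m.+1%:Z - n%:Z) (open_preimage ik V))); first exact: ht'.
exact: (@res_irr _ (I (m.+1%:Z - n%:Z))).
Qed.

End step.
Lemma deligne_pure (p : nat -> nat) (i : nat) : (forall k, (2 <= k)%N -> (p k + 2 <= k)%N) ->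
  (i <= n.-1)%N -> pure (deligne_step p L i) (0 - n%:Z) (extended_system (isT : (2 <= i.+2)%N)).
Proof.
move=> hp; elim: i => [_|i IH ni].
  apply: (pure_iso (K := L)); first by apply: pure_shift; exact: pure_concentrated.
  by apply: direct_image_id_iso => x; exact: val_inj.
have kn : (i.+2 <= n)%N by lia.
have := pure_step (k2 := (isT : (2 <= i.+2)%N)) kn (hp i.+2 isT) (IH (ltnW ni)).
by rewrite (bool_irrelevance (leqW _) (isT : (2 <= i.+3)%N)).
Qed.

Lemma IC_pure (p : nat -> nat) : (forall k, (2 <= k)%N -> (p k + 2 <= k)%N) ->
  pure (IC p L) (0 - n%:Z) (direct_image (@inclusion Y (U 2)) L).
Proof.
(* The last open part is all of [Y]; its inclusion is treated as a finite map with one-point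
   fibres. *)
move=> hp; have finU : finite_separated (@inclusion Y (U n.-1.+2)).
  move=> y O Oy; have [z ez] : exists z : U n.-1.+2, val z = y.
    by apply: sub_point; rewrite /U (open_part_last hGn1 hf).
  have uniq x : inclusion x = y -> x = z by move=> e; apply: val_inj; rewrite ez.
  have [W oW WO] := (sub_openP _).1 (oset_open (O z)).
  exists (Opens oW), O; split=> //.
  - by rewrite -ez; apply/WO; exact: Oy.
  - by move=> x ex; split=> //; exact: Oy.
  - by move=> x Wx; exists z => //; apply/WO.
  - by move=> x x' w ex ex' _ _; rewrite (uniq x ex) (uniq x' ex').
apply: pure_iso (pure_finite_direct_image finU (deligne_pure hp (leqnn _))) _.
exact: direct_image_comp_iso.
Qed.

End deligne_steps.

Lemma shift_coefficients (V : lmodType rat) d (b : 'I_d.+1 -> rat) (v : 'I_d.+1 -> V) :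
  v ord0 = - \sum_(k < d) v (lift ord0 k) ->
  \sum_k b k *: v k = \sum_(k < d) (b (lift ord0 k) - b ord0) *: v (lift ord0 k).
Proof.
move=> v0; rewrite big_ord_recl v0 scalerN scaler_sumr -sumrN -big_split /=.
by apply: eq_bigr => k _; rewrite scalerBl addrC.
Qed.

(** * Constructibility *)

Section sheaf_sums.
Variable T : topologicalType.

Lemma hom_sum (F F' : sheaf T) (a : sheaf_hom F F') (U : opens T) r (c : 'I_r -> rat) (e : 'I_r -> F U) :
  a U (\sum_k c k *: e k) = \sum_k c k *: a U (e k).
Proof.
rewrite (big_morph (a U) (@homD _ _ _ a U) (@hom0 _ _ _ a U)).
by apply: eq_bigr => k _; rewrite homZ.
Qed.

Lemma value_at_eq (U : opens T) (s t : constant_sheaf T U) :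
  (forall z, U z -> value_at s z = value_at t z) -> s = t.
Proof.
by move=> st; apply: smval_inj; apply/funext => z; rewrite -!value_atE st //; exact: set_valP.
Qed.

Lemma value_at0 (U : opens T) z : value_at (0 : constant_sheaf T U) z = 0.
Proof. by rewrite /value_at; case: pselect. Qed.

Lemma value_at_sum (U : opens T) r (c : 'I_r -> rat) (e : 'I_r -> constant_sheaf T U) z :
  value_at (\sum_k c k *: e k) z = \sum_k c k * value_at (e k) z.
Proof.
rewrite (big_morph (fun s : constant_sheaf T U => value_at s z) (op1 := +%R) (id1 := 0)).
- by apply: eq_bigr => k _; rewrite -[c k *: e k]addr0 value_at_lin value_at0 addr0.
- by move=> s t; rewrite -{1}[s]scale1r value_at_lin mul1r.
- exact: value_at0.
Qed.

Lemma locally_constant_on_iso (F F' : sheaf T) (A : set T) :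
  sheaf_iso F F' -> locally_constant_on F A -> locally_constant_on F' A.
Proof.
move=> [a [b [ba ab]]] lF x Ax; have [V [r [e [Vx he]]]] := lF x Ax.
exists V, r, (fun k => a V (e k)); split=> // y Ay Vy; have [indep span] := he y Ay Vy.
split=> [c [W [WV [Wy h]]] k|U s Uy].
  apply: indep; exists W, WV; split=> //.
  by rewrite -(ba W (res WV _)) hom_res hom_sum h hom0.
have [c [W [WU [WV [Wy h]]]]] := span U (b U s) Uy.
exists c, W, WU, WV; split=> //.
by rewrite -hom_sum -hom_res -h hom_res ab.
Qed.

Lemma locally_constant_on_zero (F : sheaf T) (A : set T) :
  (forall U (s : F U), s = 0) -> locally_constant_on F A.
Proof.
move=> F0 x Ax; exists (Opens openT), 0, (fun _ => 0); split=> // y _ _; split=> [c _ []//|U s Uy].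
exists (fun _ => 0), U, (fun _ => id), (fun _ _ => I); split=> //.
by rewrite [LHS]F0 [RHS]F0.
Qed.

Lemma direct_image_sheaf_iso (S : topologicalType) (g : continuousType T S) (F F' : sheaf T) :
  sheaf_iso F F' -> sheaf_iso (direct_image g F) (direct_image g F').
Proof.
move=> [a [b [ba ab]]]; exists (direct_image_hom g a), (direct_image_hom g b).
by split=> U s; [exact: ba|exact: ab].
Qed.

End sheaf_sums.

Section trace_kernel_iso.
Variables (S S' T : topologicalType) (q : continuousType S T) (q' : continuousType S' T).
Hypotheses (finq : forall t, finite_set (q @^-1` [set t])) (finq' : forall t, finite_set (q' @^-1` [set t])).

Lemma trace_kernel_pull (phi : S' -> S) (psi : S -> S') : continuous phi -> cancel phi psi ->
  cancel psi phi -> (forall z, q (phi z) = q' z) ->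
  exists a : sheaf_hom (trace_kernel finq) (trace_kernel finq'),
    forall (V : opens T) s z, V (q' z) -> value_at (smval (a V s)) z = value_at (smval s) (phi z).
Proof.
move=> cphi phiK psiK qphi.
have lc (V : opens T) (s : direct_image q (constant_sheaf S) V) :
    @locally_constant _ (open_preimage q' V) (fun z => value_at s (phi (val z))).
  move=> z; have Vz : open_preimage q V (phi (val z)).
    by rewrite /open_preimage /in_opens /= /preimage /= qphi; exact: (set_valP z).
  have [w ew] := sub_point Vz; have [E [Ew hE]] := smvalP s w.
  exists (Opens ((continuousP _).1 cphi _ (oset_open E))); split.
    by rewrite /in_opens /= /preimage /= -ew.
  move=> z' Ez'; have Vz' : open_preimage q V (phi (val z')).
    by rewrite /open_preimage /in_opens /= /preimage /= qphi; exact: (set_valP z').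
  have [w' ew'] := sub_point Vz'; rewrite -ew -ew' !value_atE; apply: hE.
  by rewrite ew'.
pose m (V : opens T) (s : direct_image q (constant_sheaf S) V) : direct_image q' (constant_sheaf S') V :=
  Submod (ssc_submod (locally_constant_closed S') (open_preimage q' V)) (lc V s).
have mE (V : opens T) s z : V (q' z) -> value_at (m V s) z = value_at s (phi z).
  move=> Vz; have [w ew] := sub_point (Vz : open_preimage q' V z).
  by rewrite -ew value_atE.
have mt (V : opens T) (s : trace_kernel finq V) : traceless (m V (smval s)).
  move=> t Vt; rewrite -(smvalP s t Vt).
  have bij : set_bij (q' @^-1` [set t]) (q @^-1` [set t]) phi.
    split=> [z /= <-|z z' _ _ e|x /= qx]; first by rewrite qphi.
      by rewrite -(phiK z) e phiK.
    by exists (psi x) => //=; rewrite -qphi psiK.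
  rewrite /trace (@reindex_fsbig _ _ _ _ _ phi _ _ _ bij); apply: eq_fsbigr => z; rewrite inE /= => qz.
  by rewrite mE // qz.
pose a (V : opens T) (s : trace_kernel finq V) : trace_kernel finq' V :=
  Submod (ssc_submod (traceless_closed finq') V) (mt V s).
have aE (V : opens T) s z : V (q' z) -> value_at (smval (a V s)) z = value_at (smval s) (phi z).
  exact: mE.
have la (V : opens T) : linear (@a V).
  move=> c s t; apply: smval_inj; apply: value_at_eq => z Vz; rewrite aE //.
  transitivity (value_at (c *: smval (a V s) + smval (a V t)) z) => //.
  have e1 := aE V s z Vz; have e2 := aE V t z Vz.
  transitivity (c * value_at (smval s) (phi z) + value_at (smval t) (phi z)).
    exact: value_at_lin.
  by rewrite -e1 -e2; apply/esym/value_at_lin.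
have ra (V W : opens T) (WV : W `<=` V) s : a W (res WV s) = res WV (a V s).
  apply: smval_inj; apply: value_at_eq => z Wz; rewrite aE //.
  have Wz' : open_preimage q W (phi z) by rewrite /open_preimage /in_opens /= /preimage /= qphi.
  transitivity (value_at (smval s) (phi z)).
    exact: (@value_at_res _ (open_preimage q V) (open_preimage q W) _ (smval s) _ Wz').
  transitivity (value_at (smval (a V s)) z); first by rewrite aE //; exact: WV.
  apply/esym.
  exact: (@value_at_res _ (open_preimage q' V) (open_preimage q' W) _ (smval (a V s)) _ Wz).
by exists (SheafHom la ra).
Qed.

End trace_kernel_iso.

(** The source of the uniqueness claim: isomorphic unbranched coverings have isomorphic trace
    kernels, and these alone enter the direct image along the inclusion. *)
Lemma trace_kernel_iso (S S' T : topologicalType) (q : continuousType S T) (q' : continuousType S' T)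
    (finq : forall t, finite_set (q @^-1` [set t])) (finq' : forall t, finite_set (q' @^-1` [set t]))
    (h : S -> S') : homeomorphism h -> (forall z, q' (h z) = q z) ->
  sheaf_iso (trace_kernel finq) (trace_kernel finq').
Proof.
move=> [ch [g [cg hK gK]]] qh.
have qg z : q (g z) = q' z by rewrite -qh gK.
have [a ha] := trace_kernel_pull finq finq' cg gK hK qg.
have [b hb] := trace_kernel_pull finq' finq ch hK gK qh.
exists a, b; split=> V s; apply: smval_inj; apply: value_at_eq => z Vz.
  by rewrite hb // ha ?hK // qh.
by rewrite ha // hb ?gK // qg.
Qed.

Section constructibility.
Variables (R : realType) (n : nat) (X Y : topologicalType) (G : filtration Y)
  (f : branched_covering R X Y).
Hypotheses (hGn : G n%:Z = setT) (hGn1 : G (n%:Z - 1) = G (n%:Z - 2)).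
Hypothesis hf : locally_flat_covering n G f.

Let A := direct_image f (constant_sheaf X).
Let U2 := open_part n G 2.
Let K := direct_image (@inclusion Y U2) (local_system f U2).

(* The basis consists of the indicator functions of the sheets. *)
Lemma sheet_basis i y0 : level G i y0 -> exists (V : opens Y) (d : nat) (e : 'I_d.+1 -> A V),
  [/\ V y0, \sum_k e k = constant_section (open_preimage f V) 1 &
    forall y, level G i y -> V y ->
      (forall c : 'I_d.+1 -> rat,
         (exists (W : opens Y) (WV : W `<=` V), W y /\ res WV (\sum_k c k *: e k) = 0) ->
         forall k, c k = 0) /\
      (forall (U : opens Y) (s : A U), U y ->
         exists (c : 'I_d.+1 -> rat) (W : opens Y) (WU : W `<=` U) (WV : W `<=` V),
           W y /\ res WU s = res WV (\sum_k c k *: e k))].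
Proof.
move=> Gy0; have finf := covering_finite_separated hf.
have [W [O [[Wy0 Ox cov dis] bij]]] := sheets_bij (f := f) finf (@bc_finite _ _ _ f) (@bc_open _ _ _ f)
  (strata_injective hGn hGn1 hf (i := i)) (O0 := fun=> Opens openT) Gy0 (fun _ _ => I).
have [r ur fr] : exists2 r : seq X, uniq r & forall x, x \in r <-> f x = y0.
  have /finite_seqP[r0 fr0] := @bc_finite _ _ _ f y0; exists (undup r0); first exact: undup_uniq.
  by move=> x; rewrite mem_undup; have := congr1 (fun B => B x) fr0; rewrite /preimage /= => ->.
have [x0 fx0] := @bc_surj _ _ _ f y0.
have x0r : x0 \in r by apply/fr.
case er : (size r) => [|d]; first by move/size0nil: er => er; rewrite er in x0r.
pose x (k : 'I_d.+1) := nth x0 r k.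
have fx k : f (x k) = y0 by apply/fr; rewrite mem_nth // er.
have xP z : f z = y0 -> exists k, x k = z.
  move=> /fr zr; have zi : (index z r < d.+1)%N by rewrite -er index_mem.
  by exists (Ordinal zi); rewrite /x nth_index.
have x_inj : injective x.
  move=> k l /eqP; rewrite /x nth_uniq ?er // => /eqP; exact: val_inj.
pose ind k (z : open_preimage f W) : rat := if `[< O (x k) (val z) >] then 1 else 0.
have lc k : @locally_constant _ (open_preimage f W) (ind k).
  move=> z; have [z1 fz1 Oz1] := cov _ (set_valP z).
  exists (O z1); split=> // z' Oz'; rewrite /ind.
  have [e|ne] := pselect (z1 = x k); first by rewrite -e !asboolT.
  by rewrite !asboolF // => Oxk; apply: ne; apply: (dis _ _ _ fz1 (fx k) _ Oxk).
pose e k : A W := Submod (ssc_submod (locally_constant_closed X) (open_preimage f W)) (lc k).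
have eE k l z : W (f z) -> O (x l) z -> value_at (e k) z = (k == l)%:R.
  move=> Wz Oz; have [w ew] := sub_point (Wz : open_preimage f W z).
  rewrite -ew value_atE /= /ind; have [->|kl] := eqVneq k l; first by rewrite asboolT // ew.
  rewrite asboolF // ew => Okz; case/eqP: kl; apply: x_inj.
  exact: (dis _ _ _ (fx k) (fx l) Okz Oz).
have sumE (c : 'I_d.+1 -> rat) l z : W (f z) -> O (x l) z -> value_at (\sum_k c k *: e k) z = c l.
  move=> Wz Oz; rewrite value_at_sum (bigD1 l) //= big1 => [|k kl]; rewrite (eE _ l) //.
    by rewrite eqxx mulr1 addr0.
  by rewrite (negbTE kl) mulr0.
exists W, d, e; split=> //.
  apply: value_at_eq => z Wz; have [z1 fz1 Oz1] := cov z Wz; have [l el] := xP z1 fz1.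
  rewrite -el in Oz1; rewrite (eq_bigr (fun k => 1 *: e k)); last by move=> k _; rewrite scale1r.
  rewrite (sumE (fun=> 1) l) //; have [w <-] := sub_point (Wz : open_preimage f W z).
  by rewrite value_atE.
move=> y Gy Wy; have [s bs Os] := bij y Wy Gy.
have fs z : f z = y0 -> f (s z) = y by case: bs => h _ _; exact: h.
split=> [c [W1 [W1W [W1y h]]] k|U t Uy].
  rewrite -(sumE c k (s (x k))) ?fs //; last exact: Os.
  have -> : value_at (\sum_k c k *: e k) (s (x k)) = value_at (res W1W (\sum_k c k *: e k)) (s (x k)).
    apply/esym/(@value_at_res _ (open_preimage f W) (open_preimage f W1)).
    by rewrite /open_preimage /in_opens /= /preimage /= fs.
  by rewrite h value_at0.
(* The coefficients of [t] are its values at the points of the fibre over [y], one in each sheet. *)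
pose c k := value_at t (s (x k)).
have ex z : exists E : opens X, f z = y -> [/\ E z, E `<=` open_preimage f U &
    forall k, s (x k) = z -> forall z', E z' -> value_at t z' = c k /\ O (x k) z'].
  have [fz|fz] := pselect (f z = y); last by exists (Opens openT).
  have Uz : open_preimage f U z by rewrite /open_preimage /in_opens /= /preimage /= fz.
  have [z1 fz1 sz1] : exists2 z1, f z1 = y0 & s z1 = z by case: bs => _ _ h; have [z1] := h z fz; exists z1.
  have [l el] := xP z1 fz1; have [w ew] := sub_point Uz; have [E [Ew hE]] := smvalP t w.
  exists (opensI (opensI E (open_preimage f U)) (O (x l))) => _; split.
  - by split; [split=> //; rewrite -ew|rewrite -sz1 el; exact: Os].
  - by move=> z' [[]].
  - move=> k sxk z' [[Ez' Uz'] Oz']; have ekl : k = l.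
      apply: x_inj; case: bs => _ inj _; apply: inj; rewrite ?inE ?fx //.
      by rewrite sxk el.
    subst k; split=> //; rewrite /c sxk -ew value_atE.
    by have [w' ew'] := sub_point Uz'; rewrite -ew' value_atE; apply: hE; rewrite ew'.
have /choice[E hE] := ex.
have [z fz|W1 [E' [W1y E'E cov1 _]]] := finf y E; first by case: (hE z fz).
pose W2 := opensI (opensI W1 U) W.
have W2U : W2 `<=` U by move=> z [[]].
have W2W : W2 `<=` W by move=> z [].
exists c, W2, W2U, W2W; split=> //.
apply: value_at_eq => z W2z.
rewrite (@value_at_res _ (open_preimage f U) (open_preimage f W2)) //.
rewrite (@value_at_res _ (open_preimage f W) (open_preimage f W2)) //.
have [[W1z Uz] Wz] := W2z; have [z1 fz1 E'z] := cov1 z W1z.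
have [_ E'Ez1] := E'E z1 fz1; have [_ _ h] := hE z1 fz1.
have [z2 fz2 sz2] : exists2 z2, f z2 = y0 & s z2 = z1 by case: bs => _ _ h2; have [z2] := h2 z1 fz1; exists z2.
have [l el] := xP z2 fz2.
have [|-> Oz] := h l _ z (E'Ez1 z E'z); first by rewrite el.
by rewrite (sumE c l).
Qed.

Lemma direct_image_constructible : constructible_sheaf G A.
Proof.
move=> i y Gy; have [V [d [e [Vy _ h]]]] := sheet_basis Gy.
by exists V, d.+1, e.
Qed.

Let image_id_open (T : topologicalType) (U : set T) : open U -> open (id @` U).
Proof. by rewrite image_id. Qed.

Lemma global_splitting : exists (i : sheaf_hom K A) (k : sheaf_hom A K) (c : sheaf_hom (constant_sheaf Y) A),
  [/\ forall V s, k V (i V s) = s,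
      forall V a, c V (constant_section V a) = constant_section (open_preimage f V) a,
      forall V s, k V (c V s) = 0,
      forall V s, c V s = 0 -> s = 0 &
      forall V t, k V t = 0 -> exists s, c V s = t].
Proof.
apply: (trace_splitting hGn hGn1 hf (q := f) (u := @inclusion Y U2) (al := id) (be := id)) => //.
- by move=> x; exact: cvg_id.
- exact: image_id_open.
- by move=> x; exact: cvg_id.
- exact: image_id_open.
- by move=> x t; exists x.
Qed.

(** [K] is a retract of the direct image, so the images of the sheet indicators generate it. They
    sum to the image of the constant 1, which is 0; leaving out the first one gives a basis. *)
Lemma local_system_extension_constructible : constructible_sheaf G K.
Proof.
have [io [ka [c [kio cc kc _ kerk]]]] := global_splitting.
move=> i y0 Gy0; have [V [d [e [Vy0 e1 h]]]] := sheet_basis Gy0.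
have ke0 : ka V (e ord0) = - \sum_(k < d) ka V (e (lift ord0 k)).
  have := kc V (constant_section V 1); rewrite cc -e1.
  rewrite (eq_bigr (fun k => 1 *: e k)); last by move=> k _; rewrite scale1r.
  rewrite hom_sum big_ord_recl scale1r => /eqP; rewrite addr_eq0 => /eqP ->.
  by congr (- _); apply: eq_bigr => k _; rewrite scale1r.
exists V, d, (fun k => ka V (e (lift ord0 k))); split=> // y Gy Vy.
have [indep span] := h y Gy Vy; split=> [b [W [WV [Wy hb]]]|U s Uy].
  (* A relation between the images lifts to a pullback of some [g], equal near [y] to a constant
     [a], that is, to [a] times the sum of all indicators. Independence at the omitted sheet gives
     [a = 0], then all coefficients vanish. *)
  have [|g hg] := kerk W (res WV (\sum_k b k *: e (lift ord0 k))); first by rewrite hom_res hom_sum.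
  have [w ew] := sub_point Wy; have [E [Ey hE]] := smvalP g w; rewrite ew in Ey.
  set a := smval g w in hE.
  pose W1 := opensI W E; have W1W : W1 `<=` W by move=> z [].
  have W1V : W1 `<=` V by move=> z /W1W/WV.
  have ga : res W1W g = constant_section W1 a.
    apply: value_at_eq => z W1z; rewrite value_at_res //; have [Wz Ez] := W1z.
    have [v ev] := sub_point W1z; rewrite -{2}ev value_atE /=.
    by have [v' ev'] := sub_point Wz; rewrite -ev' value_atE; apply: hE; rewrite ev'.
  pose b' (k : 'I_d.+1) := if unlift ord0 k is Some k' then b k' - a else - a.
  have hb' : res W1V (\sum_k b' k *: e k) = 0.
    have -> : \sum_k b' k *: e k = \sum_k b k *: e (lift ord0 k) - a *: constant_section (open_preimage f V) 1.
      rewrite -e1 !big_ord_recl /b' unlift_none scalerDr opprD addrCA scaleNr; congr (_ + _).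
      rewrite scaler_sumr -sumrB; apply: eq_bigr => k _.
      by rewrite liftK scalerBl.
    rewrite resB -(res_comp WV W1W W1V) -hg -hom_res ga cc resZ.
    have -> : res W1V (constant_section (open_preimage f V) 1 : A V) =
      constant_section (open_preimage f W1) 1 by exact: smval_inj.
    by rewrite constant_sectionZ mulr1 subrr.
  have b0 := indep b' (ex_intro _ W1 (ex_intro _ W1V (conj (conj Wy Ey) hb'))).
  have a0 : a = 0.
    by have := b0 ord0; rewrite /b' unlift_none => /eqP; rewrite oppr_eq0 => /eqP.
  by move=> k; have := b0 (lift ord0 k); rewrite /b' liftK a0 subr0.
have [b [W [WU [WV [Wy hW]]]]] := span U (io U s) Uy.
exists (fun k => b (lift ord0 k) - b ord0), W, WU, WV; split=> //.
rewrite -{1}(kio U s) -hom_res hW hom_res hom_sum.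
by rewrite (shift_coefficients b (v := fun k => ka V (e k)) ke0).
Qed.

Lemma pushforward_decomposition : sheaf_iso (dsum_sheaf (constant_sheaf Y) K) A.
Proof.
have [i [k [c [ki _ kc c0 kerk]]]] := global_splitting.
exact: (split_exact_iso ki kc c0 kerk).
Qed.

Lemma pure_derived_pushforward :
  pure (derived_direct_image f (concentrated (constant_sheaf X))) 0 A.
Proof.
have pC := pure_concentrated (constant_sheaf X).
have [_ _ [u qu]] := injective_resolutionP pC.
apply: pure_finite_direct_image; first exact: (covering_finite_separated hf).
exact: quasi_iso_pure pC qu.
Qed.

End constructibility.

Lemma higher_direct_image0 (S T : topologicalType) (g : continuousType S T) (F : sheaf S) :
  sheaf_iso (higher_direct_image g 0 F) (direct_image g F).
Proof.
have pC := pure_concentrated F; have [bI injI [u qu]] := injective_resolutionP pC.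
apply: cohomology_sheaf_iso; apply: direct_image_cohomology => //.
exact: quasi_iso_pure pC qu.
Qed.

(** For the upper perversity equality holds at [k = 2] and [k = 3], so the vanishing range is used
    to its end. *)
Lemma middle_perversity (p : nat -> nat) k : p = lower_middle \/ p = upper_middle ->
  (2 <= k)%N -> (p k + 2 <= k)%N.
Proof. by case=> ->; rewrite /lower_middle /upper_middle; lia. Qed.

Theorem theorem28 (R : realType) (n : nat) (X Y : topologicalType)
  (G : filtration Y) (f : branched_covering R X Y) (p : nat -> nat)
  (hGn : G n%:Z = setT) (hGn1 : G (n%:Z - 1) = G (n%:Z - 2))
  (hf : locally_flat_covering n G f)
  (hp : p = lower_middle \/ p = upper_middle) :
  let U := open_part n G 2 in
  let L := local_system f U in
  let R0jL := higher_direct_image (@inclusion Y U) 0 L in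
  let RfQ := derived_direct_image f (concentrated (constant_sheaf X)) in
  [/\ bounded_constructible G RfQ,
      derived_iso (shift_complex n RfQ)
        (dsum (shift_complex n (concentrated (constant_sheaf Y))) (@IC Y n G p L)),
      constructible_sheaf G R0jL &
      forall (X' : topologicalType) (f' : branched_covering R X' Y),
        locally_flat_covering n G f' ->
        (exists2 h : f @^-1` U -> f' @^-1` U,
           homeomorphism h &
           forall x, restrict_over (f := f') (h x) = restrict_over (f := f) x) ->
        sheaf_iso R0jL
          (higher_direct_image (@inclusion Y U) 0 (local_system f' U))].
Proof.
move=> U L R0jL RfQ.
have pR : pure RfQ 0 (direct_image f (constant_sheaf X)) := pure_derived_pushforward hf.
split.
- have [coh ac] := (pureE _ _ _).1 pR; split=> [|i k].
    by exists 0, 0 => i i0 V s; apply: cohomology_sheaf0; apply: ac; lia.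
  have [->|i0] := pselect (i = 0).
    apply: (locally_constant_on_iso (sheaf_iso_sym (cohomology_sheaf_iso coh))).
    have cA := direct_image_constructible hGn hGn1 hf; exact: cA.
  by apply: locally_constant_on_zero => V s; apply: cohomology_sheaf0; exact: ac.
(* Both sides have a single cohomology sheaf, in degree [- n], and these two sheaves are identified
   by the trace splitting. *)
- have [p1 h1] := pure_shift n pR.
  have pIC := IC_pure hGn hGn1 hf (fun k => middle_perversity (k := k) hp).
  have pQ := pure_shift n (pure_concentrated (constant_sheaf Y)).
  have [p2 h2] := pure_iso (pure_dsum pQ pIC) (pushforward_decomposition hGn hGn1 hf).
  exact: (pure_derived_iso h1 h2).
- move=> i; apply: (locally_constant_on_iso (sheaf_iso_sym (higher_direct_image0 _ _))).
  have cK := local_system_extension_constructible hGn hGn1 hf; exact: cK.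
- move=> X' f' _ [h hh hE].
  apply: sheaf_iso_trans (higher_direct_image0 _ _) _.
  apply: sheaf_iso_trans _ (sheaf_iso_sym (higher_direct_image0 _ _)).
  by apply: direct_image_sheaf_iso; apply: trace_kernel_iso hh hE.
Qed.
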